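(* Let $-\infty<a<b<\infty$, $\Omega=(a,b)$, and let $\alpha,\beta,\mu$ be real constants with $0<\alpha,\beta,\mu<1$ and $\alpha+\beta=1$. Let $0<\sigma<1$, let $c$ be a real constant, let $\psi\in \widehat{H}^{(1+\mu)/2}_0(\Omega)$ and let $f\in H(\overline{\Omega})\cap H^*_\sigma(\Omega)$. If $$\alpha\,({_aD_x^{-(1-\mu)}}\psi)(x)+\beta\,({_xD_b^{-(1-\mu)}}\psi)(x)=({_aD_x^{-1}}f)(x)+c\quad\text{for almost every }x\in\Omega,$$ then there exists a function $K_\sigma\in H^*(\Omega)$ (depending on $\sigma$) such that $$\psi(x)=({_aD_x^{-(\mu+\sigma)}}K_\sigma)(x),\qquad x\in\Omega .$$
   Context: All functions are real-valued. Elements of $L^p$ or Sobolev spaces are understood as suitable representatives of their equivalence classes, and equalities between them hold almost everywhere. Riemann-Liouville integrals: for $s>0$, $$({_aD_x^{-s}}w)(x)=\frac{1}{\Gamma(s)}\int_a^x (x-t)^{s-1}w(t)\,dt,\qquad ({_xD_b^{-s}}w)(x)=\frac{1}{\Gamma(s)}\int_x^b (t-x)^{s-1}w(t)\,dt .$$ Hölderian spaces: $H^\lambda(\overline\Omega)$, $\lambda>0$, is the Hölder space of exponent $\lambda$ on $\overline\Omega=[a,b]$; $H(\overline\Omega)=\bigcup_{\lambda>0}H^\lambda(\overline\Omega)$ (functions that are Hölder continuous on $[a,b]$ with some positive exponent); $H^\lambda_0(\overline\Omega)=\{g\in H^\lambda(\overline\Omega): g(a)=g(b)=0\}$. For $\epsilon_1,\epsilon_2>0$,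 $$H^\lambda_0(\epsilon_1,\epsilon_2)=\Big\{f: f(x)=\frac{g(x)}{(x-a)^{1-\epsilon_1}(b-x)^{1-\epsilon_2}},\ g\in H^\lambda_0(\overline\Omega)\Big\},$$ $$H^*(\Omega)=\bigcup_{0<\lambda\le 1,\ \epsilon_1,\epsilon_2>0}H^\lambda_0(\epsilon_1,\epsilon_2),\qquad H^*_\sigma(\Omega)=\bigcup_{\sigma<\lambda\le 1,\ \epsilon_1,\epsilon_2>0}H^\lambda_0(\epsilon_1,\epsilon_2).$$ Fractional Sobolev space: for $s\ge0$, $\widehat H^s_0(\Omega)$ is the closure of $C_0^\infty(\Omega)$ (smooth functions with compact support in $\Omega$) with respect to the norm $\|\tilde u\|_{\widehat H^s(\mathbb R)}$, where $\tilde u$ is the extension of $u$ by $0$ outside $\Omega$ and $$\|w\|^2_{\widehat H^s(\mathbb R)}=\|w\|^2_{L^2(\mathbb R)}+\|(2\pi|\xi|)^s\widehat w(\xi)\|^2_{L^2(\mathbb R)},$$ with $\widehat w$ the Fourier transform of $w$. *)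

(* Defs.v *)
From mathcomp Require Import all_boot all_order all_algebra.
From mathcomp Require Import all_classical all_reals all_analysis.
From mathcomp Require Import complex.

Set Implicit Arguments.
Unset Strict Implicit.
Unset Printing Implicit Defensive.
Import Order.TTheory GRing.Theory Num.Theory.
Import numFieldNormedType.Exports.

Local Open Scope classical_set_scope.
Local Open Scope ring_scope.

(* Functions on an interval are represented by total functions R -> R whose
   values outside the interval are never used. *)

(* Euler's integral, for s > 0. *)
Definition Gamma (R : realType) (s : R) : R :=
  \int[@lebesgue_measure R]_(t in `]0, +oo[) (t `^ (s - 1) * expR (- t)).

(* Riemann-Liouville integrals of order s > 0 with base point a, resp. b. *)
Definition RL_left (R : realType) (a s : R) (w : R -> R) (x : R) : R :=
  (Gamma s)^-1 *
  \int[@lebesgue_measure R]_(t in `[a, x]) ((x - t) `^ (s - 1) * w t).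

Definition RL_right (R : realType) (b s : R) (w : R -> R) (x : R) : R :=
  (Gamma s)^-1 *
  \int[@lebesgue_measure R]_(t in `[x, b]) ((t - x) `^ (s - 1) * w t).

(* For lambda > 1 this set contains only the functions constant on [a, b]; a
   definition of the spaces with lambda > 1 through derivatives would give
   smaller spaces than lambda = 1 as well, so the union [hoelder_any] does not
   depend on that choice, and elsewhere only lambda <= 1 is used. *)
Definition hoelder (R : realType) (a b lambda : R) : set (R -> R) :=
  [set g | exists C : R, forall x y : R, a <= x <= b -> a <= y <= b ->
     `|g x - g y| <= C * `|x - y| `^ lambda].

Definition hoelder_any (R : realType) (a b : R) : set (R -> R) :=
  [set g | exists2 lambda : R, 0 < lambda & hoelder a b lambda g].

Definition hoelder0 (R : realType) (a b lambda : R) : set (R -> R) :=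
  [set g | [/\ hoelder a b lambda g, g a = 0 & g b = 0]].

Definition hoelder0_weighted (R : realType) (a b lambda eps1 eps2 : R) :
    set (R -> R) :=
  [set f | exists2 g : R -> R, hoelder0 a b lambda g &
     forall x : R, a < x < b ->
       f x = g x / ((x - a) `^ (1 - eps1) * (b - x) `^ (1 - eps2))].

Definition Hstar (R : realType) (a b : R) : set (R -> R) :=
  [set f | exists lambda eps1 eps2 : R,
     [/\ 0 < lambda <= 1, 0 < eps1, 0 < eps2 &
         hoelder0_weighted a b lambda eps1 eps2 f]].

Definition Hstar_above (R : realType) (a b sigma : R) : set (R -> R) :=
  [set f | exists lambda eps1 eps2 : R,
     [/\ sigma < lambda <= 1, 0 < eps1, 0 < eps2 &
         hoelder0_weighted a b lambda eps1 eps2 f]].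

(* C_0^oo(]a, b[), each function being identified with its extension by 0. *)
Definition test_function (R : realType) (a b : R) : set (R -> R) :=
  [set phi | [/\ forall (n : nat) (x : R), derivable (derive1n n phi) x 1,
     compact (closure [set x : R | phi x != 0]) &
     closure [set x : R | phi x != 0] `<=` `]a, b[ ]].

(* Fourier transform  int w(x) exp(-2 pi i x xi) dx  of a real function w. It
   is only applied to square-integrable functions vanishing outside a bounded
   interval, which are integrable, so that the integral is the L^2 transform. *)
Definition fourier (R : realType) (w : R -> R) (xi : R) : R[i] :=
  Complex
    (\int[@lebesgue_measure R]_x (w x * cos (2 * pi * x * xi)))
    (- \int[@lebesgue_measure R]_x (w x * sin (2 * pi * x * xi))).

Definition sobolev_norm (R : realType) (s : R) (w : R -> R) : \bar R :=
  let D (xi : R) : R :=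
    (2 * pi * `|xi|) `^ s * ComplexField.Normc.normc (fourier w xi) in
  (('N[@lebesgue_measure R]_2%:E [EFin \o w] ^+ 2 +
    'N[@lebesgue_measure R]_2%:E [EFin \o D] ^+ 2) `^ 2^-1)%E.

(* [u \_ A] is the extension by 0 outside A. As elements of the space are
   classes of almost everywhere equal functions, u is taken to be a Borel
   representative. *)
Definition sobolev0 (R : realType) (a b s : R) : set (R -> R) :=
  [set u | u \_ `]a, b[ \in Lfun (@lebesgue_measure R) 2%:E /\
     forall e : R, 0 < e -> exists2 phi : R -> R, test_function a b phi &
       (sobolev_norm s (((u \- phi)%R) \_ `]a, b[)%classic < e%:E)%E].

(* Main.v *)
(* Let k = alpha x_+^(-mu) + beta x_-^(-mu) and extend psi by 0. The hypothesis
   says that k * psi is, up to constants, a primitive of f on ]a, b[. By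
   homogeneity M = alpha x_+^(mu-1) - beta x_-^(mu-1) inverts k: with fo the
   derivative of k * psi outside [a, b], one has g psi = M * (f + fo) on ]a, b[
   for a constant g > 0. The Sobolev hypothesis enters only through the Hoelder
   continuity of psi and its vanishing at the end points.
   Since k is convex on both half-lines, k * w = const implies a maximum
   principle, and a barrier yields |psi x| <= C d(x)^mu, where d is the distance
   to {a, b}. Hence fo is controlled near the end points, and the representation
   bounds the second differences of psi by h^(mu + lambda) times a power of d.
   With s = mu + sigma < mu + lambda, the integral
     K0 x = int_0^oo (psi x - 2 psi (x - t) + psi (x - 2 t)) t^(-1-s) dt
   then converges and belongs to H^*. Integrating the truncated K0 against
   (x - t)_+^(s-1) gives an average of psi with a fixed profile at scale eps, so
   that the left integral of order s of K0 is a nonzero multiple of psi. *)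
Require Import Defs.
From mathcomp Require Import all_boot all_order all_algebra.
From mathcomp Require Import all_classical all_reals all_analysis.
From mathcomp Require Import measurable_realfun ring lra.

Set Implicit Arguments.
Unset Strict Implicit.
Unset Printing Implicit Defensive.
Import Order.TTheory GRing.Theory Num.Theory.
Import numFieldNormedType.Exports.

Local Open Scope classical_set_scope.
Local Open Scope ring_scope.

(** * Integration on the line *)

Section Integrals.
Variable R : realType.
Implicit Types (f g h : R -> R) (a b c d r e x y z : R).
Notation mu := (@lebesgue_measure R).

(** The Sobolev hypothesis yields only the Hoelder exponent m/2, by which the order (1 + m)/2
    exceeds 1/2. If |psi| were only O(d^(m/2)), the part t > d/8 of the integral K0 would be
    O(d^(-sigma - m/2)), too large for H^* as soon as sigma + m/2 >= 1. The exponent m of the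
    boundary decay turns this into O(d^(-sigma)); it also bounds fo by any small negative power of
    the distance to the end points. The representation alone cannot provide it, since fo is built
    from psi itself. The maximum principle breaks this circle: it compares psi with M * f and the
    barrier only. As s lies in ]0, 2[, on either side of 1, second differences are used throughout.
    The bounds for them, and the modulus of continuity of K0, degenerate at the end points by powers
    of 1/d. This is harmless: the product of K0 with a suitable weight decays at the end points like
    a positive power of d, and interpolation between the two facts yields one global Hoelder
    exponent. The constant g and the integral of the averaging profile enter only through their
    positivity. *)

Definition itg h : Prop := mu.-integrable setT (EFin \o h).
Definition Int h : R := \int[mu]_x h x.

Lemma itg_meas h : itg h -> measurable_fun setT h.
Proof. by move=> /measurable_int /measurable_EFinP. Qed.

Lemma itgE h : itg h -> (\int[mu]_x (h x)%:E = (Int h)%:E)%E.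
Proof. by move=> ih; rewrite /Int /Rintegral fineK//; apply: (@integrable_fin_num _ _ _ mu setT measurableT (EFin \o h)). Qed.

Lemma itgP h : measurable_fun setT h -> (\int[mu]_x (`|h x|)%:E < +oo)%E -> itg h.
Proof. by move=> mh ih; apply/integrableP; split => //; exact/measurable_EFinP. Qed.

Lemma itg_le g h : measurable_fun setT h -> (forall x, `|h x| <= g x) -> itg g -> itg h.
Proof.
move=> mh hg ig; apply: (le_integrable measurableT _ _ ig) => //.
  exact/measurable_EFinP.
by move=> x _ /=; rewrite lee_fin (le_trans (hg x))// ler_norm.
Qed.

Lemma itgD g h : itg g -> itg h -> itg (fun x => g x + h x).
Proof. by move=> ig ih; have := integrableD measurableT ig ih; apply: eq_integrable => // x _. Qed.

Lemma itgN h : itg h -> itg (fun x => - h x).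
Proof. by move=> ih; have := integrableN ih; apply: eq_integrable. Qed.

Lemma itgB g h : itg g -> itg h -> itg (fun x => g x - h x).
Proof. by move=> ig /itgN; exact: itgD. Qed.

Lemma itgZ c h : itg h -> itg (fun x => c * h x).
Proof. by move=> ih; have := integrableZl measurableT c ih; apply: eq_integrable. Qed.

Lemma itg0 : itg (fun=> 0).
Proof. exact: (@integrable0 _ _ R mu setT). Qed.

Lemma itg_abs h : itg h -> itg (fun x => `|h x|).
Proof. exact: integrable_norm. Qed.

Lemma eq_itg g h : g =1 h -> itg g -> itg h.
Proof. by move=> /funext ->. Qed.

Lemma eq_Int g h : g =1 h -> Int g = Int h.
Proof. by move=> /funext ->. Qed.

Lemma IntD g h : itg g -> itg h -> Int (fun x => g x + h x) = Int g + Int h.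
Proof. by move=> ig ih; rewrite /Int RintegralD. Qed.

Lemma IntB g h : itg g -> itg h -> Int (fun x => g x - h x) = Int g - Int h.
Proof. by move=> ig ih; rewrite /Int RintegralB. Qed.

Lemma IntZ c h : itg h -> Int (fun x => c * h x) = c * Int h.
Proof. by move=> ih; rewrite /Int RintegralZl. Qed.

Lemma IntN h : itg h -> Int (fun x => - h x) = - Int h.
Proof. by move=> ih; rewrite -mulN1r -IntZ//; apply: eq_Int => x; rewrite mulN1r. Qed.

Lemma Int0 : Int (fun=> 0) = 0.
Proof. by rewrite /Int Rintegral_cst// mul0r. Qed.

Lemma Int_ge0 h : (forall x, 0 <= h x) -> 0 <= Int h.
Proof. by move=> h0; apply: Rintegral_ge0 => x _. Qed.

Lemma le_Int g h : itg g -> itg h -> (forall x, g x <= h x) -> Int g <= Int h.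
Proof. by move=> ig ih gh; apply: le_Rintegral => // x _. Qed.

Lemma abs_Int h : itg h -> `|Int h| <= Int (fun x => `|h x|).
Proof. by move=> ih; apply: le_normr_Rintegral. Qed.

Lemma abs_Int_le g h : measurable_fun setT h -> (forall x, `|h x| <= g x) -> itg g ->
  `|Int h| <= Int g.
Proof.
move=> mh hg ig; have ih := itg_le mh hg ig.
by apply: (le_trans (abs_Int ih)); apply: le_Int => //; exact: itg_abs.
Qed.

Lemma ae_imp (P Q : R -> Prop) : (forall x, P x -> Q x) ->
  {ae mu, forall x, P x} -> {ae mu, forall x, Q x}.
Proof. by move=> PQ; apply: (@filterS _ _ (ae_filter_ringOfSetsType mu)). Qed.

Lemma ae_and (P Q : R -> Prop) : {ae mu, forall x, P x} ->
  {ae mu, forall x, Q x} -> {ae mu, forall x, P x /\ Q x}.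
Proof.
move=> hP hQ.
exact: (@filterI _ _ (ae_filter_ringOfSetsType mu) _ _ hP hQ).
Qed.

Lemma ae_Int g h : measurable_fun setT g -> measurable_fun setT h ->
  {ae mu, forall x, g x = h x} -> Int g = Int h.
Proof.
move=> mg mh gh; congr fine; apply: ae_eq_integral => //.
- exact/measurable_EFinP.
- exact/measurable_EFinP.
- by apply: ae_imp gh => x /= -> _.
Qed.

Lemma ae_itg g h : measurable_fun setT h ->
  {ae mu, forall x, g x = h x} -> itg g -> itg h.
Proof.
move=> mh gh ig; apply: itgP => //.
move: (ig) => /integrableP[mg].
suff -> : (\int[mu]_x `|(EFin \o g) x| = \int[mu]_x (`|h x|)%:E)%E by [].
apply: ae_eq_integral => //.
- by apply: measurableT_comp.
- by apply/measurable_EFinP; apply: measurableT_comp.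
- by apply: ae_imp gh => x /= -> _.
Qed.

(** The measure c times the image of mu under x -> c x + d gives half-open intervals their length,
    so it is Lebesgue measure by uniqueness. *)
Lemma mu_affine c d (A : set (measurableTypeR R)) : 0 < c -> measurable A ->
  mu ((fun x : R => (c * x + d)%R) @^-1` A) = ((c^-1)%:E * mu A)%E.
Proof.
move=> c0 mA.
pose phi : measurableTypeR R -> measurableTypeR R := fun x : R => c * x + d.
have mphi : measurable_fun setT phi.
  by apply: measurable_funD => //; apply: measurable_funM.
pose m1 := mscale (NngNum (ltW c0)) (measure_function_pushforward__canonical__measure_function_Measure mu mphi).
have H X : ocitv X -> lebesgue_measure X = m1 X.
  move=> [[u v] _ <-]; rewrite /m1 /= /mscale /= /pushforward.
  have -> : phi @^-1` `]u, v] = `](u - d) / c, (v - d) / c]%classic.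
    apply/seteqP; split => x /=; rewrite /phi !in_itv/= ler_pdivlMr// ltr_pdivrMr// ltrBlDr lerBrDr ![x * c]mulrC //.
  rewrite !lebesgue_measure_itv/= !lte_fin ltr_pM2r ?invr_gt0// ltrD2r.
  case: ifPn => uv; last by rewrite mule0.
  by rewrite -!EFinD -EFinM; congr EFin; field; rewrite gt_eqF.
have := lebesgue_measure_unique H mA; rewrite /m1 /= /mscale /= /pushforward => ->.
by rewrite muleA -EFinM mulVf ?gt_eqF// mul1e.
Qed.

Lemma ge0_Int_affine c d (h : R -> R) : 0 < c -> measurable_fun setT h ->
  (forall x, 0 <= h x) ->
  (\int[mu]_x (h (c * x + d)%R)%:E = (c^-1)%:E * \int[mu]_x (h x)%:E)%E.
Proof.
move=> c0 mh h0.
pose phi : measurableTypeR R -> measurableTypeR R := fun x : R => c * x + d.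
have mphi : measurable_fun setT phi.
  by apply: measurable_funD => //; apply: measurable_funM.
have ci0 : 0 <= c^-1 by rewrite invr_ge0 ltW.
have mE : measurable_fun [set: measurableTypeR R] (fun x => (h x)%:E) by exact/measurable_EFinP.
have H := ge0_integral_pushforward mphi mu measurableT mE (fun x _ => h0 x).
rewrite -[LHS]H.
rewrite -(@ge0_integral_mscale _ _ _ mu setT measurableT (NngNum ci0) _ mE (fun x _ => h0 x))//.
by apply: eq_measure_integral => //= A mA _; rewrite /mscale/= -(@mu_affine c d).
Qed.

Lemma itg_affine c d h : 0 < c -> itg h -> itg (fun x => h (c * x + d)).
Proof.
move=> c0 ih; apply: itgP.
  apply: measurableT_comp; first exact: itg_meas.
  by apply: measurable_funD => //; apply: measurable_funM.
have mh := itg_meas ih.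
rewrite (@ge0_Int_affine c d (fun x => `|h x|))//; last by apply: measurableT_comp.
by rewrite (itgE (itg_abs ih)) -EFinM ltry.
Qed.

Lemma max0_subN r : r = Num.max r 0 - Num.max (- r) 0.
Proof.
have [r0|r0] := leP r 0; first by rewrite max_l ?sub0r ?opprK ?oppr_ge0.
by rewrite max_r ?subr0// oppr_le0 ltW.
Qed.

Lemma itg_funrpos h : itg h -> itg (fun x => Num.max (h x) 0).
Proof.
move=> ih; apply: (itg_le _ _ (itg_abs ih)).
  by apply: measurable_maxr => //; exact: itg_meas.
move=> x; rewrite /Num.max; case: ifPn => // _; rewrite normr0 normr_ge0//.
Qed.

(** The nonnegative case is the change of variables for measures; a general h is split into its
    positive and negative parts. *)
Lemma Int_affine c d h : 0 < c -> itg h -> Int (fun x => h (c * x + d)) = c^-1 * Int h.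
Proof.
move=> c0 ih.
have P g : itg g -> (forall x, 0 <= g x) -> Int (fun x => g (c * x + d)) = c^-1 * Int g.
  move=> ig g0; apply: EFin_inj; rewrite -(itgE (itg_affine d c0 ig)) ge0_Int_affine//; last exact: itg_meas.
  by rewrite (itgE ig) EFinM.
have ip := itg_funrpos ih; have in_ := itg_funrpos (itgN ih).
have e x : h x = Num.max (h x) 0 - Num.max (- h x) 0.
  exact: max0_subN.
rewrite (eq_Int e) (eq_Int (fun x => e (c * x + d))).
rewrite !IntB//; last 2 first.
- exact: (itg_affine _ _ ip).
- exact: (itg_affine _ _ in_).
rewrite (P _ ip) ?(P _ in_) ?mulrBr// => x; rewrite le_max lexx orbT//.
Qed.

Lemma itg_shift d h : itg h -> itg (fun x => h (x + d)).
Proof. by move=> /(itg_affine d ltr01); apply: eq_itg => x; rewrite mul1r. Qed.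

Lemma Int_shift d h : itg h -> Int (fun x => h (x + d)) = Int h.
Proof.
move=> ih; rewrite -[RHS]mul1r -[X in X * _]invr1 -(Int_affine d ltr01)//.
by apply: eq_Int => x; rewrite mul1r.
Qed.

Lemma itg_scale c h : 0 < c -> itg h -> itg (fun x => h (c * x)).
Proof. by move=> c0 /(itg_affine 0 c0); apply: eq_itg => x; rewrite addr0. Qed.

Lemma Int_scale c h : 0 < c -> itg h -> Int (fun x => h (c * x)) = c^-1 * Int h.
Proof.
move=> c0 ih; rewrite -(Int_affine 0 c0)//.
by apply: eq_Int => x; rewrite addr0.
Qed.

Lemma ge0_Int_opp (h : R -> R) : measurable_fun setT h -> (forall x, 0 <= h x) ->
  (\int[mu]_x (h (- x)%R)%:E = \int[mu]_x (h x)%:E)%E.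
Proof.
move=> mh h0.
have mN : measurable_fun setT (-%R : measurableTypeR R -> measurableTypeR R) by [].
have mE : measurable_fun [set: measurableTypeR R] (fun x => (h x)%:E) by exact/measurable_EFinP.
rewrite -[LHS](ge0_integral_pushforward mN mu measurableT mE (fun x _ => h0 x)).
by apply: eq_measure_integral => //= A mA _; exact: lebesgue_measureN.
Qed.

Lemma itg_opp h : itg h -> itg (fun x => h (- x)).
Proof.
move=> ih; have mh := itg_meas ih; apply: itgP; first by apply: measurableT_comp.
rewrite (@ge0_Int_opp (fun x => `|h x|))//; last by apply: measurableT_comp.
by rewrite (itgE (itg_abs ih)) ltry.
Qed.

Lemma Int_opp h : itg h -> Int (fun x => h (- x)) = Int h.
Proof.
move=> ih.
have P g : itg g -> (forall x, 0 <= g x) -> Int (fun x => g (- x)) = Int g.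
  by move=> ig g0; rewrite /Int /Rintegral ge0_Int_opp//; exact: itg_meas.
have ip := itg_funrpos ih; have in_ := itg_funrpos (itgN ih).
have e x : h x = Num.max (h x) 0 - Num.max (- h x) 0.
  exact: max0_subN.
rewrite (eq_Int e) (eq_Int (fun x => e (- x))).
rewrite !IntB//; last 2 first.
- exact: (itg_opp ip).
- exact: (itg_opp in_).
by rewrite (P _ ip) ?(P _ in_)// => x; rewrite le_max lexx orbT.
Qed.

Lemma itg_refl d h : itg h -> itg (fun x => h (d - x)).
Proof. by move=> /(itg_shift d) /itg_opp; apply: eq_itg => x; rewrite addrC. Qed.

Lemma Int_refl d h : itg h -> Int (fun x => h (d - x)) = Int h.
Proof.
move=> ih; rewrite -[RHS](Int_shift d ih) -[RHS](Int_opp (itg_shift d ih)).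
by apply: eq_Int => x; rewrite addrC.
Qed.

End Integrals.

(** * Fubini, dominated convergence and improper integrals *)

Section Indicators.
Variable R : realType.
Implicit Types (f g h : R -> R) (a b c d r e x y : R).
Notation mu := (@lebesgue_measure R).

(** All integrals run over the whole line and intervals of integration are expressed by this factor,
    so that translations, dilations and Fubini need no bookkeeping of domains. *)
Definition chi (P : bool) : R := P%:R.

Lemma chi_ge0 P : 0 <= chi P. Proof. exact: ler0n. Qed.

Lemma chi_le1 P : chi P <= 1. Proof. by case: P; rewrite /chi. Qed.

(** The hypothesis is of Tonelli type: the inner integrals of |H| need an integrable majorant G, for
    almost every x. *)
Lemma Int_fubini (H : R -> R -> R) G :
  measurable_fun setT (fun z : R * R => H z.1 z.2) ->
  {ae mu, forall x, itg (H x) /\ Int (fun y => `|H x y|) <= G x} -> itg G ->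
  [/\ itg (fun x => Int (H x)), itg (fun y => Int (H ^~ y)),
      {ae mu, forall y, itg (H ^~ y)} &
      Int (fun x => Int (H x)) = Int (fun y => Int (H ^~ y))].
Proof.
move=> mH hH iG.
pose f := fun z : measurableTypeR R * measurableTypeR R => (H z.1 z.2)%:E.
have mf : measurable_fun setT f by exact/measurable_EFinP.
have if_ : (mu \x mu)%E.-integrable setT f.
  apply/integrable12ltyP => //.
  apply: (@le_lt_trans _ _ (\int[mu]_x (`|G x|)%:E)%E); last first.
    by rewrite (itgE (itg_abs iG)) ltry.
  apply: ae_ge0_le_integral => //.
  - by move=> x _; apply: integral_ge0.
  - have mabs : measurable_fun setT (abse \o f) by apply: measurableT_comp.
    have Q := @measurable_fun_fubini_tonelli_F _ _ _ _ _ mu (abse \o f).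
    exact: (Q mabs (fun w => abse_ge0 (f w))).
  - apply/measurable_EFinP; apply: measurableT_comp => //; exact: itg_meas.
  apply: ae_imp hH => x [ih hx] _.
  have -> : (\int[mu]_y `|f (x, y)| = \int[mu]_y (`|H x y|)%:E)%E by [].
  by rewrite (itgE (itg_abs ih)) lee_fin (le_trans hx)// ler_norm.
(* Iterated integrals are extended-real functions, finite almost everywhere; passing to [fine] makes
   them real-valued without changing their integral. *)
have P (F : R -> \bar R) : mu.-integrable setT F -> itg (fun x => fine (F x)) /\ (\int[mu]_x F x = (Int (fun x => fine (F x)))%:E)%E.
  move=> iF.
  have e : {ae mu, forall x, F x = ((fine (F x)))%:E}.
    apply: ae_imp (integrable_ae measurableT iF) => x /(_ I) fx.
    by rewrite fineK.
  have mF := measurable_int _ iF.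
  have mfF : measurable_fun setT (fun x => fine (F x)) by exact: measurableT_comp.
  have iF' : itg (fun x => fine (F x)).
    apply/integrableP; split; first exact/measurable_EFinP.
    move: (iF) => /integrableP[_]; apply: le_lt_trans.
    apply: ae_ge0_le_integral => //.
    - by apply/measurable_EFinP; apply: measurableT_comp.
    - exact: measurableT_comp.
    - by apply: ae_imp e => x ex _ /=; rewrite [in leRHS]ex.
  split => //; rewrite -(itgE iF').
  apply: ae_eq_integral => //; first exact/measurable_EFinP.
  by apply: ae_imp e => x + _.
have [i1 e1] := P _ (integrable_fubini_F if_).
pose f' := fun z : measurableTypeR R * measurableTypeR R => (H z.2 z.1)%:E.
have mf' : measurable_fun setT f'.
  have -> : f' = f \o (fun w : measurableTypeR R * measurableTypeR R => (w.2, w.1)) by [].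
  by apply: measurableT_comp => //; exact: measurable_fun_pair.
have if' : (mu \x mu)%E.-integrable setT f'.
  apply/integrable12ltyP => //.
  by have /(integrable21ltyP _ _ mf) := if_.
have [i2 e2] := P _ (integrable_fubini_F if').
split; [exact: i1|exact: i2| |].
- have := ae_integrable2 if_; exact: ae_imp.
- by apply: EFin_inj; rewrite -[LHS]e1 -[RHS]e2; exact: Fubini.
Qed.

Lemma Int_dominated (h_ : nat -> R -> R) h g : (forall n, measurable_fun setT (h_ n)) ->
  measurable_fun setT h -> {ae mu, forall x, h_ ^~ x @ \oo --> h x} -> itg g ->
  (forall n x, `|h_ n x| <= g x) ->
  itg h /\ (fun n => Int (h_ n)) @ \oo --> Int h.
Proof.
move=> mh_ mh hh ig hg.
have [||||| i1 _ c] := @dominated_convergence _ _ R mu setT measurableT (fun n x => (h_ n x)%:E)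
   (EFin \o h) (EFin \o g).
- by move=> n; apply: measurableT_comp => //; exact: mh_.
- by apply: measurableT_comp.
- apply: ae_imp hh => x hx _; apply: cvg_EFin => //; exact: nearW.
- exact: ig.
- by apply: aeW => x n _; rewrite lee_fin.
split => //; apply: fine_cvg; rewrite (_ : (fine (\int[mu]_x (h x)%:E))%:E = \int[mu]_x (h x)%:E)%E//.
by rewrite (itgE i1).
Qed.

(** For a nonnegative integrand the integrals over the growing intervals [u n, v n] increase, so
    monotone convergence gives integrability and the value at once, whatever the growth of f at the
    ends of D. *)
Lemma FTC_exhaust (D : R -> bool) F f (u v : nat -> R) L :
  (forall n, u n < v n) -> (forall n m, (n <= m)%N -> u m <= u n /\ v n <= v m) ->
  (forall n x, u n <= x <= v n -> D x) -> (forall x, D x -> exists n, u n <= x <= v n) ->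
  (forall x, D x -> is_derive x 1 F (f x)) -> (forall x, D x -> {for x, continuous f}) ->
  (forall x, D x -> 0 <= f x) ->
  (F (v n) - F (u n)) @[n --> \oo] --> L ->
  itg (fun x => chi (D x) * f x) /\ Int (fun x => chi (D x) * f x) = L.
Proof.
move=> uv mono sub cov dF cf f0 FL.
pose gn n x := chi (u n <= x <= v n) * f x.
have gnr n : gn n = f \_ `[u n, v n].
  apply/funext => x; rewrite /gn /chi /patch mem_setE in_itv/=.
  by case: ifP => _; rewrite (mul1r,mul0r).
have mgn n : measurable_fun setT (gn n).
  rewrite gnr; apply/(measurable_restrictT f) => //.
  apply: subspace_continuous_measurable_fun => //.
  apply: continuous_in_subspaceT => x; rewrite inE/= in_itv/= => xuv.
  by apply: cf; apply: sub xuv.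
have gn0 n x : 0 <= gn n x.
  rewrite /gn /chi; case: (boolP (u n <= x <= v n)) => xuv; rewrite ?mul1r ?mul0r//; exact/f0/(sub n).
have ndg x : {homo gn^~ x : n m / (n <= m)%N >-> n <= m}.
  move=> n m nm; rewrite /gn /chi; have [un vn] := mono _ _ nm.
  case: (boolP (u n <= x <= v n)) => [/andP[a b]|_]; last by rewrite mul0r; exact: gn0.
  by rewrite (le_trans un a) (le_trans b vn).
have lim x : gn ^~ x @ \oo --> chi (D x) * f x.
  rewrite /chi; case: (boolP (D x)) => [Dx|nDx]; last first.
    rewrite mul0r; apply: cvg_near_cst; apply: nearW => n; rewrite /gn.
    case: (boolP (u n <= x <= v n)) => xuv; rewrite ?mul0r//.
    by move: nDx; rewrite (sub n).
  have [n xn] := cov _ Dx; apply: cvg_near_cst; exists n => // m /= nm.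
  have [um vm] := mono _ _ nm; move: xn => /andP[a b].
  by rewrite /gn /chi (le_trans um a) (le_trans b vm).
have Ign n : (\int[mu]_x (gn n x)%:E = (F (v n) - F (u n))%:E)%E.
  have -> : (\int[mu]_x (gn n x)%:E = \int[mu]_(x in `[u n, v n]) (f x)%:E)%E.
    rewrite [RHS]integral_mkcond; apply: eq_integral => x _.
    by rewrite gnr restrict_EFin.
  have dFn x : u n <= x <= v n -> is_derive x 1 F (f x) by move=> /sub /dF.
  have cF x : u n <= x <= v n -> {for x, continuous F}.
    by move=> /dFn [dx _]; apply: differentiable_continuous; apply/derivable1_diffP.
  rewrite (@continuous_FTC2 _ f F)//.
  - apply: continuous_in_subspaceT => x; rewrite inE/= in_itv/= => xuv.
    by apply: cf; apply: sub xuv.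
  - split.
    + by move=> x; rewrite in_itv/= => /andP[a b]; have /dFn [] : u n <= x <= v n by rewrite (ltW a) (ltW b).
    + by apply: cvg_at_right_filter; apply: cF; rewrite lexx ltW.
    + by apply: cvg_at_left_filter; apply: cF; rewrite lexx ltW.
  - move=> x; rewrite in_itv/= => /andP[a b].
    have /dFn [_ <-] : u n <= x <= v n by rewrite (ltW a) (ltW b).
    by rewrite derive1E.
have mD : measurable_fun setT (fun x => chi (D x) * f x).
  by apply: (measurable_fun_cvg mgn) => x _; exact: lim.
have D0 x : 0 <= chi (D x) * f x by rewrite /chi; case: (boolP (D x)) => [/f0|]; rewrite ?mul1r ?mul0r.
have E : (\int[mu]_x (chi (D x) * f x)%:E = L%:E)%E.
  have := @cvg_monotone_convergence _ _ R mu setT measurableT (fun n x => (gn n x)%:E).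
  move=> /(_ _ _ _); rewrite /=.
  have -> : (fun n => \int[mu]_x (gn n x)%:E)%E = (fun n => (F (v n) - F (u n))%:E).
    by apply/funext => n; rewrite Ign.
  have -> : (fun x => limn (fun n => (gn n x)%:E)) = (fun x => (chi (D x) * f x)%:E).
    apply/funext => x; apply/cvg_lim => //; apply: cvg_EFin; [exact: nearW|exact: lim].
  move=> H; apply: (cvg_unique _ (H _ _ _)) => //.
  - by move=> n; apply: measurableT_comp => //; exact: mgn.
  - by move=> n x _; rewrite lee_fin.
  - by move=> x _ n m nm; rewrite lee_fin ndg.
  - by apply: cvg_EFin => //; exact: nearW.
have iD : itg (fun x => chi (D x) * f x).
  apply: itgP => //; rewrite (_ : \int[mu]_x _ = L%:E)%E ?ltry//.
  by rewrite -E; apply: eq_integral => x _; rewrite ger0_norm.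
by split => //; apply: EFin_inj; rewrite -E itgE.
Qed.

End Indicators.

Arguments chi {R}.

(** * Truncated powers *)

Section TruncatedPowers.
Variable R : realType.
Implicit Types (f g h : R -> R) (a b c d r e x y : R).
Notation mu := (@lebesgue_measure R).

Lemma measurable_chi (di : measure_display) (T : measurableType di) (p : T -> bool) :
  measurable_fun setT p -> measurable_fun setT (fun t => chi (p t) : R).
Proof.
move=> mp; rewrite /chi (_ : (fun t => _) = (fun t => if p t then 1 else 0)).
  exact: measurable_fun_ifT.
by apply/funext => t; case: (p t).
Qed.

(* The positive part x_+^e; [powR] alone would not do, since x `^ e = 1 for x < 0. *)
Definition pp e x : R := if 0 < x then x `^ e else 0.

Lemma measurable_pp e : measurable_fun setT (pp e).
Proof.
apply: (@measurable_fun_ifT _ _ _ _ (fun x => x `^ e) (fun=> 0) (fun x => 0 < x)) => //.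
by apply: measurable_fun_ltr.
Qed.

Lemma pp_ge0 e x : 0 <= pp e x.
Proof. by rewrite /pp; case: ifP => // _; exact: powR_ge0. Qed.

Lemma pp_pos e x : 0 < x -> pp e x = x `^ e.
Proof. by rewrite /pp => ->. Qed.

Lemma pp_neg e x : x <= 0 -> pp e x = 0.
Proof. by rewrite /pp ltNge => ->. Qed.

Lemma ppZ e c x : 0 < c -> pp e (c * x) = c `^ e * pp e x.
Proof.
move=> c0; rewrite /pp pmulr_rgt0//; case: ifP => x0; last by rewrite mulr0.
by rewrite powRM// ltW.
Qed.

Lemma FTC_oo F f a b A B : a < b ->
  (forall x, a < x < b -> is_derive x 1 F (f x)) ->
  (forall x, a < x < b -> {for x, continuous f}) ->
  (forall x, a < x < b -> 0 <= f x) ->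
  F x @[x --> a^'+] --> A -> F x @[x --> b^'-] --> B ->
  itg (fun x => chi (a < x < b) * f x) /\ Int (fun x => chi (a < x < b) * f x) = B - A.
Proof.
move=> ab dF cf f0 FA FB.
have ba : 0 < b - a by rewrite subr_gt0.
(* The denominator n + 3 gives 2 q n < b - a already for n = 0, so that the two ends do not
   cross. *)
pose q (n : nat) : R := (b - a) / n.+3%:R.
have q0 n : 0 < q n by rewrite divr_gt0.
have qd n m : (n <= m)%N -> q m <= q n.
  by move=> nm; rewrite ler_pM2l// lef_pV2 ?posrE// ler_nat !ltnS.
have q2 n : q n + q n < b - a.
  have := qd 0%N n (leq0n n); rewrite /q => H.
  apply: (@le_lt_trans _ _ ((b - a) / 3 + (b - a)/3)); first exact: lerD.
  by move: ba; lra.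
have qc : q @ \oo --> 0.
  rewrite -(mulr0 (b - a)); apply: cvgM; first exact: cvg_cst.
  have := @cvg_harmonic R; rewrite -(cvg_shiftn 2%N).
  by apply: cvg_trans; apply: near_eq_cvg; apply: nearW => n /=; rewrite addn2.
apply: (@FTC_exhaust _ (fun x => a < x < b) F f (fun n => a + q n) (fun n => b - q n)) => //.
- by move=> n; have := q2 n; lra.
- by move=> n m /qd; lra.
- by move=> n x /andP[h1 h2]; have := q0 n; lra.
- move=> x /andP[ax xb].
  have m0 : 0 < Num.min (x - a) (b - x) by rewrite lt_min !subr_gt0 ax xb.
  have /cvgrPdist_lt /(_ _ m0) [n _ /(_ n (leqnn n))] := qc.
  by rewrite /= sub0r normrN gtr0_norm// lt_min => /andP[h1 h2]; exists n; lra.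
- apply: cvgB.
  + apply: (@cvg_at_leftP _ F b B).1 => //; split.
    * by move=> n; have := q0 n; lra.
    * by rewrite -[X in _ --> X]subr0; apply: cvgB => //; exact: cvg_cst.
  + apply: (@cvg_at_rightP _ F a A).1 => //; split.
    * by move=> n; have := q0 n; lra.
    * by rewrite -[X in _ --> X]addr0; apply: cvgD => //; exact: cvg_cst.
Qed.

Lemma FTC_oy F f a A B :
  (forall x, a < x -> is_derive x 1 F (f x)) ->
  (forall x, a < x -> {for x, continuous f}) ->
  (forall x, a < x -> 0 <= f x) ->
  F x @[x --> a^'+] --> A -> F x @[x --> +oo] --> B ->
  itg (fun x => chi (a < x) * f x) /\ Int (fun x => chi (a < x) * f x) = B - A.
Proof.
move=> dF cf f0 FA FB.
pose q (n : nat) : R := n.+1%:R^-1.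
have q0 n : 0 < q n by rewrite invr_gt0.
have qd n m : (n <= m)%N -> q m <= q n.
  by move=> nm; rewrite lef_pV2 ?posrE// ler_nat !ltnS.
have qc : q @ \oo --> 0 by exact: cvg_harmonic.
have q1 n : q n <= 1 by rewrite invf_le1// ler1n.
(* Since q 0 = 1, the upper end needs n + 2 to exceed the lower end strictly for n = 0. *)
apply: (@FTC_exhaust _ (fun x => a < x) F f (fun n => a + q n) (fun n => a + n.+2%:R)) => //.
- move=> n; have := q1 n; rewrite ltrD2l => h; apply: (le_lt_trans h); by rewrite ltr1n.
- move=> n m nm; have := qd _ _ nm; split; first lra.
  by rewrite lerD2l ler_nat !ltnS.
- by move=> n x /andP[h1 h2]; have := q0 n; lra.
- move=> x ax.
  have m0 : 0 < x - a by rewrite subr_gt0.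
  have /cvgrPdist_lt /(_ _ m0) [n _ hn] := qc.
  pose k := Num.bound (x - a).
  have kk : x - a < k%:R by apply: archi_boundP; exact: ltW.
  have /= := hn (maxn n k) (leq_maxl _ _); rewrite sub0r normrN gtr0_norm// => h.
  exists (maxn n k); apply/andP; split; first lra.
  rewrite -lerBlDl; apply: (le_trans (ltW kk)); rewrite ler_nat.
  by rewrite (leq_trans (leq_maxr n k))// -addn2 leq_addr.
- apply: cvgB.
  + apply: ((@cvg_pinftyP _ F B).1 FB).
    apply/cvgryPge => r; near=> n.
    rewrite -lerBlDl; apply: (@le_trans _ _ n%:R); first by near: n; exact: nbhs_infty_ger.
    by rewrite ler_nat -addn2 leq_addr.
  + apply: (@cvg_at_rightP _ F a A).1 => //; split.
    * by move=> n; have := q0 n; lra.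
    * by rewrite -[X in _ --> X]addr0; apply: cvgD => //; exact: cvg_cst.
Unshelve. all: by end_near. Qed.

Lemma continuous_powR e x : 0 < x -> {for x, continuous (fun y : R => y `^ e)}.
Proof.
move=> x0; apply: differentiable_continuous; apply/derivable1_diffP.
by apply: derivable_powR; rewrite in_itv/= x0.
Qed.

Lemma is_derive_pow e x : 0 < x -> e + 1 != 0 ->
  is_derive x 1 (fun y => (e + 1)^-1 * y `^ (e + 1)) (x `^ e).
Proof.
move=> x0 e1; have H := is_derive1_powR (e + 1) x0.
apply: (is_derive_eq (is_deriveZ (e + 1)^-1 H)).
by rewrite /GRing.scale/= addrK mulrA mulVf// mul1r.
Qed.

Lemma powR_cvgy0 e : e < 0 -> x `^ e @[x --> +oo] --> (0 : R).
Proof.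
move=> e0; apply/cvgrPdist_lt => eps eps0; near=> x.
have x0 : 0 < x by near: x; exact: nbhs_pinfty_gt.
rewrite sub0r normrN ger0_norm ?powR_ge0//.
have -> : eps = (eps `^ e^-1) `^ e by rewrite -powRrM mulVf ?lt_eqF// powRr1 // ltW.
rewrite -ltf_pV2 ?posrE ?powR_gt0// ?powR_gt0// -!powRN.
apply: gt0_ltr_powR; rewrite ?oppr_gt0// ?nnegrE ?powR_ge0 ?ltW//.
Unshelve. all: by end_near. Qed.

Lemma pp_near0 e r : -1 < e -> 0 < r ->
  itg (fun x => chi (x < r) * pp e x) /\ Int (fun x => chi (x < r) * pp e x) = (e + 1)^-1 * r `^ (e + 1).
Proof.
move=> e1 r0.
have e10 : 0 < e + 1 by lra.
have := @FTC_oo (fun y => (e + 1)^-1 * y `^ (e + 1)) (fun x => x `^ e) 0 r 0 ((e + 1)^-1 * r `^ (e + 1)) r0.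
rewrite subr0.
rewrite (_ : (fun x => chi (0 < x < r) * _) = (fun x => chi (x < r) * pp e x)); last first.
  apply/funext => x; rewrite /pp; case: ltP => x0; last by rewrite /chi mul0r mulr0.
  by [].
apply.
- by move=> x /andP[x0 _]; apply: is_derive_pow => //; rewrite gt_eqF.
- by move=> x /andP[x0 _]; exact: continuous_powR.
- by move=> x _; exact: powR_ge0.
- by rewrite -[X in _ --> X](mulr0 (e + 1)^-1); apply: cvgM; [exact: cvg_cst|exact: powR_cvg0].
- apply: cvgM; first exact: cvg_cst.
  by apply: cvg_at_left_filter; exact: continuous_powR.
Qed.

Lemma pp_neary e r : e < -1 -> 0 < r ->
  itg (fun x => chi (r < x) * pp e x) /\ Int (fun x => chi (r < x) * pp e x) = - ((e + 1)^-1 * r `^ (e + 1)).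
Proof.
move=> e1 r0.
have e10 : e + 1 < 0 by lra.
have := @FTC_oy (fun y => (e + 1)^-1 * y `^ (e + 1)) (fun x => x `^ e) r ((e + 1)^-1 * r `^ (e + 1)) 0.
rewrite sub0r.
rewrite (_ : (fun x => chi (r < x) * x `^ e) = (fun x => chi (r < x) * pp e x)); last first.
  apply/funext => x; case: (ltP r x) => rx; last by rewrite /chi !mul0r.
  by rewrite pp_pos// (lt_trans r0).
apply.
- by move=> x rx; apply: is_derive_pow; rewrite ?lt_eqF// (lt_trans r0).
- by move=> x rx; apply: continuous_powR; rewrite (lt_trans r0).
- by move=> x _; exact: powR_ge0.
- apply: cvgM; first exact: cvg_cst.
  by apply: cvg_at_right_filter; exact: continuous_powR.
- by rewrite -(mulr0 (e + 1)^-1); apply: cvgM; [exact: cvg_cst|exact: powR_cvgy0].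
Qed.

End TruncatedPowers.

Ltac mea :=
  repeat first
  [ assumption
  | apply: measurable_cst
  | exact: measurable_id
  | exact: measurable_pp
  | apply: measurable_funB | apply: measurable_funD | apply: measurable_funM
  | apply: measurable_funN
  | apply: measurable_fst | apply: measurable_snd
  | match goal with
    | mh : measurable_fun _ ?h |- measurable_fun _ (fun z => ?h _) =>
        apply: (measurableT_comp mh)
    | |- measurable_fun _ (fun z => chi _) => apply: measurable_chi
    | |- measurable_fun _ (fun z => pp ?e _) => apply: (measurableT_comp (measurable_pp e))
    | |- measurable_fun _ (fun z => `|_|) => apply: measurableT_comp
    | |- measurable_fun _ (fun z => _ < _) => apply: measurable_fun_ltr
    | |- measurable_fun _ (fun z => _ <= _) => apply: measurable_fun_ler
    | |- measurable_fun _ (fun z => _ && _) => apply: measurable_and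
    | |- measurable_fun _ (fun z => if _ then _ else _) => apply: measurable_fun_ifT
    end ].

(** * Powers of |x| and two-sided power kernels *)

Section PowerKernels.
Variable R : realType.
Implicit Types (f g : R -> R) (a b c d r e h x y u v : R).
Notation mu := (@lebesgue_measure R).

Lemma chiT (P : bool) : P -> chi P = 1 :> R. Proof. by rewrite /chi => ->. Qed.
Lemma chiF (P : bool) : ~~ P -> chi P = 0 :> R. Proof. by rewrite /chi => /negbTE ->. Qed.

Lemma ae_neq a : {ae mu, forall x, x != a}.
Proof.
exists [set a]; split => //; first by rewrite lebesgue_measure_set1.
by move=> x /= /negP; rewrite negbK => /eqP.
Qed.

Lemma ae_le_Int g (h : R -> R) : itg g -> itg h -> {ae mu, forall x, g x <= h x} -> Int g <= Int h.
Proof.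
move=> ig ih gh.
(* The maximum equals h almost everywhere and dominates g everywhere. *)
have im : itg (fun x => Num.max (g x) (h x)).
  apply: (itg_le _ _ (itgD (itg_abs ig) (itg_abs ih))).
    by apply: measurable_maxr; apply: itg_meas.
  move=> x; rewrite /Num.max; case: ifP => _; first by rewrite lerDr.
  by rewrite lerDl.
have <- : Int (fun x => Num.max (g x) (h x)) = Int h.
  apply: ae_Int; [exact: itg_meas|exact: itg_meas|].
  by apply: ae_imp gh => x gh; rewrite max_r.
by apply: le_Int => // x; rewrite le_max lexx.
Qed.

Lemma itg_chi a b : itg (fun x => chi (a < x < b)) /\
  (a < b -> Int (fun x => chi (a < x < b)) = b - a).
Proof.
have e : (fun x => chi (a < x < b)) = \1_(`]a, b[%classic : set R) :> (R -> R).
  by apply/funext => x; rewrite indicE mem_setE in_itv.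
have i : itg (fun x => chi (a < x < b)).
  by rewrite e; have := @integrable_indic_itv R a b false true.
split => // ab; apply: EFin_inj; rewrite -(itgE i).
rewrite (_ : (fun x => (chi (a < x < b))%:E) = (fun x => (\1_(`]a, b[%classic : set R) x)%:E)); last first.
  by apply/funext => x; move: (congr1 (fun k => k x) e) => /= ->.
rewrite integral_indic//= setIT lebesgue_measure_itv/= lte_fin ab.
by rewrite -EFinB.
Qed.

Lemma Int_gt0 (h : R -> R) a b c : itg h -> {ae mu, forall x, 0 <= h x} -> a < b -> 0 < c ->
  {ae mu, forall x, a < x < b -> c <= h x} -> 0 < Int h.
Proof.
move=> ih h0 ab c0 hc.
have [i e] := itg_chi a b.
apply: (@lt_le_trans _ _ (c * (b - a))); first by rewrite mulr_gt0// subr_gt0.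
rewrite -e// -IntZ//; apply: ae_le_Int => //; first exact: itgZ.
apply: ae_imp (ae_and h0 hc) => x [h0x hcx].
case: (boolP (a < x < b)) => axb; first by rewrite chiT// mulr1 hcx.
by rewrite chiF// mulr0.
Qed.

Definition ab e x : R := pp e `|x|.

Lemma ab_ge0 e x : 0 <= ab e x. Proof. exact: pp_ge0. Qed.

Lemma abN e x : ab e (- x) = ab e x. Proof. by rewrite /ab normrN. Qed.

Lemma abE e x : x != 0 -> ab e x = `|x| `^ e.
Proof. by move=> x0; rewrite /ab pp_pos// normr_gt0. Qed.

Lemma ab_pos e x : 0 < x -> ab e x = x `^ e.
Proof. by move=> x0; rewrite abE ?gt_eqF// gtr0_norm. Qed.

Lemma ab_even e x : ab e x = pp e x + pp e (- x).
Proof.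
rewrite /ab; have [x0|x0|->] := ltrgt0P x.
- by rewrite (pp_neg _ (_ : - x <= 0)) ?addr0// oppr_le0 ltW.
- by rewrite (pp_neg _ (_ : x <= 0)) ?add0r// ltW.
- by rewrite oppr0 pp_neg ?addr0.
Qed.

Lemma measurable_ab e : measurable_fun setT (ab e).
Proof. rewrite (_ : ab e = pp e \o Num.norm)//; apply: measurableT_comp => //; exact: measurable_pp. Qed.

Lemma abZ e c x : 0 < c -> ab e (c * x) = c `^ e * ab e x.
Proof. by move=> c0; rewrite /ab normrM gtr0_norm// ppZ. Qed.

Lemma ab_le e r x : e <= 0 -> 0 < r -> r <= `|x| -> ab e x <= r `^ e.
Proof.
move=> e0 r0 rx; have x0 : 0 < `|x| by exact: lt_le_trans rx.
rewrite /ab pp_pos// -[e]opprK !(powRN _ (- e)) lef_pV2 ?posrE ?powR_gt0//.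
by apply: ge0_ler_powR; rewrite ?oppr_ge0 ?nnegrE// ltW.
Qed.

Lemma ab_le_pos e r x : 0 <= e -> 0 <= r -> `|x| <= r -> ab e x <= r `^ e.
Proof.
move=> e0 r0 rx; rewrite /ab /pp; case: ifP => x0; last exact: powR_ge0.
by apply: ge0_ler_powR; rewrite ?nnegrE.
Qed.

Lemma ab_near0 e r : -1 < e -> 0 < r -> itg (fun x => chi (`|x| < r) * ab e x) /\
  Int (fun x => chi (`|x| < r) * ab e x) = 2 * ((e + 1)^-1 * r `^ (e + 1)).
Proof.
move=> e1 r0; have [i E] := pp_near0 e1 r0.
have -> : (fun x => chi (`|x| < r) * ab e x) =
   (fun x => chi (x < r) * pp e x + chi (- x < r) * pp e (- x)).
  apply/funext => x; rewrite ab_even.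
  have [x0|x0|->] := ltrgt0P x.
  - by rewrite (pp_neg _ (_ : - x <= 0)) ?oppr_le0 ?(ltW x0)// !(addr0, mulr0).
  - by rewrite (pp_neg _ (_ : x <= 0)) ?(ltW x0)// !(add0r, mulr0).
  - by rewrite oppr0 pp_neg// addr0 !mulr0 addr0.
have j := itg_opp i; split; first exact: itgD.
by rewrite (IntD i j) (Int_opp i) E mulr_natl mulr2n.
Qed.

Lemma ab_neary e r : e < -1 -> 0 < r -> itg (fun x => chi (r < `|x|) * ab e x) /\
  Int (fun x => chi (r < `|x|) * ab e x) = - (2 * ((e + 1)^-1 * r `^ (e + 1))).
Proof.
move=> e1 r0; have [i E] := pp_neary e1 r0.
have -> : (fun x => chi (r < `|x|) * ab e x) =
   (fun x => chi (r < x) * pp e x + chi (r < - x) * pp e (- x)).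
  apply/funext => x; rewrite ab_even.
  have [x0|x0|->] := ltrgt0P x.
  - by rewrite (pp_neg _ (_ : - x <= 0)) ?oppr_le0 ?(ltW x0)// !(addr0, mulr0).
  - by rewrite (pp_neg _ (_ : x <= 0)) ?(ltW x0)// !(add0r, mulr0).
  - by rewrite oppr0 pp_neg// addr0 !mulr0 addr0.
have j := itg_opp i; split; first exact: itgD.
by rewrite (IntD i j) (Int_opp i) E mulr_natl mulr2n opprD.
Qed.

Lemma powR_mvt e x y : 0 < x -> x < y ->
  exists2 t, x < t < y & y `^ e - x `^ e = e * t `^ (e - 1) * (y - x).
Proof.
move=> x0 xy.
have dF t : t \in `]x, y[ -> is_derive t 1 (fun t : R => t `^ e) (e * t `^ (e - 1)).
  by rewrite in_itv/= => /andP[xt _]; apply: is_derive1_powR; exact: lt_trans xt.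
have cF : {within `[x, y], continuous (fun t : R => t `^ e)}.
  apply: continuous_in_subspaceT => t; rewrite inE/= in_itv/= => /andP[xt _].
  by apply: continuous_powR; exact: lt_le_trans xt.
have [t + ->] := MVT xy dF cF.
by rewrite in_itv/= => txy; exists t.
Qed.

Lemma powR_anti e x y : e <= 0 -> 0 < x -> x <= y -> y `^ e <= x `^ e.
Proof. by move=> e0 x0 xy; rewrite -(ab_pos e (lt_le_trans x0 xy)); apply: ab_le => //; rewrite (le_trans xy)// ler_norm. Qed.

Lemma powR_lip e r x y : e <= 1 -> 0 < r -> r <= x -> r <= y ->
  `|y `^ e - x `^ e| <= `|e| * r `^ (e - 1) * `|y - x|.
Proof.
move=> e1 r0.
wlog xy : x y / x <= y.
  move=> H rx ry; have [xy|/ltW yx] := leP x y; first exact: H.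
  by rewrite distrC (distrC y); exact: H.
move: xy; rewrite le_eqVlt => /predU1P[->|xy] rx ry.
  by rewrite !subrr normr0 mulr0.
have [t /andP[xt ty] ->] := powR_mvt e (lt_le_trans r0 rx) xy.
rewrite !normrM ler_wpM2r// ler_wpM2l// ger0_norm ?powR_ge0//.
by apply: powR_anti => //; [lra|exact: (le_trans rx (ltW xt))].
Qed.

(** The mean value theorem is used twice: for (t + h)^e - t^e on [x - h, x], then for the derivative
    on [t, t + h]. *)
Lemma powR_diff2 e x h : 0 < h -> h < x ->
  exists2 t, x - h < t < x + h &
    (x + h) `^ e + (x - h) `^ e - 2 * x `^ e = e * (e - 1) * t `^ (e - 2) * h ^+ 2.
Proof.
move=> h0 hx.
pose G (t : R) := (t + h) `^ e - t `^ e.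
have x0 : 0 < x - h by rewrite subr_gt0.
have dG t : t \in `](x - h), x[ -> is_derive t 1 G (e * (t + h) `^ (e - 1) - e * t `^ (e - 1)).
  rewrite in_itv/= => /andP[xt _]; have t0 := lt_trans x0 xt.
  apply: is_deriveB; last exact: is_derive1_powR.
  have th0 : 0 < t + h by rewrite addr_gt0.
  have D1 := is_derive1_powR e th0.
  have D2 : is_derive t 1 (fun t => t + h) 1.
    by apply: is_derive_eq; rewrite ?addr0.
  have := @is_derive1_comp _ (fun s => s `^ e) (fun t => t + h) t _ _ D1 D2.
  by rewrite mulr1.
have cG : {within `[x - h, x], continuous G}.
  apply: continuous_in_subspaceT => t; rewrite inE/= in_itv/= => /andP[xt _].
  have t0 : 0 < t by exact: lt_le_trans xt.
  apply: cvgB; last exact: continuous_powR.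
  apply: (@continuous_comp _ _ _ (fun t => t + h) (fun s => s `^ e)).
    by apply: cvgD; [exact: cvg_id|exact: cvg_cst].
  by apply: continuous_powR; rewrite addr_gt0.
have xh : x - h < x by lra.
have [t] := MVT xh dG cG; rewrite in_itv/= => /andP[xt tx] E.
have t0 := lt_trans x0 xt.
have th : t < t + h by rewrite ltrDl.
have [w /andP[w1 w2] Ew] := powR_mvt (e - 1) t0 th.
exists w; first by lra.
have -> : (x + h) `^ e + (x - h) `^ e - 2 * x `^ e = G x - G (x - h).
  by rewrite /G subrK; ring.
rewrite E -mulrBr Ew (_ : e - 1 - 1 = e - 2); last by ring.
by rewrite (_ : t + h - t = h); ring.
Qed.

Lemma powR_diff2_le e r x h : e <= 2 -> 0 <= h -> 0 < r -> r <= x - h ->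
  `|(x + h) `^ e + (x - h) `^ e - 2 * x `^ e| <= `|e * (e - 1)| * r `^ (e - 2) * h ^+ 2.
Proof.
move=> e2; rewrite le_eqVlt => /predU1P[<-|h0] r0 rx.
  by rewrite addr0 subr0 -mulr2n mulr_natl subrr normr0 expr0n/= mulr0.
have hx : h < x by lra.
have [t /andP[t1 t2] ->] := powR_diff2 e h0 hx.
rewrite [in leLHS]normrM (ger0_norm (sqr_ge0 h)) ler_wpM2r ?sqr_ge0//.
rewrite normrM ler_wpM2l// ger0_norm ?powR_ge0//.
by apply: powR_anti => //; lra.
Qed.

Lemma measurable_oppr_id : measurable_fun setT (fun x => - x).
Proof. exact: (@oppr_measurable R setT). Qed.

(* u x_+^e + v x_-^e. *)
Definition ker u v e x := u * pp e x + v * pp e (- x).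

Lemma measurable_ker u v e : measurable_fun setT (ker u v e).
Proof. rewrite /ker; mea. Qed.

Lemma kerZ u v e c x : 0 < c -> ker u v e (c * x) = c `^ e * ker u v e x.
Proof. by move=> c0; rewrite /ker -mulrN !ppZ//; ring. Qed.

Lemma ker_pos u v e x : 0 < x -> ker u v e x = u * x `^ e.
Proof. by move=> x0; rewrite /ker pp_pos// pp_neg ?mulr0 ?addr0// oppr_le0 ltW. Qed.

Lemma kerN u v e x : ker u v e (- x) = ker v u e x.
Proof. by rewrite /ker opprK addrC. Qed.

Lemma ker_neg u v e x : x < 0 -> ker u v e x = v * (- x) `^ e.
Proof. by move=> x0; rewrite -[in LHS](opprK x) kerN ker_pos// oppr_gt0. Qed.

Lemma ker0 u v e : ker u v e 0 = 0.
Proof. by rewrite /ker oppr0 pp_neg// !mulr0 addr0. Qed.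

Lemma ker_le u v e x : `|ker u v e x| <= (`|u| + `|v|) * ab e x.
Proof.
rewrite /ker ab_even (le_trans (ler_normD _ _))// !normrM !(ger0_norm (pp_ge0 _ _)).
rewrite mulrDl lerD// ler_wpM2l// ?lerDl ?lerDr pp_ge0//.
Qed.

(** The segment from x to y then misses ]-r, r[, where the kernels are singular. *)
Definition away r x y := (r <= x /\ r <= y) \/ (r <= - x /\ r <= - y).

Lemma ker_lip u v e r x y : e <= 1 -> 0 < r -> away r x y ->
  `|ker u v e y - ker u v e x| <= (`|u| + `|v|) * (`|e| * r `^ (e - 1) * `|y - x|).
Proof.
move=> e1 r0; wlog [rx ry] : u v x y / r <= x /\ r <= y.
  move=> H [rxy|rxy]; first by apply: H => //; left.
  have := H v u (- x) (- y) rxy (or_introl rxy).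
  rewrite !kerN (addrC `|v|) (_ : - y - - x = - (y - x)) ?normrN//; ring.
move=> _; rewrite !ker_pos ?(lt_le_trans r0)// -mulrBr normrM.
apply: ler_pM => //; first by rewrite lerDl.
exact: powR_lip.
Qed.

Lemma ker_diff2 u v e r x h : e <= 2 -> 0 <= h -> 0 < r -> r + h <= `|x| ->
  `|ker u v e (x + h) + ker u v e (x - h) - 2 * ker u v e x| <=
  (`|u| + `|v|) * (`|e * (e - 1)| * r `^ (e - 2) * h ^+ 2).
Proof.
move=> e2 h0 r0; wlog x0 : u v x / 0 <= x.
  move=> H rx; have [x0|/ltW x0] := leP 0 x; first exact: H.
  have := H v u (- x); rewrite oppr_ge0 normrN => /(_ x0 rx).
  rewrite (_ : - x + h = - (x - h)); last by ring.
  rewrite (_ : - x - h = - (x + h)); last by ring.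
  by rewrite !kerN (addrC `|v|) (addrC (ker u v e (x - h))).
rewrite ger0_norm// => rx.
rewrite !ker_pos; [|lra..].
rewrite (_ : _ - _ = u * ((x + h) `^ e + (x - h) `^ e - 2 * x `^ e)); last by ring.
rewrite normrM; apply: ler_pM => //; first by rewrite lerDl.
by apply: powR_diff2_le => //; lra.
Qed.

Lemma powR_small (C e eps : R) : 0 <= C -> 0 < e -> 0 < eps -> exists2 h, 0 < h & forall t, 0 <= t -> t < h -> C * t `^ e <= eps.
Proof.
move=> C0 e0 eps0; have c1 : 0 < C + 1 by lra.
exists ((eps / (C + 1)) `^ e^-1); first by rewrite powR_gt0// divr_gt0.
move=> t t0 th; apply: (@le_trans _ _ ((C + 1) * (eps / (C + 1)))); last by rewrite mulrCA mulfV ?mulr1// gt_eqF.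
apply: ler_pM => //; [exact: powR_ge0|lra|].
have : t `^ e <= ((eps / (C + 1)) `^ e^-1) `^ e.
  by apply: ge0_ler_powR => //; rewrite ?nnegrE ?powR_ge0 ?ltW.
by rewrite -powRrM mulVf ?gt_eqF// powRr1// ltW// divr_gt0.
Qed.

End PowerKernels.

Arguments chiT {R P}.
Arguments chiF {R P}.

Ltac mea ::=
  repeat first
  [ assumption
  | apply: measurable_cst
  | exact: measurable_id
  | exact: measurable_pp | exact: measurable_oppr_id | exact: measurable_ab | exact: measurable_ker
  | match goal with
    | mh : measurable_fun _ ?h |- measurable_fun _ (fun z => ?h _) =>
        apply: (measurableT_comp mh)
    | |- measurable_fun _ (fun z => chi _) => apply: measurable_chi
    | |- measurable_fun _ (fun z => pp ?e _) => apply: (measurableT_comp (measurable_pp e))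
    | |- measurable_fun _ (fun z => ab ?e _) => apply: (measurableT_comp (measurable_ab e))
    | |- measurable_fun _ (fun z => ker ?u ?v ?e _) => apply: (measurableT_comp (measurable_ker u v e))
    | |- measurable_fun _ (fun z => `|_|) => apply: (measurableT_comp (@normr_measurable _ setT))
    | |- measurable_fun _ (fun z => _ < _) => apply: measurable_fun_ltr
    | |- measurable_fun _ (fun z => _ <= _) => apply: measurable_fun_ler
    | |- measurable_fun _ (fun z => _ && _) => apply: measurable_and
    | |- measurable_fun _ (fun z => if _ then _ else _) => apply: measurable_fun_ifT
    | |- measurable_fun _ (fun z => _ * _) => apply: measurable_funM
    | |- measurable_fun _ (fun z => _ - _) => apply: measurable_funB
    | |- measurable_fun _ (fun z => _ + _) => apply: measurable_funD
    | |- measurable_fun _ (fun z => - _) => apply: (measurableT_comp measurable_oppr_id)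
    end
  | apply: measurable_fst | apply: measurable_snd | apply: measurable_fun_ltr | apply: measurable_fun_ler ].
(* Otherwise unification unfolds the construction of the Lebesgue integral. *)
#[global] Opaque Int itg.

(** * The kernels k and M *)

Section KernelIdentity.
Variable R : realType.
Variables (m al be : R).
Hypotheses (m0 : 0 < m) (m1 : m < 1) (al0 : 0 < al) (be0 : 0 < be).
Implicit Types (f g : R -> R) (a b c d r e h x y u v : R).
Notation mu := (@lebesgue_measure R).

Lemma one_powR e : 1 `^ e = 1 :> R. Proof. by rewrite powR1. Qed.

Definition kk := ker al be (- m).
Definition MM := ker al (- be) (m - 1).

Let A := al + be.

Lemma A0 : 0 < A. Proof. exact: addr_gt0. Qed.

Lemma kk_le x : `|kk x| <= A * ab (- m) x.
Proof. by have := ker_le al be (- m) x; rewrite (gtr0_norm al0) (gtr0_norm be0). Qed.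

Lemma MM_le x : `|MM x| <= A * ab (m - 1) x.
Proof. by have := ker_le al (- be) (m - 1) x; rewrite normrN (gtr0_norm al0) (gtr0_norm be0). Qed.

Lemma kk_lip r x y : 0 < r -> away r x y ->
  `|kk y - kk x| <= A * (r `^ (- m - 1) * `|y - x|).
Proof.
move=> r0 aw.
have h1 : - m <= 1 by move: m0; lra.
apply: le_trans (@ker_lip _ al be (- m) r x y h1 r0 aw) _.
rewrite (gtr0_norm al0) (gtr0_norm be0) ler_wpM2l ?(ltW A0)// ler_wpM2r// ler_piMl ?powR_ge0//.
by rewrite normrN gtr0_norm// ltW.
Qed.

(** M(y) k(x - y) is only of order 1/|y| at infinity; subtracting k(- y) there gains one power and
    makes the integral absolutely convergent. *)
Let Gx x y := MM y * (kk (x - y) - chi (`|x| < `|y|) * kk (- y)).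

Lemma Gx_itg1 (s : R) : `|s| = 1 -> itg (Gx s).
Proof.
move=> s1; have hA := A0.
pose C1 := 2^-1 `^ (m - 1) : R; pose C2 := 2^-1 `^ (- m) : R; pose C3 := 2^-1 `^ (- m - 1) : R.
pose C := A * A * (1 + C1 + C2 + C3).
have C10 : 0 <= C1 by exact: powR_ge0.
have C20 : 0 <= C2 by exact: powR_ge0.
have C30 : 0 <= C3 by exact: powR_ge0.
have AA : 0 <= A * A by rewrite mulr_ge0// ltW.
have C0 : 0 <= C by rewrite mulr_ge0// !addr_ge0.
(* Three majorants: T1 for the singularity of M at 0, T2 for that of k at y = s, T3 for the tail of
   order |y|^(-2). *)
pose T1 y := chi (`|y| < 3) * ab (m - 1) y.
pose T2 y := chi (`|y - s| < 1) * ab (- m) (y - s).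
pose T3 y := chi (2 < `|y|) * ab (-2) y.
have T10 y : 0 <= T1 y by rewrite mulr_ge0// ?chi_ge0 ?ab_ge0.
have T20 y : 0 <= T2 y by rewrite mulr_ge0// ?chi_ge0 ?ab_ge0.
have T30 y : 0 <= T3 y by rewrite mulr_ge0// ?chi_ge0 ?ab_ge0.
apply: (@itg_le _ (fun y => C * (T1 y + T2 y + T3 y))).
- by rewrite /Gx /MM /kk; mea.
- move=> y; rewrite /Gx.
  have key (t X Y : R) : 0 <= t -> t <= 1 + C1 + C2 + C3 -> X <= A * A * (t * Y) -> 0 <= Y -> 
      Y <= T1 y + T2 y + T3 y -> X <= C * (T1 y + T2 y + T3 y).
    move=> t0 tC XY Y0 YT; apply: (le_trans XY); rewrite /C -[leRHS]mulrA; apply: ler_wpM2l => //; exact: ler_pM.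
  have [y2|y2] := ltP 2 `|y|.
    apply: (@key C3 _ (T3 y)) => //; [by lra| |by rewrite lerDr addr_ge0].
    have sy : `|s| < `|y| by rewrite s1; lra.
    rewrite chiT// mul1r normrM /T3 chiT// mul1r.
    have y0 : y != 0 by rewrite -normr_gt0; lra.
    have yp : 0 < `|y| / 2 by lra.
    have aw : away (`|y| / 2) (- y) (s - y).
      have := s1; rewrite /away; case: (ltrgt0P s) => ss ss1; case: (ltrgt0P y) y2 => yy y2; lra.
    have H1 := kk_lip yp aw; have H2 := MM_le y.
    apply: (le_trans (ler_pM _ _ H2 H1)) => //.
    rewrite opprK subrK s1 mulr1 !abE//.
    rewrite powRM ?invr_ge0// -/C3 mulrACA ler_wpM2l//.
    rewrite (mulrC _ C3) mulrCA ler_wpM2l// -powRD ?normr_eq0 ?y0 ?implybT//.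
    by rewrite (_ : m - 1 + (- m - 1) = -2)//; ring.
  have [->|y0] := eqVneq y 0.
    by rewrite /MM ker0 mul0r normr0 mulr_ge0// !addr_ge0.
  have ab0 : 0 <= ab (m - 1) y by exact: ab_ge0.
  have K2 : `|chi (`|s| < `|y|) * kk (- y)| <= A.
    rewrite s1; case: (boolP (1 < `|y|)) => yy; last by rewrite chiF// mul0r normr0 ltW.
    rewrite chiT// mul1r (le_trans (kk_le _))// abN ler_piMr ?(ltW hA)//.
    by rewrite -(one_powR (- m)); apply: ab_le => //; [move: m0; lra|exact: ltW].
  have T1E : T1 y = ab (m - 1) y by rewrite /T1 chiT ?mul1r//; lra.
  rewrite normrM; have [ys|ys] := leP (2^-1) `|y - s|.
    apply: (@key (C2 + 1) _ (ab (m - 1) y)) => //; [lra|lra| |by rewrite T1E -addrA lerDl addr_ge0].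
    have K1 : `|kk (s - y)| <= A * C2.
      rewrite (le_trans (kk_le _))// ler_wpM2l ?(ltW hA)//.
      by apply: ab_le; rewrite ?invr_gt0// ?oppr_le0 ?(ltW m0)// distrC.
    have K3 : `|kk (s - y) - chi (`|s| < `|y|) * kk (- y)| <= A * (C2 + 1).
      by rewrite (le_trans (ler_normB _ _))// [leRHS]mulrDr mulr1; exact: lerD.
    by apply: (le_trans (ler_pM _ _ (MM_le y) K3)) => //; rewrite mulrACA ler_wpM2l// mulrC.
  have yh : 2^-1 <= `|y|.
    have := ler_normD (s - y) y; rewrite subrK s1 distrC; lra.
  have T2E : T2 y = ab (- m) (y - s) by rewrite /T2 chiT ?mul1r//; lra.
  have M1 : `|MM y| <= A * C1.
    rewrite (le_trans (MM_le _))// ler_wpM2l ?(ltW hA)//.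
    by apply: ab_le => //; move: m1; lra.
  have k1 : `|kk (s - y)| <= A * ab (- m) (y - s) by rewrite -(abN _ (y - s)) opprB kk_le.
  have abs0 : 0 <= ab (- m) (y - s) by exact: ab_ge0.
  apply: (@le_trans _ _ (A * A * (C1 * ab (- m) (y - s) + 1 * ab (m - 1) y))).
    apply: (@le_trans _ _ (`|MM y| * `|kk (s - y)| + `|MM y| * `|chi (`|s| < `|y|) * kk (- y)|)).
      by rewrite -mulrDr ler_wpM2l// ler_normB.
    rewrite [leRHS]mulrDr; apply: lerD.
      by apply: (le_trans (ler_pM _ _ M1 k1)) => //; rewrite mulrACA.
    by apply: (le_trans (ler_pM _ _ (MM_le y) K2)) => //; rewrite mul1r mulrAC.
  rewrite /C -[leRHS]mulrA; apply: ler_wpM2l => //; rewrite T1E T2E.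
  have := mulr_ge0 C10 ab0; have := mulr_ge0 C20 ab0; have := mulr_ge0 C30 ab0.
  have := mulr_ge0 C20 abs0; have := mulr_ge0 C30 abs0; have := T30 y.
  have := mulr_ge0 C20 (T30 y); have := mulr_ge0 C30 (T30 y); have := mulr_ge0 C10 (T30 y).
  by lra.
- apply: itgZ; apply: itgD; first apply: itgD.
  + by apply: (ab_near0 _ _).1 => //; move: m0; lra.
  + have : itg (fun x => chi (`|x| < 1) * ab (- m) x) by apply: (ab_near0 _ _).1 => //; move: m1; lra.
    exact: itg_shift.
  + by apply: (ab_neary _ _).1 => //; lra.
Qed.

Lemma GxZ c x y : 0 < c -> Gx (c * x) (c * y) = c^-1 * Gx x y.
Proof.
move=> c0; rewrite /Gx /MM /kk -mulrBr -[- (c * y)]mulrN !kerZ// !normrM ltr_pM2l ?normr_gt0 ?gt_eqF//.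
have -> : c^-1 = c `^ (m - 1) * c `^ (- m).
  rewrite -powRD ?(gt_eqF c0) ?implybT// (_ : m - 1 - m = -1); last by ring.
  by rewrite powR_inv1// ltW.
by ring.
Qed.

Lemma Gx_itg x : x != 0 -> itg (Gx x) /\ Int (Gx x) = Int (Gx (Num.sg x)).
Proof.
move=> x0; have c0 : 0 < `|x| by rewrite normr_gt0.
have i1 : itg (Gx (Num.sg x)) by apply: Gx_itg1; rewrite normr_sg x0.
have E y : Gx x y = `|x|^-1 * Gx (Num.sg x) (`|x|^-1 * y).
  rewrite -GxZ// mulrC -numEsg; congr Gx; rewrite mulrA divff ?mul1r// gt_eqF//.
have ci : 0 < `|x|^-1 by rewrite invr_gt0.
have i2 := itg_scale ci i1.
have e : Gx x = (fun y => `|x|^-1 * Gx (Num.sg x) (`|x|^-1 * y)) by apply/funext.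
rewrite e; split; first exact: itgZ.
by rewrite IntZ// Int_scale// invrK mulrA mulVf ?mul1r// gt_eqF.
Qed.

(** M(y) k(- y) = al be / y is odd, and the difference of indicators is even and supported between
    |x| and |x'|, away from 0. *)
Lemma odd_itg x x' : x != 0 -> x' != 0 ->
  itg (fun y => (chi (`|x'| < `|y|) - chi (`|x| < `|y|)) * (MM y * kk (- y))) /\
  Int (fun y => (chi (`|x'| < `|y|) - chi (`|x| < `|y|)) * (MM y * kk (- y))) = 0.
Proof.
move=> x0 x0'; have hA := A0; set h := (fun y => _).
pose rr := Num.min `|x| `|x'|; pose qq := Num.max `|x| `|x'| + 1.
have r0 : 0 < rr by rewrite lt_min !normr_gt0 x0.
have q0 : 0 < qq by rewrite ltr_pwDr// le_max normr_ge0.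
have ih : itg h.
  apply: (@itg_le _ (fun y => A * A * (rr `^ (m - 1) * rr `^ (- m)) * (chi (`|y| < qq) * ab 0 y))).
  - by rewrite /h /MM /kk; mea.
  - move=> y; rewrite /h.
    have [yq|yq] := ltP `|y| qq; last first.
      have [h1 h2] : `|x| < `|y| /\ `|x'| < `|y|.
        have : Num.max `|x| `|x'| < `|y| by rewrite (lt_le_trans _ yq)// ltrDl.
        by rewrite gt_max => /andP[].
      by rewrite (chiT h1) (chiT h2) subrr mul0r normr0 chiF ?mul0r ?mulr0// -leNgt.
    have [yr|yr] := ltP `|y| rr.
      move: yr; rewrite lt_min => /andP[h1 h2].
      have e1 : ~~ (`|x| < `|y|) by rewrite -leNgt ltW.
      have e2 : ~~ (`|x'| < `|y|) by rewrite -leNgt ltW.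
      rewrite (chiF e1) (chiF e2) subrr mul0r normr0.
      by apply: mulr_ge0; apply: mulr_ge0; rewrite ?mulr_ge0 ?powR_ge0 ?chi_ge0 ?ab_ge0 ?(ltW hA).
    have y0 : y != 0 by rewrite -normr_gt0 (lt_le_trans r0 yr).
    rewrite (chiT isT) mul1r (abE _ y0) powRr0 mulr1 normrM.
    have n1 : `|chi (`|x'| < `|y|) - chi (`|x| < `|y|)| <= 1 :> R.
      by rewrite /chi; case: (_ < _); case: (_ < _); rewrite ?subrr ?subr0 ?sub0r ?normrN ?normr0 ?normr1.
    rewrite -[leRHS]mul1r ler_pM// normrM.
    apply: (le_trans (ler_pM _ _ (MM_le y) (kk_le _))) => //.
    rewrite mulrACA ler_wpM2l ?mulr_ge0 ?(ltW hA)// abN ler_pM ?ab_ge0//.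
      by apply: ab_le => //; move: m1; lra.
    by apply: ab_le => //; move: m0; lra.
  - by apply: itgZ; apply: (ab_near0 _ _).1 => //; lra.
split => //.
have : Int h = - Int h.
  rewrite -[in LHS](Int_opp ih) -IntN//; apply: eq_Int => y.
  rewrite /h !normrN /MM /kk -[RHS]mulrN opprK !kerN; congr (_ * _).
  have [y0|y0|->] := ltrgt0P y.
  - by rewrite !ker_pos//; ring.
  - by rewrite !ker_neg//; ring.
  - by rewrite !ker0; ring.
by lra.
Qed.

Definition gam := Int (fun y => MM y * (kk (1 - y) - kk (-1 - y))).

(* The integral depends only on the signs of x and x': subtracting the tail
   [kk (- y)] for |x| < |y| makes each term homogeneous of degree 0, and the
   subtracted tails cancel because their product with [MM] is odd. *)
Lemma kernel_id x x' : x < x' -> x != 0 -> x' != 0 ->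
  itg (fun y => MM y * (kk (x' - y) - kk (x - y))) /\
  Int (fun y => MM y * (kk (x' - y) - kk (x - y))) = gam * chi (x < 0 < x').
Proof.
have W u v : u != 0 -> v != 0 ->
    itg (fun y => MM y * (kk (v - y) - kk (u - y))) /\
    Int (fun y => MM y * (kk (v - y) - kk (u - y))) = Int (Gx (Num.sg v)) - Int (Gx (Num.sg u)).
  move=> u0 v0.
  have [iu <-] := Gx_itg u0; have [iv <-] := Gx_itg v0.
  have [io Eo] := odd_itg u0 v0.
  have -> : (fun y => MM y * (kk (v - y) - kk (u - y))) = (fun y => Gx v y - Gx u y +
      (chi (`|v| < `|y|) - chi (`|u| < `|y|)) * (MM y * kk (- y))).
    by apply/funext => y; rewrite /Gx; ring.
  split; first by apply: itgD => //; exact: itgB.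
  by rewrite IntD ?Eo ?addr0 ?IntB//; exact: itgB.
move=> xx x0 x0'; have [i E] := W x x' x0 x0'; split => //; rewrite {}E.
have n1 : -1 != 0 :> R by rewrite oppr_eq0 oner_eq0.
have [_ E] := W (-1) 1 n1 (oner_neq0 _).
rewrite /gam E sgrN sgr1.
have [h|h|h] := ltrgt0P x; last by rewrite h eqxx in x0.
- by rewrite (gtr0_sg h) (gtr0_sg (lt_trans h xx)) subrr chiF ?mulr0.
- have [h'|h'|h'] := ltrgt0P x'; last by rewrite h' eqxx in x0'.
  + by rewrite (ltr0_sg h) gtr0_sg// chiT ?mulr1.
  + by rewrite (ltr0_sg h) ltr0_sg// subrr chiF ?mulr0.
Qed.

(** The integrand T is symmetrised: T(y) + T(- y) is nonnegative for y > 0, by 2 al be <= al^2 +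
    be^2 when y < 1 and because t^(-m) decreases, and it has a positive lower bound on ]1/2, 1[. *)
Lemma gam_gt0 : 0 < gam.
Proof.
have n11 : -1 < 1 :> R by lra.
have [||i _] := kernel_id n11; rewrite ?oppr_eq0 ?oner_eq0//.
set T := (fun y => _) in i.
have i2 := itg_opp i.
have E : gam * 2 = Int (fun y => T y + T (- y)) by rewrite IntD// Int_opp// -/gam; ring.
suff : 0 < gam * 2 by lra.
rewrite E; clear E.
have TT y : 0 < y -> y != 1 -> T y + T (- y) = if y < 1 then
    y `^ (m - 1) * ((al ^+ 2 + be ^+ 2) * (1 - y) `^ (- m) - 2 * al * be * (1 + y) `^ (- m))
    else y `^ (m - 1) * (2 * al * be * ((y - 1) `^ (- m) - (1 + y) `^ (- m))).
  move=> y0 y1; have yn : - y < 0 by lra.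
  rewrite /T /MM /kk (ker_pos _ _ _ y0) (ker_neg _ _ _ yn) opprK.
  rewrite (_ : -1 + y = - (1 - y)); last by ring.
  rewrite (_ : -1 - y = - (1 + y)); last by ring.
  rewrite !kerN.
  have y1' : 0 < 1 + y by lra.
  rewrite !(ker_pos _ _ _ y1'); case: ltP => yy.
    by rewrite !ker_pos ?subr_gt0//; ring.
  have y2 : 1 - y < 0 by rewrite subr_lt0 lt_neqAle eq_sym y1.
  by rewrite !ker_neg// opprB; ring.
have ab0 : 0 < al * be by exact: mulr_gt0.
have sq : 2 * al * be <= al ^+ 2 + be ^+ 2.
  by rewrite -subr_ge0 (_ : _ - _ = (al - be) ^+ 2) ?sqr_ge0//; ring.
have T0 y : 0 < y -> y != 1 -> 0 <= T y + T (- y).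
  move=> y0 y1; rewrite TT//; case: ltP => yy.
    rewrite mulr_ge0 ?powR_ge0// subr_ge0.
    apply: ler_pM; rewrite ?powR_ge0//; first by rewrite -mulrA mulr_ge0// ltW.
    have nm : - m <= 0 by rewrite oppr_le0 ltW.
    have y1y : 0 < 1 - y by rewrite subr_gt0.
    have yy1 : 1 - y <= 1 + y by rewrite lerD2l -subr_ge0 opprK addr_ge0 ?(ltW y0).
    exact: powR_anti.
  have y2 : 0 < y - 1 by rewrite subr_gt0 lt_neqAle eq_sym y1.
  apply: mulr_ge0; first exact: powR_ge0.
  apply: mulr_ge0; first by rewrite -mulrA mulr_ge0// ltW.
  have nm : - m <= 0 by rewrite oppr_le0 ltW.
  rewrite subr_ge0; apply: powR_anti => //.
  by rewrite (@le_trans _ _ y)// ?lerDr// gerDl oppr_le0.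
(* On ]1/2, 1[ one has y^(m - 1) >= 1, (1 - y)^(-m) >= (1/2)^(-m) and (1 + y)^(-m) <= 1. *)
pose c := 2 * al * be * (2^-1 `^ (- m) - 1).
apply: (@Int_gt0 _ _ 2^-1 1 c) => //.
- exact: itgD.
- apply: ae_imp (ae_and (ae_neq 0) (ae_and (ae_neq 1) (ae_neq (-1)))) => y [y0 [y1 y2]].
  have [h|h|h] := ltrgt0P y; last by rewrite h eqxx in y0.
    exact: T0.
  rewrite addrC -{2}(opprK y); apply: T0; first by rewrite oppr_gt0.
  by apply: contra y2 => /eqP h1; rewrite -(opprK y) h1.
- by rewrite invf_lt1// ltr1n.
- rewrite /c mulr_gt0// -?mulrA ?mulr_gt0// subr_gt0 -[ltLHS](one_powR (- m)).
  rewrite !powRN ltf_pV2 ?posrE ?powR_gt0// ?invr_gt0//.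
  apply: gt0_ltr_powR; rewrite ?nnegrE//; lra.
- apply: aeW => y'; move: (y' : R) => {y'} y /andP[yh y1].
  have y0 : 0 < y by lra.
  rewrite TT ?lt_eqF// y1.
  have q1 : 1 <= y `^ (m - 1).
    by rewrite -[leLHS](one_powR (m - 1)); apply: powR_anti; move: m0 m1; lra.
  have p2 : 2^-1 `^ (- m) <= (1 - y) `^ (- m) by apply: powR_anti; move: m0; lra.
  have p3 : (1 + y) `^ (- m) <= 1.
    by rewrite -[leRHS](one_powR (- m)); apply: powR_anti; move: m0; lra.
  have p4 : 1 <= 2^-1 `^ (- m) :> R.
    by rewrite -[leLHS](one_powR (- m)); apply: powR_anti; move: m0; lra.
  have ab2 : 0 <= 2 * al * be by rewrite -mulrA mulr_ge0// ltW.
  rewrite -[c]mul1r; apply: ler_pM => //.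
    by rewrite /c mulr_ge0// subr_ge0.
  rewrite /c mulrBr mulr1 lerB//.
    by apply: ler_pM => //; lra.
  by rewrite ler_piMr.
Qed.

End KernelIdentity.

(** * Integrals and L^1 moduli of the kernels *)

Section ConvolutionBounds.
Variable R : realType.
Implicit Types (f g : R -> R) (a b c d r e h x y u v : R).
Notation mu := (@lebesgue_measure R).

(** Within distance 1 of x the kernel is integrable as e > -1; farther away it is at most |u| + |v|
    as e <= 0. The constant depends on the kernel and the interval only, not on x or th. *)
Lemma conv_bd u v e a b : -1 < e -> e <= 0 -> a < b ->
  exists2 C, 0 <= C & forall (th : R -> R) (S : R), 0 <= S -> measurable_fun setT th ->
    (forall y, `|th y| <= S * chi (a < y < b)) ->
    forall x, itg (fun y => ker u v e (x - y) * th y) /\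
      Int (fun y => `|ker u v e (x - y) * th y|) <= C * S.
Proof.
move=> e1 e0 hab.
have [i1 E1] := ab_near0 e1 (@ltr01 R).
have [i2 E2] := itg_chi a b.
set I1 := Int _ in E1.
have I10 : 0 <= I1 by apply: Int_ge0 => x; rewrite mulr_ge0 ?chi_ge0 ?ab_ge0.
pose A := `|u| + `|v|.
have A0 : 0 <= A by rewrite addr_ge0.
exists (A * (I1 + (b - a))).
  by rewrite mulr_ge0// addr_ge0// subr_ge0 ltW.
move=> th S S0 mth thS x.
pose T y := A * S * (chi (`|x - y| < 1) * ab e (x - y) + chi (a < y < b)).
have i1x := itg_refl x i1.
have iT : itg T by apply: itgZ; apply: itgD.
have le y : `|ker u v e (x - y) * th y| <= T y.
  rewrite normrM /T -mulrA.
  apply: (@le_trans _ _ ((A * ab e (x - y)) * (S * chi (a < y < b)))).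
    by apply: ler_pM => //; exact: ker_le.
  rewrite mulrACA -mulrA; apply: ler_wpM2l => //; apply: ler_wpM2l => //.
  have a0 := @ab_ge0 R e (x - y).
  have [h1|h1] := ltP `|x - y| 1.
    rewrite (chiT isT) mul1r (@le_trans _ _ (ab e (x - y)))// ?lerDl ?chi_ge0//.
    by rewrite ler_piMr// chi_le1.
  rewrite (@le_trans _ _ (chi (a < y < b)))// ?lerDr ?mulr_ge0 ?chi_ge0//.
  rewrite ler_piMl ?chi_ge0// (le_trans (ab_le e0 ltr01 h1))//.
  by rewrite powR1.
have mT : measurable_fun setT (fun y => ker u v e (x - y) * th y) by mea.
have iK := itg_le mT le iT.
split => //; apply: (@le_trans _ _ (Int T)).
  by apply: le_Int => //; exact: itg_abs.
rewrite /T IntZ ?IntD//; last exact: itgD.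
by rewrite (Int_refl x i1) -/I1 E2// mulrAC.
Qed.

(** The singularities at 0 and -1 are integrable because e > -1; at infinity the difference is
    O(|x|^(e - 1)), integrable because e < 0. *)
Lemma ker_diff1_itg u v e : -1 < e -> e < 0 -> itg (fun x => ker u v e (x + 1) - ker u v e x).
Proof.
move=> e1 e0; pose A := `|u| + `|v|.
have A0 : 0 <= A by rewrite addr_ge0.
have [i1 _] := @ab_near0 R e 4 e1 (ltr0n _ 4).
have e11 : e - 1 < -1 by lra.
have [i2 _] := ab_neary e11 (@ltr01 R).
pose C := `|e| * 2^-1 `^ (e - 1).
have C0 : 0 <= C by rewrite mulr_ge0 ?powR_ge0.
pose T x := A * (chi (`|x + 1| < 4) * ab e (x + 1) + chi (`|x| < 4) * ab e x + C * (chi (1 < `|x|) * ab (e - 1) x)).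
have iT : itg T.
  apply: itgZ; apply: itgD; last exact: itgZ.
  by apply: itgD => //; exact: (itg_shift 1 i1).
apply: (itg_le _ _ iT); first by mea.
move=> x; rewrite /T.
have p1 y : 0 <= chi (`|y| < 4) * ab e y :> R by rewrite mulr_ge0 ?chi_ge0 ?ab_ge0.
have p2 : 0 <= C * (chi (1 < `|x|) * ab (e - 1) x) by rewrite !mulr_ge0 ?chi_ge0 ?ab_ge0.
have [x3|x3] := leP `|x| 2.
  have h1 : `|x + 1| < 4 by have := ler_normD x 1; rewrite normr1; lra.
  have h2 : `|x| < 4 by lra.
  rewrite (chiT h1) (chiT h2) !mul1r (le_trans (ler_normB _ _))//.
  apply: (le_trans (lerD (ker_le _ _ _ _) (ker_le _ _ _ _))).
  by rewrite -mulrDr; apply: ler_wpM2l => //; rewrite lerDl.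
have x1 : 1 < `|x| by lra.
rewrite (@le_trans _ _ (A * (C * (chi (1 < `|x|) * ab (e - 1) x))))//; last first.
  by apply: ler_wpM2l => //; rewrite lerDr addr_ge0.
have x0 : x != 0 by rewrite -normr_gt0; lra.
rewrite (chiT x1) mul1r (abE _ x0).
have xh : 0 < `|x| / 2 by lra.
have aw : away (`|x| / 2) x (x + 1).
  by rewrite /away; move: x3 x1; have [y0|y0|->] := ltrgt0P x => h1 h2; lra.
have e2 : e <= 1 by lra.
apply: (le_trans (ker_lip u v e2 xh aw)); apply: ler_wpM2l => //.
rewrite (_ : x + 1 - x = 1); last by ring.
by rewrite normr1 mulr1 /C powRM ?invr_ge0// -mulrA [X in _ <= _ * X]mulrC.
Qed.

(** Homogeneity reduces h > 0 to h = 1: the kernel contributes h^e and the change of variables h.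
    Negative h follows by a translation. *)
Lemma ker_mod u v e : -1 < e -> e < 0 -> exists2 C, 0 <= C &
  forall h, itg (fun x => ker u v e (x + h) - ker u v e x) /\
    Int (fun x => `|ker u v e (x + h) - ker u v e x|) <= C * `|h| `^ (e + 1).
Proof.
move=> e1 e0; have i := ker_diff1_itg u v e1 e0.
exists (Int (fun x => `|ker u v e (x + 1) - ker u v e x|)); first by apply: Int_ge0.
set C := Int _.
have P h : 0 < h -> itg (fun x => ker u v e (x + h) - ker u v e x) /\
    Int (fun x => `|ker u v e (x + h) - ker u v e x|) <= C * `|h| `^ (e + 1).
  move=> h0; have hi : 0 < h^-1 by rewrite invr_gt0.
  have E x : ker u v e (x + h) - ker u v e x = h `^ e * (ker u v e (h^-1 * x + 1) - ker u v e (h^-1 * x)).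
    have hn : h != 0 by rewrite gt_eqF.
    rewrite mulrBr -!(kerZ _ _ _ _ h0) mulrDr mulr1 mulrA divff// mul1r//.
  have EE : (fun x => ker u v e (x + h) - ker u v e x) = fun x => h `^ e * (ker u v e (h^-1 * x + 1) - ker u v e (h^-1 * x)).
    by apply/funext.
  have ii := itg_scale hi i.
  rewrite EE; split; first exact: (itgZ _ ii).
  rewrite (@eq_Int _ _ (fun x => h `^ e * `|ker u v e (h^-1 * x + 1) - ker u v e (h^-1 * x)|)); last first.
    by move=> x; rewrite E normrM ger0_norm ?powR_ge0.
  have ia := itg_abs i.
  rewrite IntZ; last exact: (itg_scale hi ia).
  rewrite (Int_scale hi ia) -/C invrK (gtr0_norm h0).
  rewrite mulrA mulrC ler_wpM2l ?Int_ge0// powRD; last by rewrite (gt_eqF h0) implybT.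
  by rewrite powRr1// ltW.
move=> h; have [h0|h0|->] := ltrgt0P h.
- by have := P _ h0; rewrite gtr0_norm.
- have hn : 0 < - h by rewrite oppr_gt0.
  have [j1 j2] := P _ hn; rewrite (gtr0_norm hn) in j2.
  have j3 := itg_shift h j1.
  have EE : (fun x => ker u v e (x + h) - ker u v e x) = fun x => - (ker u v e (x + h + - h) - ker u v e (x + h)).
    by apply/funext => x; rewrite addrK opprB.
  split; first by rewrite EE; exact: (itgN j3).
  rewrite (@eq_Int _ _ (fun x => `|ker u v e (x + h + - h) - ker u v e (x + h)|)); last first.
    by move=> x; rewrite addrK distrC.
  by rewrite (Int_shift h (itg_abs j1)).
- have E : (fun x => ker u v e (x + 0) - ker u v e x) = fun=> 0.
    by apply/funext => x; rewrite addr0 subrr.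
  split; first by rewrite E; exact: itg0.
  rewrite (@eq_Int _ _ (fun=> 0)); last by move=> x; rewrite addr0 subrr normr0.
  by rewrite Int0 mulr_ge0 ?powR_ge0 ?Int_ge0.
Qed.

End ConvolutionBounds.

(** * Convolution with the kernels *)

Section ConvolutionIdentities.
Variable R : realType.
Variables (m al be : R).
Hypotheses (m0 : 0 < m) (m1 : m < 1) (al0 : 0 < al) (be0 : 0 < be).
Implicit Types (f : R -> R) (a b c d r e h x y u v : R).
Notation mu := (@lebesgue_measure R).
Local Notation k := (ker al be (- m)).
Local Notation M := (ker al (- be) (m - 1)).
Local Notation g := (gam m al be).

Lemma M_kdiff x x' : x < x' -> x != 0 -> x' != 0 ->
  itg (fun y => M y * (k (x' - y) - k (x - y))) /\
  Int (fun y => M y * (k (x' - y) - k (x - y))) = g * chi (x < 0 < x').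
Proof. exact: kernel_id. Qed.

Lemma kdiff_itg x x' : itg (fun y => k (x' - y) - k (x - y)).
Proof.
have [||C _ /(_ (x' - x)) [i _]] := @ker_mod R al be (- m); [by move: m1; lra|by move: m0; lra|].
have := itg_refl x i; apply: eq_itg => y.
by rewrite (_ : x - y + (x' - x) = x' - y)//; ring.
Qed.

(** A common majorant for the uses of Fubini below. B stands for the size of an increment of a
    convolution with k, which decays like |y|^(-m - 1); the product with M is then O(|y|^(-2)). *)
Lemma M_dominated (C1 C2 Y : R) : 0 <= C1 -> 0 <= C2 -> 0 < Y -> exists2 G, itg G &
  forall (B : R -> R), (forall y, 0 <= B y <= C1) -> (forall y, Y < `|y| -> B y <= C2 * `|y| `^ (- m - 1)) ->
    forall y, `|M y| * B y <= G y.
Proof.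
move=> C10 C20 Y0.
have em : -1 < m - 1 by move: m0; lra.
have Y2 : 0 < 2 * Y by lra.
have [i1 _] := ab_near0 em Y2.
have e2 : -2 < -1 :> R by lra.
have [i2 _] := ab_neary e2 Y0.
pose A := `|al| + `|- be|.
exists (fun y => A * (C1 * (chi (`|y| < 2 * Y) * ab (m - 1) y) + C2 * (chi (Y < `|y|) * ab (-2) y))).
  by apply: itgZ; apply: itgD; exact: itgZ.
move=> B B0 BY y; have /andP[By0 By1] := B0 y.
have a0 := @ab_ge0 R (m - 1) y.
apply: (@le_trans _ _ (A * ab (m - 1) y * B y)).
  by apply: ler_wpM2r => //; exact: ker_le.
rewrite -mulrA; apply: ler_wpM2l; first by rewrite addr_ge0.
have [h|h] := leP `|y| Y.
  have h1 : `|y| < 2 * Y by lra.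
  rewrite (chiT h1) mul1r -[leLHS]addr0; apply: lerD; first by rewrite mulrC ler_wpM2r.
  by rewrite !mulr_ge0 ?chi_ge0 ?ab_ge0.
rewrite (chiT isT) mul1r -[leLHS]add0r; apply: lerD.
  by rewrite !mulr_ge0 ?chi_ge0 ?ab_ge0.
have y0 : y != 0 by rewrite -normr_gt0; lra.
apply: (@le_trans _ _ (ab (m - 1) y * (C2 * `|y| `^ (- m - 1)))).
  by apply: ler_wpM2l => //; exact: BY.
rewrite mulrCA; apply: ler_wpM2l => //.
rewrite !(abE _ y0) -powRD; last by rewrite normr_eq0 y0 implybT.
by rewrite (_ : m - 1 + (- m - 1) = -2)//; ring.
Qed.

Section Bounded.
Variables (a b S : R) (th : R -> R).
Hypotheses (hab : a < b) (S0 : 0 <= S) (mth : measurable_fun setT th)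
  (thS : forall y, `|th y| <= S * chi (a < y < b)).

Definition cM z := Int (fun y => M (z - y) * th y).
Definition cK z := Int (fun y => k (z - y) * th y).

(* Fubini and [M_kdiff] for the pairs (x - y, x' - y). *)
Lemma Int_kdiff_cM x x' : x < x' -> itg (fun z => (k (x' - z) - k (x - z)) * cM z) /\
  Int (fun z => (k (x' - z) - k (x - z)) * cM z) = g * Int (fun y => chi (x < y < x') * th y).
Proof.
move=> xx.
have [||C C0 HC] := @conv_bd R al (- be) (m - 1) a b _ _ hab; [by move: m0; lra|by move: m1; lra|].
have ik := kdiff_itg x x'.
pose H z t := (k (x' - z) - k (x - z)) * (M (z - t) * th t).
have [|||j1 j2 j3 j4] := @Int_fubini R H (fun z => (C * S) * `|k (x' - z) - k (x - z)|).
- by rewrite /H; mea.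
- apply: aeW => z; have [i1 i2] := HC th S S0 mth thS z.
  split; first exact: (itgZ _ i1).
  rewrite (@eq_Int _ _ (fun t => `|k (x' - z) - k (x - z)| * `|M (z - t) * th t|)); last first.
    by move=> t; rewrite /H normrM.
  rewrite IntZ; last exact: itg_abs.
  by rewrite mulrC ler_wpM2r.
- by apply: itgZ; exact: itg_abs.
have E z : Int (H z) = (k (x' - z) - k (x - z)) * cM z.
  by rewrite /H IntZ//; have [] := HC th S S0 mth thS z.
split; first by apply: eq_itg j1.
rewrite -(eq_Int E) j4.
have ith : itg (fun y => chi (x < y < x') * th y).
  have [ic _] := itg_chi a b.
  apply: (itg_le _ _ (itgZ S ic)); first by mea.
  move=> y; rewrite normrM (@le_trans _ _ `|th y|)//.
  by rewrite ler_piMl// ger0_norm ?chi_ge0 ?chi_le1.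
rewrite -IntZ//; apply: ae_Int.
- exact: itg_meas.
- by apply: itg_meas; exact: itgZ.
apply: ae_imp (ae_and (ae_neq x) (ae_neq x')) => t [tx tx'].
have h1 : x - t != 0 by rewrite subr_eq0 eq_sym.
have h2 : x' - t != 0 by rewrite subr_eq0 eq_sym.
have h3 : x - t < x' - t by rewrite ltrD2r.
have [i1 E1] := M_kdiff h3 h1 h2.
have i2 := itg_shift (- t) i1.
rewrite (@eq_Int _ _ (fun z => th t * (M (z - t) * (k (x' - t - (z - t)) - k (x - t - (z - t)))))); last first.
  move=> z; rewrite /H (_ : x' - t - (z - t) = x' - z); last by ring.
  by rewrite (_ : x - t - (z - t) = x - z); [ring|ring].
rewrite IntZ// (Int_shift (- t) i1) E1 subr_lt0 subr_gt0; ring.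
Qed.

(** The same kernel identity with th convolved with k instead of M. Neither M nor a bounded
    increment of k * th is integrable at infinity, so Fubini rests on the decay of that increment,
    obtained from [ker_lip] for large y. *)
Lemma Int_M_cKdiff x x' : x < x' -> itg (fun y => M y * (cK (x' - y) - cK (x - y))) /\
  Int (fun y => M y * (cK (x' - y) - cK (x - y))) = g * Int (fun y => chi (x < y < x') * th y).
Proof.
move=> xx.
have [||C C0 HC] := @conv_bd R al be (- m) a b _ _ hab; [by move: m1; lra|by move: m0; lra|].
pose A := `|al| + `|be|.
have A0 : 0 <= A by rewrite addr_ge0.
(* For |y| > Y and t in ]a, b[, the points x - y - t and x' - y - t lie on the same side of 0 at
   distance at least |y| / 2. *)
pose Y := 2 * (`|a| + `|b| + `|x| + `|x'| + 1).
have Y0 : 0 < Y by rewrite mulr_gt0// ltr_pwDr// !addr_ge0.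
pose C2 := A * (`|- m| * 2^-1 `^ (- m - 1) * (x' - x)) * (S * (b - a)).
have ba : 0 < b - a by rewrite subr_gt0.
have xx0 : 0 < x' - x by rewrite subr_gt0.
have C20 : 0 <= C2 by rewrite /C2 !mulr_ge0 ?powR_ge0// ltW.
have CS0 : 0 <= C * S by rewrite mulr_ge0.
have CS2 : 0 <= C * S + C * S by rewrite addr_ge0.
have [G iG HG] := M_dominated CS2 C20 Y0.
pose H y t := M y * ((k (x' - y - t) - k (x - y - t)) * th t).
pose B y := Int (fun t => `|(k (x' - y - t) - k (x - y - t)) * th t|).
have iB y : itg (fun t => (k (x' - y - t) - k (x - y - t)) * th t).
  have [i1 _] := HC th S S0 mth thS (x' - y).
  have [i2 _] := HC th S S0 mth thS (x - y).
  by apply: eq_itg (itgB i1 i2) => t; rewrite mulrBl.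
have [ic Ec] := itg_chi a b.
have [|||j1 j2 j3 j4] := @Int_fubini R H G.
- by rewrite /H; mea.
- apply: aeW => y; split; first exact: (itgZ _ (iB y)).
  rewrite (@eq_Int _ _ (fun t => `|M y| * `|(k (x' - y - t) - k (x - y - t)) * th t|)); last first.
    by move=> t; rewrite /H normrM.
  rewrite (IntZ _ (itg_abs (iB y))); apply: (HG B) => [{}y|{}y yY].
    rewrite Int_ge0//=; have [i1 l1] := HC th S S0 mth thS (x' - y).
    have [i2 l2] := HC th S S0 mth thS (x - y).
    apply: (le_trans _ (lerD l1 l2)); rewrite -IntD; [|exact: itg_abs..].
    apply: le_Int; [by apply: itg_abs|by apply: itgD; apply: itg_abs|].
    by move=> t; rewrite mulrBl ler_normB.
  have y0 : 0 < `|y| by lra.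
  have yh : 0 < `|y| / 2 by lra.
  apply: (@le_trans _ _ (Int (fun t => (A * (`|- m| * (`|y| / 2) `^ (- m - 1) * (x' - x)) * S) * chi (a < t < b)))).
    apply: le_Int; [by apply: itg_abs|by apply: itgZ|].
    move=> t; rewrite normrM -mulrA.
    have [tab|tab] := boolP (a < t < b); last first.
      have := thS t; rewrite (chiF tab) mulr0 => h; rewrite [leRHS]mulr0.
      have e0 : `|th t| = 0 by apply: le_anti; rewrite h normr_ge0.
      by rewrite e0 mulr0.
    apply: ler_pM => //; last by have := thS t; rewrite tab.
    have nm : - m <= 1 by move: m0; lra.
    have aw : away (`|y| / 2) (x - y - t) (x' - y - t).
      have t1 : `|t| <= `|a| + `|b|.
        case/andP: tab => t1 t2; rewrite ler_norml.
        have := ler_norm b; have := normr_ge0 a; have := normr_ge0 b.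
        have : - `|a| <= a by rewrite lerNl -normrN ler_norm.
        lra.
      move: yY; rewrite /Y => yY.
      have x1 : - `|x| <= x <= `|x| by rewrite -ler_norml.
      have x2 : - `|x'| <= x' <= `|x'| by rewrite -ler_norml.
      have t2 : - `|t| <= t <= `|t| by rewrite -ler_norml.
      move: yY x1 x2 t1 t2 (normr_ge0 a) (normr_ge0 b); rewrite /away; move: (`|x|) (`|x'|) (`|t|) (`|a|) (`|b|) => q1 q2 q3 q4 q5.
      by have [yy|yy|->] := ltrgt0P y => H1 /andP[H2 H3] /andP[H4 H5] H6 /andP[H7 H8] H9 H10; [right|left|left]; lra.
    have := ker_lip al be nm yh aw.
    rewrite (_ : x' - y - t - (x - y - t) = x' - x); last by ring.
    by rewrite (gtr0_norm xx0).
  rewrite IntZ// Ec// /C2 powRM ?invr_ge0// le_eqVlt; apply/orP; left; apply/eqP; ring.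
- exact: iG.
have E y : Int (H y) = M y * (cK (x' - y) - cK (x - y)).
  rewrite /H IntZ; last exact: iB.
  congr (_ * _); have [i1 _] := HC th S S0 mth thS (x' - y).
  have [i2 _] := HC th S S0 mth thS (x - y).
  by rewrite /cK -IntB//; apply: eq_Int => t; rewrite mulrBl.
split; first by apply: eq_itg j1.
rewrite -(eq_Int E) j4.
have ith : itg (fun y => chi (x < y < x') * th y).
  apply: (itg_le _ _ (itgZ S ic)); first by mea.
  move=> y; rewrite normrM (@le_trans _ _ `|th y|)//.
  by rewrite ler_piMl// ger0_norm ?chi_ge0 ?chi_le1.
rewrite -IntZ//; apply: ae_Int.
- exact: itg_meas.
- by apply: itg_meas; exact: itgZ.
apply: ae_imp (ae_and (ae_neq x) (ae_neq x')) => t [tx tx'].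
have h1 : x - t != 0 by rewrite subr_eq0 eq_sym.
have h2 : x' - t != 0 by rewrite subr_eq0 eq_sym.
have h3 : x - t < x' - t by rewrite ltrD2r.
have [i1 E1] := M_kdiff h3 h1 h2.
rewrite (@eq_Int _ _ (fun y => th t * (M y * (k (x' - t - y) - k (x - t - y))))); last first.
  move=> y; rewrite /H (_ : x' - t - y = x' - y - t); last by ring.
  by rewrite (_ : x - t - y = x - y - t); [ring|ring].
rewrite IntZ// E1 subr_lt0 subr_gt0; ring.
Qed.

End Bounded.

(** It will be applied with ft the derivative of k * ps on the whole line: the inner integral on the
    left is then an increment of k * ps, while the right-hand side is the integral of M * ft. The
    decay of ft justifies Fubini. *)
Lemma Int_M_primitive (ft : R -> R) (D Z : R) : itg ft -> 0 <= D -> 0 < Z ->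
  (forall z, Z < `|z| -> `|ft z| <= D * `|z| `^ (- m - 1)) ->
  forall x x', x < x' ->
  itg (fun z => chi (x < z < x') * Int (fun y => M y * ft (z - y))) /\
  Int (fun y => M y * Int (fun z => chi (x - y < z < x' - y) * ft z)) =
  Int (fun z => chi (x < z < x') * Int (fun y => M y * ft (z - y))).
Proof.
move=> ift D0 Z0 ftD x x' xx.
have xx0 : 0 < x' - x by rewrite subr_gt0.
have mft := itg_meas ift.
pose Y := 2 * (`|x| + `|x'| + Z).
have Y0 : 0 < Y by rewrite mulr_gt0// ltr_wpDl// addr_ge0.
pose C1 := Int (fun z => `|ft z|).
have C10 : 0 <= C1 by exact: Int_ge0.
pose C2 := D * 2^-1 `^ (- m - 1) * (x' - x).
have C20 : 0 <= C2 by rewrite /C2 !mulr_ge0 ?powR_ge0// ltW.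
have [G iG HG] := M_dominated C10 C20 Y0.
have [ic Ec] := itg_chi x x'.
pose H y z := M y * (chi (x < z < x') * ft (z - y)).
pose B y := Int (fun z => `|chi (x < z < x') * ft (z - y)|).
have chi1 z : `|chi (x < z < x')| <= 1 :> R by rewrite ger0_norm ?chi_ge0 ?chi_le1.
have iB y : itg (fun z => chi (x < z < x') * ft (z - y)).
  apply: (itg_le _ _ (itg_abs (itg_shift (- y) ift))); first by mea.
  by move=> z; rewrite normrM ler_piMl.
have [|||j1 j2 j3 j4] := @Int_fubini R H G.
- by rewrite /H; mea.
- apply: aeW => y; split; first exact: (itgZ _ (iB y)).
  rewrite (@eq_Int _ _ (fun t => `|M y| * `|chi (x < t < x') * ft (t - y)|)); last first.
    by move=> t; rewrite /H normrM.
  rewrite (IntZ _ (itg_abs (iB y))); apply: (HG B) => [{}y|{}y yY].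
    rewrite Int_ge0//= /B /C1 -(Int_shift (- y) (itg_abs ift)).
    apply: le_Int; [by apply: itg_abs|exact: (itg_shift (- y) (itg_abs ift))|].
    by move=> z; rewrite normrM ler_piMl.
  have yh : 0 < `|y| / 2 by lra.
  apply: (@le_trans _ _ (Int (fun z => (D * (`|y| / 2) `^ (- m - 1)) * chi (x < z < x')))).
    apply: le_Int; [by apply: itg_abs|by apply: itgZ|].
    move=> z; have [zx|zx] := boolP (x < z < x'); last by rewrite /chi/= mul0r normr0 mulr0.
    rewrite (chiT isT) mul1r mulr1.
    have t1 : `|z| <= `|x| + `|x'|.
      case/andP: zx => t1 t2; rewrite ler_norml.
      have := ler_norm x'; have := normr_ge0 x; have := normr_ge0 x'.
      have : - `|x| <= x by rewrite lerNl -normrN ler_norm.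
      lra.
    have zy : `|y| / 2 <= `|z - y| /\ Z < `|z - y|.
      have := ler_normD (y - z) z; rewrite subrK distrC; move: yY; rewrite /Y.
      by have := normr_ge0 x; have := normr_ge0 x'; lra.
    case: zy => zy1 zy2; apply: (le_trans (ftD _ zy2)); apply: ler_wpM2l => //.
    by apply: powR_anti => //; move: m0; lra.
  rewrite IntZ// Ec// /C2 powRM ?invr_ge0// le_eqVlt; apply/orP; left; apply/eqP; ring.
- exact: iG.
have E2 z : Int (H^~ z) = chi (x < z < x') * Int (fun y => M y * ft (z - y)).
  have [zx|zx] := boolP (x < z < x').
    by rewrite (chiT isT) mul1r; apply: eq_Int => y; rewrite /H zx (chiT isT) mul1r.
  rewrite {1}/chi mul0r -[RHS](Int0 R); apply: eq_Int => y.
  by rewrite /H (chiF zx) mul0r mulr0.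
split; first by apply: eq_itg j2.
rewrite -(eq_Int E2) -j4; apply: eq_Int => y.
rewrite /H IntZ; last exact: iB.
congr (_ * _).
have i2 : itg (fun z => chi (x - y < z < x' - y) * ft z).
  apply: (itg_le _ _ (itg_abs ift)); first by mea.
  by move=> z; rewrite normrM ler_piMl// ger0_norm ?chi_ge0 ?chi_le1.
rewrite -(Int_shift (- y) i2); apply: eq_Int => z.
by rewrite !ltrD2r.
Qed.

End ConvolutionIdentities.

(** * Regularity of convolutions and the exterior derivative *)

Section ConvolutionModuli.
Variable R : realType.
Implicit Types (f : R -> R) (a b c d r e h x y : R).
Notation mu := (@lebesgue_measure R).

(** The L^1 modulus of the kernel times the bound of th; the exponent e + 1 is m for M and 1 - m for
    k. *)
Lemma conv_mod u v e a b : -1 < e -> e < 0 -> a < b ->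
  exists2 C, 0 <= C & forall (th : R -> R) (S : R), 0 <= S -> measurable_fun setT th ->
    (forall y, `|th y| <= S * chi (a < y < b)) -> forall x z : R,
    `|Int (fun y => ker u v e (z - y) * th y) - Int (fun y => ker u v e (x - y) * th y)|
      <= C * S * `|z - x| `^ (e + 1).
Proof.
move=> e1 e0 hab.
have [C1 C10 H1] := conv_bd u v e1 (ltW e0) hab.
have [C C0 HC] := ker_mod u v e1 e0.
exists C => // th S S0 mth thS x z.
have [i1 _] := H1 th S S0 mth thS x; have [i2 _] := H1 th S S0 mth thS z.
rewrite -IntB//.
have [i3 l3] := HC (z - x).
have i4 := itg_refl x i3.
have E y : x - y + (z - x) = z - y by ring.
apply: (@le_trans _ _ (Int (fun y => S * `|ker u v e (z - y) - ker u v e (x - y)|))).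
  apply: abs_Int_le; first by mea.
    move=> y; rewrite -mulrBl normrM mulrC; apply: ler_wpM2r => //.
    by apply: (le_trans (thS y)); rewrite ler_piMr// chi_le1.
  by apply: itgZ; apply: itg_abs; apply: eq_itg i4 => y; rewrite E.
have i5 : itg (fun y => `|ker u v e (z - y) - ker u v e (x - y)|).
  by apply: itg_abs; apply: eq_itg i4 => y; rewrite E.
rewrite (IntZ _ i5) (_ : C * S * _ = S * (C * `|z - x| `^ (e + 1))); last by ring.
apply: (ler_wpM2l S0); apply: le_trans l3.
have := Int_refl x (itg_abs i3) => <-.
by rewrite (@eq_Int _ _ (fun y => `|ker u v e (x - y + (z - x)) - ker u v e (x - y)|))// => y; rewrite E.
Qed.

(** As fo vanishes on ]a, b[, the kernel is only evaluated at distance at least d from its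
    singularity. The next two bounds for first and second differences rest on the same remark. *)
Lemma off_itg u v e a b d (fo : R -> R) x : e <= 0 -> itg fo -> (forall t, a < t < b -> fo t = 0) ->
  0 < d -> a + d <= x <= b - d -> itg (fun t => ker u v e (x - t) * fo t).
Proof.
move=> e0 ifo fo0 d0 /andP[xa xb]; have mfo := itg_meas ifo.
apply: (itg_le _ _ (itgZ ((`|u| + `|v|) * d `^ e) (itg_abs ifo))); first by mea.
move=> t; have [tab|tab] := boolP (a < t < b).
  by rewrite fo0// !(mulr0, normr0).
rewrite normrM; apply: ler_wpM2r => //.
apply: (le_trans (ker_le _ _ _ _)); apply: ler_wpM2l; first by rewrite addr_ge0.
apply: ab_le => //; move: tab; rewrite negb_and -!leNgt => /orP[h|h].
  by rewrite ger0_norm; lra.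
by rewrite ler0_norm; lra.
Qed.

Lemma off_lip u v e a b d (fo : R -> R) x z : e <= 0 -> itg fo -> (forall t, a < t < b -> fo t = 0) ->
  0 < d -> a + d <= x <= b - d -> a + d <= z <= b - d ->
  `|Int (fun t => ker u v e (z - t) * fo t) - Int (fun t => ker u v e (x - t) * fo t)| <=
  (`|u| + `|v|) * (`|e| * d `^ (e - 1) * `|z - x|) * Int (fun t => `|fo t|).
Proof.
move=> e0 ifo fo0 d0 hx hz; have mfo := itg_meas ifo.
have i1 := off_itg u v e0 ifo fo0 d0 hx; have i2 := off_itg u v e0 ifo fo0 d0 hz.
have ifa := itg_abs ifo.
rewrite -IntB// -IntZ//; apply: abs_Int_le => //; [exact: itg_meas (itgB i2 i1)| |exact: itgZ].
move=> t; rewrite -mulrBl normrM.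
have [tab|tab] := boolP (a < t < b).
  by rewrite fo0// !(mulr0, normr0).
apply: ler_wpM2r => //.
rewrite (_ : z - x = z - t - (x - t)); last by ring.
have e1 : e <= 1 by lra.
apply: ker_lip => //; move: hx hz tab => /andP[x1 x2] /andP[z1 z2].
by rewrite negb_and -!leNgt => /orP[h|h]; [left|right]; lra.
Qed.

Lemma off_diff2 u v e a b d h (fo : R -> R) x : e <= 0 -> itg fo -> (forall t, a < t < b -> fo t = 0) ->
  0 < d -> 0 <= h -> h <= d -> a + 2 * d <= x <= b - 2 * d ->
  `|Int (fun t => ker u v e (x + h - t) * fo t) + Int (fun t => ker u v e (x - h - t) * fo t)
    - 2 * Int (fun t => ker u v e (x - t) * fo t)| <=
  (`|u| + `|v|) * (`|e * (e - 1)| * d `^ (e - 2) * h ^+ 2) * Int (fun t => `|fo t|).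
Proof.
move=> e0 ifo fo0 d0 h0 hd /andP[x1 x2]; have mfo := itg_meas ifo.
have p1 : a + d <= x <= b - d by lra.
have p2 : a + d <= x + h <= b - d by lra.
have p3 : a + d <= x - h <= b - d by lra.
have i1 := off_itg u v e0 ifo fo0 d0 p1; have i2 := off_itg u v e0 ifo fo0 d0 p2.
have i3 := off_itg u v e0 ifo fo0 d0 p3.
have ifa := itg_abs ifo.
rewrite -IntD// -IntZ// -IntB//; [|exact: itgD|exact: itgZ].
rewrite -IntZ//; apply: abs_Int_le => //; [exact: itg_meas (itgB (itgD i2 i3) (itgZ _ i1))| |exact: itgZ].
move=> t; rewrite mulrA -mulrDl -mulrBl normrM.
have [tab|tab] := boolP (a < t < b).
  by rewrite fo0// !(mulr0, normr0).
apply: ler_wpM2r => //.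
rewrite (_ : x + h - t = x - t + h); last by ring.
rewrite (_ : x - h - t = x - t - h); last by ring.
have e2 : e <= 2 by lra.
apply: ker_diff2 => //; move: tab; rewrite negb_and -!leNgt => /orP[t1|t1].
  by rewrite ger0_norm; lra.
by rewrite ler0_norm; lra.
Qed.

(** Right continuity at x suffices: the averages over ]x, x + h[ tend to the values at x. *)
Lemma avg_eq (u v : R -> R) x h0 : 0 < h0 ->
  (forall h, 0 < h -> h <= h0 -> itg (fun z => chi (x < z < x + h) * u z) /\ itg (fun z => chi (x < z < x + h) * v z)) ->
  (forall h, 0 < h -> h <= h0 -> Int (fun z => chi (x < z < x + h) * u z) = Int (fun z => chi (x < z < x + h) * v z)) ->
  (forall eps, 0 < eps -> exists2 h, 0 < h & forall z, x < z < x + h -> `|u z - u x| <= eps /\ `|v z - v x| <= eps) ->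
  u x = v x.
Proof.
move=> h00 iuv E mod.
apply/eqP; rewrite -subr_eq0 -normr_le0; apply/ler_addgt0Pl => eps eps0; rewrite addr0.
have [|h1 h10 H] := mod (eps / 2); first by lra.
pose h := Num.min h0 h1.
have hp : 0 < h by rewrite lt_min h00.
have hh0 : h <= h0 by rewrite ge_min lexx.
have hh1 : h <= h1 by rewrite ge_min lexx orbT.
have [iu iv] := iuv h hp hh0.
have [ic Ec] := itg_chi x (x + h).
have xh : x < x + h by rewrite ltrDl.
rewrite -(ler_pM2r hp).
have -> : `|u x - v x| * h = `|Int (fun z => (u x - v x) * chi (x < z < x + h) - (chi (x < z < x + h) * u z - chi (x < z < x + h) * v z))|.
  rewrite IntB; [|exact: itgZ|exact: itgB].
  by rewrite IntZ// Ec// (IntB iu iv) E// subrr subr0 normrM (_ : x + h - x = h) ?(gtr0_norm hp)//; ring.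
have -> : eps * h = Int (fun z => eps * chi (x < z < x + h)).
  by rewrite IntZ// Ec//; congr (_ * _); ring.
apply: abs_Int_le.
- by apply: itg_meas; apply: itgB; [exact: itgZ|exact: itgB].
- move=> z; have [zx|zx] := boolP (x < z < x + h); last by rewrite /chi/= !(mulr0, mul0r, subr0) normr0.
  have [|H1 H2] := H z; first by move: zx hh1; lra.
  rewrite (chiT isT) !(mulr1, mul1r).
  rewrite (_ : _ - _ - _ = (v z - v x) - (u z - u x)); last by ring.
  apply: (le_trans (ler_normB _ _)); move: H1 H2; lra.
- exact: itgZ.
Qed.

Section LeftRight.
Variables (m a b S : R) (ps : R -> R).
Hypotheses (m0 : 0 < m) (m1 : m < 1) (hab : a < b) (S0 : 0 <= S) (mps : measurable_fun setT ps)
  (psS : forall y, `|ps y| <= S * chi (a < y < b)).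

(** For z < a, m times this is the derivative in z of the integral of (t - z)^(-m) ps(t). *)
Definition Lf z := Int (fun t => pp (- m - 1) (t - z) * ps t).

(** Fubini with the integral of (t - z)^(-m - 1) over z < x, which is (t - x)^(-m) / m. The case x =
    a is included because t^(-m) is integrable at 0. *)
Lemma Lf_int x : x <= a -> itg (fun z => chi (z < x) * Lf z) /\
  m * Int (fun z => chi (z < x) * Lf z) = Int (fun t => pp (- m) (t - x) * ps t).
Proof.
move=> xa.
pose H t z := chi (z < x) * pp (- m - 1) (t - z) * ps t.
have em : -1 < - m by move: m1; lra.
have em0 : - m <= 0 by move: m0; lra.
have e2 : - m - 1 < -1 by move: m0; lra.
have [C C0 HC] := conv_bd 0 1 em em0 hab.
have i0 : itg (fun t => pp (- m) (t - x) * ps t).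
  have [i _] := HC ps S S0 mps psS x; apply: eq_itg i => t.
  by rewrite /ker mul0r add0r mul1r opprB.
have zero t : ~~ (a < t < b) -> ps t = 0.
  move=> h; have := psS t; rewrite (chiF h) mulr0 normr_le0 => /eqP //.
have inner t : itg (H t) /\ Int (fun z => `|H t z|) = m^-1 * `|pp (- m) (t - x) * ps t| /\
   Int (H t) = m^-1 * (pp (- m) (t - x) * ps t).
  have [tab|tab] := boolP (a < t < b); last first.
    rewrite /H zero//; split; first by apply: eq_itg (itg0 R) => z; rewrite mulr0.
    split; rewrite !(mulr0, normr0) -[RHS](Int0 R); apply: eq_Int => z; by rewrite mulr0 ?normr0.
  have tx : 0 < t - x by case/andP: tab; lra.
  have [i E] := pp_neary e2 tx.
  have Eq z : chi (z < x) * pp (- m - 1) (t - z) = chi (t - x < t - z) * pp (- m - 1) (t - z).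
    by rewrite ltrD2l ltrN2.
  have j := itg_refl t i.
  have V : - ((- m - 1 + 1)^-1 * (t - x) `^ (- m - 1 + 1)) = m^-1 * pp (- m) (t - x).
    by rewrite pp_pos// (_ : - m - 1 + 1 = - m); [rewrite invrN mulNr opprK|ring].
  have jH : itg (H t).
    by apply: eq_itg (itgZ (ps t) j) => z; rewrite /H Eq mulrC.
  have EH w : Int (fun z => chi (z < x) * pp (- m - 1) (t - z) * w) = m^-1 * (pp (- m) (t - x) * w).
    rewrite (@eq_Int _ _ (fun z => w * (chi (t - x < t - z) * pp (- m - 1) (t - z)))); last by move=> z; rewrite Eq mulrC.
    by rewrite IntZ// (Int_refl t i) E V; ring.
  split=> //; split; last exact: EH.
  rewrite normrM (ger0_norm (pp_ge0 _ _)) -EH; apply: eq_Int => z.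
  by rewrite /H normrM ger0_norm// mulr_ge0 ?chi_ge0 ?pp_ge0.
have [|||j1 j2 j3 j4] := @Int_fubini R H (fun t => m^-1 * `|pp (- m) (t - x) * ps t|).
- by rewrite /H; mea.
- by apply: aeW => t; have [h1 [h2 h3]] := inner t; split => //; rewrite h2.
- by apply: itgZ; exact: itg_abs.
have E z : Int (H^~ z) = chi (z < x) * Lf z.
  have [zx|zx] := boolP (z < x).
    by rewrite (chiT isT) mul1r; apply: eq_Int => y; rewrite /H zx (chiT isT) mul1r.
  rewrite {1}/chi mul0r -[RHS](Int0 R); apply: eq_Int => y.
  by rewrite /H (chiF zx) !mul0r.
split; first by apply: eq_itg j2.
rewrite -(eq_Int E) -j4 (@eq_Int _ _ (fun t => m^-1 * (pp (- m) (t - x) * ps t))).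
  by rewrite IntZ; [rewrite mulVKf// gt_eqF|exact: i0].
by move=> t; have [_ []] := inner t.
Qed.

Lemma Lf_decay z : z < a -> `|Lf z| <= (a - z) `^ (- m - 1) * S * (b - a).
Proof.
move=> za; have [ic Ec] := itg_chi a b.
rewrite -Ec// -IntZ//; apply: abs_Int_le; [by mea| |exact: itgZ].
move=> t; rewrite normrM.
have [tab|tab] := boolP (a < t < b); last first.
  have : `|ps t| <= 0 by have := psS t; rewrite (chiF tab) mulr0.
  by rewrite normr_le0 => /eqP ->; rewrite {1}/chi !(normr0, mulr0).
have := psS t; rewrite tab (chiT isT) !mulr1 => h; apply: ler_pM => //.
case/andP: tab => t1 t2; rewrite ger0_norm ?pp_ge0// pp_pos; last by lra.
by apply: powR_anti; move: m0; lra.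
Qed.

End LeftRight.

End ConvolutionModuli.

(** * The representation of the solution inside the interval *)

Section Representation.
Variable R : realType.
Implicit Types (f : R -> R) (a b c d r e h x y : R).
Notation mu := (@lebesgue_measure R).

Lemma itg_chiM (p : R -> bool) (h : R -> R) : measurable_fun setT p -> itg h -> itg (fun z => chi (p z) * h z).
Proof.
move=> mp ih; have mh := itg_meas ih; apply: (itg_le _ _ (itg_abs ih)); first by mea.
by move=> z; rewrite normrM ler_piMl// ger0_norm ?chi_ge0 ?chi_le1.
Qed.

Lemma chi_split x y x' (h : R -> R) : x <= y -> y <= x' -> itg h ->
  Int (fun z => chi (x < z < x') * h z) = Int (fun z => chi (x < z < y) * h z) + Int (fun z => chi (y < z < x') * h z).
Proof.
move=> xy yx ih.
have P u v : itg (fun z => chi (u < z < v) * h z) by apply: itg_chiM => //; mea.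
rewrite -IntD//; apply: ae_Int.
- exact: itg_meas.
- by apply: itg_meas; exact: itgD.
apply: ae_imp (ae_neq y) => z zy; rewrite -mulrDl; congr (_ * _).
rewrite /chi; have [z1|z1|z1] := ltrgtP z y; last by rewrite z1 eqxx in zy.
  have z2 : z < x' by lra.
  by rewrite z2 !andbT addr0.
have z2 : x < z by lra.
by rewrite z2 !andbF !andTb add0r.
Qed.

Lemma chi_diff x x' (h : R -> R) : x < x' -> itg (fun z => chi (z < x') * h z) ->
  Int (fun z => chi (x < z < x') * h z) = Int (fun z => chi (z < x') * h z) - Int (fun z => chi (z < x) * h z).
Proof.
move=> xx ih.
have P (p : R -> bool) (q : R -> bool) : (forall z, p z = q z && (z < x')) -> measurable_fun setT q -> itg (fun z => chi (p z) * h z).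
  move=> pq mp; apply: eq_itg (itg_chiM mp ih) => z; rewrite pq mulrA; congr (_ * _).
  by rewrite /chi -natrM mulnb.
have i1 : itg (fun z => chi (z < x) * h z).
  apply: (P _ (fun z => z < x)); last by mea.
  by move=> z; case: ltP => //= zx; rewrite (lt_trans zx).
have i2 : itg (fun z => chi (x < z < x') * h z).
  by apply: (P _ (fun z => x < z)) => //; mea.
rewrite -IntB//; apply: ae_Int.
- exact: itg_meas.
- by apply: itg_meas; exact: itgB.
apply: ae_imp (ae_neq x) => z zy; rewrite -mulrBl; congr (_ * _).
rewrite /chi; have [z1|z1|z1] := ltrgtP z x; last by rewrite z1 eqxx in zy.
  have z2 : z < x' by lra.
  by rewrite z2 /= subrr.
by rewrite andTb subr0.
Qed.

Section Solution.
Variables (m al be a b S : R) (ps ff : R -> R).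
Hypotheses (m0 : 0 < m) (m1 : m < 1) (al0 : 0 < al) (be0 : 0 < be).
Hypotheses (hab : a < b) (S0 : 0 <= S) (mps : measurable_fun setT ps) (mff : measurable_fun setT ff)
  (psS : forall y, `|ps y| <= S * chi (a < y < b)) (ffS : forall y, `|ff y| <= S * chi (a < y < b)).
Hypothesis cps : forall x eps, 0 < eps -> exists2 h, 0 < h & forall z, x < z < x + h -> `|ps z - ps x| <= eps.
Local Notation k := (ker al be (- m)).
Local Notation M := (ker al (- be) (m - 1)).
Local Notation g := (gam m al be).
Hypothesis eqn : forall x x', a <= x -> x < x' -> x' <= b ->
  cK m al be ps x' - cK m al be ps x = Int (fun z => chi (x < z < x') * ff z).

Lemma off_zero (h : R -> R) t : (forall y, `|h y| <= S * chi (a < y < b)) -> ~~ (a < t < b) -> h t = 0.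
Proof. by move=> hS t1; have := hS t; rewrite (chiF t1) mulr0 normr_le0 => /eqP. Qed.

(** Reflection carries the exterior to the right of b to the exterior to the left of - b, where [Lf]
    is available. *)
Let psr t := ps (- t).

Lemma mpsr : measurable_fun setT psr. Proof. rewrite /psr; mea. Qed.
Lemma psrS y : `|psr y| <= S * chi (- b < y < - a).
Proof. by rewrite /psr (_ : (- b < y < - a) = (a < - y < b)) ?psS// ltrNr ltrNl andbC. Qed.
Lemma nab : - b < - a. Proof. by rewrite ltrN2. Qed.

(* On the complement of [a, b] the function k * ps may be differentiated under
   the integral sign, and [fo] is the derivative. *)
Definition fo z := m * be * (chi (z < a) * Lf m ps z) - m * al * (chi (- z < - b) * Lf m psr (- z)).
Definition ft z := ff z + fo z.

Lemma fo_itg : itg fo.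
Proof.
have [i1 _] := Lf_int m0 m1 hab S0 mps psS (lexx a).
have [i2 _] := Lf_int m0 m1 nab S0 mpsr psrS (lexx (- b)).
by apply: itgB; apply: itgZ; [exact: i1|exact: (itg_opp i2)].
Qed.

Lemma ff_itg : itg ff.
Proof.
have [ic _] := itg_chi a b; exact: (itg_le mff ffS (itgZ S ic)).
Qed.

Lemma ft_itg : itg ft. Proof. exact: itgD ff_itg fo_itg. Qed.

Lemma fo0 t : a < t < b -> fo t = 0.
Proof.
case/andP=> at_ tb; rewrite /fo ltrN2 !chiF -?leNgt ?(ltW tb) ?(ltW at_)//.
by rewrite !mul0r !mulr0 subr0.
Qed.

Lemma ftl z : z < a -> ft z = m * be * Lf m ps z.
Proof.
move=> za; rewrite /ft (off_zero ffS) ?negb_and -?leNgt ?(ltW za)// /fo za ltrN2 (chiT isT) chiF.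
  by rewrite add0r mul1r mul0r mulr0 subr0.
by rewrite -leNgt; move: hab; lra.
Qed.

Lemma ftr z : b < z -> ft z = - (m * al * Lf m psr (- z)).
Proof.
move=> za; rewrite /ft (off_zero ffS) ?negb_and -?leNgt ?(ltW za) ?orbT// /fo ltrN2 za (chiT isT) chiF.
  by rewrite add0r mul1r mul0r mulr0 sub0r.
by rewrite -leNgt; move: hab; lra.
Qed.

Lemma cKl x : x <= a -> cK m al be ps x = be * Int (fun t => pp (- m) (t - x) * ps t).
Proof.
move=> xa; have em : -1 < - m by move: m1; lra.
have em0 : - m <= 0 by move: m0; lra.
have [C C0 HC] := conv_bd 0 1 em em0 hab.
have [i _] := HC ps S S0 mps psS x.
rewrite -IntZ; last by apply: eq_itg i => t; rewrite /ker mul0r add0r mul1r opprB.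
apply: eq_Int => t; have [/andP[t1 t2]|h] := boolP (a < t < b); last by rewrite (off_zero psS)// !mulr0.
by rewrite mulrA ker_neg; [rewrite opprB pp_pos//; lra|lra].
Qed.

Lemma cKr x : b <= x -> cK m al be ps x = al * Int (fun t => pp (- m) (t - (- x)) * psr t).
Proof.
move=> xa; have em : -1 < - m by move: m1; lra.
have em0 : - m <= 0 by move: m0; lra.
have [C C0 HC] := conv_bd 1 0 em em0 hab.
have [i _] := HC ps S S0 mps psS x.
have i2 : itg (fun t => pp (- m) (x - t) * ps t).
  by apply: eq_itg i => t; rewrite /ker mul0r addr0 mul1r.
have <- : Int (fun t => pp (- m) (x - t) * ps t) = Int (fun t => pp (- m) (t - (- x)) * psr t).
  by rewrite -(Int_opp i2); apply: eq_Int => t; rewrite !opprK addrC.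
rewrite -IntZ//.
apply: eq_Int => t; have [/andP[t1 t2]|h] := boolP (a < t < b); last by rewrite (off_zero psS)// !mulr0.
by rewrite mulrA ker_pos; [rewrite pp_pos//; lra|lra].
Qed.

Lemma ft_left x x' : x < x' -> x' <= a -> Int (fun z => chi (x < z < x') * ft z) = cK m al be ps x' - cK m al be ps x.
Proof.
move=> xx xa; have xa1 : x <= a by lra.
have [i1 E1] := Lf_int m0 m1 hab S0 mps psS xa1.
have [i2 E2] := Lf_int m0 m1 hab S0 mps psS xa.
rewrite !cKl// -E1 -E2 -mulrBr -mulrBr -(chi_diff xx i2) mulrA [be * m]mulrC -IntZ; last first.
  apply: eq_itg (itg_chiM (_ : measurable_fun setT (fun z => x < z)) i2); last by mea.
  by move=> z; rewrite mulrA; congr (_ * _); rewrite /chi -natrM mulnb.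
clear E1 E2; apply: eq_Int => z; have [/andP[z1 z2]|h] := boolP (x < z < x'); last by rewrite /chi/= !(mul0r, mulr0).
have za : z < a by lra.
by rewrite (ftl za) (chiT isT) !mul1r.
Qed.

Lemma ft_right x x' : b <= x -> x < x' -> Int (fun z => chi (x < z < x') * ft z) = cK m al be ps x' - cK m al be ps x.
Proof.
move=> bx xx; have xa1 : - x <= - b by lra.
have xa2 : - x' <= - b by lra.
have xxN : - x' < - x by lra.
have bx' : b <= x' by lra.
rewrite (cKr bx) (cKr bx').
have [i1 E1] := Lf_int m0 m1 nab S0 mpsr psrS xa1.
have [i2 E2] := Lf_int m0 m1 nab S0 mpsr psrS xa2.
have i3 : itg (fun z => chi (- x' < z < - x) * Lf m psr z).
  apply: eq_itg (itg_chiM (_ : measurable_fun setT (fun z => - x' < z)) i1); last by mea.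
  by move=> z; rewrite mulrA; congr (_ * _); rewrite /chi -natrM mulnb.
transitivity (- (m * al) * Int (fun z => chi (- x' < z < - x) * Lf m psr z)); last first.
  rewrite (chi_diff xxN i1) -E1 -E2; ring.
rewrite -(Int_opp i3) -IntZ; last exact: itg_opp i3.
clear E1 E2.
apply: eq_Int => z; rewrite !ltrN2 [(z < x') && _]andbC.
have [/andP[z1 z2]|h] := boolP (x < z < x'); last by rewrite /chi/= !(mul0r, mulr0).
have bz : b < z by lra.
by rewrite (ftr bz) (chiT isT) !mul1r mulNr.
Qed.

Lemma ft_mid x x' : a <= x -> x < x' -> x' <= b -> Int (fun z => chi (x < z < x') * ft z) = cK m al be ps x' - cK m al be ps x.
Proof.
move=> ax xx xb; rewrite eqn//; apply: eq_Int => z.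
have [/andP[z1 z2]|h] := boolP (x < z < x'); last by rewrite /chi/= !(mul0r, mulr0).
by rewrite /ft fo0 ?addr0//; lra.
Qed.

(** [ft] is the derivative of k * ps on the whole line, in integrated form. The interval is cut at a
    and b; inside, this is the equation, outside, the primitive of [Lf]. *)
Lemma ft_id x x' : x < x' -> Int (fun z => chi (x < z < x') * ft z) = cK m al be ps x' - cK m al be ps x.
Proof.
have i := ft_itg.
have L u v : a <= u -> u < v -> Int (fun z => chi (u < z < v) * ft z) = cK m al be ps v - cK m al be ps u.
  move=> au uv; have [bu|ub] := leP b u; first exact: ft_right.
  have [vb|bv] := leP v b; first exact: ft_mid.
  by rewrite (chi_split (ltW ub) (ltW bv) i) (ft_mid au ub (lexx b)) (ft_right (lexx b) bv) addrC addrA subrK.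
move=> xx; have [ax|xa] := leP a x; first exact: L.
have [xa'|ax'] := leP x' a; first exact: ft_left.
by rewrite (chi_split (ltW xa) (ltW ax') i) (ft_left xa (lexx a)) (L _ _ (lexx a) ax') addrC addrA subrK.
Qed.

Lemma ft_decay : exists D Z, [/\ 0 <= D, 0 < Z & forall z, Z < `|z| -> `|ft z| <= D * `|z| `^ (- m - 1)].
Proof.
have ba : 0 < b - a by move: hab; lra.
pose D1 := 2^-1 `^ (- m - 1) * S * (b - a).
have D10 : 0 <= D1 by rewrite /D1 !mulr_ge0 ?powR_ge0// ltW.
exists (m * be * D1 + m * al * D1), (2 * (`|a| + `|b| + 1)); split.
- by rewrite addr_ge0// !mulr_ge0// ltW.
- by have := normr_ge0 a; have := normr_ge0 b; lra.
move=> z hz; have z0 : 0 < `|z| by have := normr_ge0 a; have := normr_ge0 b; lra.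
have pz : 0 <= `|z| `^ (- m - 1) by exact: powR_ge0.
have xa : - `|a| <= a <= `|a| by rewrite -ler_norml.
have xb : - `|b| <= b <= `|b| by rewrite -ler_norml.
have em : - m - 1 <= 0 by move: m0; lra.
have Q w : `|z| / 2 <= w -> w `^ (- m - 1) * S * (b - a) <= D1 * `|z| `^ (- m - 1).
  move=> hw; have -> : D1 * `|z| `^ (- m - 1) = (`|z| * 2^-1) `^ (- m - 1) * S * (b - a).
    by rewrite /D1 powRM ?invr_ge0//; ring.
  rewrite ler_pM2r//; apply: ler_wpM2r => //; apply: powR_anti => //; lra.
have mb : 0 <= m * be by rewrite mulr_ge0// ltW.
have ma : 0 <= m * al by rewrite mulr_ge0// ltW.
have F c1 c2 L : 0 <= c1 -> 0 <= c2 -> L <= D1 * `|z| `^ (- m - 1) -> c1 * L <= (c1 * D1 + c2 * D1) * `|z| `^ (- m - 1).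
  move=> c10 c20 hL; rewrite mulrDl -[c1 * D1 * _]mulrA -[c2 * D1 * _]mulrA -[leLHS]addr0; apply: lerD; first exact: (ler_wpM2l c10 hL).
  by apply: mulr_ge0 => //; apply: mulr_ge0.
have z1 : z != 0 by rewrite -normr_gt0.
move: z1; rewrite neq_lt => /orP[zn|zp]; last first.
  have bz : b < z by move: hz xb (normr_ge0 a); rewrite (gtr0_norm zp); lra.
  rewrite (ftr bz) normrN normrM (ger0_norm ma) (addrC (m * be * D1)); apply: (F _ _ _ ma mb).
  have zb : - z < - b by lra.
  apply: (le_trans (Lf_decay m0 nab mpsr psrS zb)).
  rewrite (_ : - a - - b = b - a); last by ring.
  by have := Q (- b - - z); apply; move: hz xb (normr_ge0 a); rewrite (gtr0_norm zp); lra.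
have bz : z < a by move: hz xa (normr_ge0 b); rewrite (ltr0_norm zn); lra.
rewrite (ftl bz) normrM (ger0_norm mb); apply: (F _ _ _ mb ma).
apply: (le_trans (Lf_decay m0 hab mps psS bz)).
by have := Q (a - z); apply; move: hz xa (normr_ge0 b); rewrite (ltr0_norm zn); lra.
Qed.

Definition M_conv_ft x := Int (fun y => M y * ft (x - y)).

(** As [ft] integrates to the increments of k * ps, [Int_M_cKdiff] and [Int_M_primitive] evaluate
    the same integral. *)
Lemma ps_int x x' : x < x' -> itg (fun z => chi (x < z < x') * M_conv_ft z) /\
  g * Int (fun y => chi (x < y < x') * ps y) = Int (fun z => chi (x < z < x') * M_conv_ft z).
Proof.
move=> xx; have [D [Z [D0 Z0 H]]] := ft_decay.
have [j1 j2] := Int_M_primitive al be m0 ft_itg D0 Z0 H xx.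
have [_ E] := Int_M_cKdiff m0 m1 al0 be0 hab S0 mps psS xx.
split; first exact: j1.
rewrite -[RHS]j2 -E; apply: eq_Int => y.
clear E j1 j2; congr (_ * _); symmetry; apply: ft_id; by rewrite ltrD2r.
Qed.

Lemma Mff_itg x : itg (fun t => M (x - t) * ff t).
Proof.
have [||C C0 HC] := @conv_bd R al (- be) (m - 1) a b _ _ hab; [by move: m0; lra|by move: m1; lra|].
by have [] := HC ff S S0 mff ffS x.
Qed.

Lemma Mfo_itg x : a < x < b -> itg (fun t => M (x - t) * fo t).
Proof.
move=> /andP[ax xb]; pose d := Num.min (x - a) (b - x).
have d0 : 0 < d by rewrite lt_min !subr_gt0 ax.
have h : d <= x - a /\ d <= b - x by rewrite !ge_min !lexx orbT.
apply: (@off_itg _ _ _ _ a b d) => //; [by move: m1; lra|exact: fo_itg|exact: fo0|by lra].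
Qed.

Lemma M_conv_ftE x : a < x < b -> itg (fun t => M (x - t) * ft t) /\
  M_conv_ft x = Int (fun t => M (x - t) * ff t) + Int (fun t => M (x - t) * fo t).
Proof.
move=> xab; have i1 := Mff_itg x; have i2 := Mfo_itg xab.
have i3 : itg (fun t => M (x - t) * ft t).
  by apply: eq_itg (itgD i1 i2) => t; rewrite /ft [RHS]mulrDr.
split; first exact: i3.
rewrite -IntD; [|exact: i1|exact: i2].
rewrite (@eq_Int _ _ (fun t => M (x - t) * ft t)); last by move=> t; rewrite /ft [RHS]mulrDr.
by rewrite -(Int_refl x i3); apply: eq_Int => t; rewrite (_ : x - (x - t) = t); [|ring].
Qed.

(** The integrated identity is localised at x by [avg_eq]: M * ff is Hoelder of exponent m and M *
    fo is Lipschitz at a positive distance from the end points. *)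
Lemma interior_representation x : a < x < b ->
  g * ps x = Int (fun t => M (x - t) * ff t) + Int (fun t => M (x - t) * fo t).
Proof.
move=> xab; have [ax xb] := andP xab; have [_ <-] := M_conv_ftE xab.
have g0 : 0 < g by exact: gam_gt0.
pose d := Num.min (x - a) (b - x) / 2.
have d2 : 0 < d * 2 by rewrite /d divfK// lt_min !subr_gt0 ax.
have d0 : 0 < d by lra.
have hd : d * 2 <= x - a /\ d * 2 <= b - x by rewrite /d divfK// !ge_min !lexx orbT.
apply: (@avg_eq _ (fun x => g * ps x) M_conv_ft x d) => //.
- move=> h h0 hh; have xh : x < x + h by lra.
  have [i1 _] := ps_int xh; split; last exact: i1.
  have ip : itg ps by have [ic _] := itg_chi a b; exact: (itg_le mps psS (itgZ S ic)).
  apply: eq_itg (itgZ g (itg_chiM (_ : measurable_fun setT (fun z => x < z < x + h)) ip)); last by mea.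
  by move=> z; rewrite mulrCA.
- move=> h h0 hh; have xh : x < x + h by lra.
  have [_ <-] := ps_int xh; rewrite -IntZ.
    by apply: eq_Int => z; rewrite mulrCA.
  have ip : itg ps by have [ic _] := itg_chi a b; exact: (itg_le mps psS (itgZ S ic)).
  by apply: itg_chiM => //; mea.
- move=> eps eps0.
  have [|h1 h10 H1] := cps x (_ : 0 < eps / g); first by rewrite divr_gt0.
  have [||C C0 HC] := @conv_mod R al (- be) (m - 1) a b _ _ hab; [by move: m0; lra|by move: m1; lra|].
  have e2 : 0 < eps / 2 by lra.
  have [h2 h20 H2] := powR_small (mulr_ge0 C0 S0) m0 e2.
  pose B := (`|al| + `|- be|) * (`|m - 1| * d `^ (m - 1 - 1)) * Int (fun t => `|fo t|).
  have B0 : 0 <= B by rewrite /B !mulr_ge0 ?addr_ge0 ?powR_ge0 ?Int_ge0.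
  have [h3 h30 H3] := powR_small B0 ltr01 e2.
  pose h := Num.min (Num.min d h1) (Num.min h2 h3).
  have [hd1 hh1 hh2 hh3] : [/\ h <= d, h <= h1, h <= h2 & h <= h3].
    by rewrite /h !ge_min !lexx !orbT.
  have h0 : 0 < h by rewrite /h !lt_min d0 h10 h20 h30.
  exists h => // z /andP[xz zh].
  split.
    rewrite -mulrBr normrM (gtr0_norm g0) mulrC -ler_pdivlMr//; apply: H1; lra.
  have zab : a < z < b by lra.
  have [_ ->] := M_conv_ftE zab; have [_ ->] := M_conv_ftE xab.
  rewrite opprD addrACA (le_trans (ler_normD _ _))// (_ : eps = eps / 2 + eps / 2); last by field.
  have nzx : `|z - x| = z - x by apply: gtr0_norm; rewrite subr_gt0.
  have zx0 : 0 <= z - x by lra.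
  apply: lerD.
    apply: (le_trans (HC ff S S0 mff ffS x z)); rewrite (_ : m - 1 + 1 = m); last by ring.
    rewrite nzx; apply: H2; lra.
  have em : m - 1 <= 0 by move: m1; lra.
  have hx : a + d <= x <= b - d by lra.
  have hz : a + d <= z <= b - d by lra.
  apply: (le_trans (off_lip al (- be) em fo_itg fo0 d0 hx hz)).
  have := H3 (z - x) zx0 (_ : z - x < h3); rewrite powRr1// nzx /B => H4.
  by rewrite (_ : _ * _ * _ = (`|al| + `|- be|) * (`|m - 1| * d `^ (m - 1 - 1)) * Int (fun t => `|fo t|) * (z - x)); [apply: H4; lra|ring].
Qed.

End Solution.
End Representation.

(** * Maximum principle and boundary decay *)

Section MaxPrinciple.
Variable R : realType.
Variables (m al be a b : R) (w : R -> R).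
Hypotheses (m0 : 0 < m) (m1 : m < 1) (al0 : 0 < al) (be0 : 0 < be) (hab : a < b).
Notation mu := (@lebesgue_measure R).
Local Notation k := (ker al be (- m)).
Definition d2k h y : R := k (y + h) + k (y - h) - 2 * k y.

(** k is not integrable at infinity, but [d2k] is the difference of two translates of the integrable
    function k(y + h) - k(y). *)
Lemma d2k_itg h : itg (d2k h) /\ Int (d2k h) = 0.
Proof.
have [||C _ /(_ h) [i _]] := @ker_mod R al be (- m); [by move: m1; lra|by move: m0; lra|].
have E y : (k (y + h) - k y) - (k (y - h + h) - k (y - h)) = d2k h y.
  by rewrite /d2k subrK; ring.
have i2 := itg_shift (- h) i.
split; first exact: eq_itg E (itgB i i2).
by rewrite -(eq_Int E) (IntB i i2) (Int_shift (- h) i) subrr.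
Qed.

(** Multiplied by a second-difference bound C h^2 this gives O(h^(3 - m)), the o(h^2) needed by the
    maximum principle. *)
Lemma d2k_L1 : exists2 C, 0 <= C & forall h, 0 < h -> Int (fun y => `|d2k h y|) <= C * h `^ (1 - m).
Proof.
have [||C C0 HC] := @ker_mod R al be (- m); [by move: m1; lra|by move: m0; lra|].
exists (C + C); first exact: addr_ge0.
move=> h h0; have [i l] := HC h.
rewrite (gtr0_norm h0) (_ : - m + 1 = 1 - m) in l; last by ring.
have E y : (k (y + h) - k y) - (k (y - h + h) - k (y - h)) = d2k h y.
  by rewrite /d2k subrK; ring.
have i2 := itg_shift (- h) i.
have [i3 _] := d2k_itg h.
rewrite mulrDl; apply: le_trans (lerD l l).
rewrite -{2}(Int_shift (- h) (itg_abs i)) -IntD; [|exact: itg_abs i|exact: itg_abs i2].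
apply: le_Int; [exact: itg_abs|exact: itgD (itg_abs i) (itg_abs i2)|].
by move=> y; rewrite -E; exact: ler_normB.
Qed.

(** Convexity on each half-line; |y| > h keeps y - h, y and y + h on the same side of 0. *)
Lemma d2k_pos h y : 0 < h -> h < `|y| -> 0 <= d2k h y.
Proof.
move=> h0 hy.
have P e t : 0 < t -> 0 <= (- m) * (- m - 1) * t `^ e.
  move=> t0; rewrite (_ : - m * (- m - 1) = m * (m + 1)); last by ring.
  by rewrite !mulr_ge0 ?powR_ge0//; move: m0; lra.
have [y0|y0] := leP 0 y.
  rewrite ger0_norm// in hy; have [t /andP[t1 t2] E] := powR_diff2 (- m) h0 hy.
  rewrite /d2k !ker_pos; try lra.
  rewrite (_ : _ - _ = al * ((y + h) `^ (- m) + (y - h) `^ (- m) - 2 * y `^ (- m))); last by ring.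
  rewrite E; apply: mulr_ge0; first exact: ltW.
by apply: mulr_ge0; [apply: P; lra|exact: sqr_ge0].
rewrite ltr0_norm// in hy; have [t /andP[t1 t2] E] := powR_diff2 (- m) h0 hy.
rewrite /d2k !ker_neg; try lra.
rewrite (_ : - (y + h) = - y - h); last by ring.
rewrite (_ : - (y - h) = - y + h); last by ring.
rewrite (_ : _ - _ = be * ((- y + h) `^ (- m) + (- y - h) `^ (- m) - 2 * (- y) `^ (- m))); last by ring.
rewrite E; apply: mulr_ge0; first exact: ltW.
by apply: mulr_ge0; [apply: P; lra|exact: sqr_ge0].
Qed.

(** A lower bound for the second derivative of be r^(-m) at points r < B + 2. With B = b - x0, the
    range of y is the one for which x0 - y lies in ]b, b + 1[. *)
Lemma d2k_far h y B : 0 < h -> h < 1 -> h < B -> B < - y -> - y < B + 1 ->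
  be * (m * (m + 1) * (B + 2) `^ (- m - 2)) * h ^+ 2 <= d2k h y.
Proof.
move=> h0 h1 hB By yB; have hy : h < - y by lra.
have [t /andP[t1 t2] E] := powR_diff2 (- m) h0 hy.
rewrite /d2k !ker_neg; try lra.
rewrite (_ : - (y + h) = - y - h); last by ring.
rewrite (_ : - (y - h) = - y + h); last by ring.
rewrite (_ : _ + _ - _ = be * ((- y + h) `^ (- m) + (- y - h) `^ (- m) - 2 * (- y) `^ (- m))); last by ring.
rewrite E -mulrA ler_wpM2l ?(ltW be0)// ler_wpM2r ?sqr_ge0//.
rewrite (_ : - m * (- m - 1) = m * (m + 1)); last by ring.
rewrite ler_wpM2l//; first by move: m0; nra.
by apply: powR_anti; move: m0; lra.
Qed.

Hypotheses (mw : measurable_fun setT w) (cw : continuous w)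
  (w0 : forall z, ~~ (a < z < b) -> 0 <= w z)
  (wC : forall x, a < x < b -> exists C d, [/\ 0 <= C, 0 < d &
     forall h, 0 <= h -> h <= d -> w (x + h) + w (x - h) - 2 * w x <= C * h ^+ 2])
  (weq : forall x h, 0 < h -> a <= x - h -> x + h <= b ->
     itg (fun y => d2k h y * w (x - y)) /\ Int (fun y => d2k h y * w (x - y)) = 0).

(* At a negative interior minimum x0 of w, the integrand of [weq] with w replaced
   by w - w x0 is nonnegative outside |y| <= h, where it is O(h^2 |d2k h y|) and
   has integral o(h^2); beyond b it is at least a constant times h^2. *)
Lemma max_principle z : 0 <= w z.
Proof.
have [zab|] := boolP (a < z < b); last exact: w0.
rewrite leNgt; apply/negP => wz.
have [x0 xab hmin] : exists2 c, c \in `[a, b] & forall t, t \in `[a, b] -> w c <= w t.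
  by apply: EVT_min; [exact: ltW|apply: continuous_subspaceT].
have wx0 : w x0 < 0.
  by apply: le_lt_trans wz; apply: hmin; rewrite in_itv/=; move: zab => /andP[/ltW -> /ltW].
have x0ab : a < x0 < b by apply/negPn/negP => /w0; rewrite leNgt wx0.
have hall t : w x0 <= w t.
  have [/andP[t1 t2]|/w0 t0] := boolP (a < t < b).
    by apply: hmin; rewrite in_itv/= !ltW.
  by apply: le_trans t0; exact: ltW.
have [C [d [C0 d0 HC]]] := wC x0ab.
have [C1 C10 HC1] := d2k_L1.
pose q := - w x0; have q0 : 0 < q by rewrite oppr_gt0.
pose B := b - x0.
have B0 : 0 < B by rewrite subr_gt0; case/andP: x0ab.
pose c := be * (m * (m + 1) * (B + 2) `^ (- m - 2)) * q.
have c0 : 0 < c.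
  rewrite /c !mulr_gt0// ?powR_gt0//; [by move: m0; lra|by lra].
have m11 : 0 < 1 - m by move: m1; lra.
have c2 : 0 < c / 2 by lra.
have [h1 h10 H1] := powR_small (mulr_ge0 C0 C10) m11 c2.
(* [d] validates the second-difference bound at x0, [h1 / 2] makes C C1 h^(1 - m) at most c / 2, and
   the others keep x0 - h and x0 + h in [a, b] and meet the hypotheses of [d2k_far]. *)
pose h := Num.min (Num.min d (h1 / 2)) (Num.min (Num.min (x0 - a) (B / 2)) 2^-1).
have h0 : 0 < h.
  have B2 : 0 < B / 2 by lra.
  have h12 : 0 < h1 / 2 by lra.
  by rewrite !lt_min d0 B2 h12 invr_gt0 ltr0n !andbT subr_gt0; move: x0ab => /andP[-> _].
have [hd hh1 ha hB h2] : [/\ h <= d, h <= h1 / 2, h <= x0 - a, h <= B / 2 & h <= 2^-1].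
  by rewrite /h !ge_min !lexx !orbT.
have hB2 : x0 + h <= b by move: hB; rewrite /B; lra.
have ha2 : a <= x0 - h by lra.
have [i E] := weq h0 ha2 hB2.
have [i1 E1] := d2k_itg h.
have i2 : itg (fun y => d2k h y * (w (x0 - y) - w x0)).
  by apply: eq_itg (itgB i (itgZ (w x0) i1)) => y; rewrite [RHS]mulrBr [d2k h y * w x0]mulrC.
have E2 : Int (fun y => d2k h y * (w (x0 - y) - w x0)) = 0.
  rewrite (@eq_Int _ _ (fun y => d2k h y * w (x0 - y) - w x0 * d2k h y)); last first.
    by move=> y; rewrite [LHS]mulrBr [d2k h y * w x0]mulrC.
  by rewrite (IntB i (itgZ _ i1)) (IntZ _ i1) E E1 mulr0 subr0.
have [ic Ec] := itg_chi (- B - 1) (- B).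
have ia := itg_abs i1.
pose lo y := (c * h ^+ 2) * chi (- B - 1 < y < - B) - (C * h ^+ 2) * `|d2k h y|.
have ilo : itg lo by apply: itgB; apply: itgZ.
have lole : Int lo <= 0.
  rewrite -E2; apply: le_Int => [||y]; [exact: ilo|exact: i2|rewrite /lo; clear E E1 E2].
  have v0 : 0 <= w (x0 - y) - w x0 by rewrite subr_ge0.
  have [yh|hy] := leP `|y| h.
    rewrite chiF; last first.
      rewrite negb_and -!leNgt; apply/orP; right.
      by move: yh; rewrite ler_norml => /andP[? _]; lra.
    rewrite mulr0 sub0r lerNl -mulrN.
    apply: (@le_trans _ _ (`|d2k h y| * (w (x0 - y) - w x0))).
      by rewrite mulrN -mulNr ler_wpM2r// -normrN ler_norm.
    rewrite mulrC ler_wpM2r//.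
    have yd : `|y| <= d by exact: le_trans yh hd.
    have := HC _ (normr_ge0 y) yd.
    have -> : w (x0 + `|y|) + w (x0 - `|y|) = w (x0 + y) + w (x0 - y).
      have [_|_|->] := ltrgt0P y => //.
      by rewrite opprK addrC.
    have : C * `|y| ^+ 2 <= C * h ^+ 2 by rewrite ler_wpM2l// ler_pXn2r ?nnegrE// ltW.
    by have := hall (x0 + y); lra.
  have dp := d2k_pos h0 hy.
  have [/andP[y1 y2]|yJ] := boolP (- B - 1 < y < - B); last first.
    rewrite {1}/chi mulr0 sub0r; apply: (@le_trans _ _ 0); last exact: mulr_ge0.
    by rewrite oppr_le0; apply: mulr_ge0 => //; apply: mulr_ge0 => //; exact: sqr_ge0.
  rewrite (chiT isT) mulr1; apply: (@le_trans _ _ (c * h ^+ 2)).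
    by rewrite gerBl; apply: mulr_ge0 => //; apply: mulr_ge0 => //; exact: sqr_ge0.
  have qv : q <= w (x0 - y) - w x0.
    rewrite /q lerDr; apply: w0; rewrite negb_and -!leNgt; apply/orP; right.
    by move: y2; rewrite /B; lra.
  have := @d2k_far h y B h0 (_ : h < 1) (_ : h < B) (_ : B < - y) (_ : - y < B + 1).
  move=> /(_ ltac:(lra) ltac:(lra) ltac:(lra) ltac:(lra)) far.
  apply: (@le_trans _ _ (d2k h y * q)); last by rewrite ler_wpM2l.
  rewrite /c mulrAC; apply: ler_wpM2r => //; exact: ltW.
have hp : 0 < h ^+ 2 by rewrite exprn_gt0.
have : c * h ^+ 2 <= (c / 2) * h ^+ 2.
  have LI : Int lo = c * h ^+ 2 - C * h ^+ 2 * Int (fun y => `|d2k h y|).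
    rewrite /lo (IntB (itgZ _ ic) (itgZ _ ia)) (IntZ _ ic) (IntZ _ ia) Ec; last by lra.
    by congr (_ - _); ring.
  have h01 : 0 <= h by exact: ltW.
  have := H1 h h01 (_ : h < h1) => /(_ ltac:(lra)) H2.
  move: lole; rewrite LI subr_le0 => l1; apply: (le_trans l1).
  rewrite mulrAC; apply: ler_wpM2r; first exact: ltW.
  apply: le_trans H2; rewrite -mulrA; apply: (ler_wpM2l C0); exact: HC1.
rewrite ler_pM2r//; lra.
Qed.

End MaxPrinciple.

(** * The barrier *)

Section Barrier.
Variable R : realType.
Variables (m al be a : R).
Hypotheses (m0 : 0 < m) (m1 : m < 1) (al0 : 0 < al) (be0 : 0 < be).
Notation mu := (@lebesgue_measure R).
Local Notation M := (ker al (- be) (m - 1)).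

Lemma Pp_int r : itg (fun x => chi (x < r) * pp (m - 1) x) /\ Int (fun x => chi (x < r) * pp (m - 1) x) = m^-1 * pp m r.
Proof.
have [r0|r0] := leP r 0.
  have E x : chi (x < r) * pp (m - 1) x = 0.
    by have [xr|xr] := ltP x r; rewrite /chi/= ?mul0r// pp_neg ?mulr0//; lra.
  split; first by apply: eq_itg (itg0 R) => x; rewrite E.
  by rewrite (eq_Int E) (Int0 R) pp_neg// mulr0.
have em : -1 < m - 1 by move: m0; lra.
have [i E] := pp_near0 em r0; split; first exact: i.
by rewrite E subrK pp_pos.
Qed.

Lemma Pp_int2 t : itg (fun x => chi (t < x < t + 1) * pp (m - 1) x) /\
  Int (fun x => chi (t < x < t + 1) * pp (m - 1) x) = m^-1 * (pp m (t + 1) - pp m t).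
Proof.
have [i1 E1] := Pp_int t; have [i2 E2] := Pp_int (t + 1).
have tt : t < t + 1 by lra.
split; last by rewrite (chi_diff tt i2) E1 E2 mulrBr.
apply: eq_itg (itg_chiM (_ : measurable_fun setT (fun z => t < z)) i2); last by mea.
by move=> z; rewrite mulrA; congr (_ * _); rewrite /chi -natrM mulnb.
Qed.

Lemma barrier_formula z : m * Int (fun y => M (z - y) * chi (a - 1 < y < a)) =
  al * (pp m (z - a + 1) - pp m (z - a)) - be * (pp m (a - z) - pp m (a - z - 1)).
Proof.
have [i1 E1] := Pp_int2 (z - a); have [i2 E2] := Pp_int2 (a - z - 1).
have j1 := itg_refl z i1; have j2 := itg_shift (- z) i2.
rewrite (@eq_Int _ _ (fun y => al * (chi (z - a < z - y < z - a + 1) * pp (m - 1) (z - y)) -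
   be * (chi (a - z - 1 < y - z < a - z - 1 + 1) * pp (m - 1) (y - z)))); last first.
  move=> y; rewrite /ker opprB.
  have -> : (z - a < z - y < z - a + 1) = (a - 1 < y < a).
    by rewrite andbC; congr andb; apply/idP/idP; lra.
  have -> : (a - z - 1 < y - z < a - z - 1 + 1) = (a - 1 < y < a).
    by congr andb; apply/idP/idP; lra.
  by ring.
rewrite (IntB (itgZ _ j1) (itgZ _ j2)) (IntZ _ j1) (IntZ _ j2).
rewrite (Int_refl z i1) (Int_shift (- z) i2) E1 E2 subrK.
by field; rewrite gt_eqF.
Qed.

Lemma powR_succ_le t : 1 <= t -> (t + 1) `^ m - t `^ m <= m.
Proof.
move=> t1; have t0 : 0 < t by lra.
have tt : t < t + 1 by lra.
have [x /andP[tx xt] ->] := powR_mvt m t0 tt.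
rewrite (_ : t + 1 - t = 1) ?mulr1; last by ring.
rewrite ler_piMr ?(ltW m0)//.
have := @powR_anti R (m - 1) 1 x _ ltr01; rewrite powR1; apply; move: m1; lra.
Qed.

(** The convolution of M with the indicator of ]a - 1, a[ has its maximum at a, with a cusp of order
    m. With t = |z - a|, m times the drop is al (1 + t^m - (t + 1)^m) to the right of a. To the left
    it is at least be t^m for t < 1 and at least al for t >= 1. *)
Lemma barrier : exists2 c, 0 < c & forall z,
  c * Num.min (`|z - a| `^ m) 1 <=
  Int (fun y => M (a - y) * chi (a - 1 < y < a)) - Int (fun y => M (z - y) * chi (a - 1 < y < a)).
Proof.
have Mm : 0 < m^-1 by rewrite invr_gt0.
exists (m^-1 * Num.min (al * (1 - m)) be).
  by rewrite mulr_gt0// lt_min be0 mulr_gt0// subr_gt0.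
move=> z; rewrite -mulrA.
have HA := barrier_formula a; have HZ := barrier_formula z.
move: (Int (fun y => M (a - y) * _)) (Int (fun y => M (z - y) * _)) HA HZ => IA IZ HA HZ.
rewrite -(ler_pM2l m0) [leRHS]mulrBr HA HZ mulVKf ?gt_eqF//; clear HA HZ IA IZ.
rewrite subrr add0r sub0r (pp_neg _ (lexx 0)) (pp_neg _ (_ : -1 <= 0)); last by lra.
rewrite !subr0 mulr0 (pp_pos _ ltr01) powR1 mulr1 subr0.
set mn := Num.min (al * (1 - m)) be.
have mn1 : mn <= al * (1 - m) by rewrite ge_min lexx.
have mn2 : mn <= be by rewrite ge_min lexx orbT.
have mn0 : 0 < mn by rewrite lt_min be0 mulr_gt0// subr_gt0.
have al1 : al * (1 - m) <= al by rewrite ler_piMr ?(ltW al0)//; move: m0; lra.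
have [t0|t0|t0] := ltrgtP z a; last first.
- rewrite t0 subrr powR0 ?gt_eqF// (pp_neg _ (lexx 0)) add0r (pp_pos _ ltr01) powR1.
  rewrite (pp_neg _ (_ : 0 - 1 <= 0)); last by lra.
  by rewrite min_l// mulr0 !subr0 !mulr0 mulr1 subr0 subrr.
- have za : 0 < z - a by rewrite subr_gt0.
  rewrite (pp_pos _ za) (@pp_neg _ m (a - z)); last by lra.
  rewrite (@pp_neg _ m (a - z - 1)); last by lra.
  rewrite pp_pos; last by lra.
  rewrite subrr mulr0 subr0; set t := z - a.
  apply: (@le_trans _ _ (al * (1 - m) * Num.min (t `^ m) 1)).
    by rewrite ler_wpM2r// le_min powR_ge0 ler01.
  rewrite -mulrA -{2}[al]mulr1 -mulrBr ler_wpM2l ?(ltW al0)//.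
  have [t1|t1] := leP 1 t.
    have := powR_succ_le t1.
    have : (1 - m) * Num.min (t `^ m) 1 <= (1 - m) * 1.
      by rewrite ler_wpM2l ?ge_min ?lexx ?orbT//; move: m1; lra.
    lra.
  (* The case t < 1 follows from the case of 1/t >= 1 on multiplying by t^m. *)
  have ti : 1 <= t^-1 by rewrite invf_ge1// ltW.
  have := powR_succ_le ti.
  have tm : 0 < t `^ m by rewrite powR_gt0.
  have E1 : t `^ m * (t^-1 + 1) `^ m = (t + 1) `^ m.
    rewrite -powRM ?(ltW za)//; last by lra.
    by rewrite mulrDr mulr1 mulfV ?gt_eqF// addrC.
  have E2 : t `^ m * t^-1 `^ m = 1.
    rewrite -powRM ?(ltW za)//; last by lra.
    by rewrite mulfV ?gt_eqF// powR1.
  move=> h; have : t `^ m * ((t^-1 + 1) `^ m - t^-1 `^ m) <= t `^ m * m by apply: ler_wpM2l => //; exact: ltW.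
  rewrite mulrBr E1 E2 => h2.
  have : (1 - m) * Num.min (t `^ m) 1 <= (1 - m) * t `^ m.
    by rewrite ler_wpM2l ?ge_min ?lexx//; move: m1; lra.
  move: h2; nra.
- have az : 0 < a - z by rewrite subr_gt0.
  rewrite (pp_pos _ az) (@pp_neg _ m (z - a)); last by lra.
  rewrite subr0; set t := a - z.
  have E1 : z - a + 1 = 1 - t by rewrite /t; ring.
  rewrite E1.
  have [t1|t1] := ltP t 1.
    rewrite pp_pos; last by lra.
    rewrite (@pp_neg _ m (t - 1)); last by lra.
    rewrite subr0.
    have h1 : (1 - t) `^ m <= 1.
      have := @ge0_ler_powR R m (ltW m0) (1 - t) 1; rewrite powR1; apply; rewrite ?nnegrE; lra.
    have h2 : mn * Num.min (t `^ m) 1 <= be * t `^ m.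
      by apply: ler_pM => //; [exact: ltW|rewrite le_min powR_ge0 ler01|rewrite ge_min lexx].
    have h3 : al * (1 - t) `^ m <= al * 1 by rewrite ler_wpM2l// ltW.
    by move: h2 h3; lra.
  rewrite (@pp_neg _ m (1 - t)); last by lra.
  have h1 : pp m (t - 1) <= t `^ m.
    rewrite /pp; case: ifP => h; last exact: powR_ge0.
    by apply: ge0_ler_powR; rewrite ?nnegrE; move: m0; lra.
  have h2 : mn * Num.min (t `^ m) 1 <= mn * 1.
    by rewrite ler_wpM2l ?(ltW mn0)// ge_min lexx orbT.
  have h3 : be * pp m (t - 1) <= be * t `^ m by rewrite ler_wpM2l// ltW.
  by move: h2 h3 mn1 al1; lra.
Qed.

End Barrier.

(** * Decay of the solution at the end points *)

Section Decay.
Variable R : realType.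
Notation mu := (@lebesgue_measure R).

Lemma hoelder_continuous (F : R -> R) C e : 0 <= C -> 0 < e ->
  (forall x z, `|F z - F x| <= C * `|z - x| `^ e) -> continuous F.
Proof.
move=> C0 e0 H x; apply/(@cvgrPdist_le _ R) => eps eps0.
have [h h0 Hh] := powR_small C0 e0 eps0.
exists h => //= z xz; rewrite distrC; apply: (le_trans (H x z)); apply: Hh => //.
by rewrite distrC.
Qed.

Variables (m al be a b S : R) (ps ff : R -> R).
Hypotheses (m0 : 0 < m) (m1 : m < 1) (al0 : 0 < al) (be0 : 0 < be).
Hypotheses (hab : a < b) (S0 : 0 <= S) (mff : measurable_fun setT ff)
  (psS : forall y, `|ps y| <= S * chi (a < y < b)) (ffS : forall y, `|ff y| <= S * chi (a < y < b)).
Hypothesis cps : continuous ps.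
Local Notation k := (ker al be (- m)).
Local Notation M := (ker al (- be) (m - 1)).
Local Notation g := (gam m al be).
Hypothesis eqn : forall x x', a <= x -> x < x' -> x' <= b ->
  cK m al be ps x' - cK m al be ps x = Int (fun z => chi (x < z < x') * ff z).

Lemma mps : measurable_fun setT ps. Proof. exact: continuous_measurable_fun. Qed.

Lemma cps_right (x eps : R) : 0 < eps -> exists2 h, 0 < h & forall z : R, x < z < x + h -> `|ps z - ps x| <= eps.
Proof.
move=> eps0; have := @cps x; move/(@cvgrPdist_le _ R) => /(_ _ eps0) [h h0 H].
exists h => // z /andP[z1 z2]; rewrite distrC; apply: H => /=; rewrite distrC gtr0_norm; lra.
Qed.

(** The source of the barrier, placed just outside ]a, b[: it does not enter the equation inside,
    and its convolution with M is largest at a. *)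
Definition Jc t : R := chi (a - 1 < t < a).

Lemma mJc : measurable_fun setT Jc. Proof. rewrite /Jc; mea. Qed.
Lemma JcS y : `|Jc y| <= 1 * chi (a - 1 < y < a).
Proof. by rewrite mul1r ger0_norm ?chi_ge0. Qed.
Lemma Jc_itg : itg Jc. Proof. by have [] := itg_chi (a - 1) a. Qed.
Lemma Jc0 t : a < t < b -> Jc t = 0.
Proof. by move=> /andP[t1 _]; rewrite /Jc chiF// negb_and -!leNgt (ltW t1) orbT. Qed.

Lemma em : -1 < m - 1. Proof. by move: m0; lra. Qed.
Lemma em0 : m - 1 <= 0. Proof. by move: m1; lra. Qed.
Lemma em1 : m - 1 < 0. Proof. by move: m1; lra. Qed.
Lemma lt_sub1 : a - 1 < a. Proof. by lra. Qed.
Lemma lt_sub1_b : a - 1 < b. Proof. by move: hab; lra. Qed.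
Lemma g0 : 0 < g. Proof. exact: gam_gt0. Qed.

Section W.
Variables (s N : R).

(** By [Int_kdiff_cM], the term in ff makes k * (M * th) compensate s ff on ]a, b[, where Jc
    vanishes; N is the strength of the barrier. *)
Definition th t := - (s / g) * ff t - N * Jc t.
(* W solves the homogeneous equation on ]a, b[; for large N the barrier
   M * Jc makes it nonnegative outside, hence everywhere, and this bounds
   - s ps from above by multiples of M * ff and of the barrier. *)
Definition W z := s * ps z + cM m al be th z.

Lemma mth : measurable_fun setT th.
Proof. have := mJc => mJ; rewrite /th; mea. Qed.

Definition S1 := `|s / g| * S + `|N|.
Lemma S10 : 0 <= S1. Proof. by rewrite addr_ge0// mulr_ge0. Qed.

Lemma thS y : `|th y| <= S1 * chi (a - 1 < y < b).
Proof.
rewrite /th /S1 mulrDl; apply: (le_trans (ler_normB _ _)).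
rewrite (normrM (- (s / g))) (normrM N) normrN; apply: lerD.
  rewrite -mulrA; apply: ler_wpM2l => //; apply: (le_trans (ffS y)); apply: ler_wpM2l => //.
  have [/andP[h1 h2]|h] := boolP (a < y < b); last by rewrite chi_ge0.
  by rewrite (@chiT _ (a - 1 < y < b))// h2 andbT; have := lt_sub1; lra.
apply: ler_wpM2l => //; apply: (le_trans (JcS y)); rewrite mul1r.
have [/andP[h1 h2]|h] := boolP (a - 1 < y < a); last by rewrite chi_ge0.
by rewrite (@chiT _ (a - 1 < y < b))// h1 /=; move: hab; lra.
Qed.

Lemma W_kdiff x x' : a <= x -> x < x' -> x' <= b ->
  itg (fun z => (k (x' - z) - k (x - z)) * W z) /\ Int (fun z => (k (x' - z) - k (x - z)) * W z) = 0.
Proof.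
move=> ax xx xb.
have [||C C0 HC] := @conv_bd R al be (- m) a b _ _ hab; [by move: m1; lra|by move: m0; lra|].
have [i1 _] := HC ps S S0 mps psS x; have [i2 _] := HC ps S S0 mps psS x'.
have i3 : itg (fun z => (k (x' - z) - k (x - z)) * ps z).
  by apply: eq_itg (itgB i2 i1) => z; rewrite [RHS]mulrBl.
have E3 : Int (fun z => (k (x' - z) - k (x - z)) * ps z) = Int (fun z => chi (x < z < x') * ff z).
  rewrite -eqn// /cK -(IntB i2 i1); apply: eq_Int => z; by rewrite [LHS]mulrBl.
have [i4 E4] := Int_kdiff_cM m0 m1 al0 be0 lt_sub1_b S10 mth thS xx.
have E z : s * ((k (x' - z) - k (x - z)) * ps z) + (k (x' - z) - k (x - z)) * cM m al be th z = (k (x' - z) - k (x - z)) * W z.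
  by rewrite /W [RHS]mulrDr mulrCA.
have i5 := itgD (itgZ s i3) i4.
split; first exact: eq_itg E i5.
rewrite -(eq_Int E) (IntD (itgZ s i3) i4) (IntZ _ i3) E3 E4.
rewrite (@eq_Int _ (fun y => chi (x < y < x') * th y) (fun y => - (s / g) * (chi (x < y < x') * ff y))); last first.
  move=> y; have [/andP[y1 y2]|h] := boolP (x < y < x'); last by rewrite /chi/= !(mul0r, mulr0).
  by rewrite (chiT isT) !mul1r /th Jc0 ?mulr0 ?subr0//; apply/andP; split; lra.
rewrite IntZ; last first.
  by apply: itg_chiM; [mea|exact: ff_itg mff ffS].
by rewrite mulrA mulrN mulrCA mulfV ?gt_eqF ?g0// mulr1 mulNr subrr.
Qed.

(** The difference of two consecutive increments of k * W. A constant may be added to W because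
    [d2k] has integral 0. *)
Lemma W_d2k x h c0 : 0 < h -> a <= x - h -> x + h <= b ->
  itg (fun y => d2k m al be h y * (W (x - y) + c0)) /\ Int (fun y => d2k m al be h y * (W (x - y) + c0)) = 0.
Proof.
move=> h0 xa xb.
have ax : a <= x by lra.
have bx : x <= b by lra.
have h1 : x < x + h by lra.
have h2 : x - h < x by lra.
have [i1 E1] := W_kdiff ax h1 xb; have [i2 E2] := W_kdiff xa h2 bx.
have [i3 E3] := d2k_itg al be m0 m1 h.
have i4 := itg_refl x i1; have i5 := itg_refl x i2.
have E y : ((k (x + h - (x - y)) - k (x - (x - y))) * W (x - y) - (k (x - (x - y)) - k (x - h - (x - y))) * W (x - y)) + c0 * d2k m al be h y
   = d2k m al be h y * (W (x - y) + c0).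
  rewrite /d2k (_ : x + h - (x - y) = y + h); last by ring.
  rewrite (_ : x - (x - y) = y); last by ring.
  by rewrite (_ : x - h - (x - y) = y - h); ring.
have i6 := itgB i4 i5.
split; first exact: eq_itg E (itgD i6 (itgZ c0 i3)).
rewrite -(eq_Int E) (IntD i6 (itgZ c0 i3)) (IntZ _ i3) E3 mulr0 addr0 (IntB i4 i5).
by rewrite (etrans (Int_refl x i1) E1) (etrans (Int_refl x i2) E2) subrr.
Qed.

Lemma W_cont c0 : continuous (fun z => W z + c0).
Proof.
have [C C0 HC] := conv_mod al (- be) em em1 lt_sub1_b.
have c1 : continuous (cM m al be th).
  apply: (@hoelder_continuous _ (C * S1) m) => //; first by rewrite mulr_ge0 ?S10.
  by move=> x z; have := HC th S1 S10 mth thS x z; rewrite subrK.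
move=> x; apply: cvgD; last exact: cvg_cst.
apply: cvgD; last exact: c1.
by apply: cvgM; [exact: cvg_cst|exact: cps].
Qed.

Local Notation fo := (fo m al be a b ps).
Definition Th t := (s / g) * fo t - N * Jc t.

Lemma Th_itg : itg Th.
Proof. by apply: itgB; apply: itgZ; [exact: (fo_itg al be m0 m1 hab S0 mps psS)|exact: Jc_itg]. Qed.

Lemma Th0 t : a < t < b -> Th t = 0.
Proof. by move=> h; rewrite /Th Jc0// fo0// !mulr0 subrr. Qed.

Lemma itg_M_parts x : a < x < b -> [/\ itg (fun y => M (x - y) * ff y), itg (fun y => M (x - y) * Jc y) & itg (fun y => M (x - y) * fo y)].
Proof.
move=> hx.
have [C2 _ HC2] := conv_bd al (- be) em em0 hab.
have [C4 _ HC4] := conv_bd al (- be) em em0 lt_sub1.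
split.
- by have [] := HC2 ff S S0 mff ffS x.
- by have [] := HC4 Jc 1 ler01 mJc JcS x.
- exact: (Mfo_itg al be m0 m1 hab S0 mps psS hx).
Qed.

(** The representation of ps cancels the terms in ff, whose limited regularity would spoil second
    differences. What remains is M applied to a source vanishing on ]a, b[, which is smooth
    there. *)
Lemma W_interior x : a < x < b -> W x = Int (fun t => M (x - t) * Th t).
Proof.
move=> hx; have [i1 i2 i3] := itg_M_parts hx.
have r := interior_representation m0 m1 al0 be0 hab S0 mps mff psS ffS cps_right eqn hx.
rewrite /W /cM (@eq_Int _ (fun y => M (x - y) * th y) (fun y => - (s / g) * (M (x - y) * ff y) - N * (M (x - y) * Jc y))); last first.
  by move=> y; rewrite /th; ring.
rewrite (@eq_Int _ (fun t => M (x - t) * Th t) (fun y => (s / g) * (M (x - y) * fo y) - N * (M (x - y) * Jc y))); last first.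
  by move=> y; rewrite /Th; ring.
rewrite (IntB (itgZ _ i1) (itgZ _ i2)) (IntB (itgZ _ i3) (itgZ _ i2)) !IntZ//.
have -> : ps x = g^-1 * (Int (fun t => M (x - t) * ff t) + Int (fun t => M (x - t) * fo t)).
  by rewrite -r mulKf// gt_eqF ?g0.
by clear r; move: (Int _) (Int _) (Int _) => q1 q2 q3; ring.
Qed.

Lemma W_semiconcave c0 x : a < x < b -> exists C d, [/\ 0 <= C, 0 < d &
     forall h, 0 <= h -> h <= d -> (W (x + h) + c0) + (W (x - h) + c0) - 2 * (W x + c0) <= C * h ^+ 2].
Proof.
move=> /andP[ax xb]; pose d := Num.min (x - a) (b - x) / 2.
have d2 : 0 < d * 2 by rewrite /d divfK// lt_min !subr_gt0 ax.
have d0 : 0 < d by lra.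
have hd : d * 2 <= x - a /\ d * 2 <= b - x by rewrite /d divfK// !ge_min !lexx orbT.
exists ((`|al| + `|- be|) * (`|(m - 1) * (m - 1 - 1)| * d `^ (m - 1 - 2)) * Int (fun t => `|Th t|)), d; split => //.
  by rewrite !mulr_ge0 ?addr_ge0 ?powR_ge0 ?Int_ge0.
move=> h h0 hd1.
rewrite !W_interior; try (apply/andP; split; lra).
have H : a + 2 * d <= x <= b - 2 * d by lra.
have gen (q1 q2 q3 A B I : R) : `|q1 + q2 - 2 * q3| <= A * (B * h ^+ 2) * I ->
    q1 + c0 + (q2 + c0) - 2 * (q3 + c0) <= A * B * I * h ^+ 2.
  by move=> /(le_trans (ler_norm _)); lra.
exact: gen (off_diff2 al (- be) em0 Th_itg Th0 d0 h0 hd1 H).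
Qed.

End W.

Lemma sgn_bound (s : R) : `|s| = 1 -> exists2 C, 0 <= C & forall z, a < z < b -> - (s * ps z) <= C * `|z - a| `^ m.
Proof.
move=> s1; have g0 := g0.
have [C1 C10 HC1] := conv_mod al (- be) em em1 hab.
have [C2 C20 HC2] := conv_bd al (- be) em em0 hab.
have [C3 C30 HC3] := conv_mod al (- be) em em1 lt_sub1.
have [C4 C40 HC4] := conv_bd al (- be) em em0 lt_sub1.
have [c c0 Hc] := barrier a m0 m1 al0 be0.
have mE : m - 1 + 1 = m by ring.
pose U z := Int (fun y => M (z - y) * ff y).
pose u0 z := Int (fun y => M (z - y) * Jc y).
have iU z : itg (fun y => M (z - y) * ff y) by have [] := HC2 ff S S0 mff ffS z.
have iu z : itg (fun y => M (z - y) * Jc y) by have [] := HC4 Jc 1 ler01 mJc JcS z.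
have U1 x z : `|U z - U x| <= C1 * S * `|z - x| `^ m.
  by have := HC1 ff S S0 mff ffS x z; rewrite mE.
have U2 z : `|U z| <= C2 * S.
  by have [i l] := HC2 ff S S0 mff ffS z; apply: le_trans l; exact: abs_Int.
have u1 x z : `|u0 z - u0 x| <= C3 * `|z - x| `^ m.
  by have := HC3 Jc 1 ler01 mJc JcS x z; rewrite mE mulr1.
have Hu z : c * Num.min (`|z - a| `^ m) 1 <= u0 a - u0 z by exact: Hc.
(* B min(|z - a|^m, 1) bounds the oscillation |U z - U a| of M * ff, by its Hoelder estimate near a
   and by its supremum elsewhere. Dividing by g and by the barrier constant c gives the strength N
   for which the barrier dominates. *)
pose B := C1 * S + 2 * (C2 * S).
have B0 : 0 <= B by rewrite /B !(addr_ge0, mulr_ge0).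
pose N := g^-1 * B / c.
have N0 : 0 <= N by rewrite /N !mulr_ge0// ?invr_ge0 ltW.
have cMth z : cM m al be (th s N) z = - (s / g) * U z - N * u0 z.
  rewrite /cM /th (@eq_Int _ _ (fun y => - (s / g) * (M (z - y) * ff y) - N * (M (z - y) * Jc y))); last by move=> y; ring.
  by rewrite (IntB (itgZ _ (iU z)) (itgZ _ (iu z))) (IntZ _ (iU z)) (IntZ _ (iu z)).
(* This constant makes M * th vanish at a, so that only increments from a occur. *)
pose c1 := - cM m al be (th s N) a.
have ws z : W s N z + c1 = s * ps z + (- (s / g) * (U z - U a) + N * (u0 a - u0 z)).
  by rewrite /W /c1 !cMth; move: (U z) (U a) (u0 z) (u0 a) => q1 q2 q3 q4; ring.
have W3 := W_d2k s N c1; have W4 := @W_cont s N c1; have W5 := @W_semiconcave s N c1.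
clearbody U u0; clear Hc HC1 HC2 HC3 HC4 iU iu cMth.
have Ub z : `|- (s / g) * (U z - U a)| <= g^-1 * B * Num.min (`|z - a| `^ m) 1.
  rewrite normrM normrN normrM s1 mul1r (gtr0_norm (_ : 0 < g^-1)) ?invr_gt0// -mulrA.
  apply: ler_wpM2l; first by rewrite invr_ge0 ltW.
  have [h|h] := leP (`|z - a| `^ m) 1.
    apply: (le_trans (U1 a z)); apply: ler_wpM2r; first exact: powR_ge0.
    by rewrite /B lerDl !mulr_ge0.
  rewrite mulr1; apply: (le_trans (ler_normB _ _)); rewrite /B.
  have := U2 z; have := U2 a; have : 0 <= C1 * S by rewrite mulr_ge0.
  by move: (C2 * S) (C1 * S) (`|U z|) (`|U a|) => q1 q2 q3 q4; lra.
have NB z : g^-1 * B * Num.min (`|z - a| `^ m) 1 <= N * (u0 a - u0 z).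
  have -> : g^-1 * B * Num.min (`|z - a| `^ m) 1 = N * (c * Num.min (`|z - a| `^ m) 1).
    by rewrite mulrA /N divfK// gt_eqF.
  by apply: (ler_wpM2l N0); exact: Hu.
have w0 z : ~~ (a < z < b) -> 0 <= W s N z + c1.
  move=> zab; rewrite ws (off_zero psS zab) mulr0 add0r.
  have := Ub z; have := NB z; rewrite ler_norml => n1 /andP[n2 n3].
  by move: n1 n2 n3; move: (g^-1 * B * _) (- (s / g) * _) (N * _) => q1 q2 q3; lra.
have w_ge0 z : 0 <= W s N z + c1.
  exact: (@max_principle R m al be a b (fun z => W s N z + c1) m0 m1 al0 be0 hab W4 w0 W5 W3).
exists (g^-1 * B + N * C3); first by rewrite addr_ge0// mulr_ge0// invr_ge0 ltW.
move=> z zab; have := w_ge0 z; rewrite ws.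
have h1 : N * (u0 a - u0 z) <= N * C3 * `|z - a| `^ m.
  rewrite -mulrA; apply: (ler_wpM2l N0).
  by have := u1 a z; rewrite distrC => /(le_trans (ler_norm _)).
have h2 : - (s / g) * (U z - U a) <= g^-1 * B * `|z - a| `^ m.
  apply: (le_trans (ler_norm _)); apply: (le_trans (Ub z)); apply: ler_wpM2l.
    by rewrite mulr_ge0// invr_ge0 ltW.
  by rewrite ge_min lexx.
rewrite mulrDl; move: h1 h2; move: (N * (u0 a - u0 z)) (- (s / g) * _) (N * C3 * _) (g^-1 * B * _) (s * ps z) => q1 q2 q3 q4 q5; lra.
Qed.

Lemma left_decay : exists2 C, 0 <= C & forall z, `|ps z| <= C * `|z - a| `^ m.
Proof.
have [|C C0 HC] := @sgn_bound 1; first by rewrite normr1.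
have [|D D0 HD] := @sgn_bound (-1); first by rewrite normrN1.
exists (C + D); first exact: addr_ge0.
move=> z; have p := powR_ge0 `|z - a| m.
have [zab|zab] := boolP (a < z < b); last first.
  by rewrite (off_zero psS zab) normr0 mulr_ge0// addr_ge0.
have := HC z zab; have := HD z zab; rewrite mulN1r opprK mul1r mulrDl => h1 h2.
have := mulr_ge0 C0 p; have := mulr_ge0 D0 p.
by rewrite ler_norml; move: h1 h2; move: (C * _) (D * _) => q1 q2; lra.
Qed.

End Decay.

Section Decay2.
Variable R : realType.
Variables (m al be a b S : R) (ps ff : R -> R).
Hypotheses (m0 : 0 < m) (m1 : m < 1) (al0 : 0 < al) (be0 : 0 < be).
Hypotheses (hab : a < b) (S0 : 0 <= S) (mff : measurable_fun setT ff)
  (psS : forall y, `|ps y| <= S * chi (a < y < b)) (ffS : forall y, `|ff y| <= S * chi (a < y < b)).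
Hypothesis cps : continuous ps.
Hypothesis eqn : forall x x', a <= x -> x < x' -> x' <= b ->
  cK m al be ps x' - cK m al be ps x = Int (fun z => chi (x < z < x') * ff z).

(** Reflection turns b into the left end point - b, exchanges al and be, and replaces ff by - ff(-
    t). *)
Lemma right_decay : exists2 C, 0 <= C & forall z, `|ps z| <= C * `|z - b| `^ m.
Proof.
have mps : measurable_fun setT ps by exact: continuous_measurable_fun.
have chiN y : chi (- b < y < - a) = chi (a < - y < b) :> R by rewrite ltrNr ltrNl andbC.
have [||C C0 HC] := @conv_bd R al be (- m) a b _ _ hab; [by move: m1; lra|by move: m0; lra|].
have cKE x : cK m be al (fun t => ps (- t)) x = cK m al be ps (- x).
  have [i _] := HC ps S S0 mps psS (- x).
  rewrite /cK -(Int_opp i); apply: eq_Int => y.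
  by rewrite -kerN (_ : - (x - y) = - x - - y)//; ring.
have [|||||||||||D D0 HD] := @left_decay R m be al (- b) (- a) S (fun t => ps (- t)) (fun t => - ff (- t)).
- exact: m0.
- exact: m1.
- exact: be0.
- exact: al0.
- by rewrite ltrN2.
- exact: S0.
- apply: (measurableT_comp (@measurable_oppr_id R)).
  exact: (measurableT_comp mff (@measurable_oppr_id R)).
- by move=> y; rewrite chiN.
- by move=> y; rewrite chiN normrN.
- by move=> x; apply: continuous_comp; [exact: opp_continuous|exact: cps].
- move=> x x' xb xx xa; rewrite !cKE.
  have h1 : a <= - x' by lra.
  have h2 : - x' < - x by lra.
  have h3 : - x <= b by lra.
  have i : itg (fun z => chi (- x' < z < - x) * ff z).
    by apply: itg_chiM; [mea|exact: ff_itg mff ffS].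
  rewrite -opprB (eqn h1 h2 h3) -(Int_opp i) -IntN; last exact: itg_opp i.
  by apply: eq_Int => z; rewrite !ltrN2 andbC mulrN.
exists D => // z; have := HD (- z); rewrite opprK (_ : - z - - b = - (z - b)) ?normrN//; ring.
Qed.

End Decay2.

(** * Second differences in the interior *)

Section SecondDiff.
Variable R : realType.
Implicit Types (x y z h e d r : R).
Notation mu := (@lebesgue_measure R).

(** With |ps t| <= D (t - a)^m the integrand is at most D / (t - z), whose integral grows
    logarithmically as z tends to a. Writing 1 / (t - z) as (t - z)^(-del) (t - z)^(del - 1)
    replaces the logarithm by an arbitrarily small power. *)
Lemma Lf_bound m a b D del (ps : R -> R) z : 0 < m -> a < b -> 0 < del -> del <= 1 -> 0 <= D ->
  measurable_fun setT ps -> (forall t, ~~ (a < t < b) -> ps t = 0) -> (forall t, `|ps t| <= D * `|t - a| `^ m) ->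
  z < a -> `|Lf m ps z| <= D * (del^-1 * (b - a) `^ del) * (a - z) `^ (- del).
Proof.
move=> m0 hab del0 del1 D0 mps ps0 psD za.
have ba : 0 < b - a by lra.
have e1 : -1 < del - 1 by lra.
have [i E] := pp_near0 e1 ba.
have j := itg_shift (- a) i.
rewrite subrK in E.
rewrite -E -(Int_shift (- a) i) mulrAC -(IntZ _ j).
apply: abs_Int_le; [by mea| |exact: itgZ].
move=> t; have [tab|tab] := boolP (a < t < b); last first.
  by rewrite ps0// mulr0 normr0 !mulr_ge0 ?powR_ge0 ?chi_ge0 ?pp_ge0.
case/andP: (tab) => t1 t2.
have ta : 0 < t - a by lra.
have tz : 0 < t - z by lra.
have az : 0 < a - z by lra.
rewrite (chiT (_ : t - a < b - a)) ?mul1r; last by lra.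
rewrite normrM (ger0_norm (pp_ge0 _ _)) !pp_pos//.
apply: (@le_trans _ _ ((t - z) `^ (- m - 1) * (D * (t - a) `^ m))).
  by apply: ler_wpM2l; [exact: powR_ge0|have := psD t; rewrite (gtr0_norm ta)].
rewrite mulrCA -mulrA; apply: ler_wpM2l => //.
apply: (@le_trans _ _ ((t - z) `^ (- m - 1) * (t - z) `^ m)).
  by apply: ler_wpM2l; [exact: powR_ge0|apply: ge0_ler_powR; rewrite ?nnegrE; lra].
rewrite -powRD ?(gt_eqF tz) ?implybT// (_ : - m - 1 + m = - del + (del - 1)); last by ring.
rewrite powRD ?(gt_eqF tz) ?implybT//; apply: ler_pM; rewrite ?powR_ge0//.
  by apply: powR_anti; lra.
by apply: powR_anti; lra.
Qed.

(** The profile, at unit distance, of the second derivative of M, of size r^(m - 3), against an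
    exterior source of size v^(-del). *)
Definition G0 m del v : R := pp (- del) v * pp (m - 3) (v + 1).

Lemma G0_itg m del : 0 < m -> m < 1 -> 0 < del -> del < 1 -> itg (G0 m del).
Proof.
move=> m0 m1 d0 d1; have e1 : -1 < - del by lra.
have e2 : m - 3 < -1 by lra.
have [i1 _] := pp_near0 e1 (ltr0n _ 2).
have [i2 _] := pp_neary e2 ltr01.
apply: (itg_le _ _ (itgD i1 i2)); first by rewrite /G0; mea.
move=> v; rewrite /G0 ger0_norm ?mulr_ge0 ?pp_ge0//.
have [v0|v0] := leP v 0; first by rewrite (pp_neg _ v0) mul0r addr_ge0 ?mulr_ge0 ?pp_ge0 ?chi_ge0.
rewrite !pp_pos//; last by lra.
have h1 : (v + 1) `^ (m - 3) <= 1.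
  by have := @powR_anti R (m - 3) 1 (v + 1); rewrite powR1; apply; lra.
have [v1|v1] := leP v 1.
  rewrite (chiT (_ : v < 2)) ?mul1r; last by lra.
  rewrite -[leLHS]addr0; apply: lerD; last by rewrite mulr_ge0 ?chi_ge0 ?powR_ge0.
  by rewrite ler_piMr ?powR_ge0.
rewrite (chiT isT) mul1r -[leLHS]add0r; apply: lerD; first by rewrite mulr_ge0 ?chi_ge0 ?powR_ge0.
have h2 : (v + 1) `^ (m - 3) <= v `^ (m - 3) by apply: powR_anti; lra.
apply: le_trans h2; rewrite ler_piMl ?powR_ge0//.
by have := @powR_anti R (- del) 1 v; rewrite powR1; apply; lra.
Qed.

Lemma G0_scale m del d : 0 < m -> m < 1 -> 0 < del -> del < 1 -> 0 < d ->
  itg (fun u => pp (- del) u * pp (m - 3) (u + d)) /\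
  Int (fun u => pp (- del) u * pp (m - 3) (u + d)) = d `^ (m - 2 - del) * Int (G0 m del).
Proof.
move=> m0 m1 d0 d1 dp; have i := G0_itg m0 m1 d0 d1.
have E u : d `^ (m - 3 - del) * G0 m del (d^-1 * u) = pp (- del) u * pp (m - 3) (u + d).
  rewrite /G0.
  have -> : u + d = d * (d^-1 * u + 1) by rewrite mulrDr mulr1 mulVKf// gt_eqF.
  have -> : pp (- del) u = d `^ (- del) * pp (- del) (d^-1 * u) by rewrite -ppZ// mulVKf// gt_eqF.
  rewrite ppZ//.
  rewrite (_ : m - 3 - del = - del + (m - 3)); last by ring.
  by rewrite powRD ?(gt_eqF dp) ?implybT//; ring.
have di : 0 < d^-1 by rewrite invr_gt0.
have j := itg_scale di i.
split; first exact: eq_itg E (itgZ _ j).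
rewrite -(eq_Int E) (IntZ _ j) (Int_scale di i) invrK mulrA; congr (_ * _).
by rewrite -[X in _ * X]powRr1 ?(ltW dp)// -powRD ?(gt_eqF dp) ?implybT//; congr (_ `^ _); ring.
Qed.

Section D2.
Variables (u v e : R).
Hypotheses (e1 : -1 < e) (e0 : e < 0).
Local Notation M := (ker u v e).
Let A := `|u| + `|v|.

Definition D2 h y : R := M (y + h) + M (y - h) - 2 * M y.

Lemma D2_itg h : itg (D2 h) /\ Int (D2 h) = 0.
Proof.
have := @d2k_itg R (- e) u v; rewrite /d2k opprK => H.
by apply: H; [move: e0; lra|move: e1; lra].
Qed.

Lemma measurable_D2 h : measurable_fun setT (D2 h).
Proof. by apply: itg_meas; have [] := D2_itg h. Qed.

Lemma D2_far h y : 0 < h -> 2 * h <= `|y| -> `|D2 h y| <= A * (`|e * (e - 1)| * 2^-1 `^ (e - 2)) * (`|y| `^ (e - 2) * h ^+ 2).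
Proof.
move=> h0 hy; have y0 : 0 < `|y| / 2 by lra.
have e2 : e <= 2 by move: e0; lra.
have h01 : 0 <= h by lra.
have hy2 : `|y| / 2 + h <= `|y| by lra.
apply: (le_trans (ker_diff2 u v e2 h01 y0 hy2)).
by rewrite powRM ?invr_ge0// le_eqVlt; apply/orP; left; apply/eqP; rewrite /A; ring.
Qed.

(** By homogeneity everything reduces to h = 1. The moment is finite because D2 is O(|y|^(e - 2)) at
    infinity and e + lam < 1. *)
Lemma D2_moment lam : 0 < lam -> e + lam < 1 -> exists2 C, 0 <= C & forall h, 0 < h ->
  itg (fun y => `|D2 h y| * ab lam y) /\ Int (fun y => `|D2 h y| * ab lam y) = C * h `^ (e + lam + 1).
Proof.
move=> l0 el; have [i1 _] := D2_itg 1.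
have [c c0 Hc] : exists2 c, 0 <= c & forall y, 2 <= `|y| -> `|D2 1 y| <= c * `|y| `^ (e - 2).
  exists (A * (`|e * (e - 1)| * 2^-1 `^ (e - 2))); first by rewrite !mulr_ge0 ?addr_ge0 ?powR_ge0.
  by move=> y y2; have := @D2_far 1 y ltr01; rewrite mulr1 expr1n mulr1; exact.
have e3 : e - 2 + lam < -1 by lra.
have [i2 _] := ab_neary e3 ltr01.
have mD := measurable_D2 1.
have i : itg (fun y => `|D2 1 y| * ab lam y).
  apply: (itg_le _ _ (itgD (itgZ (2 `^ lam) (itg_abs i1)) (itgZ c i2))); first by mea.
  move=> y; have a0 := ab_ge0 lam y.
  rewrite ger0_norm ?mulr_ge0//.
  have [y2|y2] := leP `|y| 2.
    rewrite -[leLHS]addr0; apply: lerD; last by rewrite !mulr_ge0 ?chi_ge0 ?ab_ge0.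
    rewrite mulrC; apply: ler_wpM2r => //.
    by apply: ab_le_pos => //; lra.
  rewrite -[leLHS]add0r; apply: lerD; first by rewrite mulr_ge0 ?powR_ge0.
  rewrite (chiT (_ : 1 < `|y|)) ?mul1r; last by lra.
  have y0 : y != 0 by rewrite -normr_gt0; lra.
  apply: (le_trans (ler_wpM2r a0 (Hc _ (ltW y2)))).
  rewrite -mulrA; apply: ler_wpM2l => //.
  by rewrite !abE// -powRD ?normr_eq0 ?(negbTE y0) ?implybT.
exists (Int (fun y => `|D2 1 y| * ab lam y)).
  by apply: Int_ge0 => y; rewrite mulr_ge0 ?ab_ge0.
move=> h h0; have hi : 0 < h^-1 by rewrite invr_gt0.
have E y : h `^ (e + lam) * (`|D2 1 (h^-1 * y)| * ab lam (h^-1 * y)) = `|D2 h y| * ab lam y.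
  have Y : y = h * (h^-1 * y) by rewrite mulVKf// gt_eqF.
  rewrite {3 4}Y abZ// /D2.
  have -> : h * (h^-1 * y) + h = h * (h^-1 * y + 1) by ring.
  have -> : h * (h^-1 * y) - h = h * (h^-1 * y - 1) by ring.
  rewrite !(kerZ _ _ _ _ h0).
  have -> : h `^ e * M (h^-1 * y + 1) + h `^ e * M (h^-1 * y - 1) - 2 * (h `^ e * M (h^-1 * y)) =
     h `^ e * (M (h^-1 * y + 1) + M (h^-1 * y - 1) - 2 * M (h^-1 * y)) by ring.
  rewrite normrM (ger0_norm (powR_ge0 _ _)) powRD ?(gt_eqF h0) ?implybT//; ring.
have j := itg_scale hi i.
split; first exact: eq_itg E (itgZ _ j).
rewrite -(eq_Int E) (IntZ _ j) (Int_scale hi i) invrK mulrA mulrC; congr (_ * _).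
by rewrite [RHS]powRD ?(gt_eqF h0) ?implybT// powRr1// ltW.
Qed.

End D2.
End SecondDiff.

(** * Second differences of the solution *)

Section Interior.
Variable R : realType.
Notation mu := (@lebesgue_measure R).
Variables (m al be a b S : R) (ps ff : R -> R).
Hypotheses (m0 : 0 < m) (m1 : m < 1) (al0 : 0 < al) (be0 : 0 < be).
Hypotheses (hab : a < b) (S0 : 0 <= S) (mff : measurable_fun setT ff)
  (psS : forall y, `|ps y| <= S * chi (a < y < b)) (ffS : forall y, `|ff y| <= S * chi (a < y < b)).
Hypothesis cps : continuous ps.
Local Notation M := (ker al (- be) (m - 1)).
Local Notation g := (gam m al be).
Hypothesis eqn : forall x x', a <= x -> x < x' -> x' <= b ->
  cK m al be ps x' - cK m al be ps x = Int (fun z => chi (x < z < x') * ff z).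

Definition dist x := Num.min (x - a) (b - x).

Lemma dist_gt0 x : a < x < b -> 0 < dist x.
Proof. by move=> /andP[h1 h2]; rewrite lt_min !subr_gt0 h1. Qed.

Lemma dist_le x : dist x <= x - a /\ dist x <= b - x.
Proof. by rewrite !ge_min !lexx orbT. Qed.

Variables (lam q0 Cf del : R).
Hypotheses (lam0 : 0 < lam) (lam1 : lam <= 1) (Cf0 : 0 <= Cf) (del0 : 0 < del) (del1 : del < 1).
Hypothesis Hff : forall x z, a < x < b -> `|z - x| <= dist x / 2 ->
  `|ff z - ff x| <= Cf * (`|z - x| `^ lam * dist x `^ (- q0)).

Local Notation fo := (fo m al be a b ps).
Let em := em m0.
Let em1 := em1 m1.
Let mps := mps cps.
Lemma ps_outside t : ~~ (a < t < b) -> ps t = 0. Proof. exact: off_zero psS. Qed.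

Lemma D2_farM : exists2 c, 0 <= c & forall h y, 0 < h -> 2 * h <= `|y| ->
  `|D2 al (- be) (m - 1) h y| <= c * (`|y| `^ (m - 3) * h ^+ 2).
Proof.
exists ((`|al| + `|- be|) * (`|(m - 1) * (m - 1 - 1)| * 2^-1 `^ (m - 1 - 2))).
  by rewrite !mulr_ge0 ?addr_ge0 ?powR_ge0.
move=> h y h0 hy; have := D2_far al (- be) em1 h0 hy.
by rewrite (_ : m - 1 - 2 = m - 3); [|ring].
Qed.

(** Here the decay with exponent m at both end points is used: it leaves in fo only an arbitrarily
    weak singularity. *)
Lemma fo_bound : exists2 E, 0 <= E & forall z, `|fo z| <= E * (pp (- del) (a - z) + pp (- del) (z - b)).
Proof.
have [C C0 HC] := left_decay m0 m1 al0 be0 hab S0 mff psS ffS cps eqn.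
have [D D0 HD] := right_decay m0 m1 al0 be0 hab S0 mff psS ffS cps eqn.
have nab : - b < - a by rewrite ltrN2.
pose L := del^-1 * (b - a) `^ del.
have L0 : 0 <= L by rewrite mulr_ge0 ?powR_ge0// invr_ge0 ltW.
have mb : 0 <= m * be by rewrite mulr_ge0// ltW.
have ma : 0 <= m * al by rewrite mulr_ge0// ltW.
have E1 : 0 <= m * be * (C * L) by rewrite mulr_ge0// mulr_ge0.
have E2 : 0 <= m * al * (D * L) by rewrite mulr_ge0// mulr_ge0.
exists (m * be * (C * L) + m * al * (D * L)); first exact: addr_ge0.
have mpr : measurable_fun setT (fun t : R => ps (- t)) by exact: (measurableT_comp mps (@measurable_oppr_id R)).
have gen (x y p q : R) : 0 <= x -> 0 <= y -> 0 <= p -> 0 <= q -> x * p <= (x + y) * (p + q) /\ y * q <= (x + y) * (p + q).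
  by move=> *; split; nra.
move=> z; rewrite /fo.
have p1 := pp_ge0 (- del) (a - z); have p2 := pp_ge0 (- del) (z - b).
have [g1 g2] := gen _ _ _ _ E1 E2 p1 p2.
have [za|za] := ltP z a.
  rewrite (chiT isT) mul1r (_ : chi (- z < - b) = 0); last by rewrite chiF// -leNgt lerN2; move: hab; lra.
  rewrite mul0r mulr0 subr0 normrM (ger0_norm mb); apply: le_trans g1.
  rewrite -mulrA; apply: ler_wpM2l => //.
  rewrite pp_pos; last by lra.
  exact: (Lf_bound m0 hab del0 (ltW del1) C0 mps ps_outside HC za).
rewrite (_ : chi false = 0)// mul0r mulr0 sub0r normrN.
have [zb|zb] := ltP (- z) (- b); last first.
  rewrite (_ : chi false = 0)// mul0r mulr0 normr0 mulr_ge0// addr_ge0//.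
rewrite (chiT isT) mul1r normrM (ger0_norm ma); apply: le_trans g2.
rewrite -mulrA; apply: ler_wpM2l => //.
rewrite pp_pos; last by lra.
have H1 t : ~~ (- b < t < - a) -> ps (- t) = 0.
  by move=> h; apply: ps_outside; rewrite ltrNr ltrNl andbC.
have H2 t : `|ps (- t)| <= D * `|t - - b| `^ m.
  by have := HD (- t); rewrite (_ : - t - b = - (t - - b)) ?normrN//; ring.
have := Lf_bound m0 nab del0 (ltW del1) D0 mpr H1 H2 zb.
by rewrite (_ : - a - - b = b - a) 1?(_ : - b - - z = z - b)//; ring.
Qed.

Lemma D2_conv h x (th : R -> R) : itg (fun t => M (x + h - t) * th t) -> itg (fun t => M (x - h - t) * th t) ->
  itg (fun t => M (x - t) * th t) -> itg (fun t => D2 al (- be) (m - 1) h (x - t) * th t) /\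
  Int (fun t => M (x + h - t) * th t) + Int (fun t => M (x - h - t) * th t) - 2 * Int (fun t => M (x - t) * th t)
  = Int (fun t => D2 al (- be) (m - 1) h (x - t) * th t).
Proof.
move=> i1 i2 i3.
have E t : M (x + h - t) * th t + M (x - h - t) * th t - 2 * (M (x - t) * th t) = D2 al (- be) (m - 1) h (x - t) * th t.
  rewrite /D2 (_ : x + h - t = x - t + h); last by ring.
  by rewrite (_ : x - h - t = x - t - h); ring.
have i4 := itgD i1 i2.
split; first exact: eq_itg E (itgB i4 (itgZ 2 i3)).
by rewrite -(eq_Int E) (IntB i4 (itgZ 2 i3)) (IntD i1 i2) (IntZ _ i3).
Qed.

(** Outside ]a, b[ one has |x - t| >= d, and even |x - t| >= (a - t) + d for t <= a, symmetrically
    at b. There D2 is O(h^2 |x - t|^(m - 3)), and the integral against the bound for fo scales by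
    [G0_scale]. *)
Lemma F_diff2 : exists2 C, 0 <= C & forall x h, a < x < b -> 0 < h -> 4 * h <= dist x ->
  `|Int (fun t => M (x + h - t) * fo t) + Int (fun t => M (x - h - t) * fo t) - 2 * Int (fun t => M (x - t) * fo t)|
  <= C * (h ^+ 2 * dist x `^ (m - 2 - del)).
Proof.
have [E E0 HE] := fo_bound.
have [c c0 Hc] := D2_farM.
have I0 : 0 <= Int (G0 m del) by apply: Int_ge0 => v; rewrite mulr_ge0 ?pp_ge0.
exists (c * E * (2 * Int (G0 m del))).
  by apply: mulr_ge0; [exact: mulr_ge0|rewrite mulr_ge0].
move=> x h xab h0 hd; have d0 := dist_gt0 xab; have [d1 d2] := dist_le x.
set d := dist x in hd d0 d1 d2 *.
have x1 : a < x + h < b by lra.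
have x2 : a < x - h < b by lra.
have I y : a < y < b -> itg (fun t => M (y - t) * fo t) := fun hy => Mfo_itg al be m0 m1 hab S0 mps psS hy.
have [i ->] := D2_conv (I _ x1) (I _ x2) (I _ xab).
have [j E1] := G0_scale m0 m1 del0 del1 d0.
have j1 := itg_refl a j; have j2 := itg_shift (- b) j.
pose K u := pp (- del) u * pp (m - 3) (u + d).
have K0 u : 0 <= K u by rewrite mulr_ge0 ?pp_ge0.
have ce0 : 0 <= c * h ^+ 2 * E by apply: mulr_ge0 => //; apply: mulr_ge0 => //; exact: sqr_ge0.
apply: (@le_trans _ _ (Int (fun t => (c * h ^+ 2 * E) * (K (a - t) + K (t - b))))); last first.
  rewrite (IntZ _ (itgD j1 j2)) (IntD j1 j2) (Int_refl a j) (Int_shift (- b) j) E1.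
  by clear; move: (Int _) => q; rewrite le_eqVlt; apply/orP; left; apply/eqP; ring.
apply: abs_Int_le; [exact: itg_meas i| |exact: itgZ (itgD j1 j2)].
clear E1 I0.
move=> t; rewrite normrM.
have [tab|tab] := boolP (a < t < b).
  by rewrite fo0// normr0 mulr0; apply: mulr_ge0 => //; exact: addr_ge0.
have far : d <= `|x - t|.
  move: tab; rewrite negb_and -!leNgt => /orP[t1|t1].
    by rewrite ger0_norm; lra.
  by rewrite ler0_norm; lra.
have h2 : 2 * h <= `|x - t| by lra.
have HD := Hc h _ h0 h2.
apply: (le_trans (ler_pM (normr_ge0 _) (normr_ge0 _) HD (HE t))).
rewrite (_ : c * (`|x - t| `^ (m - 3) * h ^+ 2) * _ = (c * h ^+ 2 * E) * (`|x - t| `^ (m - 3) * pp (- del) (a - t) + `|x - t| `^ (m - 3) * pp (- del) (t - b))); last by ring.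
apply: (ler_wpM2l ce0); rewrite /K.
have em3 : m - 3 <= 0 by move: m1; lra.
apply: lerD; rewrite mulrC.
  have [ta|ta] := leP (a - t) 0; first by rewrite pp_neg// !mul0r.
  apply: ler_wpM2l; first exact: pp_ge0.
  rewrite pp_pos; last by lra.
  by apply: powR_anti; [lra|lra|rewrite ger0_norm; lra].
have [ta|ta] := leP (t - b) 0; first by rewrite pp_neg// !mul0r.
apply: ler_wpM2l; first exact: pp_ge0.
rewrite pp_pos; last by lra.
by apply: powR_anti; [lra|lra|rewrite ler0_norm; lra].
Qed.

(** As D2 has integral 0, ff x may be subtracted. For |y| <= d/2 the local Hoelder bound of ff meets
    the moment of D2; beyond, the bound of ff meets the decay of D2. *)
Lemma U_diff2 : exists2 C, 0 <= C & forall x h, a < x < b -> 0 < h -> 4 * h <= dist x ->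
  `|Int (fun t => M (x + h - t) * ff t) + Int (fun t => M (x - h - t) * ff t) - 2 * Int (fun t => M (x - t) * ff t)|
  <= C * (h `^ (m + lam) * dist x `^ (- q0) + h ^+ 2 * dist x `^ (m - 2)).
Proof.
have [c c0 Hc] := D2_farM.
have el : m - 1 + lam < 1 by move: m1 lam1; lra.
have [C1 C10 HC1] := D2_moment al (- be) em em1 lam0 el.
have e3 : m - 3 < -1 by move: m1; lra.
pose c2 := 2 * S * c * (2 * ((2 - m)^-1 * 2^-1 `^ (m - 2))).
have c20 : 0 <= c2.
  rewrite /c2 !mulr_ge0 ?powR_ge0// invr_ge0; move: m1; lra.
have CC : 0 <= Cf * C1 by exact: mulr_ge0.
exists (Cf * C1 + c2); first exact: addr_ge0.
move=> x h xab h0 hd; have d0 := dist_gt0 xab; have [d1 d2] := dist_le x.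
have HF := @Hff x.
set d := dist x in hd d0 d1 d2 HF *.
have I y : itg (fun t => M (y - t) * ff t) := Mff_itg al be m0 m1 hab S0 mff ffS y.
have [i ->] := D2_conv (I (x + h)) (I (x - h)) (I x).
have [iD ED] := D2_itg al (- be) em em1 h.
have j := itg_refl x i.
have j2 : itg (fun y => D2 al (- be) (m - 1) h y * ff (x - y)).
  by apply: eq_itg j => y; rewrite (_ : x - (x - y) = y)//; ring.
have E1 y : D2 al (- be) (m - 1) h y * ff (x - y) - ff x * D2 al (- be) (m - 1) h y = D2 al (- be) (m - 1) h y * (ff (x - y) - ff x).
  by rewrite [RHS]mulrBr [ff x * _]mulrC.
have j3 : itg (fun y => D2 al (- be) (m - 1) h y * (ff (x - y) - ff x)).
  exact: eq_itg E1 (itgB j2 (itgZ (ff x) iD)).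
have -> : Int (fun t => D2 al (- be) (m - 1) h (x - t) * ff t) = Int (fun y => D2 al (- be) (m - 1) h y * (ff (x - y) - ff x)).
  rewrite -(eq_Int E1) (IntB j2 (itgZ _ iD)) (IntZ _ iD) ED mulr0 subr0 -(Int_refl x i).
  by apply: eq_Int => y; rewrite (_ : x - (x - y) = y)//; ring.
have [k1 Ek1] := HC1 h h0.
have dh : 0 < d / 2 by lra.
have [k2 Ek2] := ab_neary e3 dh.
pose A1 := Cf * d `^ (- q0).
have A10 : 0 <= A1 by rewrite mulr_ge0 ?powR_ge0.
pose A2 := 2 * S * c * h ^+ 2.
have A20 : 0 <= A2 by rewrite /A2 mulr_ge0 ?sqr_ge0// !mulr_ge0.
apply: (@le_trans _ _ (Int (fun y => A1 * (`|D2 al (- be) (m - 1) h y| * ab lam y) + A2 * (chi (d / 2 < `|y|) * ab (m - 3) y)))); last first.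
  rewrite (IntD (itgZ _ k1) (itgZ _ k2)) (IntZ _ k1) (IntZ _ k2) Ek1 Ek2.
  clear Ek1 Ek2 ED HC1.
  have -> : m - 1 + lam + 1 = m + lam by ring.
  have -> : m - 3 + 1 = m - 2 by ring.
  have -> : (m - 2)^-1 = - (2 - m)^-1 by rewrite -invrN opprB.
  rewrite powRM ?invr_ge0 ?(ltW d0)//.
  have -> : A1 * (C1 * h `^ (m + lam)) + A2 * - (2 * (- (2 - m)^-1 * (d `^ (m - 2) * 2^-1 `^ (m - 2)))) =
    Cf * C1 * (h `^ (m + lam) * d `^ (- q0)) + c2 * (h ^+ 2 * d `^ (m - 2)).
    by rewrite /A1 /A2 /c2; ring.
  have p1 : 0 <= h `^ (m + lam) * d `^ (- q0) by rewrite mulr_ge0 ?powR_ge0.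
  have p2 : 0 <= h ^+ 2 * d `^ (m - 2) by rewrite mulr_ge0 ?powR_ge0 ?sqr_ge0.
  have gen (r1 r2 r3 r4 : R) : 0 <= r1 -> 0 <= r2 -> 0 <= r3 -> 0 <= r4 -> r3 * r1 + r4 * r2 <= (r3 + r4) * (r1 + r2).
    by move=> *; nra.
  exact: gen.
apply: abs_Int_le; [exact: itg_meas j3| |exact: itgD (itgZ _ k1) (itgZ _ k2)].
clear Ek1 Ek2 ED HC1.
move=> y; rewrite normrM.
have [yd|yd] := leP `|y| (d / 2).
  rewrite (_ : chi false = 0)// mul0r mulr0 addr0.
  rewrite [leRHS]mulrCA; apply: ler_wpM2l => //.
  have := HF (x - y) xab; rewrite (_ : x - y - x = - y) ?normrN; last by ring.
  move=> /(_ yd) => H; apply: (le_trans H); rewrite /A1 -mulrA; apply: ler_wpM2l => //.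
  rewrite mulrC; apply: ler_wpM2l; first exact: powR_ge0.
  have [->|y0] := eqVneq y 0; last by rewrite abE.
  by rewrite normr0 powR0 ?gt_eqF// ab_ge0.
rewrite -[leLHS]add0r; apply: lerD; first by rewrite mulr_ge0// mulr_ge0 ?ab_ge0.
rewrite (chiT isT) mul1r.
have h2 : 2 * h <= `|y| by lra.
have y0 : y != 0 by rewrite -normr_gt0; lra.
have HD := Hc h _ h0 h2.
have H2 : `|ff (x - y) - ff x| <= 2 * S.
  have H3 z : `|ff z| <= S by apply: (le_trans (ffS z)); rewrite ler_piMr// chi_le1.
  by apply: (le_trans (ler_normB _ _)); have := H3 x; have := H3 (x - y); lra.
apply: (le_trans (ler_pM (normr_ge0 _) (normr_ge0 _) HD H2)).
rewrite (abE _ y0).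
by rewrite /A2 le_eqVlt; apply/orP; left; apply/eqP; ring.
Qed.

Lemma ps_diff2 : exists2 C, 0 <= C & forall x h, a < x < b -> 0 < h -> 4 * h <= dist x ->
  `|ps (x + h) + ps (x - h) - 2 * ps x| <=
  C * (h `^ (m + lam) * dist x `^ (- q0) + h ^+ 2 * dist x `^ (m - 2) + h ^+ 2 * dist x `^ (m - 2 - del)).
Proof.
have [C1 C10 H1] := U_diff2; have [C2 C20 H2] := F_diff2.
have g0 : 0 < g by exact: gam_gt0.
have gi : 0 <= g^-1 by rewrite invr_ge0 ltW.
exists (g^-1 * (C1 + C2)); first by rewrite mulr_ge0// addr_ge0.
move=> x h xab h0 hd; have d0 := dist_gt0 xab; have [d1 d2] := dist_le x.
have x1 : a < x + h < b by move: hd; lra.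
have x2 : a < x - h < b by move: hd; lra.
have r y : a < y < b -> ps y = g^-1 * (Int (fun t => M (y - t) * ff t) + Int (fun t => M (y - t) * fo t)).
  move=> hy; have := interior_representation m0 m1 al0 be0 hab S0 mps mff psS ffS (cps_right cps) eqn hy.
  by move=> <-; rewrite mulKf// gt_eqF.
have := H1 x h xab h0 hd; have := H2 x h xab h0 hd.
rewrite (r _ x1) (r _ x2) (r _ xab).
have p1 : 0 <= h `^ (m + lam) * dist x `^ (- q0) by rewrite mulr_ge0 ?powR_ge0.
have p2 : 0 <= h ^+ 2 * dist x `^ (m - 2) by rewrite mulr_ge0 ?powR_ge0 ?sqr_ge0.
have p3 : 0 <= h ^+ 2 * dist x `^ (m - 2 - del) by rewrite mulr_ge0 ?powR_ge0 ?sqr_ge0.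
clear r H1 H2 d1 d2 x1 x2 hd d0.
move: (Int (fun t => M (x + h - t) * ff t)) (Int (fun t => M (x - h - t) * ff t)) (Int (fun t => M (x - t) * ff t)) => u1 u2 u3.
move: (Int (fun t => M (x + h - t) * fo t)) (Int (fun t => M (x - h - t) * fo t)) (Int (fun t => M (x - t) * fo t)) => v1 v2 v3.
move: (h `^ (m + lam) * _) (h ^+ 2 * _) (h ^+ 2 * _) p1 p2 p3 => r1 r2 r3 p1 p2 p3 l1 l2.
rewrite (_ : _ - _ = g^-1 * ((u1 + u2 - 2 * u3) + (v1 + v2 - 2 * v3))); last by ring.
rewrite normrM (ger0_norm gi) -mulrA; apply: ler_wpM2l => //.
apply: (le_trans (ler_normD _ _)); move: l1 l2; move: (`|_|) (`|_|) => w1 w2; nra.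
Qed.

End Interior.

(** * Interpolation at the end points *)

Section Interp.
Variable R : realType.
Implicit Types (x y z h e d r p q : R).

Lemma pow_cmp L x p q : 0 < x -> x <= L -> p <= q -> x `^ q <= L `^ (q - p) * x `^ p.
Proof.
move=> x0 xL pq; rewrite -{1}(subrK p q) (@powRD _ x) ?(gt_eqF x0) ?implybT//.
apply: ler_wpM2r; first exact: powR_ge0.
by apply: ge0_ler_powR; rewrite ?nnegrE; lra.
Qed.

Lemma powR_mul x p q : 0 < x -> x `^ p * x `^ q = x `^ (p + q).
Proof. by move=> x0; rewrite powRD// (gt_eqF x0) implybT. Qed.

Variables (a b : R) (g : R -> R).
Hypothesis hab : a < b.
Local Notation dist := (dist a b).

Lemma dist_lip x y : dist x <= dist y + `|x - y|.
Proof.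
have [h1 h2] := dist_le a b x.
have := ler_norm (x - y); have := ler_norm (y - x); rewrite distrC => l1 l2.
have [|] : dist y = y - a \/ dist y = b - y by rewrite /dist /Num.min; case: ifP => _; [left|right].
  by lra.
by lra.
Qed.

Lemma dist_ge0 x : a <= x <= b -> 0 <= dist x.
Proof. by move=> /andP[h1 h2]; rewrite le_min !subr_ge0 h1. Qed.

(** Two points farther from the end points than a power of their mutual distance are compared by the
    degenerate bound; otherwise both values are small by decay. *)
Lemma hoelder_of_local e p q C1 C2 : 0 < e -> 0 < p -> 0 < q -> 0 <= C1 -> 0 <= C2 ->
  (forall x, a <= x <= b -> `|g x| <= C1 * dist x `^ e) ->
  (forall x y, a < x < b -> a < y < b -> `|g x - g y| <= C2 * (Num.min (dist x) (dist y) `^ (- q) * `|x - y| `^ p)) ->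
  exists2 lam, 0 < lam <= 1 & Defs.hoelder a b lam g.
Proof.
move=> e0 p0 q0 C10 C20 H1 H2.
pose L := b - a; have L0 : 0 < L by rewrite subr_gt0.
(* The two cases are separated at dist = |x - y|^th; th q <= p / 2 leaves at least the exponent p /
   2 from the degenerate bound. *)
pose th := Num.min 1 (p / (2 * q)).
have th0 : 0 < th by rewrite lt_min ltr01 divr_gt0// mulr_gt0.
have th1 : th <= 1 by rewrite ge_min lexx.
have thq : th * q <= p / 2.
  have h : th <= p / (2 * q) by rewrite ge_min lexx orbT.
  have := ler_wpM2r (ltW q0) h; rewrite (_ : p / (2 * q) * q = p / 2)//.
  by field; rewrite gt_eqF.
pose lam := Num.min 1 (Num.min (th * e) (p / 2)).
have lam0 : 0 < lam by rewrite !lt_min ltr01 mulr_gt0//= divr_gt0.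
have lam1 : lam <= 1 by rewrite ge_min lexx.
have lam2 : lam <= th * e by rewrite !ge_min lexx orbT.
have lam3 : lam <= p / 2 by rewrite !ge_min lexx !orbT.
pose D := 1 + L `^ (1 - th).
have D0 : 1 <= D by rewrite lerDl powR_ge0.
pose A1 := C2 * L `^ (p - th * q - lam).
pose A2 := (C1 + C1 * D `^ e) * L `^ (th * e - lam).
have A10 : 0 <= A1 by rewrite mulr_ge0 ?powR_ge0.
have A20 : 0 <= A2 by rewrite mulr_ge0 ?powR_ge0// addr_ge0// mulr_ge0 ?powR_ge0.
exists lam; first by rewrite lam0 lam1.
exists (A1 + A2) => x y.
wlog dxy : x y / dist x <= dist y.
  move=> H hx hy; have [dxy|/ltW dyx] := leP (dist x) (dist y); first exact: H.
  by rewrite distrC (distrC x); exact: H.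
move=> hx hy.
have [->|xy] := eqVneq x y; first by rewrite !subrr normr0 mulr_ge0 ?powR_ge0// addr_ge0.
have h0 : 0 < `|x - y| by rewrite normr_gt0 subr_eq0.
have hL : `|x - y| <= L by rewrite ler_norml /L; move: hx hy => /andP[x1 x2] /andP[y1 y2]; lra.
have dx0 := dist_ge0 hx; have dy0 := dist_ge0 hy.
have dyx : dist y <= dist x + `|x - y| by rewrite distrC; exact: dist_lip.
have Hp r : 0 <= `|x - y| `^ r by exact: powR_ge0.
set h := `|x - y| in h0 hL dyx Hp *.
have [big|small] := leP (h `^ th) (dist x).
  have hth : 0 < h `^ th by rewrite powR_gt0.
  have dxp : 0 < dist x by exact: lt_le_trans big.
  have dyp : 0 < dist y by exact: lt_le_trans dxy.
  have ins u : 0 < dist u -> a < u < b by rewrite lt_min !subr_gt0.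
  have := H2 x y (ins _ dxp) (ins _ dyp); rewrite min_l// -/h => l.
  apply: (le_trans l); apply: (@le_trans _ _ (A1 * h `^ lam)); last first.
    by rewrite mulrDl lerDl; apply: mulr_ge0.
  rewrite -[leRHS]mulrA; apply: ler_wpM2l => //.
  apply: (@le_trans _ _ (h `^ (p - th * q))); last by apply: pow_cmp => //; lra.
  apply: (@le_trans _ _ ((h `^ th) `^ (- q) * h `^ p)).
    by apply: ler_wpM2r => //; apply: powR_anti => //; lra.
  by rewrite -powRrM powR_mul// mulrN addrC.
have hth : 0 < h `^ th by rewrite powR_gt0.
have k1 : `|g x| <= C1 * h `^ (th * e).
  apply: (le_trans (H1 x hx)); apply: ler_wpM2l => //; rewrite powRrM.
  by apply: ge0_ler_powR; rewrite ?nnegrE; lra.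
have k2 : `|g y| <= C1 * D `^ e * h `^ (th * e).
  apply: (le_trans (H1 y hy)); rewrite -mulrA; apply: ler_wpM2l => //; rewrite powRrM -powRM ?powR_ge0//; last by lra.
  have Dh : 0 <= D * h `^ th by rewrite mulr_ge0//; lra.
  apply: ge0_ler_powR; rewrite ?nnegrE //; first by lra.
  have : h <= L `^ (1 - th) * h `^ th by have := @pow_cmp L h th 1 h0 hL th1; rewrite powRr1// ltW.
  by move=> k; apply: (le_trans dyx); rewrite /D mulrDl mul1r; lra.
apply: (le_trans (ler_normB _ _)); apply: (@le_trans _ _ (A2 * h `^ lam)); last first.
  by rewrite mulrDl lerDr; apply: mulr_ge0.
apply: (le_trans (lerD k1 k2)); rewrite -mulrDl -[leRHS]mulrA; apply: ler_wpM2l.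
  by rewrite addr_ge0// mulr_ge0 ?powR_ge0.
by apply: pow_cmp.
Qed.

End Interp.

(** * The fractional derivative *)

Section FracDeriv.
Variable R : realType.
Notation mu := (@lebesgue_measure R).
Variables (a b m sg rho ep gm Ch Cd Ci : R) (ps : R -> R).
Hypotheses (hab : a < b) (m0 : 0 < m) (sg0 : 0 < sg) (s2 : m + sg < 2) (rho0 : 0 < rho)
  (ep0 : 0 < ep) (epsg : ep <= 1 - sg) (gm0 : 0 < gm)
  (Ch0 : 0 <= Ch) (Cd0 : 0 <= Cd) (Ci0 : 0 <= Ci).
Hypotheses (hps : forall x y, `|ps x - ps y| <= Ch * `|x - y| `^ gm)
  (psa : forall z, `|ps z| <= Cd * `|z - a| `^ m) (psb : forall z, `|ps z| <= Cd * `|z - b| `^ m).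
Local Notation dist := (dist a b).
Local Notation s := (m + sg).
Local Notation Q := (1 + rho - ep).
Hypothesis psi2 : forall x h, a < x < b -> 0 < h -> 4 * h <= dist x ->
  `|ps (x + h) + ps (x - h) - 2 * ps x| <= Ci * (h `^ (s + rho) * dist x `^ (- Q)).

(* Unlike the centred second difference, this one only involves the values of ps
   to the left of x, so that [K0] can be inverted by the left integral alone. *)
Definition dl x t : R := ps x - 2 * ps (x - t) + ps (x - 2 * t).
(** The left Marchaud derivative of order s, up to a constant factor, with second-order differences
    because s may reach or exceed 1. *)
Definition K0 x : R := Int (fun t => dl x t * pp (-1 - s) t).

Lemma ps_cont : continuous ps.
Proof. exact: (@hoelder_continuous _ ps Ch gm). Qed.

Lemma measurable_ps_hoelder : measurable_fun setT ps. Proof. exact: continuous_measurable_fun ps_cont. Qed.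

Lemma dist_leL x : a < x < b -> dist x <= b - a.
Proof. by move=> /andP[x1 x2]; have [h1 h2] := dist_le a b x; lra. Qed.

Lemma Q0 : 0 < Q. Proof. by move: rho0 sg0 epsg; lra. Qed.

(** [dl x t] is the centred second difference at x - t; the condition 8 t <= d keeps that point at
    distance at least 7 d / 8, where [psi2] applies with step t. *)
Lemma dl_small : exists2 A, 0 <= A & forall x t, a < x < b -> 0 < t -> 8 * t <= dist x ->
  `|dl x t| <= A * (t `^ (s + rho) * dist x `^ (- Q)).
Proof.
exists (Ci * 2^-1 `^ (- Q)); first by rewrite mulr_ge0 ?powR_ge0.
move=> x t xab t0 td; have [d1 d2] := dist_le a b x; have dx := dist_gt0 xab.
have yab : a < x - t < b by lra.
have dy : dist x <= dist (x - t) + t.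
  by have := dist_lip a b x (x - t); rewrite (_ : x - (x - t) = t) ?(gtr0_norm t0)//; ring.
have t4 : 4 * t <= dist (x - t) by lra.
have := psi2 yab t0 t4; rewrite (_ : x - t + t = x); last by ring.
rewrite (_ : x - t - t = x - 2 * t); last by ring.
rewrite (_ : ps x + _ - _ = dl x t); last by rewrite /dl; ring.
move=> l; apply: (le_trans l); rewrite -mulrA; apply: ler_wpM2l => //.
rewrite mulrCA; apply: ler_wpM2l; first exact: powR_ge0.
rewrite -powRM ?invr_ge0//; last by lra.
by apply: powR_anti; have := Q0; lra.
Qed.

(** For d < 8 t, the points x, x - t and x - 2 t lie within d + 2 t < 10 t of the end point nearest
    to x, and the boundary decay bounds each value. *)
Lemma dl_big : exists2 B, 0 <= B & forall x t, a < x < b -> dist x < 8 * t -> `|dl x t| <= B * t `^ m.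
Proof.
exists (4 * Cd * 10 `^ m); first by rewrite mulr_ge0 ?powR_ge0// mulr_ge0.
move=> x t.
move=> /andP[x1 x2] td; have dx : 0 < dist x by apply: dist_gt0; rewrite x1.
have t0 : 0 < t by lra.
suff H y : y = x \/ y = x - t \/ y = x - 2 * t -> `|ps y| <= Cd * 10 `^ m * t `^ m.
  have h1 := H x (or_introl erefl); have h2 := H (x - t) (or_intror (or_introl erefl)).
  have h3 := H (x - 2 * t) (or_intror (or_intror erefl)).
  rewrite /dl (_ : 4 * Cd * 10 `^ m * t `^ m = 4 * (Cd * 10 `^ m * t `^ m)); last by ring.
  apply: (le_trans (ler_normD _ _)); have := ler_normB (ps x) (2 * ps (x - t)).
  rewrite normrM (gtr0_norm (_ : 0 < 2))//.
  move: (Cd * _ * _) h1 h2 h3 => q h1 h2 h3; move: (`|ps x|) (`|ps (x - t)|) (`|ps (x - 2 * t)|) h1 h2 h3 => *; lra.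
move=> hy; rewrite -mulrA -powRM ?(ltW t0)//.
have [dE|dE] : dist x = x - a \/ dist x = b - x by rewrite /dist /Num.min; case: ifP => _; [left|right].
- apply: (le_trans (psa y)); apply: ler_wpM2l => //.
  apply: ge0_ler_powR; rewrite ?nnegrE ?(ltW m0)//; first by lra.
  by rewrite ler_norml; case: hy => [->|[->|->]]; lra.
- apply: (le_trans (psb y)); apply: ler_wpM2l => //.
  apply: ge0_ler_powR; rewrite ?nnegrE ?(ltW m0)//; first by lra.
  by rewrite ler_norml; case: hy => [->|[->|->]]; lra.
Qed.

Lemma mdl x : measurable_fun setT (dl x).
Proof.
have mp := measurable_ps_hoelder; rewrite /dl; apply: measurable_funD.
  apply: measurable_funB; first exact: measurable_cst.
  apply: measurable_funM; first exact: measurable_cst.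
  by mea.
by mea.
Qed.

Lemma near_pow eta : 0 < eta -> itg (fun t => chi (t < eta) * pp (rho - 1) t) /\
  Int (fun t => chi (t < eta) * pp (rho - 1) t) = rho^-1 * eta `^ rho.
Proof. by move=> e0; have [|i E] := pp_near0 (_ : -1 < rho - 1) e0; [move: rho0; lra|rewrite subrK in E]. Qed.

Lemma far_pow (e eta : R) : 0 < e -> 0 < eta -> itg (fun t => chi (eta < t) * pp (-1 - e) t) /\
  Int (fun t => chi (eta < t) * pp (-1 - e) t) = e^-1 * eta `^ (- e).
Proof.
move=> e0 eta0; have [|i E] := pp_neary (_ : -1 - e < -1) eta0; first by lra.
split; first exact: i.
by rewrite E (_ : -1 - e + 1 = - e); [rewrite invrN mulNr opprK|ring].
Qed.

(** The integral is cut at t = d/8. The lower part gives d^(-Q) d^rho = d^(ep - 1); the upper part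
    has integrand O(t^(-1 - sg)) and gives d^(- sg), which is admissible because ep <= 1 - sg. *)
Lemma K0_size : exists2 C, 0 <= C & forall x, a < x < b ->
  itg (fun t => dl x t * pp (-1 - s) t) /\ Int (fun t => `|dl x t * pp (-1 - s) t|) <= C * dist x `^ (ep - 1).
Proof.
have [A A0 dl_small] := dl_small; have [B B0 dl_big] := dl_big.
pose L := b - a; have L0 : 0 < L by rewrite subr_gt0.
pose c1 := A * rho^-1; pose c2 := B * (sg^-1 * 9^-1 `^ (- sg)) * L `^ (- sg - (ep - 1)).
have c10 : 0 <= c1 by rewrite mulr_ge0// invr_ge0 ltW.
have c20 : 0 <= c2 by rewrite /c2 !mulr_ge0 ?powR_ge0// invr_ge0 ltW.
exists (c1 + c2); first exact: addr_ge0.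
move=> x xab; have d0 := dist_gt0 xab; have dL := dist_leL xab.
set d := dist x in d0 dL *.
have d9 : 0 < d / 9 by lra.
have [i1 E1] := near_pow d0; have [i2 E2] := far_pow sg0 d9.
have mD := mdl x.
have dom t : `|dl x t * pp (-1 - s) t| <= A * d `^ (- Q) * (chi (t < d) * pp (rho - 1) t) + B * (chi (d / 9 < t) * pp (-1 - sg) t).
  clear E1 E2; rewrite normrM (ger0_norm (pp_ge0 _ _)).
  have n1 : 0 <= A * d `^ (- Q) * (chi (t < d) * pp (rho - 1) t).
    by apply: mulr_ge0; rewrite mulr_ge0 ?powR_ge0 ?chi_ge0 ?pp_ge0.
  have n2 : 0 <= B * (chi (d / 9 < t) * pp (-1 - sg) t).
    by apply: mulr_ge0 => //; rewrite mulr_ge0 ?chi_ge0 ?pp_ge0.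
  have [t0|t0] := leP t 0; first by rewrite [in leLHS](pp_neg _ t0) mulr0 addr_ge0.
  have [td|td] := leP (8 * t) d.
    apply: (@le_trans _ _ (A * d `^ (- Q) * (chi (t < d) * pp (rho - 1) t))); last exact: (ler_wpDr n2 (lexx _)).
    rewrite (chiT (_ : t < d)) ?mul1r; last by lra.
    rewrite !pp_pos//; apply: (le_trans (ler_wpM2r (powR_ge0 _ _) (dl_small _ _ xab t0 td))).
    rewrite -!mulrA; apply: ler_wpM2l => //; rewrite mulrCA; apply: ler_wpM2l; first exact: powR_ge0.
    by rewrite powR_mul// (_ : s + rho + (-1 - s) = rho - 1)//; ring.
  apply: (@le_trans _ _ (B * (chi (d / 9 < t) * pp (-1 - sg) t))); last exact: (ler_wpDl n1 (lexx _)).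
  rewrite (chiT (_ : d / 9 < t)) ?mul1r; last by lra.
  rewrite !pp_pos//; apply: (le_trans (ler_wpM2r (powR_ge0 _ _) (dl_big _ _ xab td))).
  by rewrite -mulrA powR_mul// (_ : m + (-1 - s) = -1 - sg)//; ring.
have j := itgD (itgZ (A * d `^ (- Q)) i1) (itgZ B i2).
have i : itg (fun t => dl x t * pp (-1 - s) t).
  by apply: (itg_le _ dom j); mea.
split; first exact: i.
apply: (le_trans (le_Int (itg_abs i) j dom)).
rewrite (IntD (itgZ _ i1) (itgZ _ i2)) (IntZ _ i1) (IntZ _ i2) E1 E2.
clear E1 E2 i1 i2 j i dom.
rewrite mulrDl; apply: lerD.
  rewrite (_ : A * d `^ (- Q) * _ = c1 * (d `^ (- Q) * d `^ rho)); last by rewrite /c1; ring.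
  by rewrite powR_mul// (_ : - Q + rho = ep - 1)//; ring.
rewrite powRM ?invr_ge0 ?(ltW d0)//.
rewrite (_ : B * _ = B * (sg^-1 * 9^-1 `^ (- sg)) * d `^ (- sg)); last by ring.
rewrite -[leRHS]mulrA; apply: ler_wpM2l.
  by rewrite !mulr_ge0 ?powR_ge0// invr_ge0 ltW.
by apply: pow_cmp => //; move: epsg; lra.
Qed.

(** Below the cut-off eta the second-difference bounds at x and y are added; above it the Hoelder
    continuity of ps controls the difference. The cut-off is left free for [K0_hoelder]. *)
Lemma K0_diff : exists2 C, 0 <= C & forall x y eta, a < x < b -> a < y < b -> 0 < eta ->
  8 * eta <= Num.min (dist x) (dist y) ->
  `|K0 x - K0 y| <= C * (Num.min (dist x) (dist y) `^ (- Q) * eta `^ rho + `|x - y| `^ gm * eta `^ (- s)).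
Proof.
have [A A0 dl_small] := dl_small.
have s0 : 0 < s by rewrite addr_gt0.
have [Ck Ck0 HK] := K0_size.
pose c1 := 2 * A * (rho^-1 * 2 `^ rho); pose c2 := 4 * Ch * s^-1.
have c10 : 0 <= c1 by rewrite /c1 !mulr_ge0 ?powR_ge0// invr_ge0 ltW.
have c20 : 0 <= c2 by rewrite /c2 !mulr_ge0// invr_ge0 ltW.
exists (c1 + c2); first exact: addr_ge0.
move=> x y eta xab yab e0 ed.
have [ix _] := HK x xab; have [iy _] := HK y yab.
have dx0 := dist_gt0 xab; have dy0 := dist_gt0 yab.
have dx : Num.min (dist x) (dist y) <= dist x by rewrite ge_min lexx.
have dy : Num.min (dist x) (dist y) <= dist y by rewrite ge_min lexx orbT.
set d := Num.min _ _ in ed dx dy *.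
have d0 : 0 < d by lra.
have e20 : 0 < 2 * eta by lra.
have [i1 E1] := near_pow e20; have [i2 E2] := far_pow s0 e0.
have mx := mdl x; have my := mdl y.
pose a1 := 2 * A * d `^ (- Q); pose a2 := 4 * Ch * `|x - y| `^ gm.
have a10 : 0 <= a1 by rewrite /a1 !mulr_ge0 ?powR_ge0.
have a20 : 0 <= a2 by rewrite /a2 !mulr_ge0 ?powR_ge0.
have dom t : `|dl x t * pp (-1 - s) t - dl y t * pp (-1 - s) t| <= a1 * (chi (t < 2 * eta) * pp (rho - 1) t) + a2 * (chi (eta < t) * pp (-1 - s) t).
  clear E1 E2; rewrite -mulrBl normrM (ger0_norm (pp_ge0 _ _)).
  have n1 : 0 <= a1 * (chi (t < 2 * eta) * pp (rho - 1) t).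
    by apply: mulr_ge0 => //; rewrite mulr_ge0 ?chi_ge0 ?pp_ge0.
  have n2 : 0 <= a2 * (chi (eta < t) * pp (-1 - s) t).
    by apply: mulr_ge0 => //; rewrite mulr_ge0 ?chi_ge0 ?pp_ge0.
  have [t0|t0] := leP t 0; first by rewrite [in leLHS](pp_neg _ t0) mulr0 addr_ge0.
  have [td|td] := leP t eta.
    apply: (@le_trans _ _ (a1 * (chi (t < 2 * eta) * pp (rho - 1) t))); last by rewrite (_ : chi false = 0)// mul0r mulr0 addr0.
    rewrite (chiT (_ : t < 2 * eta)) ?mul1r; last by lra.
    have tx : 8 * t <= dist x by lra.
    have ty : 8 * t <= dist y by lra.
    have P z : d <= z -> z `^ (- Q) <= d `^ (- Q) by move=> dz; apply: powR_anti => //; have := Q0; lra.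
    have h1 : `|dl x t - dl y t| <= a1 * t `^ (s + rho).
      apply: (le_trans (ler_normB _ _)).
      have := dl_small _ _ xab t0 tx; have := dl_small _ _ yab t0 ty => l1 l2.
      have tp := powR_ge0 t (s + rho).
      apply: (le_trans (lerD l2 l1)); rewrite /a1.
      have := ler_wpM2l tp (P _ dx); have := ler_wpM2l tp (P _ dy) => k1 k2.
      have := lerD (ler_wpM2l A0 k2) (ler_wpM2l A0 k1).
      by move/le_trans; apply; rewrite le_eqVlt; apply/orP; left; apply/eqP; ring.
    rewrite !pp_pos//; apply: (le_trans (ler_wpM2r (powR_ge0 _ _) h1)).
    by rewrite -mulrA powR_mul// (_ : s + rho + (-1 - s) = rho - 1)//; ring.
  apply: (@le_trans _ _ (a2 * (chi true * pp (-1 - s) t))); last exact: (ler_wpDl n1 (lexx _)).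
  rewrite (chiT isT) mul1r; apply: ler_wpM2r; first exact: pp_ge0.
  have h1 := hps x y; have h2 := hps (x - t) (y - t); have h3 := hps (x - 2 * t) (y - 2 * t).
  rewrite (_ : x - t - (y - t) = x - y) in h2; last by ring.
  rewrite (_ : x - 2 * t - (y - 2 * t) = x - y) in h3; last by ring.
  rewrite (_ : dl x t - dl y t = (ps x - ps y) - 2 * (ps (x - t) - ps (y - t)) + (ps (x - 2 * t) - ps (y - 2 * t))); last by rewrite /dl; ring.
  rewrite (_ : a2 = 4 * (Ch * `|x - y| `^ gm)); last by rewrite /a2; ring.
  apply: (le_trans (ler_normD _ _)); have := ler_normB (ps x - ps y) (2 * (ps (x - t) - ps (y - t))).
  rewrite normrM (gtr0_norm (_ : 0 < 2))//.
  clear n1 n2.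
  move: (Ch * _) h1 h2 h3 => q h1 h2 h3; lra.
have j := itgD (itgZ a1 i1) (itgZ a2 i2).
rewrite /K0 -(IntB ix iy); apply: (le_trans (abs_Int_le _ dom j)).
  exact: itg_meas (itgB ix iy).
rewrite (IntD (itgZ _ i1) (itgZ _ i2)) (IntZ _ i1) (IntZ _ i2) E1 E2.
clear E1 E2 i1 i2 j dom ix iy HK.
rewrite powRM ?(ltW e0)//.
have p1 : 0 <= d `^ (- Q) * eta `^ rho by rewrite mulr_ge0 ?powR_ge0.
have p2 : 0 <= `|x - y| `^ gm * eta `^ (- s) by rewrite mulr_ge0 ?powR_ge0.
rewrite (_ : a1 * _ + a2 * _ = c1 * (d `^ (- Q) * eta `^ rho) + c2 * (`|x - y| `^ gm * eta `^ (- s))); last by rewrite /a1 /a2 /c1 /c2; ring.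
have gen (r1 r2 r3 r4 : R) : 0 <= r1 -> 0 <= r2 -> 0 <= r3 -> 0 <= r4 -> r3 * r1 + r4 * r2 <= (r3 + r4) * (r1 + r2).
  by move=> *; nra.
exact: gen.
Qed.

Lemma K0_hoelder : exists C p, [/\ 0 <= C, 0 < p, p <= 1 & forall x y, a < x < b -> a < y < b ->
  `|K0 x - K0 y| <= C * (Num.min (dist x) (dist y) `^ (-2) * `|x - y| `^ p)].
Proof.
have s0 : 0 < s by rewrite addr_gt0.
have [C C0 HC] := K0_diff.
pose L := b - a; have L0 : 0 < L by rewrite subr_gt0.
(* The cut-off will be d (|x - y| / L)^kap / 8. This exponent makes |x - y|^gm eta^(- s) of order |x
   - y|^(gm / 2), while eta^rho still gains |x - y|^(kap rho). All powers of d are then weakened to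
   d^(-2). *)
pose kap := gm / (2 * s).
have kap0 : 0 < kap by rewrite divr_gt0// mulr_gt0.
have ks : kap * s = gm / 2 by rewrite /kap; field; rewrite gt_eqF.
have kr0 : 0 < kap * rho by rewrite mulr_gt0.
pose p := Num.min 1 (Num.min (kap * rho) (gm / 2)).
have p0 : 0 < p by rewrite !lt_min ltr01 kr0 divr_gt0.
have p1 : p <= 1 by rewrite ge_min lexx.
have p2 : p <= kap * rho by rewrite !ge_min lexx orbT.
have p3 : p <= gm / 2 by rewrite !ge_min lexx !orbT.
pose k1 := 8^-1 `^ rho * L^-1 `^ (kap * rho) * (L `^ (ep - 1 - (-2)) * L `^ (kap * rho - p)).
pose k2 := 8^-1 `^ (- s) * L^-1 `^ (- (gm / 2)) * (L `^ (- s - (-2)) * L `^ (gm / 2 - p)).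
have k10 : 0 <= k1 by rewrite /k1 !mulr_ge0 ?powR_ge0.
have k20 : 0 <= k2 by rewrite /k2 !mulr_ge0 ?powR_ge0.
exists (C * (k1 + k2)), p; split => //; first by rewrite mulr_ge0// addr_ge0.
move=> x y xab yab.
have [->|xy] := eqVneq x y.
  by rewrite !subrr normr0 !mulr_ge0 ?powR_ge0// addr_ge0.
have h0 : 0 < `|x - y| by rewrite normr_gt0 subr_eq0.
have hL : `|x - y| <= L by rewrite ler_norml /L; move: xab yab => /andP[x1 x2] /andP[y1 y2]; lra.
have d0 : 0 < Num.min (dist x) (dist y) by rewrite lt_min !dist_gt0.
have dL : Num.min (dist x) (dist y) <= L by rewrite ge_min dist_leL.
have := HC x y _ xab yab; clear HC.
set d := Num.min _ _ in d0 dL *; set h := `|x - y| in h0 hL * => HC.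
have hl : 0 < h * L^-1 by rewrite mulr_gt0// invr_gt0.
have hl1 : h * L^-1 <= 1 by rewrite ler_pdivrMr ?mul1r.
have hk : (h * L^-1) `^ kap <= 1.
  have := @ge0_ler_powR R kap (ltW kap0) (h * L^-1) 1; rewrite powR1; apply => //; rewrite ?nnegrE ?ltW//.
pose eta := d * 8^-1 * (h * L^-1) `^ kap.
have e0 : 0 < eta by rewrite mulr_gt0 ?powR_gt0// mulr_gt0// invr_gt0.
have e8 : 8 * eta <= d.
  rewrite (_ : 8 * eta = d * (h * L^-1) `^ kap); last by rewrite /eta; field.
  by rewrite ler_piMr// ltW.
apply: (le_trans (HC eta e0 e8)); rewrite -mulrA; apply: ler_wpM2l => //.
have Li : 0 <= L^-1 by rewrite invr_ge0 ltW.
have d8 : 0 <= d * 8^-1 by rewrite mulr_ge0 ?invr_ge0// ltW.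
have E1 r : eta `^ r = d `^ r * 8^-1 `^ r * (h `^ (kap * r) * L^-1 `^ (kap * r)).
  by rewrite /eta powRM ?powR_ge0// powRM ?invr_ge0 ?(ltW d0)// -powRrM powRM ?(ltW h0).
rewrite !E1 mulrDl; apply: lerD.
  rewrite (_ : _ * _ = 8^-1 `^ rho * L^-1 `^ (kap * rho) * ((d `^ (- Q) * d `^ rho) * h `^ (kap * rho))); last by ring.
  rewrite powR_mul// (_ : - Q + rho = ep - 1); last by ring.
  rewrite /k1 -[leRHS]mulrA; apply: ler_wpM2l; first by rewrite mulr_ge0 ?powR_ge0.
  have l1 := pow_cmp d0 dL (_ : -2 <= ep - 1).
  have l2 := pow_cmp h0 hL p2.
  have {}l1 := l1 ltac:(move: ep0; lra).
  rewrite (_ : _ * _ * (_ * _) = (L `^ (ep - 1 - -2) * d `^ (-2)) * (L `^ (kap * rho - p) * h `^ p)); last by ring.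
  by apply: ler_pM; rewrite ?powR_ge0.
have -> : kap * - s = - (gm / 2) by rewrite mulrN ks.
rewrite (_ : _ * _ = 8^-1 `^ (- s) * L^-1 `^ (- (gm / 2)) * (d `^ (- s) * (h `^ gm * h `^ (- (gm / 2))))); last by ring.
rewrite powR_mul// (_ : gm - gm / 2 = gm / 2); last by field.
rewrite /k2 -[leRHS]mulrA; apply: ler_wpM2l; first by rewrite mulr_ge0 ?powR_ge0.
have l1 := pow_cmp d0 dL (_ : -2 <= - s).
have l2 := pow_cmp h0 hL p3.
have {}l1 := l1 ltac:(move: s2; lra).
rewrite (_ : _ * _ * (_ * _) = (L `^ (- s - -2) * d `^ (-2)) * (L `^ (gm / 2 - p) * h `^ p)); last by ring.
by apply: ler_pM; rewrite ?powR_ge0.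
Qed.

(** K0 is O(d^(ep - 1)); with weights of exponent 1 - e, where e = ep / 2, the product is O(d^e). It
    thus extends by 0 to the end points, and [hoelder_of_local] absorbs the local loss d^(-2). *)
Lemma K0_Hstar c : Hstar a b (fun x => c * K0 x).
Proof.
have [Ck Ck0 HK] := K0_size.
have [C [p [C0 p0 p1 HC]]] := K0_hoelder.
pose L := b - a; have L0 : 0 < L by rewrite subr_gt0.
pose e := ep / 2.
have e0 : 0 < e by rewrite divr_gt0.
have e1 : e < 1 by rewrite /e; move: epsg sg0; lra.
have ee : 0 <= 1 - e by lra.
have ep1 : ep - 1 <= 0 by move: epsg sg0; lra.
have em2 : -2 <= e - 1 by lra.
have width x y : a < x < b -> a < y < b -> `|x - y| <= L.
  by move=> /andP[? ?] /andP[? ?]; rewrite ler_norml /L; lra.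
have frame x : a < x < b -> [/\ 0 <= x - a, x - a <= L, 0 <= b - x & b - x <= L].
  by move=> /andP[? ?]; rewrite /L; split; lra.
pose W x := (x - a) `^ (1 - e) * (b - x) `^ (1 - e).
pose g x := if a < x < b then c * K0 x * W x else 0.
have mono u v : 0 <= u -> u <= v -> u `^ (1 - e) <= v `^ (1 - e).
  by move=> u0 uv; apply: ge0_ler_powR; rewrite ?nnegrE//; lra.
have W0 x : 0 <= W x by rewrite mulr_ge0 ?powR_ge0.
have Wd x : a < x < b -> W x <= L `^ (1 - e) * dist x `^ (1 - e).
  move=> /andP[x1 x2].
  have [dE|dE] : dist x = x - a \/ dist x = b - x by rewrite /dist /Num.min; case: ifP => _; [left|right].
    rewrite dE /W mulrC; apply: ler_wpM2r; [exact: powR_ge0|apply: mono; rewrite /L; lra].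
  rewrite dE /W; apply: ler_wpM2r; [exact: powR_ge0|apply: mono; rewrite /L; lra].
have Kd x : a < x < b -> `|K0 x| <= Ck * dist x `^ (ep - 1).
  by move=> xab; have [i l] := HK x xab; apply: le_trans l; exact: abs_Int i.
pose C1 := `|c| * Ck * L `^ (1 - e).
have C10 : 0 <= C1 by rewrite /C1 !mulr_ge0 ?powR_ge0.
have g1 x : a <= x <= b -> `|g x| <= C1 * dist x `^ e.
  move=> _; rewrite /g; case: ifP => xab; last by rewrite normr0 mulr_ge0 ?powR_ge0.
  have dx := dist_gt0 xab.
  rewrite (normrM _ (W x)) (normrM c) (ger0_norm (W0 x)) -[leLHS]mulrA.
  rewrite (_ : C1 * dist x `^ e = `|c| * ((Ck * dist x `^ (ep - 1)) * (L `^ (1 - e) * dist x `^ (1 - e)))).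
    by apply: ler_wpM2l => //; apply: ler_pM => //; [exact: Kd|exact: Wd].
  rewrite (_ : e = (ep - 1) + (1 - e)); last by rewrite /e; field.
  rewrite -powR_mul// (_ : 1 - (ep - 1 + (1 - e)) = 1 - e); last by rewrite /e; field.
  by rewrite /C1; ring.
pose C2 := `|c| * (C * (L `^ (1 - e) * L `^ (1 - e)) + Ck * (2 * L `^ (1 - e) * (1 - e)) * (L `^ (e - 1 - (-2)) * L `^ (1 - p))).
have C20 : 0 <= C2.
  by rewrite /C2 mulr_ge0// addr_ge0// !mulr_ge0 ?powR_ge0.
have g2 x y : a < x < b -> a < y < b -> `|g x - g y| <= C2 * (Num.min (dist x) (dist y) `^ (-2) * `|x - y| `^ p).
  move=> xab yab; rewrite /g xab yab.
  have dx0 := dist_gt0 xab; have dy0 := dist_gt0 yab.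
  have d0 : 0 < Num.min (dist x) (dist y) by rewrite lt_min dx0.
  have ddx : Num.min (dist x) (dist y) <= dist x by rewrite ge_min lexx.
  have ddy : Num.min (dist x) (dist y) <= dist y by rewrite ge_min lexx orbT.
  have dL : Num.min (dist x) (dist y) <= L by apply: le_trans ddx _; exact: dist_leL.
  have Hxy := HC x y xab yab.
  have [dx1 dx2] := dist_le a b x; have [dy1 dy2] := dist_le a b y.
  set d := Num.min _ _ in d0 ddx ddy dL Hxy *.
  have [xa0 xaL bx0 bxL] := frame x xab; have [ya0 yaL by0 byL] := frame y yab.
  have hL : `|x - y| <= L by exact: width.
  have Lp := powR_ge0 L (1 - e).
  have WL : W x <= L `^ (1 - e) * L `^ (1 - e).
    by apply: ler_pM; rewrite ?powR_ge0//; exact: mono.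
  have e11 : 1 - e <= 1 by rewrite gerBl ltW.
  have lip u v : d <= u -> d <= v -> `|v `^ (1 - e) - u `^ (1 - e)| <= (1 - e) * d `^ (- e) * `|v - u|.
    move=> du dv; have := powR_lip e11 d0 du dv.
    by rewrite (ger0_norm ee) (_ : 1 - e - 1 = - e)//; ring.
  have Wl : `|W x - W y| <= 2 * L `^ (1 - e) * (1 - e) * (d `^ (- e) * `|x - y|).
    rewrite (_ : W x - W y = ((x - a) `^ (1 - e) - (y - a) `^ (1 - e)) * (b - x) `^ (1 - e) + (y - a) `^ (1 - e) * ((b - x) `^ (1 - e) - (b - y) `^ (1 - e))); last by rewrite /W; ring.
    apply: (le_trans (ler_normD _ _)); rewrite !normrM !(ger0_norm (powR_ge0 _ _)).
    have l1 : `|(x - a) `^ (1 - e) - (y - a) `^ (1 - e)| <= (1 - e) * d `^ (- e) * `|x - y|.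
      by rewrite (_ : x - y = (x - a) - (y - a)); [apply: lip; [exact: le_trans ddy dy1|exact: le_trans ddx dx1]|ring].
    have l2 : `|(b - x) `^ (1 - e) - (b - y) `^ (1 - e)| <= (1 - e) * d `^ (- e) * `|x - y|.
      by rewrite distrC (_ : x - y = (b - y) - (b - x)); [apply: lip; [exact: le_trans ddx dx2|exact: le_trans ddy dy2]|ring].
    have l3 : (b - x) `^ (1 - e) <= L `^ (1 - e) by exact: mono.
    have l4 : (y - a) `^ (1 - e) <= L `^ (1 - e) by exact: mono.
    apply: (le_trans (lerD (ler_pM (normr_ge0 _) (powR_ge0 _ _) l1 l3) (ler_pM (powR_ge0 _ _) (normr_ge0 _) l4 l2))).
    by rewrite le_eqVlt; apply/orP; left; apply/eqP; ring.
  have Ky : `|K0 y| <= Ck * d `^ (ep - 1).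
    by apply: (le_trans (Kd y yab)); apply: ler_wpM2l => //; exact: powR_anti.
  rewrite -(mulrA c (K0 x)) -(mulrA c (K0 y)) -[c * _ - _]mulrBr (_ : K0 x * W x - K0 y * W y = (K0 x - K0 y) * W x + K0 y * (W x - W y)); last by ring.
  rewrite normrM /C2 -[leRHS]mulrA; apply: ler_wpM2l => //.
  apply: (le_trans (ler_normD _ _)); rewrite (normrM _ (W x)) (normrM (K0 y)) (ger0_norm (W0 x)) [leRHS]mulrDl.
  apply: lerD.
    apply: (le_trans (ler_pM (normr_ge0 _) (W0 x) Hxy WL)).
    by rewrite le_eqVlt; apply/orP; left; apply/eqP; ring.
  apply: (le_trans (ler_pM (normr_ge0 _) (normr_ge0 _) Ky Wl)).
  rewrite (_ : Ck * d `^ (ep - 1) * _ = Ck * (2 * L `^ (1 - e) * (1 - e)) * ((d `^ (ep - 1) * d `^ (- e)) * `|x - y|)); last by ring.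
  rewrite -[leRHS]mulrA; apply: ler_wpM2l; first by rewrite !mulr_ge0.
  rewrite powR_mul// (_ : ep - 1 - e = e - 1); last by rewrite /e; field.
  rewrite [leRHS](_ : _ = (L `^ (e - 1 - -2) * d `^ (-2)) * (L `^ (1 - p) * `|x - y| `^ p)); last by ring.
  apply: ler_pM; rewrite ?powR_ge0//; first exact: pow_cmp.
  have [xy|xy] := eqVneq `|x - y| 0; first by rewrite xy mulr_ge0 ?powR_ge0.
  have h0 : 0 < `|x - y| by rewrite lt_def xy normr_ge0.
  by have := pow_cmp h0 hL p1; rewrite powRr1.
have [lam /andP[l0 l1] Hl] := hoelder_of_local hab e0 p0 (ltr0n _ 2) C10 C20 g1 g2.
exists lam, e, e; split; rewrite ?l0 ?l1//.
exists g.
  split => //; rewrite /g; first by rewrite ltxx.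
  by rewrite ltxx andbF.
move=> x xab; rewrite /g xab; move: (xab) => /andP[x1 x2].
by rewrite /W mulfK//; apply: mulf_neq0; rewrite gt_eqF// powR_gt0// subr_gt0.
Qed.

End FracDeriv.

(** * The averaging profile *)

Section Kernel.
Variable R : realType.
Notation mu := (@lebesgue_measure R).
Variable s : R.
Hypotheses (s0 : 0 < s) (s2 : s < 2).

Lemma far_pows (eta : R) : 0 < eta -> itg (fun t => chi (eta < t) * pp (-1 - s) t) /\
  Int (fun t => chi (eta < t) * pp (-1 - s) t) = s^-1 * eta `^ (- s).
Proof.
move=> eta0; have [|i E] := pp_neary (_ : -1 - s < -1) eta0; first by move: s0; lra.
split; first exact: i.
by rewrite E (_ : -1 - s + 1 = - s); [rewrite invrN mulNr opprK|ring].
Qed.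

(** The substitution y = z / t - j turns the product of the two powers into the single power y^(s -
    1), which has an explicit primitive. *)
Lemma trunc_derive z j (t : R) : 0 < t -> 0 < z - j * t -> z != 0 ->
  is_derive t 1 (fun t => - (s * z)^-1 * (z / t - j) `^ s) (pp (-1 - s) t * pp (s - 1) (z - j * t)).
Proof.
move=> t0 zt z0.
have t1 : t != 0 by rewrite gt_eqF.
have y0 : 0 < z / t - j.
  rewrite (_ : z / t - j = (z - j * t) / t); first by rewrite divr_gt0.
  by rewrite mulrBl mulfK.
have D1 : is_derive t 1 (fun t : R => z / t - j) (z * (- t ^- 2)).
  apply: is_derive_eq; first apply: is_deriveB; first apply: is_deriveZ; first exact: is_deriveV.
  by rewrite subr0 /GRing.scale/= mulr1.
have D2 := is_derive1_powR s y0.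
have D3 := @is_derive1_comp _ (fun y => y `^ s) (fun t => z / t - j) t _ _ D2 D1.
apply: (is_derive_eq (is_deriveZ (- (s * z)^-1) D3)).
rewrite /GRing.scale/= !pp_pos//.
have -> : z / t - j = (z - j * t) * t^-1 by rewrite mulrBl mulfK.
have ti : t^-1 = t `^ (-1) by rewrite powR_inv1// ltW.
rewrite powRM ?invr_ge0 ?(ltW zt) ?(ltW t0)//.
have -> : t ^- 2 = t `^ (-2) by rewrite powRN -(powR_mulrn 2 (ltW t0)).
have -> : t^-1 `^ (s - 1) = t `^ (1 - s) by rewrite ti -powRrM; congr (_ `^ _); ring.
have -> : t `^ (-1 - s) = t `^ (1 - s) * t `^ (-2) by rewrite powR_mul//; congr (_ `^ _); ring.
by field; rewrite z0 gt_eqF.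
Qed.

Lemma trunc_int (z j eps : R) : 0 <= j -> 0 < eps ->
  itg (fun t => chi (eps < t) * (pp (-1 - s) t * pp (s - 1) (z - j * t))) /\
  Int (fun t => chi (eps < t) * (pp (-1 - s) t * pp (s - 1) (z - j * t))) = pp s (z - j * eps) * pp (-1) z * (s * eps `^ s)^-1.
Proof.
move=> j0 e0.
(* For z <= j eps both sides vanish, since t > eps makes z - j t nonpositive. *)
have triv : z - j * eps <= 0 -> itg (fun t => chi (eps < t) * (pp (-1 - s) t * pp (s - 1) (z - j * t))) /\
  Int (fun t => chi (eps < t) * (pp (-1 - s) t * pp (s - 1) (z - j * t))) = pp s (z - j * eps) * pp (-1) z * (s * eps `^ s)^-1.
  move=> h; have E t : chi (eps < t) * (pp (-1 - s) t * pp (s - 1) (z - j * t)) = 0.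
    have [et|et] := ltP eps t; last by rewrite /chi/= mul0r.
    rewrite [pp (s - 1) _]pp_neg ?mulr0//.
    have : j * eps <= j * t by rewrite ler_wpM2l// ltW.
    by lra.
  split; first by apply: eq_itg (itg0 R) => t; rewrite E.
  by rewrite (eq_Int E) (Int0 R) (pp_neg _ h) !mul0r.
have [h|h] := leP (z - j * eps) 0; first exact: triv.
have je : 0 <= j * eps by rewrite mulr_ge0// ltW.
have z0 : 0 < z by lra.
have z1 : z != 0 by rewrite gt_eqF.
have em : eps `^ (- s) = (eps `^ s)^-1 by rewrite powRN.
have pz : pp (-1) z = z^-1 by rewrite pp_pos// powR_inv1// ltW.
have ep0 : eps `^ s != 0 by rewrite gt_eqF// powR_gt0.
move: j0; rewrite le_eqVlt => /predU1P[/esym j0|j0].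
  have [i E] := far_pows e0.
  have E2 t : chi (eps < t) * (pp (-1 - s) t * pp (s - 1) (z - j * t)) = z `^ (s - 1) * (chi (eps < t) * pp (-1 - s) t).
    by rewrite j0 mul0r subr0 (pp_pos _ z0); ring.
  split; first by apply: eq_itg (itgZ _ i) => t; rewrite E2.
  rewrite (eq_Int E2) (IntZ _ i) E j0 mul0r subr0 pz (pp_pos _ z0) em.
  have -> : z `^ s = z `^ (s - 1) * z.
    by rewrite -[X in _ = _ * X]powRr1 ?(ltW z0)// powR_mul// subrK.
  by field; rewrite z1 ep0 gt_eqF.
pose B := z / j.
have B0 : 0 < B by rewrite divr_gt0.
have jB : j * B = z by rewrite /B mulrCA mulfV ?mulr1// gt_eqF.
have eB : eps < B by rewrite /B ltr_pdivlMr// mulrC; lra.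
pose F (t : R) := - (s * z)^-1 * (z / t - j) `^ s.
pose f (t : R) := t `^ (-1 - s) * (z - j * t) `^ (s - 1).
have pos t : eps < t < B -> 0 < t /\ 0 < z - j * t.
  move=> /andP[t1 t2]; split; first by lra.
  by rewrite subr_gt0 -jB ltr_pM2l.
have dF t : eps < t < B -> is_derive t 1 F (f t).
  move=> /pos[t1 t2]; have := trunc_derive t1 t2 z1.
  by rewrite !pp_pos.
have cf t : eps < t < B -> {for t, continuous f}.
  move=> /pos[t1 t2].
  apply: cvgM; first exact: continuous_powR.
  apply: (@continuous_comp _ _ _ (fun t => z - j * t) (fun y => y `^ (s - 1))).
    by apply: cvgB; [exact: cvg_cst|apply: cvgM; [exact: cvg_cst|exact: cvg_id]].
  exact: continuous_powR.
have f0 t : eps < t < B -> 0 <= f t by rewrite mulr_ge0 ?powR_ge0.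
have Fe : F t @[t --> eps^'+] --> F eps.
  apply: cvg_at_right_filter.
  have D := trunc_derive e0 h z1.
  by apply: differentiable_continuous; apply/derivable1_diffP; apply: ex_derive.
have FB : F t @[t --> B^'-] --> 0.
  apply/(@cvgrPdist_le _ R) => eta eta0.
  have [d d0 Hd] := @powR_small R `|- (s * z)^-1| s eta (normr_ge0 _) s0 eta0.
  have cB : (z / t - j) @[t --> B] --> z / B - j.
    by apply: cvgB; [apply: cvgM; [exact: cvg_cst|apply: cvgV; [rewrite gt_eqF|exact: cvg_id]]|exact: cvg_cst].
  have zB : z / B - j = 0 by rewrite -jB mulfK ?subrr// gt_eqF.
  have {}cB := cvg_at_left_filter cB.
  near=> t.
  have tB : t < B by near: t; exact: nbhs_left_lt.
  have te : eps < t by near: t; exact: nbhs_left_gt.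
  have t0 : 0 < t by lra.
  have nt : `|z / t - j| < d.
    by rewrite -[z / t - j]subr0 -zB distrC; near: t; apply: cvgr_dist_lt.
  have n0 : 0 <= z / t - j.
    by rewrite subr_ge0 ler_pdivlMr// -jB ler_pM2l// ltW.
  rewrite sub0r normrN /F normrM (ger0_norm (powR_ge0 _ _)); apply: Hd => //.
  by move: nt; rewrite ger0_norm.
have [i E] := FTC_oo eB dF cf f0 Fe FB.
have E2 t : chi (eps < t < B) * f t = chi (eps < t) * (pp (-1 - s) t * pp (s - 1) (z - j * t)).
  have [te|te] := boolP (eps < t); last by rewrite /chi/= !mul0r.
  have [tB|tB] := boolP (t < B).
    have [|t1 t2] := pos t; first by rewrite te tB.
    by rewrite !pp_pos.
  rewrite /chi/= mul0r [pp (s - 1) _]pp_neg ?mulr0//.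
  by rewrite -jB subr_le0 ler_pM2l// leNgt.
split; first exact: eq_itg E2 i.
rewrite -(eq_Int E2) E sub0r /F mulNr opprK pz pp_pos//.
have -> : z / eps - j = (z - j * eps) * eps^-1 by rewrite mulrBl mulfK// gt_eqF.
have ei : eps^-1 = eps `^ (-1) by rewrite powR_inv1// ltW.
rewrite powRM ?invr_ge0 ?(ltW h) ?(ltW e0)//.
have -> : eps^-1 `^ s = (eps `^ s)^-1 by rewrite ei -powRrM mulN1r powRN.
by field; rewrite z1 ep0 gt_eqF.
Unshelve. all: by end_near. Qed.

(* Cutting [K0] at t > eps and integrating it turns ps into s^-1 times its average
   against the dilate of [qf] by eps. *)
Definition qf u : R := (pp s u - 2 * pp s (u - 1) + pp s (u - 2)) * pp (-1) u.

Lemma mqf : measurable_fun setT qf.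
Proof. rewrite /qf; mea. Qed.

Lemma pps_mono x y : x <= y -> pp s x <= pp s y.
Proof.
move=> xy; rewrite /pp; case: ifP => x0; last by case: ifP => // _; exact: powR_ge0.
by rewrite (lt_le_trans x0 xy); apply: ge0_ler_powR; rewrite ?nnegrE; move: s0; lra.
Qed.

(** Near 0 the profile is u^(s - 1), integrable as s > 0; at infinity the second difference is
    O(u^(s - 2)), and the factor 1/u makes the profile integrable as s < 2. *)
Lemma qf_itg : itg qf.
Proof.
have e1 : -1 < s - 1 by move: s0; lra.
have e3 : s - 3 < -1 by move: s2; lra.
have [i1 _] := pp_near0 e1 (ltr0n _ 5).
have [i2 _] := pp_neary e3 ltr01.
have [c c0 Hc] : exists2 c, 0 <= c & forall u, 4 < u -> `|u `^ s - 2 * (u - 1) `^ s + (u - 2) `^ s| <= c * u `^ (s - 2).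
  exists (`|s * (s - 1)| * 2^-1 `^ (s - 2)); first by rewrite mulr_ge0 ?powR_ge0.
  move=> u u4; have u2 : 0 < u / 2 by lra.
  have ss : s <= 2 by move: s2; lra.
  have h1 : u / 2 <= u - 1 - 1 by lra.
  have := powR_diff2_le ss (@ler01 R) u2 h1.
  rewrite subrK (_ : u - 1 - 1 = u - 2); last by ring.
  rewrite expr1n mulr1 powRM ?invr_ge0//; last by lra.
  by rewrite (_ : u `^ s + _ - _ = u `^ s - 2 * (u - 1) `^ s + (u - 2) `^ s) 1?[u `^ (s - 2) * _]mulrC ?mulrA//; ring.
apply: (itg_le mqf _ (itgD (itgZ 4 i1) (itgZ c i2))) => u.
rewrite /qf normrM (ger0_norm (pp_ge0 _ _)).
have [u0|u0] := leP u 0.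
  by rewrite [in leLHS](pp_neg (-1) u0) mulr0 addr_ge0 ?mulr_ge0 ?chi_ge0 ?pp_ge0.
have pu e : pp e u = u `^ e by rewrite pp_pos.
have [u4|u4] := leP u 4.
  rewrite -[leLHS]addr0; apply: lerD; last by rewrite !mulr_ge0 ?chi_ge0 ?pp_ge0.
  rewrite (chiT (_ : u < 5)) ?mul1r; last by lra.
  have h1 := @pps_mono (u - 1) u; have h2 := @pps_mono (u - 2) u.
  have {}h1 := h1 ltac:(lra); have {}h2 := h2 ltac:(lra).
  have p1 := pp_ge0 s (u - 1); have p2 := pp_ge0 s (u - 2); have p0 := pp_ge0 s u.
  have l : `|pp s u - 2 * pp s (u - 1) + pp s (u - 2)| <= 4 * u `^ s.
    by rewrite -pu ler_norml; apply/andP; split; lra.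
  have Pm : u `^ s * pp (-1) u = pp (s - 1) u by rewrite !pu powR_mul.
  by rewrite -Pm mulrA; exact: (ler_wpM2r (pp_ge0 (-1) u) l).
rewrite -[leLHS]add0r; apply: lerD; first by rewrite !mulr_ge0 ?chi_ge0 ?pp_ge0.
rewrite (chiT (_ : 1 < u)) ?mul1r; last by lra.
rewrite (@pp_pos R s (u - 1)); last by lra.
rewrite (@pp_pos R s (u - 2)); last by lra.
rewrite !pu; have := ler_wpM2r (powR_ge0 u (-1)) (Hc u u4).
by rewrite -mulrA powR_mul// (_ : s - 2 + -1 = s - 3)//; ring.
Qed.

(** For s >= 1 the profile is nonnegative because u_+^s is convex. For s < 1 it takes both signs,
    and its integral is (2 - 2^s) times that of the nonnegative first-difference profile p. *)
Lemma qf_gt0 : 0 < Int qf.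
Proof.
have half (h : R -> R) : itg h -> (forall u, 0 <= h u) -> (forall u, 2^-1 < u < 1 -> h u = u `^ (s - 1)) -> 0 < Int h.
  move=> ih h0 hu; apply: (@Int_gt0 R h (2^-1) 1 (Num.min (2^-1 `^ (s - 1)) 1)) => //.
  - exact: aeW.
  - by rewrite invf_lt1// ltr1n.
  - apply: aeW => u /[dup] u1 /hu ->; move: u1 => /andP[u1 u2].
    have u0 : 0 < u by apply: lt_trans u1; rewrite invr_gt0.
    have [s1|s1] := leP 1 s.
      rewrite ge_min; apply/orP; left; apply: ge0_ler_powR; rewrite ?nnegrE ?subr_ge0 ?(ltW u1) ?(ltW u0)//.
    rewrite ge_min; apply/orP; right.
    by have := @powR_anti R (s - 1) u 1; rewrite powR1; apply; lra.
have [s1|s1] := leP 1 s.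
  apply: half; first exact: qf_itg.
  - move=> u; rewrite /qf mulr_ge0 ?pp_ge0//.
    have [u0|u0] := leP u 1.
      by rewrite (@pp_neg _ _ (u - 1)) ?(@pp_neg _ _ (u - 2)) ?mulr0 ?subr0 ?addr0 ?pp_ge0//; lra.
    rewrite (@pp_pos _ _ u) ?(@pp_pos _ _ (u - 1)); [|lra|lra].
    have [u2|u2] := leP u 2.
      rewrite (@pp_neg _ _ (u - 2)) ?addr0; last by lra.
      rewrite subr_ge0; apply: (@le_trans _ _ ((2 * (u - 1)) `^ s)); last first.
        by apply: ge0_ler_powR; rewrite ?nnegrE; lra.
      rewrite powRM ?ler0n//; last by lra.
      apply: ler_wpM2r; first exact: powR_ge0.
      by rewrite -[leLHS]powRr1// ler_powR// ler1n.
    have h1 : 1 < u - 1 by lra.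
    have [t /andP[t1 t2]] := powR_diff2 s ltr01 h1.
    rewrite subrK (_ : u - 1 - 1 = u - 2); last by ring.
    rewrite pp_pos; last by lra.
    move=> E; rewrite (_ : _ - _ + _ = u `^ s + (u - 2) `^ s - 2 * (u - 1) `^ s); last by ring.
    rewrite E expr1n mulr1 mulr_ge0 ?powR_ge0// mulr_ge0//; lra.
  - move=> u /andP[u1 u2].
    have u0 : 0 < u by apply: lt_trans u1; rewrite invr_gt0.
    rewrite /qf (@pp_neg _ _ (u - 1)) ?(@pp_neg _ _ (u - 2)); [|lra|lra].
    by rewrite mulr0 subr0 addr0 !pp_pos// powR_mul.
pose p u : R := (pp s u - pp s (u - 1)) * pp (-1) u.
have ip : itg p.
  have e1 : -1 < s - 1 by move: s0; lra.
  have e3 : s - 2 < -1 by lra.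
  have [i1 _] := pp_near0 e1 (ltr0n _ 3).
  have [i2 _] := pp_neary e3 ltr01.
  pose c := `|s| * 2^-1 `^ (s - 1).
  apply: (itg_le _ _ (itgD i1 (itgZ c i2))); first by rewrite /p; mea.
  move=> u; rewrite /p normrM (ger0_norm (pp_ge0 _ _)).
  have c0 : 0 <= c by rewrite mulr_ge0 ?powR_ge0.
  have [u0|u0] := leP u 0.
    by rewrite [in leLHS](pp_neg (-1) u0) mulr0 addr_ge0 ?(mulr_ge0 c0) ?mulr_ge0 ?chi_ge0 ?pp_ge0.
  have pu e : pp e u = u `^ e by rewrite pp_pos.
  have [u4|u4] := leP u 2.
    rewrite -[leLHS]addr0; apply: lerD; last by rewrite (mulr_ge0 c0) ?mulr_ge0 ?chi_ge0 ?pp_ge0.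
    rewrite (chiT (_ : u < 3)) ?mul1r; last by lra.
    have h1 := @pps_mono (u - 1) u; have {}h1 := h1 ltac:(lra).
    have p1 := pp_ge0 s (u - 1).
    have l : `|pp s u - pp s (u - 1)| <= u `^ s.
      by rewrite -pu ler_norml; apply/andP; split; lra.
    have Pm : u `^ s * pp (-1) u = pp (s - 1) u by rewrite !pu powR_mul.
    by rewrite -Pm; exact: (ler_wpM2r (pp_ge0 (-1) u) l).
  rewrite -[leLHS]add0r; apply: lerD; first by rewrite !mulr_ge0 ?chi_ge0 ?pp_ge0.
  rewrite (chiT (_ : 1 < u)) ?mul1r; last by lra.
  rewrite (@pp_pos R s (u - 1)); last by lra.
  have u2 : 0 < u / 2 by lra.
  have := @powR_lip R s (u / 2) (u - 1) u (ltW s1) u2.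
  rewrite (_ : u - (u - 1) = 1) ?normr1 ?mulr1; last by ring.
  move=> /(_ ltac:(lra) ltac:(lra)) l.
  rewrite !pu; have := ler_wpM2r (powR_ge0 u (-1)) l.
  rewrite powRM ?invr_ge0 ?(ltW u0)// (_ : _ * _ * u `^ (-1) = c * (u `^ (s - 1) * u `^ (-1))); last by rewrite /c; ring.
  by rewrite powR_mul// (_ : s - 1 + -1 = s - 2)//; ring.
have p0 u : 0 <= p u by rewrite mulr_ge0 ?pp_ge0// subr_ge0 pps_mono//; lra.
have pint : 0 < Int p.
  apply: half => // u /andP[u1 u2].
  have u0 : 0 < u by apply: lt_trans u1; rewrite invr_gt0.
  rewrite /p (@pp_neg _ _ (u - 1)) ?subr0; last by lra.
  by rewrite !pp_pos// powR_mul.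
have h2 : 0 < 2^-1 :> R by rewrite invr_gt0.
(* The second difference is twice the first difference of step 1 minus the one of step 2, and the
   latter is a dilate of the former. *)
have E u : qf u = 2 * p u - 2 `^ (s - 1) * p (2^-1 * u).
  have [u0|u0] := leP u 0.
    by rewrite /qf /p (pp_neg (-1) u0) (@pp_neg _ (-1) (2^-1 * u)) ?mulr0 ?subr0//; lra.
  have e2 : pp s (u - 2) = 2 `^ s * pp s (2^-1 * u - 1).
    by rewrite -ppZ//; congr pp; field.
  have e1 : pp s u = 2 `^ s * pp s (2^-1 * u) by rewrite -ppZ//; congr pp; field.
  have e3 : pp (-1) (2^-1 * u) = 2 * pp (-1) u.
    by rewrite ppZ// powR_inv1 ?invrK// ltW.
  have e4 : 2 `^ s = 2 * 2 `^ (s - 1) :> R.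
    by rewrite -{2}[2]powRr1// powR_mul//; congr (_ `^ _); ring.
  rewrite /qf /p e3 e2.
  rewrite (_ : _ - _ + _ = 2 * (pp s u - pp s (u - 1)) - pp s u + 2 `^ s * pp s (2^-1 * u - 1)); last by ring.
  by rewrite [X in _ - X + _]e1 e4; ring.
have j := itg_scale h2 ip.
rewrite (eq_Int E) (IntB (itgZ _ ip) (itgZ _ j)) (IntZ _ ip) (IntZ _ j) (Int_scale h2 ip) invrK mulrA -mulrBl.
apply: mulr_gt0 => //; rewrite subr_gt0 -{2}[2]powRr1// powR_mul// subrK.
have g1 : 1 < 2 `^ (1 - s) :> R.
  have := @gt0_ltr_powR R (1 - s) _ 1 2; rewrite powR1; apply; rewrite ?nnegrE ?ltr1n//; lra.
have p2 : 0 < 2 `^ s :> R by rewrite powR_gt0.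
by rewrite -{2}[2]powRr1// -[X in _ < _ `^ X](subrK s 1) -powR_mul// ltr_pMl.
Qed.

End Kernel.

(** * Inversion by the left integral *)

Section Inversion.
Variable R : realType.
Notation mu := (@lebesgue_measure R).
Variables (a b s S ep Ck : R) (ps : R -> R).
Hypotheses (s0 : 0 < s) (s2 : s < 2) (hab : a < b) (S0 : 0 <= S) (ep0 : 0 < ep) (ep1 : ep < 1) (Ck0 : 0 <= Ck).
Hypotheses (cps : continuous ps) (psS : forall y, `|ps y| <= S * chi (a < y < b)).
Hypothesis HK : forall t, a < t < b -> itg (fun tau => dl ps t tau * pp (-1 - s) tau) /\
  Int (fun tau => `|dl ps t tau * pp (-1 - s) tau|) <= Ck * dist a b t `^ (ep - 1).

Lemma measurable_ps_cont : measurable_fun setT ps. Proof. exact: continuous_measurable_fun. Qed.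

Lemma ps_le y : `|ps y| <= S.
Proof. by apply: (le_trans (psS y)); rewrite ler_piMr// chi_le1. Qed.

Lemma ps_left y : y <= a -> ps y = 0.
Proof. by move=> ya; apply: (off_zero psS); rewrite negb_and -leNgt ya. Qed.

Lemma Int_pp_left y : itg (fun r => pp (s - 1) (y - r) * chi (a < r)) /\
  Int (fun r => pp (s - 1) (y - r) * chi (a < r)) = s^-1 * pp s (y - a).
Proof.
have [ya|ya] := leP (y - a) 0.
  have E r : pp (s - 1) (y - r) * chi (a < r) = 0.
    by have [ar|ar] := ltP a r; [rewrite pp_neg ?mul0r//; lra|rewrite /chi/= mulr0].
  split; first by apply: eq_itg (itg0 R) => r; rewrite E.
  by rewrite (eq_Int E) (Int0 R) (pp_neg _ ya) mulr0.
have e1 : -1 < s - 1 by move: s0; lra.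
have [i Ei] := pp_near0 e1 ya.
have E r : chi (y - r < y - a) * pp (s - 1) (y - r) = pp (s - 1) (y - r) * chi (a < r).
  by rewrite mulrC ltrD2l ltrN2.
split; first exact: eq_itg E (itg_refl y i).
by rewrite -(eq_Int E) (Int_refl y i) Ei subrK pp_pos.
Qed.

(** The truncation at eps makes the three terms of [dl] separately integrable; this is the term with
    argument t - j tau. *)
Definition Tj j eps t : R := Int (fun tau => chi (eps < tau) * (pp (-1 - s) tau * ps (t - j * tau))).

Lemma Tj_itg (j eps t : R) : 0 < eps -> itg (fun tau => chi (eps < tau) * (pp (-1 - s) tau * ps (t - j * tau))).
Proof.
move=> e0; have [i _] := far_pows s0 e0; have mp := measurable_ps_cont.
apply: (itg_le _ _ (itgZ S i)); first by mea.
move=> tau; rewrite mulrA normrM (ger0_norm (mulr_ge0 (chi_ge0 _ _) (pp_ge0 _ _))) mulrC.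
by apply: ler_wpM2r; [rewrite mulr_ge0 ?chi_ge0 ?pp_ge0|exact: ps_le].
Qed.

Definition Vj x j eps r : R := ps r * (pp s (x - r - j * eps) * pp (-1) (x - r) * (s * eps `^ s)^-1).

(** Fubini brings the t-integral inside, the translation r = t - j tau moves the shift from ps to
    the kernel, and a second Fubini leaves the tau-integral of [trunc_int] with z = x - r. As j tau
    >= 0, the inner integrals are bounded uniformly in tau. *)
Lemma Int_Tj x (j eps : R) : 0 <= j -> 0 < eps ->
  [/\ itg (fun t => pp (s - 1) (x - t) * Tj j eps t), itg (Vj x j eps) &
   Int (fun t => pp (s - 1) (x - t) * Tj j eps t) = Int (Vj x j eps)].
Proof.
move=> j0 e0; have mp := measurable_ps_cont; have [i Ei] := far_pows s0 e0.
have [w [w0 Ew iw Iw mw] wneg] : exists2 w : R -> R, [/\ forall tau, 0 <= w tau,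
    forall tau, w tau = chi (eps < tau) * pp (-1 - s) tau, itg w, Int w = s^-1 * eps `^ (- s) & measurable_fun setT w]
    & forall tau, tau <= 0 -> w tau = 0.
  exists (fun tau => chi (eps < tau) * pp (-1 - s) tau).
    by split => //; [move=> tau; rewrite mulr_ge0 ?chi_ge0 ?pp_ge0|mea].
  by move=> tau t0; rewrite pp_neg ?mulr0.
have [H EH] : exists H : R -> R -> R, forall t tau, H t tau = w tau * (pp (s - 1) (x - t) * ps (t - j * tau)) by exists (fun t tau => w tau * (pp (s - 1) (x - t) * ps (t - j * tau))).
have [p1 _] := Int_pp_left x.
have iH t : itg (H t) /\ Int (fun tau => `|H t tau|) <= S * (s^-1 * eps `^ (- s)) * (pp (s - 1) (x - t) * chi (a < t)).
  have dom tau : `|H t tau| <= S * (pp (s - 1) (x - t) * chi (a < t)) * w tau.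
    rewrite EH (normrM (w tau)) (ger0_norm (w0 tau)) mulrC.
    have [t0|t0] := leP tau 0; first by rewrite wneg ?mulr0.
    apply: ler_wpM2r => //.
    rewrite (normrM (pp _ _)) (ger0_norm (pp_ge0 _ _)) mulrCA; apply: ler_wpM2l; first exact: pp_ge0.
    have [ta|ta] := ltP a t; first by rewrite (chiT isT) mulr1; exact: ps_le.
    rewrite ps_left ?normr0 ?mulr_ge0 ?chi_ge0//.
    have : 0 <= j * tau by rewrite mulr_ge0// ltW.
    by lra.
  have iHt : itg (H t).
    apply: (itg_le _ dom (itgZ _ iw)).
    rewrite (_ : H t = fun tau => w tau * (pp (s - 1) (x - t) * ps (t - j * tau))); last by apply/funext => tau; rewrite EH.
    by mea.
  split; first exact: iHt.
  apply: (le_trans (le_Int (itg_abs iHt) (itgZ _ iw) dom)); rewrite (IntZ _ iw) Iw.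
  by rewrite le_eqVlt; apply/orP; left; apply/eqP; ring.
have [|||j1 _ _ j4] := @Int_fubini R H (fun t => S * (s^-1 * eps `^ (- s)) * (pp (s - 1) (x - t) * chi (a < t))).
- rewrite (_ : (fun z : R * R => H z.1 z.2) = fun z => w z.2 * (pp (s - 1) (x - z.1) * ps (z.1 - j * z.2))); last by apply/funext => z; rewrite EH.
  by mea.
- by apply: aeW => t; exact: iH.
- exact: itgZ.
have E1 t : Int (H t) = pp (s - 1) (x - t) * Tj j eps t.
  rewrite /Tj -(IntZ _ (Tj_itg j t e0)); apply: eq_Int => tau; rewrite EH Ew; ring.
have I2 tau : 0 <= j * tau -> itg (fun r => pp (s - 1) (x - j * tau - r) * ps r) /\
   Int (fun r => `|pp (s - 1) (x - j * tau - r) * ps r|) <= S * (s^-1 * pp s (x - a)).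
  move=> jt; have [q1 q2] := Int_pp_left (x - j * tau).
  have dom r : `|pp (s - 1) (x - j * tau - r) * ps r| <= S * (pp (s - 1) (x - j * tau - r) * chi (a < r)).
    rewrite (normrM (pp _ _)) (ger0_norm (pp_ge0 _ _)) mulrCA; apply: ler_wpM2l; first exact: pp_ge0.
    have [ta|ta] := ltP a r; first by rewrite (chiT isT) mulr1; exact: ps_le.
    by rewrite ps_left ?normr0 ?mulr_ge0 ?chi_ge0.
  have ii : itg (fun r => pp (s - 1) (x - j * tau - r) * ps r).
    by apply: (itg_le _ dom (itgZ _ q1)); mea.
  split; first exact: ii.
  apply: (le_trans (le_Int (itg_abs ii) (itgZ _ q1) dom)); rewrite (IntZ _ q1) q2.
  apply: ler_wpM2l => //; apply: ler_wpM2l; first by rewrite invr_ge0 ltW.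
  by apply: pps_mono => //; lra.
have jw tau : w tau != 0 -> 0 <= j * tau.
  by move=> wt; rewrite mulr_ge0// leNgt; apply/negP => /ltW /wneg h; rewrite h eqxx in wt.
have [H2 EH2] : exists H2 : R -> R -> R, forall tau r, H2 tau r = w tau * (pp (s - 1) (x - j * tau - r) * ps r) by exists (fun tau r => w tau * (pp (s - 1) (x - j * tau - r) * ps r)).
have [|||k1 k2 k3 k4] := @Int_fubini R H2 (fun tau => S * (s^-1 * pp s (x - a)) * w tau).
- rewrite (_ : (fun z : R * R => H2 z.1 z.2) = fun z => w z.1 * (pp (s - 1) (x - j * z.1 - z.2) * ps z.2)); last by apply/funext => z; rewrite EH2.
  by mea.
- apply: aeW => tau; have [wt|wt] := eqVneq (w tau) 0.
    rewrite wt mulr0; have E r : H2 tau r = 0 by rewrite EH2 wt mul0r.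
    split; first by apply: eq_itg (itg0 R) => r; rewrite E.
    by rewrite (@eq_Int _ _ (fun=> 0)) ?(Int0 R)// => r; rewrite E normr0.
  have [q1 q2] := I2 tau (jw _ wt).
  split; first by apply: eq_itg (itgZ (w tau) q1) => r; rewrite EH2.
  rewrite (@eq_Int _ _ (fun r => w tau * `|pp (s - 1) (x - j * tau - r) * ps r|)); last first.
    by move=> r; rewrite EH2 (normrM (w tau)) (ger0_norm (w0 tau)).
  by rewrite (IntZ _ (itg_abs q1)) mulrC; apply: ler_wpM2r.
- exact: itgZ.
have E2 tau : Int (H^~ tau) = Int (H2 tau).
  have [wt|wt] := eqVneq (w tau) 0.
    by apply: eq_Int => t; rewrite EH EH2 wt !mul0r.
  have [q1 _] := I2 tau (jw _ wt).
  have q3 := itg_shift (- (j * tau)) q1.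
  rewrite (@eq_Int _ (H^~ tau) (fun t => w tau * (pp (s - 1) (x - j * tau - (t - j * tau)) * ps (t - j * tau)))); last first.
    by move=> t; rewrite EH; congr (_ * (pp _ _ * _)); ring.
  rewrite (IntZ _ q3) (Int_shift (- (j * tau)) q1) -(IntZ _ q1).
  by apply: eq_Int => r; rewrite EH2.
have E3 r : Int (H2^~ r) = Vj x j eps r.
  have [t1 t2] := trunc_int s0 (x - r) j0 e0.
  rewrite /Vj -t2 -(IntZ _ t1); apply: eq_Int => tau; rewrite EH2 Ew.
  by rewrite (_ : x - j * tau - r = x - r - j * tau); ring.
split.
- by apply: eq_itg j1.
- by apply: eq_itg k2.
- rewrite -(eq_Int E1) j4 (eq_Int E2) k4; exact: eq_Int.
Qed.

Definition Keps eps t : R := Int (fun tau => chi (eps < tau) * (pp (-1 - s) tau * dl ps t tau)).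

Lemma KepsE eps t : 0 < eps -> Keps eps t = Tj 0 eps t - 2 * Tj 1 eps t + Tj 2 eps t.
Proof.
move=> e0; have i0 := Tj_itg 0 t e0; have i1 := Tj_itg 1 t e0; have i2 := Tj_itg 2 t e0.
rewrite /Tj -(IntZ _ i1) -(IntB i0 (itgZ _ i1)) -(IntD (itgB i0 (itgZ _ i1)) i2).
by apply: eq_Int => tau; rewrite /dl mul0r mul1r subr0; ring.
Qed.

(** The substitution r = x - eps u in the three densities [Vj]; all powers of eps cancel, and the
    profile [qf] appears. *)
Lemma Int_Keps x eps : 0 < eps -> itg (fun t => pp (s - 1) (x - t) * Keps eps t) /\
  Int (fun t => pp (s - 1) (x - t) * Keps eps t) = s^-1 * Int (fun u => qf s u * ps (x - eps * u)).
Proof.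
move=> e0; have [a0 b0 c0] := Int_Tj x (lexx 0) e0.
have [a1 b1 c1] := Int_Tj x ler01 e0; have [a2 b2 c2] := Int_Tj x (ler0n _ 2) e0.
have E t : pp (s - 1) (x - t) * Tj 0 eps t - 2 * (pp (s - 1) (x - t) * Tj 1 eps t) + pp (s - 1) (x - t) * Tj 2 eps t = pp (s - 1) (x - t) * Keps eps t.
  by rewrite KepsE//; move: (Tj _ _ _) (Tj _ _ _) (Tj _ _ _) => q1 q2 q3; ring.
have j1 := itgB a0 (itgZ 2 a1).
split; first exact: eq_itg E (itgD j1 a2).
rewrite -(eq_Int E) (IntD j1 a2) (IntB a0 (itgZ 2 a1)) (IntZ _ a1) c0 c1 c2.
rewrite -(IntZ _ b1) -(IntB b0 (itgZ _ b1)) -(IntD (itgB b0 (itgZ _ b1)) b2).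
have iV := itgD (itgB b0 (itgZ 2 b1)) b2.
have iV2 := itg_refl x iV.
clear E c0 c1 c2 a0 a1 a2 j1.
rewrite -(Int_refl x iV).
have := Int_scale e0 iV2 => /(congr1 (fun y => eps * y)); rewrite mulVKf ?gt_eqF// => <-.
have sc := itg_scale e0 iV2.
rewrite -(IntZ _ sc) -IntZ.
  apply: eq_Int => u; rewrite /Vj opprB addrCA subrr addr0.
  have P j : pp s (eps * u - j * eps) = eps `^ s * pp s (u - j) by rewrite -ppZ//; congr pp; ring.
  rewrite !P (ppZ _ _ e0) powR_inv1 ?(ltW e0)// subr0 /qf.
  have ee : eps `^ s != 0 by rewrite gt_eqF// powR_gt0.
  by field; rewrite ee !gt_eqF.
have iq := qf_itg s0 s2; have mp := measurable_ps_cont; have mq := mqf s.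
apply: (itg_le _ _ (itgZ S (itg_abs iq))); first by mea.
by move=> u; rewrite normrM mulrC; apply: ler_wpM2r => //; exact: ps_le.
Qed.

(** A Beta integrand: on either side of the midpoint of ]a, x[ one of the two factors is bounded. *)
Lemma beta_itg x : a < x -> itg (fun t => pp (s - 1) (x - t) * pp (ep - 1) (t - a)).
Proof.
move=> ax; pose c := (x - a) / 2; have c0 : 0 < c by rewrite /c; lra.
have c20 : 0 < 2 * c by lra.
have e1 : -1 < s - 1 by move: s0; lra.
have e2 : -1 < ep - 1 by move: ep0; lra.
have [i1 _] := pp_near0 e2 c20; have [i2 _] := pp_near0 e1 c20.
have j1 := itg_shift (- a) i1; have j2 := itg_refl x i2.
pose A1 := c `^ (s - 1) + (2 * c) `^ (s - 1).
have A10 : 0 <= A1 by rewrite addr_ge0 ?powR_ge0.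
have A20 : 0 <= c `^ (ep - 1) by exact: powR_ge0.
apply: (itg_le _ _ (itgD (itgZ A1 j1) (itgZ (c `^ (ep - 1)) j2))); first by mea.
move=> t; have q1 := pp_ge0 (s - 1) (x - t); have q2 := pp_ge0 (ep - 1) (t - a).
rewrite ger0_norm ?mulr_ge0//.
have n1 : 0 <= A1 * (chi (t - a < 2 * c) * pp (ep - 1) (t - a)).
  by apply: mulr_ge0 => //; rewrite mulr_ge0 ?chi_ge0.
have n2 : 0 <= c `^ (ep - 1) * (chi (x - t < 2 * c) * pp (s - 1) (x - t)).
  by apply: mulr_ge0 => //; rewrite mulr_ge0 ?chi_ge0.
have [ta|ta] := leP (t - a) 0; first by rewrite [in leLHS](pp_neg _ ta) mulr0 addr_ge0.
have [tx|tx] := leP (x - t) 0; first by rewrite [in leLHS](pp_neg _ tx) mul0r addr_ge0.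
have x2 : x - a = 2 * c by rewrite /c; field.
have [tc|tc] := leP (t - a) c.
  rewrite -[leLHS]addr0; apply: lerD => //.
  rewrite (chiT (_ : t - a < 2 * c)) ?mul1r; last by lra.
  apply: ler_wpM2r => //; rewrite pp_pos// /A1.
  have [s1|s1] := leP (s - 1) 0.
    rewrite -[leLHS]addr0; apply: lerD; last exact: powR_ge0.
    by apply: powR_anti => //; lra.
  rewrite -[leLHS]add0r; apply: lerD; first exact: powR_ge0.
  by apply: ge0_ler_powR; rewrite ?nnegrE; lra.
rewrite -[leLHS]add0r; apply: lerD => //.
rewrite (chiT (_ : x - t < 2 * c)) ?mul1r; last by lra.
rewrite mulrC; apply: ler_wpM2r => //; rewrite pp_pos//.
by apply: powR_anti; move: ep1; lra.
Qed.

Definition Kz t : R := Int (fun tau => dl ps t tau * pp (-1 - s) tau).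

Lemma dl_left t tau : t <= a -> 0 <= tau -> dl ps t tau = 0.
Proof. by move=> ta t0; rewrite /dl !ps_left ?mulr0 ?subr0 ?addr0//; lra. Qed.

Lemma Keps_left eps t : 0 < eps -> t <= a -> Keps eps t = 0.
Proof.
move=> e0 ta; rewrite /Keps -[RHS](Int0 R); apply: eq_Int => tau.
have [et|et] := ltP eps tau; last by rewrite /chi/= mul0r.
by rewrite dl_left ?mulr0//; lra.
Qed.

Lemma Keps_dom (eps t : R) : a < t < b ->
  [/\ measurable_fun setT (fun tau : R => chi (eps < tau) * (pp (-1 - s) tau * dl ps t tau)),
   forall tau : R, `|chi (eps < tau) * (pp (-1 - s) tau * dl ps t tau)| <= `|dl ps t tau * pp (-1 - s) tau| &
   `|Keps eps t| <= Ck * dist a b t `^ (ep - 1)].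
Proof.
move=> tab; have [i l] := HK tab; have mi := itg_meas i.
have mm : measurable_fun setT (fun tau : R => chi (eps < tau) * (pp (-1 - s) tau * dl ps t tau)).
  rewrite (_ : (fun tau => chi (eps < tau) * (pp (-1 - s) tau * dl ps t tau)) = (fun tau => chi (eps < tau) * (fun tau => dl ps t tau * pp (-1 - s) tau) tau)).
    apply: measurable_funM; first by mea.
    exact: mi.
  by apply/funext => tau; rewrite [dl _ _ _ * _]mulrC.
have dom tau : `|chi (eps < tau) * (pp (-1 - s) tau * dl ps t tau)| <= `|dl ps t tau * pp (-1 - s) tau|.
  by rewrite (normrM (chi _)) [pp _ _ * _]mulrC ler_piMl// ger0_norm ?chi_ge0 ?chi_le1.
split; [exact: mm|exact: dom|].
by apply: le_trans l; exact: abs_Int_le mm dom (itg_abs i).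
Qed.

Let en (n : nat) : R := n.+1%:R^-1.

Lemma en_gt0 n : 0 < en n. Proof. by rewrite invr_gt0. Qed.
Lemma en_cvg : en @ \oo --> 0. Proof. exact: cvg_harmonic. Qed.

Lemma Keps_cvg t : a < t < b -> Keps (en n) t @[n --> \oo] --> Kz t.
Proof.
move=> tab; have [i _] := HK tab.
have [|||||_ c] := @Int_dominated R (fun n tau => chi (en n < tau) * (pp (-1 - s) tau * dl ps t tau)) (fun tau => dl ps t tau * pp (-1 - s) tau) (fun tau => `|dl ps t tau * pp (-1 - s) tau|).
- by move=> n; have [] := Keps_dom (en n) tab.
- exact: itg_meas i.
- apply: aeW => tau; have [t0|t0] := leP tau 0.
    rewrite (pp_neg _ t0) mulr0; under eq_cvg do rewrite mul0r mulr0; exact: cvg_cst.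
  apply: cvg_near_cst; near=> n.
  have et : en n < tau by near: n; apply: (@cvgr_lt _ _ _ _ _ _ en_cvg).
  by rewrite (chiT et) mul1r mulrC.
- exact: itg_abs.
- by move=> n tau; have [] := Keps_dom (en n) tab.
- exact: c.
Unshelve. all: by end_near. Qed.

(** Both sides of [Int_Keps] pass to the limit by dominated convergence: on the left with the bound
    of order d^(ep - 1) for the truncated integrals, uniform in eps; on the right because ps is
    continuous and [qf] is integrable. *)
Lemma inversion x : a < x < b -> itg (fun t => pp (s - 1) (x - t) * (chi (a < t) * Kz t)) /\
  Int (fun t => pp (s - 1) (x - t) * (chi (a < t) * Kz t)) = s^-1 * (Int (qf s) * ps x).
Proof.
move=> xab; have mp := measurable_ps_cont; have iq := qf_itg s0 s2; have mq := mqf s.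
have [ax xb] := andP xab.
pose h (n : nat) t := pp (s - 1) (x - t) * Keps (en n) t.
have ih n : itg (h n) by have [] := Int_Keps x (en_gt0 n).
have hc t : h n t @[n --> \oo] --> pp (s - 1) (x - t) * (chi (a < t) * Kz t).
  have [xt|tx] := leP (x - t) 0.
    rewrite (pp_neg _ xt) mul0r /h; under eq_cvg do rewrite (pp_neg _ xt) mul0r.
    exact: cvg_cst.
  apply: cvgM; first exact: cvg_cst.
  have [ta|ta] := ltP a t; last first.
    rewrite mul0r; under eq_cvg do rewrite Keps_left// ?en_gt0//.
    exact: cvg_cst.
  by rewrite (chiT isT) mul1r; apply: Keps_cvg; apply/andP; split; lra.
have [p1 _] := Int_pp_left x; have p2 := beta_itg ax.
(* The part of d^(ep - 1) due to the end point b: for t < x, b - t is larger than b - x. *)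
pose A := (b - x) `^ (ep - 1).
have A0 : 0 <= A by exact: powR_ge0.
have dom n t : `|h n t| <= Ck * (pp (s - 1) (x - t) * pp (ep - 1) (t - a) + A * (pp (s - 1) (x - t) * chi (a < t))).
  have q1 := pp_ge0 (s - 1) (x - t); have q2 := pp_ge0 (ep - 1) (t - a); have q3 := @chi_ge0 R (a < t).
  have nn : 0 <= pp (s - 1) (x - t) * pp (ep - 1) (t - a) + A * (pp (s - 1) (x - t) * chi (a < t)).
    by apply: addr_ge0; [exact: mulr_ge0|apply: mulr_ge0 => //; exact: mulr_ge0].
  rewrite /h (normrM (pp _ _)) (ger0_norm q1).
  have [ta|ta] := ltP a t; last by rewrite Keps_left ?en_gt0// normr0 mulr0 /chi/= !mulr0 addr0; apply: mulr_ge0 => //; exact: mulr_ge0.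
  have [tx|tx] := leP (x - t) 0.
    by rewrite (pp_neg _ tx) !(mul0r, mulr0, addr0).
  have tab : a < t < b by apply/andP; split; lra.
  have [_ _ l] := Keps_dom (en n) tab.
  apply: (le_trans (ler_wpM2l q1 l)).
  rewrite (chiT isT) mulr1 (_ : Ck * (_ + _) = pp (s - 1) (x - t) * (Ck * (pp (ep - 1) (t - a) + A))); last by ring.
  apply: ler_wpM2l => //.
  apply: ler_wpM2l => //.
  have ta0 : 0 < t - a by lra.
  rewrite (pp_pos _ ta0) /dist /Num.min; case: ifP => _.
    by rewrite -[leLHS]addr0; apply: lerD.
  rewrite -[leLHS]add0r; apply: lerD; first exact: powR_ge0.
  by apply: powR_anti; move: ep1; lra.
have mlim : measurable_fun setT (fun t : R => pp (s - 1) (x - t) * (chi (a < t) * Kz t)).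
  by apply: (@measurable_fun_cvg _ _ R setT h) => [n|t _]; [exact: itg_meas|exact: hc].
have [|||||iL cL] := @Int_dominated R h (fun t => pp (s - 1) (x - t) * (chi (a < t) * Kz t))
  (fun t => Ck * (pp (s - 1) (x - t) * pp (ep - 1) (t - a) + A * (pp (s - 1) (x - t) * chi (a < t)))).
- by move=> n; exact: itg_meas (ih n).
- exact: mlim.
- by apply: aeW => t; exact: hc.
- exact: itgZ (itgD p2 (itgZ A p1)).
- exact: dom.
split; first exact: iL.
have cR : (s^-1 * Int (fun u => qf s u * ps (x - en n * u))) @[n --> \oo] --> s^-1 * (Int (qf s) * ps x).
  apply: cvgM; first exact: cvg_cst.
  have [|||||_ c] := @Int_dominated R (fun n u => qf s u * ps (x - en n * u)) (fun u => ps x * qf s u) (fun u => S * `|qf s u|).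
  - by move=> n; mea.
  - by mea.
  - apply: aeW => u; rewrite [ps x * _]mulrC; apply: cvgM; first exact: cvg_cst.
    apply: (@continuous_cvg _ _ _ _ _ (fun n => x - en n * u) ps x); first exact: cps.
    rewrite -[X in _ --> X]subr0; apply: cvgB; first exact: cvg_cst.
    by rewrite -(mul0r u); apply: cvgM; [exact: en_cvg|exact: cvg_cst].
  - by apply: itgZ; exact: itg_abs.
  - by move=> n u; rewrite normrM mulrC; apply: ler_wpM2r => //; exact: ps_le.
  - by move: c; rewrite (IntZ _ iq) mulrC; exact.
apply: (cvg_unique _ cL).
  exact: norm_hausdorff.
rewrite (_ : (fun n => Int (h n)) = (fun n => s^-1 * Int (fun u => qf s u * ps (x - en n * u)))) //.
by apply/funext => n; have [_] := Int_Keps x (en_gt0 n).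
Qed.

End Inversion.

(** * Fourier transform and Sobolev spaces *)

Section SobolevNorm.
Variable R : realType.
Notation mu := (@lebesgue_measure R).

Lemma L2_bound (w : R -> R) r : measurable_fun setT w -> ('N[mu]_2%:E [EFin \o w])%E = r%:E ->
  itg (fun x => w x ^+ 2) /\ Int (fun x => w x ^+ 2) = r ^+ 2.
Proof.
move=> mw Er.
have r0 : 0 <= r by rewrite -lee_fin -Er Lnorm_ge0.
have E : (\int[mu]_x (w x ^+ 2)%:E = (r ^+ 2)%:E)%E.
  have n2 : (2 : R) != 0 by rewrite pnatr_eq0.
  have := poweR_Lnorm mu (EFin \o w) n2; rewrite Er poweR_EFin (powR_mulrn 2 r0) => ->.
  apply: eq_integral => x _ /=.
  by rewrite (powR_mulrn 2 (normr_ge0 _)) real_normK ?num_real.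
have i : itg (fun x => w x ^+ 2).
  apply: itgP; first by apply: measurable_funX.
  rewrite (_ : (\int[mu]_x (`|w x ^+ 2|)%:E = (r ^+ 2)%:E)%E) ?ltry//.
  by rewrite -E; apply: eq_integral => x _; rewrite ger0_norm ?sqr_ge0.
split; first exact: i.
by apply: EFin_inj; rewrite -(itgE i).
Qed.

Lemma sobolev_norm_bounds (s e : R) (w : R -> R) (D := fun xi : R => (2 * pi * `|xi|) `^ s * complex.ComplexField.Normc.normc (fourier w xi)) :
  measurable_fun setT w -> measurable_fun setT D ->
  (sobolev_norm s w < e%:E)%E ->
  [/\ itg (fun x => w x ^+ 2), Int (fun x => w x ^+ 2) <= e ^+ 2, itg (fun x => D x ^+ 2) & Int (fun x => D x ^+ 2) <= e ^+ 2].
Proof.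
move=> mw mD; rewrite /sobolev_norm -/D.
have n1 := Lnorm_ge0 mu 2%:E (EFin \o w); have n2 := Lnorm_ge0 mu 2%:E (EFin \o D).
case E1 : ('N[mu]_2%:E [EFin \o w])%E n1 => [r1||] // n1; last first.
  rewrite expe2 mulyy addye; last by rewrite -ltNye; apply: lt_le_trans (sqre_ge0 _).
  by rewrite poweRyr ?invr_eq0 ?pnatr_eq0// ltNge leey.
case E2 : ('N[mu]_2%:E [EFin \o D])%E n2 => [r2||] // n2; last first.
  rewrite !expe2 mulyy addey//.
  by rewrite poweRyr ?invr_eq0 ?pnatr_eq0// ltNge leey.
have [i1 e1] := L2_bound mw E1; have [i2 e2] := L2_bound mD E2.
rewrite -!EFin_expe -EFinD poweR_EFin lte_fin => H.
have s0 : 0 <= r1 ^+ 2 + r2 ^+ 2 by rewrite addr_ge0 ?sqr_ge0.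
have := powR_ge0 (r1 ^+ 2 + r2 ^+ 2) 2^-1.
set q := _ `^ _ in H * => q0.
have qq : q ^+ 2 = r1 ^+ 2 + r2 ^+ 2 by rewrite -powR_mulrn// -powRrM mulVf ?powRr1// pnatr_eq0.
have : q ^+ 2 <= e ^+ 2 by rewrite ler_pXn2r ?nnegrE//; lra.
rewrite qq e1 e2 => h; split => //.
  by have := sqr_ge0 r2; lra.
by have := sqr_ge0 r1; lra.
Qed.

Lemma cos_lip (x y : R) : `|cos x - cos y| <= `|x - y|.
Proof.
wlog xy : x y / x < y.
  move=> H; have [->|ne] := eqVneq x y; first by rewrite !subrr ?normr0 ?lexx.
  move: ne; rewrite neq_lt => /orP[xy|xy]; first exact: H.
  by rewrite distrC [leRHS]distrC; exact: H.
have dF t : t \in `]x, y[ -> is_derive t 1 cos (- sin t) by move=> _; exact: is_derive_cos.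
have [t _ E] := MVT xy dF (continuous_subspaceT (@continuous_cos R)).
have -> : cos x - cos y = sin t * (y - x) by rewrite -opprB E; ring.
rewrite normrM [leRHS]distrC ler_piMl//.
rewrite -(ler_pXn2r (_ : (0 < 2)%N)) ?nnegrE// expr1n real_normK ?num_real//.
Qed.

Lemma sin_lip (x y : R) : `|sin x - sin y| <= `|x - y|.
Proof.
have E (z : R) : sin z = cos (z - pi / 2) by rewrite cosBpihalf.
by rewrite !E; apply: (le_trans (cos_lip _ _)); rewrite opprB addrA subrK.
Qed.

Lemma sin_max (x : R) : `|sin x| <= 1.
Proof. by have := cos_max (x - pi / 2); rewrite cosBpihalf. Qed.

Lemma expN_cvg (eps : R) : 0 < eps -> expR (- (eps * x)) @[x --> +oo] --> (0 : R).
Proof.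
move=> e0; apply/cvgrPdist_le => d d0; near=> x.
have x0 : 0 < x by near: x; exact: nbhs_pinfty_gt.
rewrite sub0r normrN gtr0_norm ?expR_gt0// expRN.
have ed : 0 < eps * d by rewrite mulr_gt0.
have : (eps * d)^-1 < x by near: x; apply: nbhs_pinfty_gt; rewrite num_real.
rewrite -[_ < x](ltr_pM2l e0) => h.
rewrite invf_ple ?posrE ?expR_gt0//.
have := expR_ge1Dx (eps * x); have : d^-1 < eps * x.
  by move: h; rewrite invfM mulrA mulfV ?gt_eqF// mul1r.
lra.
Unshelve. all: by end_near. Qed.

(** The summand 1 makes the integrand nonnegative, as [FTC_oy] requires. *)
Lemma cos_exp_itg (eps c : R) : 0 < eps -> itg (fun x => chi (0 < x) * (expR (- (eps * x)) * (1 + cos (c * x)))) /\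
  Int (fun x => chi (0 < x) * (expR (- (eps * x)) * (1 + cos (c * x)))) = eps^-1 + eps / (eps ^+ 2 + c ^+ 2).
Proof.
move=> e0; have q0 : 0 < eps ^+ 2 + c ^+ 2 by rewrite ltr_pwDl ?exprn_gt0 ?sqr_ge0.
pose B (x : R) : R := - eps^-1 + (eps ^+ 2 + c ^+ 2)^-1 * (c * sin (c * x) - eps * cos (c * x)).
pose F (x : R) : R := expR (- (eps * x)) * B x.
have D (x : R) : is_derive x 1 F (expR (- (eps * x)) * (1 + cos (c * x))).
  have D1 : is_derive x 1 (fun x : R => - (eps * x)) (- eps).
    have D0 := is_deriveN (is_deriveZ eps (is_derive_id x (1 : R))).
    by apply: (is_derive_eq D0); rewrite /GRing.scale/= mulr1.
  have D2 := @is_derive1_comp _ expR (fun x => - (eps * x)) x _ _ (is_derive_expR _) D1.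
  have D3 : is_derive x 1 (fun x : R => c * x) c.
    have D0 := is_deriveZ c (is_derive_id x (1 : R)).
    by apply: (is_derive_eq D0); rewrite /GRing.scale/= mulr1.
  have D4 := @is_derive1_comp _ sin (fun x => c * x) x _ _ (is_derive_sin _) D3.
  have D5 := @is_derive1_comp _ cos (fun x => c * x) x _ _ (is_derive_cos _) D3.
  have D6 : is_derive x 1 B ((eps ^+ 2 + c ^+ 2)^-1 * (c * (cos (c * x) * c) - eps * (- sin (c * x) * c))).
    have D7 := is_deriveB (is_deriveZ c D4) (is_deriveZ eps D5).
    have D8 := is_deriveD (is_derive_cst (- eps^-1) x 1) (is_deriveZ (eps ^+ 2 + c ^+ 2)^-1 D7).
    by apply: (is_derive_eq D8); rewrite /GRing.scale/= add0r.
  apply: (is_derive_eq (is_deriveM D2 D6)); rewrite /GRing.scale/= /B; field.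
  by rewrite !gt_eqF.
have cf (x : R) : {for x, continuous (fun x => expR (- (eps * x)) * (1 + cos (c * x)))}.
  apply: cvgM.
    apply: (@continuous_comp _ _ _ (fun x => - (eps * x)) expR); last exact: continuous_expR.
    by apply: cvgN; apply: cvgM; [exact: cvg_cst|exact: cvg_id].
  apply: cvgD; first exact: cvg_cst.
  apply: (@continuous_comp _ _ _ (fun x => c * x) cos); last exact: continuous_cos.
  by apply: cvgM; [exact: cvg_cst|exact: cvg_id].
have [||||i E] := @FTC_oy R F (fun x => expR (- (eps * x)) * (1 + cos (c * x))) 0 (F 0) 0.
- by move=> x _; exact: cf.
- move=> x _; rewrite mulr_ge0 ?expR_ge0//; have := cos_max (c * x); rewrite ler_norml; lra.
- apply: cvg_at_right_filter; apply: differentiable_continuous; apply/derivable1_diffP; apply: ex_derive.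
- apply/cvgrPdist_le => d d0.
  pose K := eps^-1 + (eps ^+ 2 + c ^+ 2)^-1 * (`|c| + eps).
  have BK x : `|B x| <= K.
    apply: (le_trans (ler_normD _ _)); rewrite normrN (gtr0_norm (_ : 0 < eps^-1)) ?invr_gt0//.
    rewrite lerD2l normrM (gtr0_norm (_ : 0 < (_)^-1)) ?invr_gt0//.
    apply: ler_wpM2l; first by rewrite invr_ge0 ltW.
    apply: (le_trans (ler_normB _ _)); rewrite !normrM (gtr0_norm e0).
    by apply: lerD; [rewrite ler_piMr// sin_max|rewrite ler_piMr ?cos_max// ltW].
  have K0 : 0 <= K by apply: le_trans (BK 0).
  have dK : 0 < d / (K + 1) by rewrite divr_gt0//; lra.
  have /cvgrPdist_le /(_ _ dK) H := expN_cvg e0.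
  near=> x.
  have : `|0 - expR (- (eps * x))| <= d / (K + 1) by near: x.
  rewrite !sub0r !normrN (ger0_norm (expR_ge0 _)) /F normrM (ger0_norm (expR_ge0 _)) => h.
  apply: (le_trans (ler_pM (expR_ge0 _) (normr_ge0 _) h (BK x))).
  by rewrite mulrAC ler_pdivrMr; [rewrite ler_pM2l//; lra|lra].
- split; first exact: i.
  rewrite E sub0r /F /B mulr0 oppr0 expR0 mulr0 sin0 cos0; field.
  by rewrite !gt_eqF.
Unshelve. all: by end_near. Qed.

(** The summand 1 is removed by subtracting half of the case c = 0, and the half-line integral is
    then symmetrised. *)
Lemma poisson (eps c : R) : 0 < eps -> itg (fun x => expR (- (eps * `|x|)) * cos (c * x)) /\
  Int (fun x => expR (- (eps * `|x|)) * cos (c * x)) = 2 * (eps / (eps ^+ 2 + c ^+ 2)).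
Proof.
move=> e0; have [i1 E1] := cos_exp_itg c e0; have [i0 E0] := cos_exp_itg 0 e0.
have e1 : eps / (eps ^+ 2 + 0 ^+ 2) = eps^-1 by rewrite expr0n addr0 expr2; field; rewrite gt_eqF.
rewrite e1 in E0.
pose h (x : R) := chi (0 < x) * (expR (- (eps * x)) * (1 + cos (c * x))) - 2^-1 * (chi (0 < x) * (expR (- (eps * x)) * (1 + cos (0 * x)))).
have hE x : h x = chi (0 < x) * (expR (- (eps * x)) * cos (c * x)) by rewrite /h mul0r cos0; field.
have ih : itg h := itgB i1 (itgZ 2^-1 i0).
have Eh : Int h = eps / (eps ^+ 2 + c ^+ 2).
  by rewrite /h (IntB i1 (itgZ _ i0)) (IntZ _ i0) E1 E0; field; rewrite !gt_eqF// ltr_pwDl ?exprn_gt0 ?sqr_ge0.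
have j := itg_opp ih.
have mm : measurable_fun setT (fun x : R => expR (- (eps * `|x|)) * cos (c * x)).
  apply: measurable_funM.
    apply: (measurableT_comp (@measurable_expR R)).
    by apply: (measurableT_comp (@measurable_oppr_id R)); mea.
  apply: (measurableT_comp (continuous_measurable_fun (@continuous_cos R))).
  by apply: measurable_funM.
have E : {ae mu, forall x, h x + h (- x) = expR (- (eps * `|x|)) * cos (c * x)}.
  apply: ae_imp (ae_neq 0) => x x0; rewrite !hE oppr_gt0 !mulrN cosN.
  move: x0; rewrite neq_lt => /orP[x0|x0].
    by rewrite (chiT x0) (@chiF _ (0 < x)) ?mul0r ?add0r ?mul1r ?ltr0_norm ?mulrN// -leNgt ltW.
  by rewrite (chiT x0) (@chiF _ (x < 0)) ?mul0r ?addr0 ?mul1r ?gtr0_norm// -leNgt ltW.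
split; first exact: ae_itg mm E (itgD ih j).
rewrite -(ae_Int _ mm E); last exact: itg_meas (itgD ih j).
by rewrite (IntD ih j) (Int_opp ih) Eh; ring.
Qed.

(** The Poisson kernel at height 1, normalised as the Fourier transform of exp(- |xi|). *)
Definition pk (v : R) : R := 2 / (1 + (2 * pi * v) ^+ 2).

Lemma pk_gt0 v : 0 < pk v.
Proof. by rewrite divr_gt0// ltr_pwDl ?sqr_ge0. Qed.

Lemma pk_le2 v : pk v <= 2.
Proof. by rewrite ler_pdivrMr ?ltr_pwDl ?sqr_ge0// ler_peMr// lerDl sqr_ge0. Qed.

Lemma measurable_pk : measurable_fun setT pk.
Proof.
apply: continuous_measurable_fun => x; apply: cvgM; first exact: cvg_cst.
apply: cvgV; first by rewrite gt_eqF// ltr_pwDl ?sqr_ge0.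
apply: cvgD; first exact: cvg_cst.
have c1 : {for x, continuous (fun v : R => 2 * pi * v)}.
  by apply: cvgM; [exact: cvg_cst|exact: cvg_id].
rewrite (_ : (fun v : R => (2 * pi * v) ^+ 2) = fun v => (2 * pi * v) * (2 * pi * v)); last by apply/funext => v; rewrite expr2.
exact: cvgM.
Qed.

Lemma pk_itg : itg pk.
Proof.
have [i1 _] := itg_chi (-2 : R) 2.
have [i2 _] := @ab_neary R (-2) 1 ltac:(lra) ltac:(lra).
apply: (itg_le measurable_pk _ (itgD (itgZ 2 i1) (itgZ 2 i2))) => v.
rewrite (ger0_norm (ltW (pk_gt0 v))).
have [v1|v1] := leP `|v| 1.
  rewrite -[leLHS]addr0; apply: lerD; last by rewrite !mulr_ge0 ?chi_ge0 ?ab_ge0.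
  rewrite chiT ?mulr1 ?pk_le2//; move: v1; rewrite ler_norml; lra.
rewrite -[leLHS]add0r; apply: lerD; first by rewrite mulr_ge0 ?chi_ge0.
have v0 : v != 0 by rewrite -normr_gt0; lra.
rewrite (chiT isT) mul1r (abE _ v0) powRN (powR_mulrn 2 (normr_ge0 _)) real_normK ?num_real// /pk.
rewrite ler_pM2l// lef_pV2 ?posrE ?ltr_pwDl ?sqr_ge0// ?exprn_even_gt0//.
rewrite exprMn -[leLHS]add0r; apply: lerD => //; rewrite ler_peMl ?sqr_ge0//.
have p2 := @pi_ge2 R; rewrite exprn_ege1//; lra.
Qed.

Lemma poisson_pk (eps y : R) : 0 < eps -> itg (fun xi => expR (- (eps * `|xi|)) * cos (2 * pi * y * xi)) /\
  Int (fun xi => expR (- (eps * `|xi|)) * cos (2 * pi * y * xi)) = eps^-1 * pk (eps^-1 * y).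
Proof.
move=> e0; have [i E] := poisson (2 * pi * y) e0; split; first exact: i.
rewrite E /pk; field.
have q (z : R) : 0 < eps ^+ 2 + z ^+ 2 by rewrite ltr_pwDl ?exprn_gt0 ?sqr_ge0.
by rewrite (gt_eqF e0) ?gt_eqF//=; have := q (2 * pi * y); rewrite !exprMn; lra.
Qed.

Section Fourier.
Variable w : R -> R.
Hypothesis iw : itg w.

Definition Cf xi := Int (fun t => w t * cos (2 * pi * t * xi)).
Definition Sf xi := Int (fun t => w t * sin (2 * pi * t * xi)).

Lemma measurable_cos2 : measurable_fun setT (fun z : R * R => cos (2 * pi * z.1 * z.2)).
Proof.
apply: (measurableT_comp (continuous_measurable_fun (@continuous_cos R))).
by apply: measurable_funM => //; apply: measurable_funM.
Qed.

Lemma measurable_sin2 : measurable_fun setT (fun z : R * R => sin (2 * pi * z.1 * z.2)).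
Proof.
apply: (measurableT_comp (continuous_measurable_fun (@continuous_sin R))).
by apply: measurable_funM => //; apply: measurable_funM.
Qed.

Lemma itg_bdd (v : R -> R) : measurable_fun setT v -> (forall t, `|v t| <= 1) -> itg (fun t => w t * v t).
Proof.
move=> mv v1; have mw := itg_meas iw; apply: (itg_le _ _ (itg_abs iw)); first by mea.
by move=> t; rewrite normrM ler_piMr.
Qed.

Lemma mcos (c : R) : measurable_fun setT (fun t : R => cos (c * t)).
Proof.
apply: (measurableT_comp (continuous_measurable_fun (@continuous_cos R))).
by apply: measurable_funM.
Qed.

Lemma msin (c : R) : measurable_fun setT (fun t : R => sin (c * t)).
Proof.
apply: (measurableT_comp (continuous_measurable_fun (@continuous_sin R))).
by apply: measurable_funM.
Qed.

Lemma C_itg xi : itg (fun t => w t * cos (2 * pi * t * xi)).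
Proof.
apply: itg_bdd => [|t]; last exact: cos_max.
by rewrite (_ : (fun t => _) = fun t => cos (2 * pi * xi * t)); [exact: mcos|apply/funext => t; congr cos; ring].
Qed.

Lemma S_itg xi : itg (fun t => w t * sin (2 * pi * t * xi)).
Proof.
apply: itg_bdd => [|t]; last exact: sin_max.
by rewrite (_ : (fun t => _) = fun t => sin (2 * pi * xi * t)); [exact: msin|apply/funext => t; congr sin; ring].
Qed.

Lemma damp_itg (eps : R) : 0 < eps -> itg (fun x : R => expR (- (eps * `|x|))).
Proof. by move=> e0; have [i _] := poisson 0 e0; apply: eq_itg i => x; rewrite mul0r cos0 mulr1. Qed.

Lemma measurable_damp (eps : R) : measurable_fun setT (fun x : R => expR (- (eps * `|x|))).
Proof.
apply: (measurableT_comp (@measurable_expR R)).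
by apply: (measurableT_comp (@measurable_oppr_id R)); mea.
Qed.

(** Damping by exp(- |xi|) makes the double integrand integrable, so Fubini gives measurability in
    xi; the damping factor is divided out afterwards. *)
Lemma meas_transform (v : R -> R -> R) : measurable_fun setT (fun z : R * R => v z.1 z.2) -> (forall t xi, `|v t xi| <= 1) ->
  measurable_fun setT (fun xi => Int (fun t => w t * v t xi)).
Proof.
move=> mv v1; have mw := itg_meas iw; have id := damp_itg ltr01; have md := measurable_damp 1.
have [mvy mvx] : (forall xi, measurable_fun setT (fun t => v t xi)) /\ (forall t, measurable_fun setT (v t)).
  split=> [xi|t]; first by apply: (measurableT_comp mv (pair2_measurable xi)).
  exact: (measurableT_comp mv (pair1_measurable t)).
have iv xi : itg (fun t => w t * v t xi) by exact: itg_bdd.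
have [|||j1 _ _ _] := @Int_fubini R (fun xi t => expR (- (1 * `|xi|)) * (w t * v t xi)) (fun xi => Int (fun t => `|w t|) * expR (- (1 * `|xi|))).
- apply: measurable_funM; first by apply: (measurableT_comp md).
  apply: measurable_funM; first by apply: (measurableT_comp mw).
  have ms : measurable_fun setT (fun z : R * R => (z.2, z.1)) by exact: measurable_fun_pair.
  exact: (measurableT_comp mv ms).
- apply: aeW => xi; split; first exact: itgZ.
  rewrite (@eq_Int _ _ (fun t => expR (- (1 * `|xi|)) * `|w t * v t xi|)); last first.
    by move=> t; rewrite (normrM (expR _)) (ger0_norm (expR_ge0 _)).
  rewrite (IntZ _ (itg_abs (iv xi))) mulrC; apply: ler_wpM2r; first exact: expR_ge0.
  apply: le_Int; [exact: itg_abs (iv xi)|exact: itg_abs iw|].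
  by move=> t; rewrite normrM ler_piMr.
- exact: itgZ.
have E xi : Int (fun t => w t * v t xi) = expR (1 * `|xi|) * Int (fun t => expR (- (1 * `|xi|)) * (w t * v t xi)).
  by rewrite (IntZ _ (iv xi)) mulrA -expRD addrN expR0 mul1r.
rewrite (_ : (fun xi => _) = fun xi => expR (1 * `|xi|) * Int (fun t => expR (- (1 * `|xi|)) * (w t * v t xi))); last by apply/funext.
apply: measurable_funM; last exact: itg_meas j1.
by apply: (measurableT_comp (@measurable_expR R)); mea.
Qed.

Lemma mCf : measurable_fun setT Cf.
Proof. by apply: meas_transform => [|t xi]; [exact: measurable_cos2|exact: cos_max]. Qed.

Lemma mSf : measurable_fun setT Sf.
Proof. by apply: meas_transform => [|t xi]; [exact: measurable_sin2|exact: sin_max]. Qed.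

(* Abel summation of the inverse Fourier integral. *)
Lemma damped_inversion (eps x : R) : 0 < eps ->
  itg (fun xi => expR (- (eps * `|xi|)) * (cos (2 * pi * x * xi) * Cf xi + sin (2 * pi * x * xi) * Sf xi)) /\
  Int (fun xi => expR (- (eps * `|xi|)) * (cos (2 * pi * x * xi) * Cf xi + sin (2 * pi * x * xi) * Sf xi)) =
  Int (fun t => w t * (eps^-1 * pk (eps^-1 * (x - t)))).
Proof.
move=> e0; have mw := itg_meas iw; have id := damp_itg e0; have md := measurable_damp eps.
have iP t := poisson_pk (x - t) e0.
have [|||j1 j2 j3 j4] := @Int_fubini R (fun t xi => w t * (expR (- (eps * `|xi|)) * cos (2 * pi * (x - t) * xi))) (fun t => Int (fun xi => expR (- (eps * `|xi|))) * `|w t|).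
- apply: measurable_funM; first by apply: (measurableT_comp mw).
  apply: measurable_funM; first by apply: (measurableT_comp md).
  have ms : measurable_fun setT (fun z : R * R => (x - z.1, z.2)).
    by apply: measurable_fun_pair => //; apply: measurable_funB.
  exact: (measurableT_comp measurable_cos2 ms).
- apply: aeW => t; have [i1 _] := iP t; split; first exact: itgZ.
  rewrite (@eq_Int _ _ (fun xi => `|w t| * `|expR (- (eps * `|xi|)) * cos (2 * pi * (x - t) * xi)|)); last first.
    by move=> xi; rewrite (normrM (w t)).
  rewrite (IntZ _ (itg_abs i1)) mulrC; apply: ler_wpM2r => //.
  apply: le_Int; [exact: itg_abs i1|exact: id|].
  by move=> xi; rewrite (normrM (expR _)) (ger0_norm (expR_ge0 _)) ler_piMr ?expR_ge0// cos_max.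
- by apply: itgZ; exact: itg_abs.
have E xi : Int (fun t => w t * (expR (- (eps * `|xi|)) * cos (2 * pi * (x - t) * xi))) =
    expR (- (eps * `|xi|)) * (cos (2 * pi * x * xi) * Cf xi + sin (2 * pi * x * xi) * Sf xi).
  have iC := C_itg xi; have iS := S_itg xi.
  rewrite /Cf /Sf -(IntZ _ iC) -(IntZ _ iS) -(IntD (itgZ _ iC) (itgZ _ iS)) -(IntZ _ (itgD (itgZ _ iC) (itgZ _ iS))).
  apply: eq_Int => t; rewrite (_ : 2 * pi * (x - t) * xi = 2 * pi * x * xi - 2 * pi * t * xi); last by ring.
  by rewrite cosB; ring.
split; first exact: eq_itg E j2.
rewrite -(eq_Int E) -j4; apply: eq_Int => t; have [i1 E1] := iP t.
by rewrite (IntZ _ i1) E1.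
Qed.

End Fourier.
End SobolevNorm.

(** * Hoelder estimates from the Fourier side *)

Section FourierHoelder.
Variable R : realType.
Notation mu := (@lebesgue_measure R).

Let en (n : nat) : R := n.+1%:R^-1.
Lemma en20_gt0 n : 0 < en n. Proof. by rewrite invr_gt0. Qed.

(** After the substitution t = x - e v, dominated convergence applies with majorant B pk(v). *)
Lemma approximate_identity (w : R -> R) (B x : R) : itg w -> continuous w -> (forall t, `|w t| <= B) ->
  Int (fun t => w t * ((en n)^-1 * pk ((en n)^-1 * (x - t)))) @[n --> \oo] --> w x * Int (@pk R).
Proof.
move=> iw cw wB; have mw := itg_meas iw; have mp := @measurable_pk R; have ip := @pk_itg R.
have B0 : 0 <= B by apply: le_trans (wB 0).
have E n : Int (fun t => w t * ((en n)^-1 * pk ((en n)^-1 * (x - t)))) = Int (fun v => w (x - en n * v) * pk v).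
  have e0 := en20_gt0 n; set e := en n in e0 *.
  have mpe : measurable_fun setT (fun t : R => pk (e^-1 * (x - t))).
    by apply: (measurableT_comp mp); mea.
  have ih : itg (fun t => w t * (e^-1 * pk (e^-1 * (x - t)))).
    apply: (itg_le _ _ (itgZ (e^-1 * 2) (itg_abs iw))); first by mea.
    move=> t; rewrite (normrM (w t)) mulrC; apply: ler_wpM2r => //.
    rewrite ger0_norm; last by rewrite mulr_ge0 ?invr_ge0 ?ltW// pk_gt0.
    by apply: ler_wpM2l; [rewrite invr_ge0 ltW|exact: pk_le2].
  have i2 := itg_refl x ih.
  rewrite -(Int_refl x ih).
  have := Int_scale e0 i2 => /(congr1 (fun y => e * y)); rewrite mulVKf ?gt_eqF// => <-.
  rewrite -(IntZ _ (itg_scale e0 i2)); apply: eq_Int => v.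
  rewrite opprB addrCA subrr addr0 mulKf ?gt_eqF// mulrCA; congr (_ * _).
  by rewrite mulrA mulfV ?mul1r// gt_eqF.
under eq_cvg do rewrite E.
have [|||||_ c] := @Int_dominated R (fun n v => w (x - en n * v) * pk v) (fun v => w x * pk v) (fun v => B * pk v).
- by move=> n; mea.
- by mea.
- apply: aeW => v; apply: cvgM; last exact: cvg_cst.
  apply: (@continuous_cvg _ _ _ _ _ (fun n => x - en n * v) w x); first exact: cw.
  rewrite -[X in _ --> X]subr0; apply: cvgB; first exact: cvg_cst.
  by rewrite -(mul0r v); apply: cvgM; [exact: cvg_harmonic|exact: cvg_cst].
- exact: itgZ.
- move=> n v; rewrite normrM (ger0_norm (ltW (pk_gt0 v))); apply: ler_wpM2r => //.
  exact: ltW (pk_gt0 v).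
- by rewrite -(IntZ _ ip); exact: c.
Qed.

Definition Ew (s xi : R) : R := (2 * pi * `|xi|) `^ s.

Lemma Ew_sq s xi : xi != 0 -> (Ew s xi ^+ 2)^-1 = (2 * pi) `^ (- 2 * s) * ab (- 2 * s) xi.
Proof.
move=> x0; have n0 : 0 < `|xi| by rewrite normr_gt0.
have p0 : 0 < 2 * pi :> R by rewrite mulr_gt0// pi_gt0.
have q0 : 0 < 2 * pi * `|xi| by rewrite mulr_gt0.
rewrite /Ew -powR_mulrn ?powR_ge0// -powRrM -powRN (abE _ x0) -powRM ?ltW//.
by congr (_ `^ _); ring.
Qed.

Lemma trig_bound (A B : R) : (cos A - cos B) ^+ 2 + (sin A - sin B) ^+ 2 <= 8 /\
  (cos A - cos B) ^+ 2 + (sin A - sin B) ^+ 2 <= 2 * (A - B) ^+ 2.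
Proof.
have sq (u v : R) : `|u| <= v -> u ^+ 2 <= v ^+ 2.
  by move=> h; rewrite -real_normK ?num_real// ler_pXn2r ?nnegrE//; apply: le_trans h.
have c1 : `|cos A - cos B| <= 2 by apply: (le_trans (ler_normB _ _)); have := cos_max A; have := cos_max B; lra.
have s1 : `|sin A - sin B| <= 2 by apply: (le_trans (ler_normB _ _)); have := sin_max A; have := sin_max B; lra.
have := sq _ _ c1; have := sq _ _ s1; have := sq _ _ (cos_lip A B); have := sq _ _ (sin_lip A B).
rewrite !real_normK ?num_real//; lra.
Qed.

Lemma amgm (k E p q C S : R) : 0 < k -> 0 < E ->
  `|p * C + q * S| <= 2^-1 * (k * ((p ^+ 2 + q ^+ 2) * (E ^+ 2)^-1) + k^-1 * (E ^+ 2 * (C ^+ 2 + S ^+ 2))).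
Proof.
move=> k0 E0.
have P (x y : R) : `|x * y| <= 2^-1 * (k * (x ^+ 2 * (E ^+ 2)^-1) + k^-1 * (E ^+ 2 * y ^+ 2)).
  have E2 : 0 < E ^+ 2 by rewrite exprn_gt0.
  have H (z : R) : 0 <= 2^-1 * (k * (x ^+ 2 * (E ^+ 2)^-1) + k^-1 * (E ^+ 2 * z ^+ 2)) - x * z.
    rewrite (_ : _ - _ = 2^-1 * (k / E ^+ 2) * (x - z * E ^+ 2 / k) ^+ 2).
      by rewrite mulr_ge0 ?sqr_ge0// mulr_ge0// divr_ge0// ltW.
    by field; rewrite !gt_eqF.
  have h1 := H y; have h2 := H (- y); rewrite sqrrN mulrN in h2.
  by rewrite ler_norml; lra.
by apply: (le_trans (ler_normD _ _)); have := P p C; have := P q S; rewrite !mulrDl !mulrDr; lra.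
Qed.

(* The parameter k comes from Young's inequality: it is taken of the order of the
   Sobolev norm for uniform convergence and of |x - y|^(1/2 - s) for a Hoelder
   estimate. *)
Lemma fourier_hoelder (s : R) : 2^-1 < s -> s < 3 / 2 -> exists2 K, 0 <= K &
  forall (w : R -> R) (B k x y : R), itg w -> continuous w -> (forall t, `|w t| <= B) ->
    itg (fun xi => Ew s xi ^+ 2 * (Cf w xi ^+ 2 + Sf w xi ^+ 2)) -> 0 < k ->
    `|w x - w y| <= K * (k * `|x - y| `^ (2 * s - 1) + k^-1 * Int (fun xi => Ew s xi ^+ 2 * (Cf w xi ^+ 2 + Sf w xi ^+ 2))).
Proof.
move=> s1 s2.
have ip := @pk_itg R.
have cP : 0 < Int (@pk R).
  apply: (@Int_gt0 R (@pk R) 0 1 (pk 1)) => //.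
  - by apply: aeW => v; exact: ltW (pk_gt0 v).
  - exact: pk_gt0.
  - apply: aeW => v /andP[v0 v1]; rewrite /pk ler_pM2l// lef_pV2 ?posrE ?ltr_pwDl ?sqr_ge0//.
    rewrite lerD2l ler_pXn2r ?nnegrE ?mulr_ge0 ?pi_ge0// ?ltW//.
    by rewrite ltr_pM2l// mulr_gt0// pi_gt0.
have p0 : 0 < 2 * pi :> R by rewrite mulr_gt0// pi_gt0.
have e1 : -1 < 2 - 2 * s by lra.
have e2 : - 2 * s < -1 by lra.
(* The frequency integral is cut at |xi| = 1/h, where h = |x - y|. Below, the squared difference of
   phases is at most 2 (2 pi h xi)^2, giving c1; above, it is at most 8, giving c2. The two
   integrals converge because s < 3/2 and s > 1/2. *)
pose c1 : R := 2 * (2 * pi) ^+ 2 * (2 * pi) `^ (- 2 * s).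
pose c2 : R := 8 * (2 * pi) `^ (- 2 * s).
have c10 : 0 <= c1 by rewrite /c1 !mulr_ge0 ?powR_ge0 ?pi_ge0.
have c20 : 0 <= c2 by rewrite /c2 !mulr_ge0 ?powR_ge0.
pose K1 : R := c1 * (2 * ((3 - 2 * s)^-1 * 2 `^ (3 - 2 * s))) + c2 * (2 * (2 * s - 1)^-1).
have K10 : 0 <= K1.
  rewrite /K1 addr_ge0// mulr_ge0// mulr_ge0 ?mulr_ge0 ?powR_ge0// invr_ge0; lra.
have Kc : 0 <= (Int (@pk R))^-1 * 2^-1 * (K1 + 1).
  apply: mulr_ge0; last exact: addr_ge0.
  by apply: mulr_ge0; rewrite invr_ge0// ltW.
exists ((Int (@pk R))^-1 * 2^-1 * (K1 + 1)); first exact: Kc.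
move=> w B k x y iw cw wB iD k0.
have [->|xy] := eqVneq x y.
  rewrite !subrr normr0; apply: mulr_ge0 => //.
  apply: addr_ge0; apply: mulr_ge0; rewrite ?powR_ge0 ?invr_ge0 ?(ltW k0)//.
  by apply: Int_ge0 => xi; rewrite mulr_ge0 ?sqr_ge0// addr_ge0 ?sqr_ge0.
have h0 : 0 < `|x - y| by rewrite normr_gt0 subr_eq0.
set h := `|x - y| in h0 *.
set D2 := fun xi => _ in iD *.
have hi : 0 < h^-1 by rewrite invr_gt0.
have hi2 : 0 < 2 * h^-1 by rewrite mulr_gt0.
have [j1 J1] := ab_near0 e1 hi2; have [j2 J2] := ab_neary e2 hi.
pose Mh xi := c1 * h ^+ 2 * (chi (`|xi| < 2 * h^-1) * ab (2 - 2 * s) xi) + c2 * (chi (h^-1 < `|xi|) * ab (- 2 * s) xi).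
have iM : itg Mh by apply: itgD; apply: itgZ.
have EM : Int Mh = K1 * h `^ (2 * s - 1).
  rewrite /Mh (IntD (itgZ _ j1) (itgZ _ j2)) (IntZ _ j1) (IntZ _ j2) J1 J2.
  rewrite (_ : 2 - 2 * s + 1 = 3 - 2 * s); last by ring.
  rewrite (_ : - 2 * s + 1 = 1 - 2 * s); last by ring.
  have hh : h^-1 = h `^ (-1) by rewrite powR_inv1// ltW.
  rewrite powRM ?invr_ge0 ?(ltW h0)// hh -!powRrM.
  rewrite (_ : -1 * (3 - 2 * s) = (2 * s - 1) + - (2%:R)); last by ring.
  rewrite (_ : -1 * (1 - 2 * s) = 2 * s - 1); last by ring.
  have -> : h `^ (2 * s - 1 + - 2%:R) = h `^ (2 * s - 1) * h ^- 2.
    by rewrite -powR_mul// powRN (powR_mulrn 2 (ltW h0)).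
  rewrite /K1; move: (h `^ (2 * s - 1)) => hs.
  have z1 : 2 * s - 1 != 0 by clear -s1; rewrite gt_eqF//; lra.
  have z2 : 1 - 2 * s != 0 by clear -s1; rewrite lt_eqF//; lra.
  have z3 : 3 - 2 * s != 0 by clear -s2; rewrite gt_eqF//; lra.
  have z4 : h != 0 by rewrite gt_eqF.
  by field; rewrite z1 z2 z3 z4.
clear J1 J2.
pose P eps xi := expR (- (eps * `|xi|)) * (cos (2 * pi * x * xi) * Cf w xi + sin (2 * pi * x * xi) * Sf w xi).
pose Q eps xi := expR (- (eps * `|xi|)) * (cos (2 * pi * y * xi) * Cf w xi + sin (2 * pi * y * xi) * Sf w xi).
pose Z xi := 2^-1 * (k * Mh xi + k^-1 * D2 xi).
have iZ : itg Z by apply: itgZ; apply: itgD; apply: itgZ.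
have dom eps xi : 0 < eps -> xi != 0 -> `|P eps xi - Q eps xi| <= Z xi.
  move=> e0 x0.
  have n0 : 0 < `|xi| by rewrite normr_gt0.
  have Ep : 0 < Ew s xi by rewrite powR_gt0// mulr_gt0.
  rewrite -mulrBr (normrM (expR _)) (ger0_norm (expR_ge0 _)).
  apply: (@le_trans _ _ `|(cos (2 * pi * x * xi) - cos (2 * pi * y * xi)) * Cf w xi + (sin (2 * pi * x * xi) - sin (2 * pi * y * xi)) * Sf w xi|).
    rewrite (_ : cos _ * _ + _ - _ = (cos (2 * pi * x * xi) - cos (2 * pi * y * xi)) * Cf w xi + (sin (2 * pi * x * xi) - sin (2 * pi * y * xi)) * Sf w xi); last by ring.
    by rewrite ler_piMl// -expR0 ler_expR oppr_le0 mulr_ge0// ltW.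
  apply: (le_trans (amgm _ _ (Cf w xi) (Sf w xi) k0 Ep)); rewrite /Z; apply: ler_wpM2l => //.
  apply: lerD => //; apply: ler_wpM2l; first exact: ltW.
  have [t1 t2] := trig_bound (2 * pi * x * xi) (2 * pi * y * xi).
  rewrite (Ew_sq s x0) /Mh.
  have pz : 0 <= (2 * pi) `^ (- 2 * s) * ab (- 2 * s) xi by rewrite mulr_ge0 ?powR_ge0 ?ab_ge0.
  have [xh|xh] := leP `|xi| h^-1.
    rewrite (_ : chi false = 0)// mul0r mulr0 addr0 (chiT (_ : `|xi| < 2 * h^-1)) ?mul1r; last by lra.
    apply: (le_trans (ler_wpM2r pz t2)).
    rewrite (_ : 2 * pi * x * xi - 2 * pi * y * xi = 2 * pi * (x - y) * xi); last by ring.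
    rewrite !exprMn -[(x - y) ^+ 2]real_normK ?num_real// -/h -[xi ^+ 2]real_normK ?num_real//.
    have -> : ab (2 - 2 * s) xi = `|xi| ^+ 2 * ab (- 2 * s) xi.
      rewrite !(abE _ x0) -(powR_mulrn 2 (normr_ge0 _)) powR_mul//; congr (_ `^ _); ring.
    by rewrite /c1 le_eqVlt; apply/orP; left; apply/eqP; ring.
  rewrite (chiT isT) mul1r -[leLHS]add0r; apply: lerD.
    exact: mulr_ge0 (mulr_ge0 c10 (sqr_ge0 h)) (mulr_ge0 (chi_ge0 _ _) (ab_ge0 _ _)).
  by apply: (le_trans (ler_wpM2r pz t1)); rewrite /c2 mulrA.
have bd n : `|Int (fun t => w t * ((en n)^-1 * pk ((en n)^-1 * (x - t)))) - Int (fun t => w t * ((en n)^-1 * pk ((en n)^-1 * (y - t))))| <= Int Z.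
  have e0 := en20_gt0 n.
  have [a1 a2] := damped_inversion iw x e0; have [b1 b2] := damped_inversion iw y e0.
  rewrite -a2 -b2 -(IntB a1 b1).
  apply: (le_trans (abs_Int (itgB a1 b1))); apply: ae_le_Int.
  - exact: itg_abs (itgB a1 b1).
  - exact: iZ.
  - by apply: ae_imp (ae_neq 0) => xi x0; exact: dom.
have cx := @approximate_identity w B x iw cw wB; have cy := @approximate_identity w B y iw cw wB.
have lim : `|w x * Int (@pk R) - w y * Int (@pk R)| <= Int Z.
  move: bd; set A := (fun n => Int _) in cx *; set B' := (fun n => Int _) in cy *.
  rewrite -/A -/B' => bd.
  have c : (fun n => `|A n - B' n|) @ \oo --> `|w x * Int (@pk R) - w y * Int (@pk R)|.
    by apply: cvg_norm; apply: cvgB.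
  apply/ler_addgt0Pl => e e0; have /cvgrPdist_le /(_ e e0) [N _ H] := c.
  have := H N (leqnn N) => /= h'; have := le_trans (ler_norm _) h'; have := bd N.
  move: (Int Z) (`|A N - B' N|) `|w x * Int (@pk R) - w y * Int (@pk R)| => u v z h1 h2; clear -h1 h2; lra.
have EZ : Int Z = 2^-1 * (k * (K1 * h `^ (2 * s - 1)) + k^-1 * Int D2).
  by rewrite /Z (IntZ _ (itgD (itgZ k iM) (itgZ k^-1 iD))) (IntD (itgZ k iM) (itgZ k^-1 iD)) (IntZ _ iM) (IntZ _ iD) EM.
have D0 : 0 <= Int D2 by apply: Int_ge0 => xi; rewrite mulr_ge0 ?sqr_ge0// addr_ge0 ?sqr_ge0.
move: lim; rewrite -mulrBl normrM (gtr0_norm cP) EZ.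
have hp := powR_ge0 h (2 * s - 1).
have ki : 0 < k^-1 by rewrite invr_gt0.
clear cx cy bd dom iZ EM iM EZ Z Mh P Q iD ip.
move: (Int (@pk R)) cP (Int D2) D0 (h `^ _) hp (`|w x - w y|) => I I0 d d0 q q0 z l.
rewrite -(ler_pM2r I0); apply: (le_trans l).
rewrite (_ : I^-1 * 2^-1 * (K1 + 1) * _ * I = 2^-1 * ((K1 + 1) * (k * q + k^-1 * d))); last by field; rewrite !gt_eqF.
apply: ler_wpM2l => //.
have := mulr_ge0 (ltW k0) q0; have := mulr_ge0 (ltW ki) d0 => h1 h2.
have := mulr_ge0 K10 h1; lra.
Qed.

End FourierHoelder.

(** * A Hoelder continuous representative of psi *)

Section TestFun.
Variable R : realType.
Notation mu := (@lebesgue_measure R).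

Lemma zero_ae (h : R -> R) : itg h -> (forall x, 0 <= h x) -> Int h <= 0 -> {ae mu, forall x, h x = 0}.
Proof.
move=> ih h0 H.
have E : Int h = 0 by apply/eqP; rewrite eq_le H Int_ge0.
have mh : measurable_fun setT (EFin \o h) by apply/measurable_EFinP; exact: itg_meas.
have [K _] := @ae_eq_integral_abs _ _ R mu setT measurableT _ mh.
have : ae_eq mu setT (EFin \o h) (cst 0%E).
  apply: K; rewrite -[RHS](congr1 EFin E) -(itgE ih).
  by apply: eq_integral => x _ /=; rewrite ger0_norm.
by apply: ae_imp => x /(_ I) /= [].
Qed.

Variables (a b : R).
Hypothesis hab : a < b.

Lemma test_off phi x : test_function a b phi -> ~~ (a < x < b) -> phi x = 0.
Proof.
move=> [_ _ H]; apply: contraNeq => px.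
have /H : closure [set x : R | phi x != 0] x by apply: subset_closure.
by rewrite /= in_itv.
Qed.

Lemma test_cont phi : test_function a b phi -> continuous phi.
Proof.
move=> [H _ _] x; apply: differentiable_continuous; apply/derivable1_diffP; exact: (H 0).
Qed.

Definition clamp z := Num.max a (Num.min z b).

Lemma clamp_itv z : a <= clamp z <= b.
Proof. by rewrite /clamp le_max lexx ge_max (ltW hab) ge_min lexx orbT. Qed.

Lemma clamp_lip x y : `|clamp x - clamp y| <= `|x - y|.
Proof.
have l1 := ler_norm (x - y); have l2 : y - x <= `|x - y| by rewrite distrC ler_norm.
rewrite /clamp /Num.max /Num.min ler_norml; case: (ltP x b) => hx; case: (ltP y b) => hy; do 2?[case: ltP => ?]; lra.
Qed.

(** The derivative is bounded on [a, b], and phi is unchanged by composition with the projection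
    [clamp], since it vanishes at and beyond the end points. *)
Lemma test_lip phi : test_function a b phi -> exists2 L, 0 <= L & forall x y, `|phi x - phi y| <= L * `|x - y|.
Proof.
move=> T; have [H _ _] := T.
have cd : continuous (derive1 phi).
  move=> x; apply: differentiable_continuous; apply/derivable1_diffP; exact: (H 1).
have cn : continuous (fun x => `|derive1 phi x|) by move=> x; apply: cvg_norm; exact: cd.
have [c _ Hc] := EVT_max (ltW hab) (continuous_subspaceT cn).
exists `|derive1 phi c| => //.
have P x y : a <= x -> x < y -> y <= b -> `|phi x - phi y| <= `|derive1 phi c| * `|x - y|.
  move=> ax xy yb.
  have dF t : t \in `]x, y[ -> is_derive t 1 phi (derive1 phi t).
    by move=> _; rewrite derive1E; apply/derivableP; exact: (H 0).
  have [t txy E] := MVT xy dF (continuous_subspaceT (test_cont T)).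
  rewrite distrC E normrM [`|x - y|]distrC; apply: ler_wpM2r => //; apply: Hc.
  by move: txy; rewrite !in_itv/= => /andP[]; lra.
have Q x y : a <= x -> a <= y -> x <= b -> y <= b -> `|phi x - phi y| <= `|derive1 phi c| * `|x - y|.
  move=> ax ay xb yb; have [->|] := eqVneq x y; first by rewrite !subrr normr0 mulr0.
  rewrite neq_lt => /orP[xy|xy]; first exact: P.
  by rewrite distrC [`|x - y|]distrC; exact: P.
have clE z : phi z = phi (clamp z).
  rewrite /clamp; have [zb|zb] := leP z b; have [az|az] := leP a _ => //.
  - by rewrite !(test_off T)// -?leNgt ?ltxx// negb_and -!leNgt ltW.
  - by rewrite !(test_off T)// negb_and -!leNgt ?lexx ?orbT// (ltW zb) orbT.
  - by have := lt_trans az hab; rewrite ltxx.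
move=> x y; rewrite (clE x) (clE y).
have [/andP[x1 x2] /andP[y1 y2]] := (clamp_itv x, clamp_itv y).
by apply: le_trans (Q _ _ x1 y1 x2 y2) _; apply: ler_wpM2l => //; exact: clamp_lip.
Qed.

Lemma restrict_chi (u : R -> R) : u \_ `]a, b[ = fun x => chi (a < x < b) * u x.
Proof.
apply/funext => x; rewrite patchE mem_setE in_itv/=; case: ifPn => h.
  by rewrite mul1r.
by rewrite mul0r.
Qed.

Lemma normc_fourier (w : R -> R) xi : itg w ->
  complex.ComplexField.Normc.normc (fourier w xi) = Num.sqrt (Cf w xi ^+ 2 + Sf w xi ^+ 2).
Proof.
move=> iw.
rewrite /fourier /= /Rintegral (itgE (C_itg iw xi)) (itgE (S_itg iw xi)) /=.
by rewrite sqrrN.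
Qed.

Lemma measurable_Ew s : measurable_fun setT (fun xi : R => Ew s xi).
Proof.
apply: (measurableT_comp (measurable_powR s)).
by apply: measurable_funM => //; exact: (@normr_measurable R setT).
Qed.

Lemma sobolev_norm_transform s e (w : R -> R) : itg w -> (sobolev_norm s w < e%:E)%E ->
  [/\ itg (fun x => w x ^+ 2), Int (fun x => w x ^+ 2) <= e ^+ 2,
   itg (fun xi => Ew s xi ^+ 2 * (Cf w xi ^+ 2 + Sf w xi ^+ 2)) &
   Int (fun xi => Ew s xi ^+ 2 * (Cf w xi ^+ 2 + Sf w xi ^+ 2)) <= e ^+ 2].
Proof.
move=> iw H.
have mC := mCf iw; have mS := mSf iw; have mE := measurable_Ew s.
have mD : measurable_fun setT (fun xi : R => (2 * pi * `|xi|) `^ s * complex.ComplexField.Normc.normc (fourier w xi)).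
  rewrite (_ : (fun xi => _) = fun xi => Ew s xi * Num.sqrt (Cf w xi ^+ 2 + Sf w xi ^+ 2)); last first.
    by apply/funext => xi; rewrite normc_fourier.
  apply: measurable_funM => //.
  apply: (measurableT_comp (continuous_measurable_fun (@sqrt_continuous R))).
  by apply: measurable_funD; apply: measurable_funX.
have [i1 e1 i2 e2] := sobolev_norm_bounds (itg_meas iw) mD H.
have E xi : ((2 * pi * `|xi|) `^ s * complex.ComplexField.Normc.normc (fourier w xi)) ^+ 2 = Ew s xi ^+ 2 * (Cf w xi ^+ 2 + Sf w xi ^+ 2).
  by rewrite normc_fourier// exprMn sqr_sqrtr// addr_ge0 ?sqr_ge0.
split; [exact: i1|exact: e1|exact: eq_itg E i2|].
by rewrite -(eq_Int E).
Qed.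

Lemma Cf_B (u v : R -> R) xi : itg u -> itg v -> Cf (fun x => u x - v x) xi = Cf u xi - Cf v xi.
Proof.
move=> iu iv; rewrite /Cf -(IntB (C_itg iu xi) (C_itg iv xi)).
by apply: eq_Int => t; rewrite mulrBl.
Qed.

Lemma Sf_B (u v : R -> R) xi : itg u -> itg v -> Sf (fun x => u x - v x) xi = Sf u xi - Sf v xi.
Proof.
move=> iu iv; rewrite /Sf -(IntB (S_itg iu xi) (S_itg iv xi)).
by apply: eq_Int => t; rewrite mulrBl.
Qed.

Lemma norm_sub_le t : a < t < b -> `|t - a| <= b - a.
Proof. by move=> /andP[h1 h2]; rewrite gtr0_norm; lra. Qed.

Lemma sqr_sub_le (u v : R) : (u - v) ^+ 2 <= 2 * (u ^+ 2 + v ^+ 2).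
Proof. by have := sqr_ge0 (u + v); rewrite sqrrD sqrrB; lra. Qed.

Variables (m : R) (psi : R -> R).
Hypotheses (m0 : 0 < m) (m1 : m < 1).
Hypothesis psiH : sobolev0 a b ((1 + m) / 2) psi.

Let s := (1 + m) / 2.
Let e (n : nat) : R := n.+1%:R^-1.
Let e0 n : 0 < e n. Proof. by rewrite invr_gt0. Qed.
Let e1 n : e n <= 1. Proof. by rewrite invf_le1// ler1n. Qed.

Lemma psi_sq : itg (fun x => (chi (a < x < b) * psi x) ^+ 2) /\ itg (fun x => chi (a < x < b) * psi x).
Proof.
have [L _] := psiH; rewrite restrict_chi in L.
have mp : measurable_fun setT (fun x => chi (a < x < b) * psi x).
  by have := sub_Lfun_mfun L; rewrite inE.
have i2 : itg (fun x => (chi (a < x < b) * psi x) ^+ 2) by exact: (Lfun2_integrable_sqr L).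
split; first exact: i2.
have [i1 _] := itg_chi a b.
apply: (itg_le mp _ (itgD i1 i2)) => x.
case: (boolP (a < x < b)) => h; last by rewrite (chiF (_ : ~~ false))// !mul0r normr0 expr0n addr0.
rewrite (chiT isT) !mul1r -[psi x ^+ 2]real_normK ?num_real//.
have := sqr_ge0 (`|psi x| - 1); have := normr_ge0 (psi x); rewrite sqrrB1; lra.
Qed.

Lemma approx_seq : exists phi : nat -> R -> R, forall n,
  [/\ test_function a b (phi n), itg (phi n), itg (fun x => chi (a < x < b) * psi x - phi n x) &
  (sobolev_norm s (fun x => chi (a < x < b) * psi x - phi n x)%R < (e n)%:E)%E].
Proof.
have [_ H] := psiH.
have [phi Hphi] : {phi : nat -> R -> R & forall n, test_function a b (phi n) /\
   (sobolev_norm s (((psi \- phi n)%R) \_ `]a, b[)%classic < (e n)%:E)%E}.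
  by apply: (@choice nat (R -> R) (fun n phi => test_function a b phi /\ (sobolev_norm s (((psi \- phi)%R) \_ `]a, b[)%classic < (e n)%:E)%E)) => n; have [phi] := H _ (e0 n); exists phi.
exists phi => n; have [T N] := Hphi n.
have [L L0 HL] := test_lip T; have [i1 _] := itg_chi a b; have [_ ip] := psi_sq.
have mphi : measurable_fun setT (phi n) by apply: continuous_measurable_fun; exact: test_cont T.
have iphi : itg (phi n).
  apply: (itg_le mphi _ (itgZ (L * (b - a)) i1)) => x.
  case: (boolP (a < x < b)) => h; last by rewrite (chiF (_ : ~~ false))// mulr0 (test_off T h) normr0.
  rewrite (chiT isT) mulr1; have := HL x a; rewrite (test_off T (_ : ~~ (a < a < b))) ?ltxx// subr0.
  move=> /le_trans; apply; apply: ler_wpM2l => //; move: h => /andP[h1 h2].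
  by rewrite gtr0_norm; lra.
split; [exact: T|exact: iphi|exact: itgB|].
rewrite (_ : (fun x => _) = ((psi \- phi n)%R) \_ `]a, b[)%classic//.
rewrite restrict_chi; apply/funext => x.
case: (boolP (a < x < b)) => h; first by rewrite (chiT isT) !mul1r.
by rewrite (chiF (_ : ~~ false))// !mul0r (test_off T h) subrr.
Qed.

(** [fourier_hoelder] asks for continuity, which psi - phi n is not known to have. It is therefore
    applied to phi n - phi p, whose weighted Fourier energy is controlled by those of psi - phi n
    and psi - phi p. *)
Lemma diff_bound : exists phi : nat -> R -> R, exists2 K, 0 <= K &
  (forall n, [/\ test_function a b (phi n), itg (fun x => (chi (a < x < b) * psi x - phi n x) ^+ 2) &
     Int (fun x => (chi (a < x < b) * psi x - phi n x) ^+ 2) <= e n ^+ 2]) /\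
  forall n p k x y, 0 < k -> `|(phi n x - phi p x) - (phi n y - phi p y)| <= K * (k * `|x - y| `^ m + k^-1 * (e n + e p) ^+ 2).
Proof.
have [phi H] := approx_seq.
have s1 : 2^-1 < s by rewrite /s; move: m0; lra.
have s2 : s < 3 / 2 by rewrite /s; move: m1; lra.
have [K K0 HK] := fourier_hoelder s1 s2.
exists phi; exists (K * 2); first by rewrite mulr_ge0.
split=> [n|n p k x y k0].
  by have [T _ i N] := H n; have [? ? _ _] := sobolev_norm_transform i N.
have [T i iw N] := H n; have [_ _ j1 l1] := sobolev_norm_transform iw N.
have [T' i' iw' N'] := H p; have [_ _ j2 l2] := sobolev_norm_transform iw' N'.
pose u t := phi n t - phi p t.
have iu : itg u by exact: itgB.
have cu : continuous u by move=> t; apply: cvgB; [exact: test_cont T t|exact: test_cont T' t].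
have [L L0 HL] := test_lip T; have [L' L'0 HL'] := test_lip T'.
have ub t : `|u t| <= (L + L') * (b - a).
  have na : ~~ (a < a < b) by rewrite ltxx.
  case: (boolP (a < t < b)) => h; last first.
    rewrite /u (test_off T h) (test_off T' h) subrr normr0 mulr_ge0//; last by rewrite subr_ge0 ltW.
    exact: addr_ge0.
  have h1 := HL t a; have h2 := HL' t a; rewrite (test_off T na) (test_off T' na) !subr0 in h1 h2.
  apply: (le_trans (ler_normB _ _)); apply: (le_trans (lerD h1 h2)); rewrite -mulrDl.
  apply: ler_wpM2l; first exact: addr_ge0.
  exact: norm_sub_le.
pose wn t := chi (a < t < b) * psi t - phi n t.
pose wp t := chi (a < t < b) * psi t - phi p t.
have E xi : Ew s xi ^+ 2 * (Cf u xi ^+ 2 + Sf u xi ^+ 2) = Ew s xi ^+ 2 * ((Cf wp xi - Cf wn xi) ^+ 2 + (Sf wp xi - Sf wn xi) ^+ 2).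
  have Eu : u = fun t => wp t - wn t by apply/funext => t; rewrite /u /wp /wn; ring.
  by rewrite Eu (Cf_B xi iw' iw) (Sf_B xi iw' iw).
pose An xi := Ew s xi ^+ 2 * (Cf wn xi ^+ 2 + Sf wn xi ^+ 2).
pose Ap xi := Ew s xi ^+ 2 * (Cf wp xi ^+ 2 + Sf wp xi ^+ 2).
have iA : itg (fun xi => 2 * (An xi + Ap xi)) by apply: itgZ; apply: itgD; [exact: j1|exact: j2].
have Q xi : `|Ew s xi ^+ 2 * (Cf u xi ^+ 2 + Sf u xi ^+ 2)| <= 2 * (An xi + Ap xi).
  rewrite ger0_norm; last by rewrite mulr_ge0 ?sqr_ge0// addr_ge0 ?sqr_ge0.
  rewrite E /An /Ap -mulrDr mulrCA; apply: ler_wpM2l; first exact: sqr_ge0.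
  apply: (le_trans (lerD (sqr_sub_le _ _) (sqr_sub_le _ _))).
  by rewrite le_eqVlt; apply/orP; left; apply/eqP; ring.
have mE := measurable_Ew s; have mC := mCf iu; have mS := mSf iu.
have iD : itg (fun xi => Ew s xi ^+ 2 * (Cf u xi ^+ 2 + Sf u xi ^+ 2)).
  apply: (itg_le _ Q iA); apply: measurable_funM; first exact: measurable_funX.
  by apply: measurable_funD; apply: measurable_funX.
have lD : Int (fun xi => Ew s xi ^+ 2 * (Cf u xi ^+ 2 + Sf u xi ^+ 2)) <= 2 * (e n + e p) ^+ 2.
  apply: (@le_trans _ _ (Int (fun xi => 2 * (An xi + Ap xi)))).
    apply: le_Int; [exact: iD|exact: iA|] => xi; exact: le_trans (ler_norm _) (Q xi).
  rewrite (IntZ _ (itgD j1 j2)) (IntD j1 j2); apply: ler_wpM2l => //.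
  move: (Int _) (Int _) l1 l2 => I1 I2 l1 l2; apply: (le_trans (lerD l1 l2)).
  have := mulr_ge0 (ltW (e0 n)) (ltW (e0 p)).
  move: (e n) (e p) => q r qr; rewrite sqrrD; lra.
have := HK u _ k x y iu cu ub iD k0; rewrite (_ : 2 * s - 1 = m); last by rewrite /s; field.
move=> /le_trans; apply; rewrite -mulrA; apply: ler_wpM2l => //; rewrite mulrDr; apply: lerD.
  rewrite ler_peMl ?ler1n// mulr_ge0 ?powR_ge0//; exact: ltW.
rewrite [leRHS]mulrCA; apply: ler_wpM2l => //; by rewrite invr_ge0 ltW.
Qed.

(** The approximants are uniformly Cauchy with a common Hoelder bound. In L^2 of ]a, b[ they tend
    both to psi, by the Sobolev norm, and to their uniform limit, which identifies the two almost
    everywhere. *)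
Lemma sobolev_representative : exists ps : R -> R, exists2 C, 0 <= C &
  [/\ forall x y, `|ps x - ps y| <= C * `|x - y| `^ (m / 2),
      forall x, ~~ (a < x < b) -> ps x = 0 &
      {ae mu, forall x, a < x < b -> psi x = ps x}].
Proof.
have [phi [K K0 [H HK]]] := diff_bound.
have na : ~~ (a < a < b) by rewrite ltxx.
have T n : test_function a b (phi n) by have [] := H n.
pose L := b - a; have L0 : 0 < L by rewrite subr_gt0.
pose C1 := K * (L `^ m + 1).
have C10 : 0 <= C1 by rewrite mulr_ge0// addr_ge0 ?powR_ge0.
have U n p x : `|phi n x - phi p x| <= C1 * (e n + e p).
  have ep : 0 < e n + e p by rewrite addr_gt0.
  case: (boolP (a < x < b)) => h; last first.
    by rewrite (test_off (T n) h) (test_off (T p) h) subrr normr0 mulr_ge0// ltW.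
  have := HK n p _ x a ep; rewrite (test_off (T n) na) (test_off (T p) na) !subr0.
  move=> /le_trans; apply; rewrite /C1 -mulrA; apply: ler_wpM2l => //.
  rewrite expr2 mulKf ?gt_eqF// [leRHS]mulrDl mul1r lerD2r mulrC; apply: ler_wpM2r; first exact: ltW.
  apply: ge0_ler_powR; rewrite ?nnegrE//; [exact: ltW|exact: ltW|].
  exact: norm_sub_le.
(* All these lower bounds lie below all the upper bounds [phi p x + C1 * e p]. *)
pose S x := [set phi n x - C1 * e n | n in [set: nat]].
pose ps x := sup (S x).
have Sub x p : ubound (S x) (phi p x + C1 * e p).
  move=> _ [n _ <-]; have := U n p x; rewrite mulrDr; have := ler_norm (phi n x - phi p x); lra.
have Sne x : S x !=set0 by exists (phi 0%N x - C1 * e 0%N); exists 0%N.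
have B n x : `|phi n x - ps x| <= C1 * e n.
  rewrite ler_norml.
  have h1 : ps x <= phi n x + C1 * e n by apply: ge_sup => //; exact: Sub.
  have h2 : phi n x - C1 * e n <= ps x.
    by apply: ub_le_sup; [exists (phi 0%N x + C1 * e 0%N); exact: Sub|exists n].
  lra.
have off x : ~~ (a < x < b) -> ps x = 0.
  move=> h; apply/eqP; rewrite -normr_eq0; apply/eqP/le_anti; rewrite normr_ge0 andbT.
  apply/ler_addgt0Pl => d d0; rewrite addr0.
  have Bn n : `|ps x| <= C1 * e n by have := B n x; rewrite (test_off (T n) h) sub0r normrN.
  have [n Hn] : exists n, (C1 * e n <= d).
    have := archi_boundP (divr_ge0 C10 (ltW d0)); set N := Num.bound _ => hN.
    exists N; rewrite /e ler_pdivrMr ?ltr0n// mulrC -ler_pdivrMr//; apply: (le_trans (ltW hN)).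
    by rewrite ler_nat.
  exact: le_trans (Bn n) Hn.
have small d : 0 < d -> exists n, e n <= d.
  move=> d0; have := archi_boundP (ltW (_ : 0 < d^-1)); rewrite invr_gt0 => /(_ d0); set N := Num.bound _ => hN.
  exists N; rewrite /e invf_ple ?posrE ?ltr0n//; apply: (le_trans (ltW hN)).
  by rewrite ler_nat.
have [L1 L10 HL1] := test_lip (T 0%N).
(* The bound must not depend on n, whereas the Lipschitz constants of the approximants might: only
   [phi 0] is estimated by its constant L1, for |x - y| <= 1, and by its supremum otherwise. The
   difference phi n - phi 0 contributes 5 K, because (e n + e 0)^2 <= 4. *)
pose C := L1 + 2 * (L1 * L) + 5 * K.
have C0 : 0 <= C by rewrite /C !addr_ge0 ?mulr_ge0// ltW.
have m20 : 0 < m / 2 by move: m0; lra.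
have Hld n x y : `|phi n x - phi n y| <= C * `|x - y| `^ (m / 2).
  have [->|ne] := eqVneq x y; first by rewrite !subrr !normr0 powR0 ?gt_eqF// mulr0.
  have d0 : 0 < `|x - y| by rewrite normr_gt0 subr_eq0.
  set d := `|x - y| in d0 *.
  have p0 : 0 < d `^ (m / 2) by rewrite powR_gt0.
  have ki : 0 < (d `^ (m / 2))^-1 by rewrite invr_gt0.
  have := HK n 0%N _ x y ki; rewrite -/d invrK.
  have -> : d `^ m = d `^ (m / 2) * d `^ (m / 2) by rewrite powR_mul//; congr (_ `^ _); field.
  rewrite mulKf ?gt_eqF// => h1.
  have h2 : `|phi 0%N x - phi 0%N y| <= (L1 + 2 * (L1 * L)) * d `^ (m / 2).
    have [d1|d1] := leP d 1.
      apply: (le_trans (HL1 x y)); rewrite -/d; apply: ler_pM => //; first exact: ltW.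
        by rewrite lerDl !mulr_ge0// ltW.
      rewrite -[leLHS]powRr1; last exact: ltW.
      have := pow_cmp d0 d1 (_ : m / 2 <= 1); rewrite powR1 mul1r; apply.
      by move: m1; lra.
    have q1 : 1 <= d `^ (m / 2) by rewrite -[leLHS](powRr0 d); exact: (ler_powR (ltW d1) (ltW m20)).
    have Bd z : `|phi 0%N z| <= L1 * L.
      case: (boolP (a < z < b)) => h; last by rewrite (test_off (T 0%N) h) normr0 mulr_ge0// ltW.
      have := HL1 z a; rewrite (test_off (T 0%N) na) subr0 => /le_trans; apply; apply: ler_wpM2l => //.
      exact: norm_sub_le.
    apply: (le_trans (ler_normB _ _)); apply: (le_trans (lerD (Bd x) (Bd y))).
    apply: (@le_trans _ _ ((L1 + 2 * (L1 * L)) * 1)); first by lra.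
    by apply: ler_wpM2l => //; rewrite addr_ge0// !mulr_ge0// ltW.
  have h3 : (e n + e 0%N) ^+ 2 <= 4.
    have := e1 n; have := e1 0; have := e0 n; have := e0 0 => q1 q2 q3 q4.
    have -> : 4 = (2 : R) ^+ 2 by ring.
    by rewrite ler_pXn2r ?nnegrE//; lra.
  have h4 : K * (d `^ (m / 2) + d `^ (m / 2) * (e n + e 0%N) ^+ 2) <= 5 * K * d `^ (m / 2).
    rewrite (_ : 5 * K * _ = K * (d `^ (m / 2) + d `^ (m / 2) * 4)); last by ring.
    by apply: ler_wpM2l => //; rewrite lerD2l; apply: ler_wpM2l => //; exact: ltW.
  rewrite (_ : _ - _ = (phi n x - phi 0%N x - (phi n y - phi 0%N y)) + (phi 0%N x - phi 0%N y)); last by ring.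
  apply: (le_trans (ler_normD _ _)); apply: (le_trans (lerD (le_trans h1 h4) h2)).
  by rewrite /C le_eqVlt; apply/orP; left; apply/eqP; ring.
have Hps x y : `|ps x - ps y| <= C * `|x - y| `^ (m / 2).
  apply/ler_addgt0Pl => d d0.
  have [|n Hn] := small (d / (2 * (C1 + 1))); first by rewrite divr_gt0// mulr_gt0//; lra.
  have h1 : C1 * e n <= d / 2.
    apply: (@le_trans _ _ ((C1 + 1) * (d / (2 * (C1 + 1))))).
      by apply: ler_pM => //; [exact: ltW|lra].
    by rewrite le_eqVlt; apply/orP; left; apply/eqP; field; rewrite gt_eqF//; lra.
  have := B n x; have := B n y; have := Hld n x y.
  rewrite (_ : ps x - ps y = (phi n x - phi n y) - (phi n x - ps x) + (phi n y - ps y)); last by ring.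
  move: (C * _) (phi n x - phi n y) (phi n x - ps x) (phi n y - ps y) => q u v w h3 h4 h5.
  have := ler_normD (u - v) w; have := ler_normB u v; lra.
exists ps; exists C; first exact: C0.
split; [exact: Hps|exact: off|].
pose g x := chi (a < x < b) * psi x - ps x.
have cps : continuous ps by apply: (hoelder_continuous (e := m / 2) C0 m20) => ? ?; exact: Hps.
have mps : measurable_fun setT ps by exact: continuous_measurable_fun.
have [i2 i1] := psi_sq; have mp := itg_meas i1.
have [ic Ec] := itg_chi a b; have {}Ec := Ec hab.
(* For every n a majorant of (psi - ps)^2, with integral O(e n): the L^2 error of phi n plus its
   uniform distance to ps. *)
pose G n x := 2 * ((chi (a < x < b) * psi x - phi n x) ^+ 2) + (2 * (C1 * e n) ^+ 2) * chi (a < x < b).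
have iG n : itg (G n) by have [_ i _] := H n; apply: itgD; apply: itgZ.
have gG n x : g x ^+ 2 <= G n x.
  rewrite /G /g; case: (boolP (a < x < b)) => h.
    rewrite (chiT isT) mul1r mulr1.
    have hB := B n x; have Cn := mulr_ge0 C10 (ltW (e0 n)).
    have : (phi n x - ps x) ^+ 2 <= (C1 * e n) ^+ 2.
      by rewrite -[leLHS]real_normK ?num_real// ler_pXn2r ?nnegrE.
    have := sqr_ge0 ((psi x - phi n x) - (phi n x - ps x)).
    rewrite (_ : psi x - ps x = (psi x - phi n x) + (phi n x - ps x)); last by ring.
    move: (psi x - phi n x) (phi n x - ps x) => u v; rewrite sqrrB sqrrD; lra.
  rewrite (chiF (_ : ~~ false))// !mul0r (off x h) subrr expr0n mulr0 addr0.
  by rewrite mulr_ge0 ?sqr_ge0.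
have ig : itg (fun x => g x ^+ 2).
  apply: (itg_le _ _ (iG 0%N)); first by apply: measurable_funX; apply: measurable_funB.
  by move=> x; rewrite ger0_norm ?sqr_ge0.
have Z : {ae mu, forall x, g x ^+ 2 = 0}.
  apply: (zero_ae ig); first by move=> x; exact: sqr_ge0.
  pose M := 2 + 2 * C1 ^+ 2 * L.
  have M0 : 0 < M by rewrite ltr_pwDl//; exact: (mulr_ge0 (mulr_ge0 (ler0n _ 2) (sqr_ge0 C1)) (ltW L0)).
  have F n : Int (fun x => g x ^+ 2) <= M * e n.
    apply: (@le_trans _ _ (Int (G n))); first by apply: le_Int; [exact: ig|exact: iG|exact: gG].
    have [_ i l] := H n; rewrite /G (IntD (itgZ _ i) (itgZ _ ic)) (IntZ _ i) (IntZ _ ic) Ec -/L.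
    have q : e n ^+ 2 <= e n by rewrite expr2 ler_piMl// ltW.
    move: (Int _) l => I l; rewrite /M exprMn.
    apply: (@le_trans _ _ ((2 + 2 * C1 ^+ 2 * L) * e n ^+ 2)); last by apply: ler_wpM2l => //; exact: ltW.
    rewrite [leRHS]mulrDl; apply: lerD; first by rewrite ler_pM2l.
    by rewrite le_eqVlt; apply/orP; left; apply/eqP; ring.
  move: (Int _) F => I F; apply/ler_addgt0Pl => d d0; rewrite addr0.
  have [|n Hn] := small (d / M); first exact: divr_gt0.
  by apply: (le_trans (F n)); rewrite mulrC -ler_pdivlMr.
apply: ae_imp Z => x /eqP; rewrite sqrf_eq0 /g => /eqP + h; rewrite (chiT h) mul1r => /eqP.
by rewrite subr_eq0 => /eqP.
Qed.

End TestFun.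

(** * Reduction to a convolution equation *)

Section RiemannLiouville.
Variable R : realType.
Notation mu := (@lebesgue_measure R).

(** The integrands on closed intervals may differ from their versions with [pp] at the two end
    points; measurability of H follows from that of h. *)
Lemma Rintegral_modify (H h : R -> R) p q : itg h -> (forall t, t != p -> t != q -> H t = h t) ->
  \int[mu]_t H t = Int h.
Proof.
move=> ih E; have mh := itg_meas ih.
have meq (r : R) : measurable_fun setT (fun t => t == r).
  rewrite (_ : (fun t => _) = fun t => (t <= r) && (r <= t)); last by apply/funext => t; rewrite eq_le.
  by mea.
have mH : measurable_fun setT H.
  rewrite (_ : H = fun t => if t == p then H p else if t == q then H q else h t).
    apply: measurable_fun_ifT; [exact: meq|exact: measurable_cst|].
    apply: measurable_fun_ifT; [exact: meq|exact: measurable_cst|exact: mh].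
  apply/funext => t; case: ifP => [/eqP -> //|/negbT tp].
  by case: ifP => [/eqP -> //|/negbT tq]; exact: E.
have A : {ae mu, forall t, h t = H t}.
  by apply: ae_imp (ae_and (ae_neq p) (ae_neq q)) => t [tp tq]; rewrite E.
have iH := ae_itg mH A ih.
by rewrite /Rintegral (itgE iH) /= (ae_Int mh mH A).
Qed.

Lemma RL_leftE a s (w : R -> R) x : a < x -> itg (fun t => pp (s - 1) (x - t) * (chi (a < t) * w t)) ->
  RL_left a s w x = (Gamma s)^-1 * Int (fun t => pp (s - 1) (x - t) * (chi (a < t) * w t)).
Proof.
move=> ax i; rewrite /RL_left Rintegral_mkcond; congr (_ * _).
apply: (Rintegral_modify (p := a) (q := x) i) => t ta tx.
rewrite patchE mem_setE in_itv/= !le_eqVlt (negbTE tx) eq_sym (negbTE ta)/=.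
have [at_|at_] := ltP a t; last by rewrite mul0r mulr0.
have [xt|xt] := ltP t x; first by rewrite pp_pos ?subr_gt0// mul1r.
by rewrite pp_neg ?mul0r// subr_le0.
Qed.

Lemma RL_rightE b s (w : R -> R) x : x < b -> itg (fun t => pp (s - 1) (t - x) * (chi (t < b) * w t)) ->
  RL_right b s w x = (Gamma s)^-1 * Int (fun t => pp (s - 1) (t - x) * (chi (t < b) * w t)).
Proof.
move=> ax i; rewrite /RL_right Rintegral_mkcond; congr (_ * _).
apply: (Rintegral_modify (p := b) (q := x) i) => t ta tx.
rewrite patchE mem_setE in_itv/= !le_eqVlt (negbTE ta) eq_sym (negbTE tx)/=.
have [at_|at_] := ltP t b; last by rewrite andbF mul0r mulr0.
have [xt|xt] := ltP x t; first by rewrite pp_pos ?subr_gt0// mul1r.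
by rewrite pp_neg ?mul0r// subr_le0.
Qed.

Lemma Gamma_gt0 (s : R) : 0 < s -> s < 2 -> 0 < Gamma s.
Proof.
move=> s0 s2; pose h (t : R) := pp (s - 1) t * expR (- t).
have h0 t : 0 <= h t by rewrite mulr_ge0 ?pp_ge0 ?expR_ge0.
have mh : measurable_fun setT h.
  apply: measurable_funM; first exact: measurable_pp.
  by apply: (measurableT_comp (@measurable_expR R)); mea.
have e1 : -1 < s - 1 by lra.
have e2 : s - 4 < -1 by lra.
have [i1 _] := @pp_near0 R (s - 1) 2 e1 ltac:(lra); have [i2 _] := pp_neary e2 ltr01.
have ih : itg h.
  (* The factor 6 is 3!: the exponential series gives exp(- t) <= 6 t^(-3), hence the exponent s - 4
     at infinity. *)
  apply: (itg_le mh _ (itgD i1 (itgZ 6 i2))) => t; rewrite ger0_norm//.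
  have [t0|t0] := leP t 0; first by rewrite /h !pp_neg// !mulr0 mul0r addr0.
  rewrite /h !(pp_pos _ t0); have p0 := powR_ge0 t (s - 1).
  have [t1|t1] := leP t 1.
    have t2 : t < 2 by lra.
    rewrite (chiT t2) (_ : chi false = 0)// mul0r mulr0 addr0.
    by rewrite mul1r ler_piMr// -expR0 ler_expR; lra.
  rewrite (chiT isT) mul1r -[leLHS]add0r; apply: lerD; first by rewrite mulr_ge0 ?chi_ge0.
  have -> : t `^ (s - 4) = t `^ (s - 1) * t ^- 3.
    by rewrite -(powR_mulrn 3 (ltW t0)) -powRN -powRD ?(gt_eqF t0) ?implybT//; congr (_ `^ _); ring.
  have et := expR_gt0 t.
  rewrite mulrCA; apply: ler_wpM2l => //; rewrite expRN -ler_pdivrMl// mulrC.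
  have t3 : 0 < t ^+ 3 by rewrite exprn_gt0.
  rewrite -invfM lef_pV2 ?posrE ?expR_gt0 ?mulr_gt0//.
  have := expR_ge1Dxn 2 (ltW t0); rewrite (_ : 3`! = 6)//; move: (t ^+ 3) t3 => z z0.
  by move: (expR t) => y; lra.
have -> : Gamma s = Int h.
  rewrite /Gamma Rintegral_mkcond; apply: (Rintegral_modify (p := 0) (q := 0) ih) => t _ _.
  rewrite patchE mem_setE in_itv/= andbT /h; have [t0|t0] := ltP 0 t; first by rewrite pp_pos.
  by rewrite pp_neg// mul0r.
have c0 : 0 < 2^-1 * expR (- 2) :> R by rewrite mulr_gt0 ?expR_gt0.
apply: (Int_gt0 ih (a := 1) (b := 2) _ _ c0); [exact: aeW|lra|].
apply: aeW => t /andP[t1 t2]; have t0 : 0 < t by lra.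
rewrite /h pp_pos//; apply: ler_pM; [lra|exact: expR_ge0| |by rewrite ler_expR; lra].
apply: (@le_trans _ _ (t `^ (-1))); last by apply: ler_powR; lra.
by rewrite powR_inv1 ?lef_pV2 ?posrE; lra.
Qed.

Lemma ae_interval (P : R -> Prop) p q : {ae mu, forall x, P x} -> p < q -> exists2 y, p < y < q & P y.
Proof.
move=> H pq; apply: contrapT => N.
have [i E] := itg_chi p q; have {}E := E pq.
suff Z : Int (fun x : R => chi (p < x < q)) = Int (fun=> 0 : R).
  by move: E; rewrite Z (Int0 R) => /eqP; rewrite eq_sym subr_eq0 (gt_eqF pq).
apply: ae_Int; [exact: itg_meas i|exact: measurable_cst|].
apply: ae_imp H => x Px; case: (boolP (p < x < q)) => // h; exfalso; apply: N.
by exists x.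
Qed.

Lemma ae_eq_closed a b (u v : R -> R) : a < b -> continuous u -> continuous v ->
  {ae mu, forall x, a < x < b -> u x = v x} -> forall x, a <= x <= b -> u x = v x.
Proof.
move=> hab cu cv H x /andP[ax xb]; apply/eqP; rewrite -subr_eq0 -normr_eq0; apply/eqP/le_anti.
rewrite normr_ge0 andbT; apply/ler_addgt0Pl => e e0; rewrite addr0.
have cw : {for x, continuous (fun y => u y - v y)} by apply: cvgB; [exact: cu|exact: cv].
move: cw => /(@cvgrPdist_le _ R) /(_ e e0) [h h0 Hh]; have {}h0 : 0 < h := h0.
pose p := Num.max a (x - h); pose q := Num.min b (x + h).
have pq : p < q.
  by rewrite /p /q lt_min !gt_max; apply/andP; split; apply/andP; split => //; lra.
have [y /andP[py yq] Hy] := ae_interval H pq.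
move: py yq; rewrite /p /q lt_min gt_max => /andP[ay y1] /andP[yb y2].
have := Hh y; rewrite /= Hy ?ay// subrr subr0; apply.
by rewrite ltr_norml; lra.
Qed.

End RiemannLiouville.

(** * The equation in integrated form *)

Section Reduction.
Variable R : realType.
Notation mu := (@lebesgue_measure R).
Variables (a b : R).
Hypothesis hab : a < b.

(** Composed with the projection onto [a, b], f is continuous on the whole line, which gives the
    measurability of its restriction. *)
Lemma hoelder_meas lambda (f : R -> R) : 0 < lambda -> Defs.hoelder a b lambda f ->
  measurable_fun setT (fun z => chi (a < z < b) * f z) /\
  exists2 S, 0 <= S & forall z, `|chi (a < z < b) * f z| <= S * chi (a < z < b).
Proof.
move=> l0 [C HC].
have clE z : a < z < b -> clamp a b z = z.
  by move=> /andP[az zb]; rewrite /clamp min_l ?max_r// ltW.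
have cf : continuous (fun z => f (clamp a b z)).
  apply: (hoelder_continuous (C := `|C|) (e := lambda) (normr_ge0 _) l0) => x z.
  apply: (le_trans (HC _ _ (clamp_itv hab z) (clamp_itv hab x))); apply: (le_trans (ler_wpM2r (powR_ge0 _ _) (ler_norm C))).
  apply: ler_wpM2l => //; apply: ge0_ler_powR; rewrite ?nnegrE//; [exact: ltW|exact: clamp_lip].
have mf := continuous_measurable_fun cf.
split.
  rewrite (_ : (fun z => _) = fun z => chi (a < z < b) * f (clamp a b z)); first by mea.
  by apply/funext => z; case: (boolP (a < z < b)) => h; [rewrite clE|rewrite /chi/= !mul0r].
exists (`|f a| + `|C| * (b - a) `^ lambda); first by rewrite addr_ge0// mulr_ge0 ?powR_ge0.
move=> z; case: (boolP (a < z < b)) => h; last by rewrite /chi/= mul0r normr0 mulr0.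
rewrite (chiT isT) mul1r mulr1; move: h => /andP[az zb].
have za : a <= z <= b by rewrite !ltW.
have lt_sub1 : a <= a <= b by rewrite lexx ltW.
rewrite -(subrK (f a) (f z)) addrC; apply: (le_trans (ler_normD _ _)); apply: lerD => //.
apply: (le_trans (HC _ _ za lt_sub1)); apply: (le_trans (ler_wpM2r (powR_ge0 _ _) (ler_norm C))).
apply: ler_wpM2l => //; apply: ge0_ler_powR; rewrite ?nnegrE ?subr_ge0//; [exact: ltW|exact: ltW|].
rewrite gtr0_norm ?subr_gt0//; lra.
Qed.

Lemma primitive_lip (h : R -> R) S x z : 0 <= S -> measurable_fun setT h ->
  (forall y, `|h y| <= S * chi (a < y < b)) ->
  `|Int (fun y => chi (a < y < z) * h y) - Int (fun y => chi (a < y < x) * h y)| <= 2 * S * `|z - x|.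
Proof.
move=> S0 mh hS.
have [ic _] := itg_chi a b; have ih : itg h := itg_le mh hS (itgZ S ic).
have j p : itg (fun y => chi (a < y < p) * h y) by apply: itg_chiM => //; mea.
wlog xz : x z / x < z.
  move=> H; have [->|] := eqVneq x z; first by rewrite !subrr normr0 mulr0.
  rewrite neq_lt => /orP[xz|xz]; first exact: H.
  by rewrite distrC (distrC z); exact: H.
(* The enlarged interval contains y = x, where the two indicators differ as well; this is the origin
   of the factor 2. *)
have lt2 : x - (z - x) < z by lra.
have [i E] := itg_chi (x - (z - x)) z; have {}E := E lt2.
rewrite -(IntB (j z) (j x)) (gtr0_norm (_ : 0 < z - x)) ?subr_gt0//.
have -> : 2 * S * (z - x) = Int (fun y => S * chi (x - (z - x) < y < z)) by rewrite (IntZ _ i) E; ring.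
apply: abs_Int_le; [exact: itg_meas (itgB (j z) (j x))| |exact: itgZ] => y.
have hy : `|h y| <= S by apply: (le_trans (hS y)); rewrite ler_piMr// chi_le1.
rewrite -mulrBl normrM mulrC; apply: ler_pM => //.
case: (boolP (a < y < z)) => h1.
  move: (h1) => /andP[h2 h3].
  case: (boolP (a < y < x)) => h4; first by rewrite subrr normr0 chi_ge0.
  rewrite (_ : chi false = 0)// subr0 ger0_norm ?chi_ge0// (chiT (_ : x - (z - x) < y < z))//.
  by move: h4; rewrite h2/= -leNgt h3 andbT => h4; lra.
rewrite (_ : chi false = 0)// (chiF (_ : ~~ (a < y < x))) ?subrr ?normr0 ?chi_ge0//.
by apply: contra h1 => /andP[-> h2] /=; lra.
Qed.

Variables (mu0 alpha beta c : R) (psi ps f : R -> R).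
Hypotheses (m0 : 0 < mu0) (m1 : mu0 < 1) (S : R) (S0 : 0 <= S) (cps : continuous ps)
  (psS : forall y, `|ps y| <= S * chi (a < y < b))
  (psE : {ae mu, forall x, a < x < b -> psi x = ps x})
  (mpsi : measurable_fun setT (fun x => chi (a < x < b) * psi x))
  (mf : measurable_fun setT (fun x => chi (a < x < b) * f x))
  (fS : forall y, `|chi (a < y < b) * f y| <= S * chi (a < y < b)).
Hypothesis psi_eq : {ae mu, forall x, a < x < b ->
  alpha * RL_left a (1 - mu0) psi x + beta * RL_right b (1 - mu0) psi x = RL_left a 1 f x + c}.

(** The factor left in front of f when the equation is multiplied by Gamma (1 - mu0). *)
Definition kap : R := Gamma (1 - mu0) * (Gamma 1)^-1.
Definition rhs z := kap * (chi (a < z < b) * f z).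

Lemma measurable_rhs : measurable_fun setT rhs.
Proof. by apply: measurable_funM. Qed.

Lemma rhs_le y : `|rhs y| <= (`|kap| * S) * chi (a < y < b).
Proof. by rewrite /rhs normrM -mulrA; apply: ler_wpM2l. Qed.

(** The left integral at x sees psi on ]a, x[ up to null sets only, so psi may be replaced by its
    continuous representative, which vanishes outside ]a, b[. *)
Lemma RL_left_ps x : a < x < b -> itg (fun t => pp (- mu0) (x - t) * ps t) /\
  RL_left a (1 - mu0) psi x = (Gamma (1 - mu0))^-1 * Int (fun t => pp (- mu0) (x - t) * ps t).
Proof.
move=> /andP[ax xb]; have mps := continuous_measurable_fun cps.
have e1 : -1 < - mu0 by move: m1; lra.
have e0 : - mu0 <= 0 by move: m0; lra.
have [C _ HC] := conv_bd 1 0 e1 e0 hab; have [i _] := HC ps S S0 mps psS x.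
have {}i : itg (fun t => pp (- mu0) (x - t) * ps t).
  by apply: eq_itg i => t; rewrite /ker mul1r mul0r addr0.
split; first exact: i.
have mh : measurable_fun setT (fun t : R => pp (- mu0) (x - t) * (chi (a < t < b) * psi t)).
  by apply: measurable_funM => //; mea.
have A : {ae mu, forall t, pp (- mu0) (x - t) * ps t = pp (- mu0) (x - t) * (chi (a < t < b) * psi t)}.
  apply: ae_imp psE => t H; case: (boolP (a < t < b)) => h; first by rewrite (chiT isT) mul1r H.
  by rewrite (_ : chi false = 0)// (off_zero psS h) mul0r.
have j := ae_itg mh A i.
have E t : pp (- mu0) (x - t) * (chi (a < t < b) * psi t) = pp (1 - mu0 - 1) (x - t) * (chi (a < t) * psi t).
  rewrite (_ : 1 - mu0 - 1 = - mu0); last by ring.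
  have [xt|xt] := leP x t; first by rewrite pp_neg ?mul0r// subr_le0.
  by rewrite (_ : t < b) ?andbT//; exact: lt_trans xb.
rewrite (RL_leftE ax (eq_itg E j)); congr (_ * _).
by rewrite -(eq_Int E) (ae_Int (itg_meas i) mh A).
Qed.

Lemma RL_right_ps x : a < x < b -> itg (fun t => pp (- mu0) (t - x) * ps t) /\
  RL_right b (1 - mu0) psi x = (Gamma (1 - mu0))^-1 * Int (fun t => pp (- mu0) (t - x) * ps t).
Proof.
move=> /andP[ax xb]; have mps := continuous_measurable_fun cps.
have e1 : -1 < - mu0 by move: m1; lra.
have e0 : - mu0 <= 0 by move: m0; lra.
have [C _ HC] := conv_bd 0 1 e1 e0 hab; have [i _] := HC ps S S0 mps psS x.
have {}i : itg (fun t => pp (- mu0) (t - x) * ps t).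
  by apply: eq_itg i => t; rewrite /ker mul1r mul0r add0r opprB.
split; first exact: i.
have mh : measurable_fun setT (fun t : R => pp (- mu0) (t - x) * (chi (a < t < b) * psi t)).
  by apply: measurable_funM => //; mea.
have A : {ae mu, forall t, pp (- mu0) (t - x) * ps t = pp (- mu0) (t - x) * (chi (a < t < b) * psi t)}.
  apply: ae_imp psE => t H; case: (boolP (a < t < b)) => h; first by rewrite (chiT isT) mul1r H.
  by rewrite (_ : chi false = 0)// (off_zero psS h) mul0r.
have j := ae_itg mh A i.
have E t : pp (- mu0) (t - x) * (chi (a < t < b) * psi t) = pp (1 - mu0 - 1) (t - x) * (chi (t < b) * psi t).
  rewrite (_ : 1 - mu0 - 1 = - mu0); last by ring.
  have [xt|xt] := leP t x; first by rewrite pp_neg ?mul0r// subr_le0.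
  by rewrite (_ : a < t) ?andbT//; exact: lt_trans xt.
rewrite (RL_rightE xb (eq_itg E j)); congr (_ * _).
by rewrite -(eq_Int E) (ae_Int (itg_meas i) mh A).
Qed.

Lemma RL_left_f x : a < x < b -> RL_left a 1 f x = (Gamma 1)^-1 * Int (fun t => chi (a < t < x) * (chi (a < t < b) * f t)).
Proof.
move=> /andP[ax xb]; have [ic _] := itg_chi a b; have i := itg_le mf fS (itgZ S ic).
have j : itg (fun t => chi (a < t < x) * (chi (a < t < b) * f t)) by apply: itg_chiM => //; mea.
have E t : chi (a < t < x) * (chi (a < t < b) * f t) = pp (1 - 1) (x - t) * (chi (a < t) * f t).
  have [xt|xt] := leP x t; first by rewrite andbF pp_neg ?mul0r// subr_le0.
  rewrite (_ : t < b) ?andbT; last exact: lt_trans xb.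
  rewrite pp_pos ?subr_gt0// subrr powRr0.
  by case: (a < t); rewrite /chi/= ?mul1r ?mul0r.
by rewrite (RL_leftE ax (eq_itg E j)); rewrite -(eq_Int E).
Qed.

(** Both sides of the equation are continuous in x, so it holds everywhere on [a, b], end points
    included; the constant c disappears on taking increments. *)
Lemma cK_eqn x x' : a <= x -> x < x' -> x' <= b ->
  cK mu0 alpha beta ps x' - cK mu0 alpha beta ps x = Int (fun z => chi (x < z < x') * rhs z).
Proof.
have mps := continuous_measurable_fun cps; have mff := measurable_rhs; have ffS := rhs_le.
have e1 : -1 < - mu0 by move: m1; lra.
have e0 : - mu0 < 0 by move: m0; lra.
have G0 : 0 < Gamma (1 - mu0) by apply: Gamma_gt0; move: m0 m1; lra.
have kS0 : 0 <= `|kap| * S by rewrite mulr_ge0.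
have [ic _] := itg_chi a b; have iff_ := itg_le mff ffS (itgZ _ ic).
pose u := cK mu0 alpha beta ps.
pose v x := Int (fun z => chi (a < z < x) * rhs z) + Gamma (1 - mu0) * c.
have cu : continuous u.
  have [C C0 HC] := conv_mod alpha beta e1 e0 hab.
  apply: (hoelder_continuous (C := C * S) (e := - mu0 + 1)); [by rewrite mulr_ge0|by lra|].
  by move=> y z; exact: HC.
have cv : continuous v.
  apply: (hoelder_continuous (C := 2 * (`|kap| * S)) (e := 1)); [by rewrite mulr_ge0|by []|].
  move=> y z; rewrite /v powRr1// (_ : _ + _ - _ = Int (fun y => chi (a < y < z) * rhs y) - Int (fun w => chi (a < w < y) * rhs w)); last by ring.
  exact: primitive_lip.
have A : {ae mu, forall x, a < x < b -> u x = v x}.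
  apply: ae_imp psi_eq => y H yab; have {}H := H yab.
  have [i1 E1] := RL_left_ps yab; have [i2 E2] := RL_right_ps yab.
  move: H; rewrite E1 E2 (RL_left_f yab) => /(congr1 (fun z => Gamma (1 - mu0) * z)).
  have i := itg_le mf fS (itgZ S ic).
  have j : itg (fun t => chi (a < t < y) * (chi (a < t < b) * f t)) by apply: itg_chiM => //; mea.
  have -> : v y = kap * Int (fun t => chi (a < t < y) * (chi (a < t < b) * f t)) + Gamma (1 - mu0) * c.
    by rewrite /v -(IntZ _ j); congr (_ + _); apply: eq_Int => t; rewrite /rhs mulrCA.
  have -> : u y = alpha * Int (fun t => pp (- mu0) (y - t) * ps t) + beta * Int (fun t => pp (- mu0) (t - y) * ps t).
    rewrite -(IntZ _ i1) -(IntZ _ i2) -(IntD (itgZ _ i1) (itgZ _ i2)); apply: eq_Int => t.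
    by rewrite /ker opprB; ring.
  rewrite /kap; clear i1 i2 E1 E2 i j.
  move: (Int (fun t => pp (- mu0) (y - t) * ps t)) (Int (fun t => pp (- mu0) (t - y) * ps t)) => I1 I2.
  move: (Int _) => I3 H.
  rewrite mulrDr mulrA in H.
  have g1 : Gamma (1 - mu0) != 0 by rewrite gt_eqF.
  transitivity (Gamma (1 - mu0) * (alpha * ((Gamma (1 - mu0))^-1 * I1)) + Gamma (1 - mu0) * (beta * ((Gamma (1 - mu0))^-1 * I2))).
    by field.
  by rewrite [_ * (alpha * _)]mulrA H; ring.
have B := ae_eq_closed hab cu cv A.
move=> ax xx xb.
have xx' : a <= x <= b by lra.
have xx'' : a <= x' <= b by lra.
rewrite -/u (B _ xx') (B _ xx'') /v (chi_split ax (ltW xx) iff_).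
by move: (Int _) (Int _) => I1 I2; ring.
Qed.

End Reduction.

(** * Weighted Hoelder functions *)

Section Weight.
Variable R : realType.

Lemma powR_between (e p q r : R) : 0 < p -> p <= r -> r <= q -> r `^ e <= p `^ e + q `^ e.
Proof.
move=> p0 pr rq; have r0 := lt_le_trans p0 pr.
have [e0|e0] := leP 0 e.
  rewrite -[leLHS]add0r; apply: lerD; first exact: powR_ge0.
  by apply: ge0_ler_powR; rewrite ?nnegrE//; lra.
rewrite -[leLHS]addr0; apply: lerD; last exact: powR_ge0.
by apply: powR_anti => //; exact: ltW.
Qed.

(** Homogeneity reduces the estimate to r = 1, where r' stays in [1/2, 3/2] and the mean value
    theorem applies for either sign of e. *)
Lemma powR_rel_lip (e : R) : exists2 c, 0 <= c & forall r r', 0 < r -> `|r' - r| <= r / 2 ->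
  `|r' `^ e - r `^ e| <= c * (r `^ e * (`|r' - r| / r)).
Proof.
pose c := `|e| * (2^-1 `^ (e - 1) + 2 `^ (e - 1)).
have c0 : 0 <= c by rewrite mulr_ge0// addr_ge0 ?powR_ge0.
exists c; first exact: c0.
have P x y : 2^-1 <= x -> x < y -> y <= 2 -> `|y `^ e - x `^ e| <= c * `|y - x|.
  move=> x1 xy y2; have x0 : 0 < x by lra.
  have [t /andP[t1 t2] ->] := powR_mvt e x0 xy.
  rewrite !(normrM (e * _)) (normrM e); apply: ler_wpM2r => //; apply: ler_wpM2l => //.
  by rewrite ger0_norm ?powR_ge0//; apply: powR_between; lra.
have Q u : `|u - 1| <= 2^-1 -> `|u `^ e - 1| <= c * `|u - 1|.
  rewrite ler_norml => /andP[u1 u2]; have [->|] := eqVneq u 1.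
    by rewrite powR1 !subrr normr0 mulr0.
  rewrite neq_lt => /orP[u3|u3].
    by have := P u 1; rewrite powR1 distrC [`|1 - u|]distrC; apply; lra.
  by have := P 1 u; rewrite powR1; apply; lra.
move=> r r' r0 rr; pose u := r' / r.
have ur : r' = r * u by rewrite /u mulrC divfK// gt_eqF.
have nu : `|u - 1| = `|r' - r| / r.
  by rewrite -[X in _ / X](gtr0_norm r0) -normf_div mulrBl divff// gt_eqF.
have h : `|u - 1| <= 2^-1 by rewrite nu ler_pdivrMr// mulrC.
have u0 : 0 <= u by move: h; rewrite ler_norml => /andP[h _]; lra.
rewrite -nu ur powRM//; last exact: ltW.
rewrite -{2}[r `^ e]mulr1 -mulrBr normrM ger0_norm ?powR_ge0// mulrCA.
by apply: ler_wpM2l; [exact: powR_ge0|exact: Q].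
Qed.

Variables (a b : R).
Hypothesis hab : a < b.
Local Notation dist := (dist a b).

(** The larger of x - a and b - x stays between L/2 and L, so its power is bounded; the smaller one
    is the distance to the end points. *)
Lemma weight_bound (E1 E2 q : R) : - q <= E1 -> - q <= E2 -> exists2 W, 0 <= W & forall x, a < x < b ->
  (x - a) `^ E1 * (b - x) `^ E2 <= W * dist x `^ (- q).
Proof.
move=> q1 q2; pose L := b - a; have L0 : 0 < L by rewrite subr_gt0.
pose B e := (L / 2) `^ e + L `^ e.
have B0 e : 0 <= B e by rewrite addr_ge0 ?powR_ge0.
have HB e r : L / 2 <= r -> r <= L -> r `^ e <= B e by move=> ? ?; apply: powR_between => //; rewrite divr_gt0.
have p0 := @powR_ge0 R.
exists (L `^ (E1 + q) * B E2 + L `^ (E2 + q) * B E1); first by rewrite addr_ge0 ?mulr_ge0.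
move=> x /andP[ax xb]; rewrite mulrDl.
have [h|h] := leP (x - a) (b - x).
  have -> : dist x = x - a by rewrite /dist min_l.
  rewrite -[leLHS]addr0; apply: lerD; last by rewrite !mulr_ge0.
  have := pow_cmp (_ : 0 < x - a) (_ : x - a <= L) q1; rewrite opprK => H.
  rewrite mulrAC; apply: ler_pM => //; first by apply: H; rewrite /L; lra.
  by apply: HB; rewrite /L; lra.
have -> : dist x = b - x by rewrite /dist min_r// ltW.
rewrite -[leLHS]add0r; apply: lerD; first by rewrite !mulr_ge0.
have := pow_cmp (_ : 0 < b - x) (_ : b - x <= L) q2; rewrite opprK => H.
rewrite mulrC mulrAC; apply: ler_pM => //; first by apply: H; rewrite /L; lra.
by apply: HB; rewrite /L; lra.
Qed.

(** The increment of f = g w has two parts. The increment of g carries the exponent lam directly.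
    The relative change of the weight w is only O(|z - x| / d), but it is multiplied by g x, which
    is O(d^lam) because g vanishes at the end points. *)
Lemma weighted_hoelder (lam e1 e2 q : R) (f : R -> R) : 0 < lam -> lam <= 1 -> 1 - q <= e1 -> 1 - q <= e2 ->
  hoelder0_weighted a b lam e1 e2 f ->
  exists2 C, 0 <= C & forall x z, a < x < b -> `|z - x| <= dist x / 2 ->
    `|f z - f x| <= C * (`|z - x| `^ lam * dist x `^ (- q)).
Proof.
move=> l0 l1 q1 q2 [g [[C HC] ga gb] Hf].
have p1 : - q <= e1 - 1 by lra.
have p2 : - q <= e2 - 1 by lra.
have [W W0 HW] := weight_bound p1 p2.
have [c1 c10 H1] := powR_rel_lip (e1 - 1); have [c2 c20 H2] := powR_rel_lip (e2 - 1).
pose w x := (x - a) `^ (e1 - 1) * (b - x) `^ (e2 - 1).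
have w0 x : 0 <= w x by rewrite mulr_ge0 ?powR_ge0.
have fE x : a < x < b -> f x = g x * w x.
  by move=> h; rewrite (Hf x h) invfM -!powRN !opprB.
have [K K0 {}HC] : exists2 K, 0 <= K & forall x y, a <= x <= b -> a <= y <= b -> `|g x - g y| <= K * `|x - y| `^ lam.
  exists `|C|; first exact: normr_ge0.
  move=> x y hx hy; apply: (le_trans (HC _ _ hx hy)); apply: ler_wpM2r; [exact: powR_ge0|exact: ler_norm].
pose c := c1 * (1 + c2) + c2.
have c0 : 0 <= c by rewrite addr_ge0// mulr_ge0// addr_ge0.
exists (K * (1 + c) * W + K * c * W); first by rewrite addr_ge0 ?mulr_ge0// addr_ge0.
move=> x z hx hz; have d0 := dist_gt0 hx; have [da db] := dist_le a b x.
have [ax xb] := andP hx; set d := dist x in hz d0 da db *.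
move: (hz); rewrite ler_norml => /andP[z1 z2].
have hz' : a < z < b by lra.
(* The relative displacement; as t <= 1 and lam <= 1, d^lam t <= d^lam t^lam = |z - x|^lam. *)
pose t := `|z - x| / d; have t0 : 0 <= t by rewrite divr_ge0// ltW.
have t1 : t <= 1 by rewrite /t ler_pdivrMr// mul1r; lra.
have rel r : d <= r -> `|z - x| / r <= t.
  by move=> dr; rewrite /t ler_wpM2l// lef_pV2 ?posrE//; exact: lt_le_trans dr.
have x0 : 0 < x - a by lra.
have x0' : 0 < b - x by lra.
have pa : 0 <= (x - a) `^ (e1 - 1) by exact: powR_ge0.
have pb : 0 <= (b - x) `^ (e2 - 1) by exact: powR_ge0.
have U1 : `|(z - a) `^ (e1 - 1) - (x - a) `^ (e1 - 1)| <= c1 * ((x - a) `^ (e1 - 1) * t).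
  have E : z - a - (x - a) = z - x by ring.
  have := H1 (x - a) (z - a) x0; rewrite E => /(_ ltac:(clear -hz da; lra)) /le_trans; apply.
  by apply: ler_wpM2l => //; apply: ler_wpM2l => //; exact: rel.
have U2 : `|(b - z) `^ (e2 - 1) - (b - x) `^ (e2 - 1)| <= c2 * ((b - x) `^ (e2 - 1) * t).
  have E : `|b - z - (b - x)| = `|z - x| by rewrite distrC; congr `|_|; ring.
  have := H2 (b - x) (b - z) x0'; rewrite E => /(_ ltac:(clear -hz db; lra)) /le_trans; apply.
  by apply: ler_wpM2l => //; apply: ler_wpM2l => //; exact: rel.
have V : `|w z - w x| <= c * (w x * t).
  rewrite /w; move: U1 U2 pa pb.
  move: ((x - a) `^ _) ((b - x) `^ _) ((z - a) `^ _) ((b - z) `^ _) => p r p' r' U1 U2 pa pb.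
  have V2 : `|r'| <= (1 + c2) * r.
    rewrite -(subrK r r'); apply: (le_trans (ler_normD _ _)); rewrite (ger0_norm pb).
    have : c2 * (r * t) <= c2 * r by apply: ler_wpM2l => //; rewrite ler_piMr.
    clear -U2; lra.
  rewrite (_ : p' * r' - p * r = (p' - p) * r' + p * (r' - r)); last by ring.
  apply: (le_trans (ler_normD _ _)); rewrite !normrM (ger0_norm pa).
  have A1 : `|p' - p| * `|r'| <= c1 * (p * t) * ((1 + c2) * r) by apply: ler_pM.
  have A2 : p * `|r' - r| <= p * (c2 * (r * t)) by apply: ler_wpM2l.
  apply: (le_trans (lerD A1 A2)); rewrite le_eqVlt; apply/orP; left; apply/eqP; rewrite /c; ring.
have gx : `|g x| <= K * d `^ lam.
  have hx' : a <= x <= b by rewrite !ltW.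
  have ha' : a <= a <= b by rewrite lexx ltW.
  have hb' : a <= b <= b by rewrite lexx ltW.
  have [E|E] : d = x - a \/ d = b - x by rewrite /d /dist /Num.min; case: ifP => _; [left|right].
    by have := HC x a hx' ha'; rewrite ga subr0 (gtr0_norm x0) -E.
  by have := HC x b hx' hb'; rewrite gb subr0 (distrC x) (gtr0_norm x0') -E.
have gz : `|g z - g x| <= K * `|z - x| `^ lam.
  by apply: HC; [move: hz'|move: hx] => /andP[h1 h2]; rewrite !ltW.
have tl : d `^ lam * t <= `|z - x| `^ lam.
  have -> : `|z - x| = d * t by rewrite /t mulrC divfK// gt_eqF.
  rewrite powRM//; last exact: ltW.
  apply: ler_wpM2l; first exact: powR_ge0.
  have [->|tn] := eqVneq t 0; first exact: powR_ge0.
  have t00 : 0 < t by rewrite lt_neqAle eq_sym tn.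
  have := pow_cmp t00 t1 l1; rewrite powR1 mul1r powRr1//.
have Wx : w x <= W * d `^ (- q) by exact: HW.
have wz : w z <= (1 + c) * w x.
  have : c * (w x * t) <= c * w x by apply: ler_wpM2l => //; rewrite ler_piMr.
  have := ler_norm (w z - w x); clear -V; lra.
rewrite (fE _ hx) (fE _ hz') (_ : g z * w z - g x * w x = (g z - g x) * w z + g x * (w z - w x)); last by ring.
apply: (le_trans (ler_normD _ _)); rewrite (normrM (g z - g x)) (normrM (g x)) (ger0_norm (w0 z)) [leRHS]mulrDl; apply: lerD.
  apply: (@le_trans _ _ (K * `|z - x| `^ lam * ((1 + c) * (W * d `^ (- q))))).
    apply: ler_pM => //; apply: (le_trans wz); apply: ler_wpM2l => //; exact: addr_ge0.
  by rewrite le_eqVlt; apply/orP; left; apply/eqP; ring.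
apply: (@le_trans _ _ (K * d `^ lam * (c * (W * d `^ (- q) * t)))).
  apply: ler_pM => //; apply: (le_trans V); apply: ler_wpM2l => //; exact: ler_wpM2r.
rewrite (_ : K * _ * _ = K * c * W * (d `^ lam * t * d `^ (- q))); last by ring.
apply: ler_wpM2l; first by rewrite !mulr_ge0.
by apply: ler_wpM2r => //; exact: powR_ge0.
Qed.

End Weight.

(** * Assembly *)

Section Assembly.
Variable R : realType.

(** Since h <= d, the surplus power of h in h^2 may be traded for the same power of d; this gives
    all terms of the second-difference bound the common form h^(m + lam) d^(- Q). *)
Lemma sqr_powR_le (L h d m lam e Q : R) : 0 < h -> h <= d -> d <= L -> m + lam <= 2 -> lam + e <= Q ->
  h ^+ 2 * d `^ (m - 2 - e) <= L `^ (Q - (lam + e)) * (h `^ (m + lam) * d `^ (- Q)).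
Proof.
move=> h0 hd dL ml lQ; have d0 := lt_le_trans h0 hd.
have A : h ^+ 2 <= h `^ (m + lam) * d `^ (2 - m - lam).
  have -> : h ^+ 2 = h `^ ((m + lam) + (2 - m - lam)).
    by rewrite -(powR_mulrn 2 (ltW h0)); congr (_ `^ _); ring.
  rewrite -powR_mul//; apply: ler_wpM2l; first exact: powR_ge0.
  by apply: ge0_ler_powR; rewrite ?nnegrE; lra.
have := pow_cmp d0 dL (_ : - Q <= - (lam + e)); rewrite (_ : - (lam + e) - - Q = Q - (lam + e)); last by ring.
move=> /(_ ltac:(lra)) B.
apply: (le_trans (ler_wpM2r (powR_ge0 d (m - 2 - e)) A)).
rewrite -mulrA powR_mul// (_ : 2 - m - lam + (m - 2 - e) = - (lam + e)); last by ring.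
by rewrite [leRHS]mulrCA; apply: ler_wpM2l => //; exact: powR_ge0.
Qed.

End Assembly.

Theorem theorem1 (R : realType) (a b alpha beta mu sigma c : R)
    (psi f : R -> R)
    (ab : a < b) (alpha01 : 0 < alpha < 1) (beta01 : 0 < beta < 1)
    (mu01 : 0 < mu < 1) (alpha_beta : alpha + beta = 1)
    (sigma01 : 0 < sigma < 1)
    (psiH : sobolev0 a b ((1 + mu) / 2) psi)
    (fH : (hoelder_any a b `&` Hstar_above a b sigma) f)
    (psi_eq : {ae @lebesgue_measure R, forall x : R, a < x < b ->
       alpha * RL_left a (1 - mu) psi x + beta * RL_right b (1 - mu) psi x =
       RL_left a 1 f x + c}) :
  exists2 K : R -> R, Hstar a b K &
    {ae @lebesgue_measure R, forall x : R, a < x < b ->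
       psi x = RL_left a (mu + sigma) K x}.
Proof.
move: alpha01 beta01 mu01 sigma01 => /andP[al0 _] /andP[be0 _] /andP[m0 m1] /andP[sg0 sg1].
have [[la la0 fhol] [lam [e1 [e2 [/andP[lsg lam1] e10 e20 fw]]]]] := fH.
have [ps [C C0 [Hps off psE]]] := sobolev_representative ab m0 m1 psiH.
have m20 : 0 < mu / 2 by lra.
have cps : continuous ps by apply: (hoelder_continuous C0 m20) => x z; exact: Hps.
have [mf [S2 S20 fS]] := hoelder_meas ab la0 fhol.
have [_ ipsi] := psi_sq psiH; have mpsi := itg_meas ipsi.
pose L := b - a; have L0 : 0 < L by rewrite subr_gt0.
have ps_le y : `|ps y| <= C * L `^ (mu / 2) * chi (a < y < b).
  case: (boolP (a < y < b)) => h; last by rewrite (off y h) normr0 mulr0.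
  have := Hps y a; rewrite (off a) ?ltxx// subr0 => /le_trans; apply; rewrite mulr1.
  apply: ler_wpM2l => //; apply: ge0_ler_powR; rewrite ?nnegrE//; [exact: ltW|exact: ltW|exact: norm_sub_le].
pose S := (C * L `^ (mu / 2) + S2).
have S0 : 0 <= S by rewrite addr_ge0// mulr_ge0// powR_ge0.
have psS y : `|ps y| <= S * chi (a < y < b).
  by apply: (le_trans (ps_le y)); rewrite ler_wpM2r ?chi_ge0// lerDl.
have {}fS y : `|chi (a < y < b) * f y| <= S * chi (a < y < b).
  by apply: (le_trans (fS y)); rewrite ler_wpM2r ?chi_ge0// lerDr mulr_ge0// powR_ge0.
have eqn := cK_eqn ab m0 m1 S0 cps psS psE mpsi mf fS psi_eq.
have mrhs := @measurable_rhs _ _ _ mu _ mf; have rS := rhs_le mu fS.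
have k0 : 0 <= `|kap mu| by [].
(* One constant for both ps and the right-hand side, as the preceding results are stated with a
   common bound. *)
pose T := (1 + `|kap mu|) * S.
have T0 : 0 <= T by rewrite mulr_ge0// addr_ge0.
have psT y : `|ps y| <= T * chi (a < y < b).
  by apply: (le_trans (psS y)); rewrite ler_wpM2r ?chi_ge0// ler_peMl// lerDl.
have rT y : `|rhs a b mu f y| <= T * chi (a < y < b).
  by apply: (le_trans (rS y)); rewrite ler_wpM2r ?chi_ge0// ler_wpM2r// lerDr.
pose eps := Num.min (Num.min e1 e2) 2^-1.
have eps0 : 0 < eps by rewrite !lt_min e10 e20/=; lra.
have [E1 E2] : eps <= e1 /\ eps <= e2 by rewrite !ge_min !lexx !orbT.
pose q0 := 1 - eps.
have lam0 : 0 < lam by lra.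
have [q1 q2] : 1 - q0 <= e1 /\ 1 - q0 <= e2 by clear -E1 E2; rewrite /q0; lra.
have [Cf Cf0 Hf] := weighted_hoelder ab lam0 lam1 q1 q2 fw.
have Hr x z : a < x < b -> `|z - x| <= dist a b x / 2 ->
    `|rhs a b mu f z - rhs a b mu f x| <= `|kap mu| * Cf * (`|z - x| `^ lam * dist a b x `^ (- q0)).
  move=> hx hz; have d0 := dist_gt0 hx; have [d1 d2] := dist_le a b x.
  have hz' : a < z < b by move: hz; rewrite ler_norml => /andP[z1 z2]; clear -z1 z2 d0 d1 d2 hx; lra.
  rewrite /rhs (chiT hx) (chiT hz') !mul1r -mulrBr normrM -mulrA.
  by apply: ler_wpM2l => //; exact: Hf.
(* Half of the gap 1 - sigma: with ep <= del, the sum ep + del does not exceed the gap, which is the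
   inequality lam + del <= Q. *)
pose del := (1 - sigma) / 2.
have del0 : 0 < del by clear -sg1; rewrite /del; lra.
have del1 : del < 1 by clear -sg0; rewrite /del; lra.
have Cr0 : 0 <= `|kap mu| * Cf by rewrite mulr_ge0.
have [C2 C20 HC2] := ps_diff2 m0 m1 al0 be0 ab T0 mrhs psT rT cps eqn lam0 lam1 Cr0 del0 del1 Hr.
have [Ca Ca0 Ha] := left_decay m0 m1 al0 be0 ab T0 mrhs psT rT cps eqn.
have [Cb Cb0 Hb] := right_decay m0 m1 al0 be0 ab T0 mrhs psT rT cps eqn.
pose Cd := Ca + Cb; have Cd0 : 0 <= Cd by rewrite addr_ge0.
have psa z : `|ps z| <= Cd * `|z - a| `^ mu.
  by apply: (le_trans (Ha z)); rewrite ler_wpM2r ?powR_ge0// lerDl.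
have psb z : `|ps z| <= Cd * `|z - b| `^ mu.
  by apply: (le_trans (Hb z)); rewrite ler_wpM2r ?powR_ge0// lerDr.
(* The Hoelder exponent of f in excess of sigma, positive by the hypothesis on f; it makes the
   integral defining K0 converge at t = 0. *)
pose rho := lam - sigma; have rho0 : 0 < rho by rewrite subr_gt0.
pose ep := Num.min eps del.
have ep0 : 0 < ep by rewrite lt_min eps0.
have [p1 p2] : ep <= eps /\ ep <= del by split; rewrite /ep ge_min lexx ?orbT.
have epsg : ep <= 1 - sigma by clear -p2 sg1; move: p2; rewrite /del; lra.
have ep1 : ep < 1 by clear -epsg sg0; lra.
(* This weight absorbs those of the three terms of [ps_diff2], while Q - rho = 1 - ep < 1 leaves K0
   of order d^(ep - 1). *)
pose Q := 1 + rho - ep.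
have [Q1 Q2 Q3] : [/\ q0 <= Q, lam + 0 <= Q & lam + del <= Q].
  by clear -p1 p2 lsg sg1; rewrite /q0 /Q /rho; split; move: p1 p2; rewrite /del; lra.
have ml : mu + lam <= 2 by clear -m1 lam1; lra.
have p0 := @powR_ge0 R.
pose Ci := C2 * (L `^ (Q - q0) + L `^ (Q - (lam + 0)) + L `^ (Q - (lam + del))).
have Ci0 : 0 <= Ci by rewrite mulr_ge0// !addr_ge0.
have psi2 x h : a < x < b -> 0 < h -> 4 * h <= dist a b x ->
    `|ps (x + h) + ps (x - h) - 2 * ps x| <= Ci * (h `^ (mu + sigma + rho) * dist a b x `^ (- (1 + rho - ep))).
  move=> hx h0 hd; apply: (le_trans (HC2 x h hx h0 hd)).
  rewrite -/Q (_ : mu + sigma + rho = mu + lam); last by rewrite /rho; ring.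
  have d0 := dist_gt0 hx; have dL : dist a b x <= L.
    by have [d1 d2] := dist_le a b x; move: hx => /andP[x1 x2]; clear -d1 d2 x1 x2; rewrite /L; lra.
  move: (dist a b x) d0 dL hd => d d0 dL hd; have hd1 : h <= d by clear -hd h0; lra.
  rewrite /Ci -mulrA; apply: ler_wpM2l => //; rewrite !mulrDl; apply: lerD; first apply: lerD.
  - rewrite [leRHS]mulrCA; apply: ler_wpM2l => //.
    have := pow_cmp d0 dL (_ : - Q <= - q0); rewrite (_ : - q0 - - Q = Q - q0); last by ring.
    by apply; clear -Q1; lra.
  - by have := sqr_powR_le h0 hd1 dL ml Q2; rewrite subr0.
  - exact: sqr_powR_le.
pose s := mu + sigma.
have s0 : 0 < s by rewrite addr_gt0.
have s2 : s < 2 by clear -m1 sg1; rewrite /s; lra.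
have [Ck Ck0 HK] := K0_size ab m0 sg0 rho0 epsg m20 C0 Cd0 Ci0 Hps psa psb psi2.
have G0 := Gamma_gt0 s0 s2; have I0 := qf_gt0 s0 s2.
(* The inversion returns ps multiplied by the integral of [qf] divided by s; k removes this factor
   and the normalisation of the left integral. *)
pose k := Gamma s * (s / Int (qf s)).
exists (fun x => k * K0 mu sigma ps x).
  exact: (K0_Hstar ab m0 sg0 s2 rho0 ep0 epsg m20 C0 Cd0 Ci0 Hps psa psb psi2).
apply: ae_imp psE => x H hx; rewrite H//.
have [i E] := inversion s0 s2 S0 ep0 ep1 Ck0 cps psS HK hx.
have F t : k * (pp (s - 1) (x - t) * (chi (a < t) * Kz s ps t)) = pp (s - 1) (x - t) * (chi (a < t) * (k * K0 mu sigma ps t)).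
  by rewrite /Kz /K0 -/s; ring.
have ax : a < x by case/andP: hx.
rewrite (RL_leftE ax (eq_itg F (itgZ k i))) -(eq_Int F) (IntZ _ i) E -/s /k.
by clear i E HK; move: (Int _) I0 => I I0; field; rewrite !gt_eqF.
Qed.
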